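(* Let $G$ be a compact, simple, simply connected Lie group, with invariant inner product $B$ on $\mathfrak g$ and canonical 3-form $\eta$, and fix a gerbe with connection $\mathcal G$ on $G$ with curvature $\eta$. Suppose $M_1$ and $M_2$ are two quasi-Hamiltonian $G$-spaces (with group-valued moment maps). The fusion product $M_1\circledast M_2$ is pre-quantizable if both $M_1$ and $M_2$ are pre-quantizable.
   Context: $\theta^L,\theta^R\in\Omega^1(G,\mathfrak g)$ are the left/right Maurer–Cartan forms and $\eta=\frac1{12}B(\theta^L,[\theta^L,\theta^L])$. A quasi-Hamiltonian $G$-space is $(M,\omega,\Psi)$: a $G$-manifold $M$, an invariant $\omega\in\Omega^2(M)$, and an equivariant smooth map $\Psi:M\to G$ (conjugation action on $G$) with (1) $d\omega=\Psi^*\eta$; (2) $\iota(\xi_M)\omega=\frac12B(\Psi^*(\theta^L+\theta^R),\xi)$ for $\xi\in\mathfrak g$, where $\xi_M(m)=\frac{d}{dt}|_{t=0}\exp(t\xi)\cdot m$; (3) $\ker\omega_m=\{\xi_M(m): (\mathrm{Ad}_{\Psi(m)}+1)\xi=0\}$. Fusion product of $(M_1,\omega_1,\Psi_1)$ and $(M_2,\omega_2,\Psi_2)$: $M_1\times M_2$ with diagonal $G$-action, moment map $\Psi_1\Psi_2$, and 2-form $\omega_1+\omega_2-\frac12B(\Psi_1^*\theta^L,\Psi_2^*\theta^R)$. Gerbes. For line bundles $L_{ii'}$ on $U_{ii'}$, $(\delta L)_{ii'i''}=L_{i'i''}\otimes L_{ii''}^{-1}\otimes L_{ii'}$; for $E_i$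 on $U_i$, $(\delta E)_{ii'}=E_{i'}\otimes E_i^{-1}$; likewise for sections, connections, forms. Curvature of a line bundle with connection is the real form $dA$ with $\nabla\sigma=2\pi\sqrt{-1}A\sigma$. A gerbe with connection: an open cover, Hermitian line bundles $L_{ii'}$ with $L_{ii'}\cong L_{i'i}^{-1}$, unitary sections $\theta$ of $\delta L$ with $\delta\theta=1$, connections $\nabla_{ii'}$ with $(\delta\nabla)\theta=0$, and 2-forms $\varpi_i$ with $\varpi_{i'}-\varpi_i=\operatorname{curv}(\nabla_{ii'})$; curvature 3-form $d\varpi_i$. A quasi-line bundle with connection for it: Hermitian line bundles with connection $(E_i,\nabla^E_i)$ and unitary sections $\psi_{ii'}$ of $(\delta E^{-1})_{ii'}\otimes L_{ii'}$ with $\delta\psi=\theta$, $\delta\nabla^E\cong\nabla$ via $\psi$; its error 2-form is $\varpi_i-\operatorname{curv}(\nabla^E_i)$ on $U_i$. A pre-quantization of $(M,\omega,\Psi)$ is a relative gerbe with connection $(\mathcal L,\mathcal G)$ for $\Psi$ with relative curvature $(\omega,\eta)$, i.e. a quasi-line bundle with connection $\mathcal L$ for $\Psi^*\mathcal G$ with error 2-form $\omega$. $(M,\omega,\Psi)$ is pre-quantizable if one exists. *)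

(* Defs.v *)
From HB Require Import structures.
From mathcomp Require Import all_boot all_order all_algebra.
From mathcomp Require Import all_classical all_reals all_analysis.
From mathcomp Require Import complex.

Set Implicit Arguments.
Unset Strict Implicit.
Unset Printing Implicit Defensive.

Import Order.TTheory GRing.Theory Num.Theory.
Import numFieldNormedType.Exports.

Local Open Scope classical_set_scope.
Local Open Scope ring_scope.

(* Conventions.
   - Structures come as a record of data together with a predicate [is_...]
     stating the axioms.
   - The tangent space T_x M of an n-manifold is 'rV[R]_n, read in the preferred
     chart [chart_at M x].
   - (alpha /\ beta)(u, v) = alpha u * beta v - alpha v * beta u for 1-forms, and
     the exterior derivative carries no factor 1/(k+1). *)

Section Smooth.
Context {R : realType}.

Fixpoint Ck (V W : normedModType R) (k : nat) (O : set V) (f : V -> W) : Prop :=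
  match k with
  | 0 => forall x, O x -> {for x, continuous f}
  | k'.+1 => (forall x, O x -> differentiable f x) /\
             (forall v : V, Ck k' O (fun x => 'd f x v))
  end.

(* only used on open sets O *)
Definition smooth_on (V W : normedModType R) (O : set V) (f : V -> W) : Prop :=
  forall k, Ck k O f.

End Smooth.

Section Manifold.
Context {R : realType}.

(* [cinv] is only meaningful on the image of [cdom] under [cmap] *)
Record chart (T : Type) (n : nat) := Chart {
  cdom : set T;
  cmap : T -> 'rV[R]_n;
  cinv : 'rV[R]_n -> T }.

Record manifold := Manifold {
  mcarrier :> topologicalType;
  mdim : nat;
  chart_at : mcarrier -> chart mcarrier mdim }.

Definition cimg (T : Type) (n : nat) (c : chart T n) : set 'rV[R]_n :=
  cmap c @` cdom c.

Definition is_manifold (M : manifold) : Prop :=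
  [/\ hausdorff_space M, @second_countable M,
      forall x : M, let c := chart_at x in
        [/\ open (cdom c), cdom c x, open (cimg c) &
            [/\ forall y, cdom c y -> cinv c (cmap c y) = y,
                forall y, cdom c y -> {for y, continuous (cmap c)} &
                forall z, cimg c z -> {for z, continuous (cinv c)}]] &
      forall x y : M, let c := chart_at x in let c' := chart_at y in
        smooth_on (cmap c @` (cdom c `&` cdom c')) (cmap c' \o cinv c)].

Definition tangent (M : manifold) := 'rV[R]_(mdim M).

Definition smooth_map (M N : manifold) (f : M -> N) : Prop :=
  continuous f /\
  forall (x : M) (y : N), let c := chart_at x in let c' := chart_at y in
    smooth_on (cmap c @` (cdom c `&` f @^-1` cdom c')) (cmap c' \o f \o cinv c).

Definition smooth_fun (M : manifold) (W : normedModType R) (O : set M)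
    (f : M -> W) : Prop :=
  forall x : M, let c := chart_at x in
    smooth_on (cmap c @` (cdom c `&` O)) (f \o cinv c).

Definition smooth_curve (M : manifold) (g : R^o -> M) : Prop :=
  continuous g /\
  forall y : M, smooth_on (g @^-1` cdom (chart_at y)) (cmap (chart_at y) \o g).

(* the tangent map T_x M -> T_(f x) N *)
Definition mdiff (M N : manifold) (f : M -> N) (x : M) (v : tangent M) :
    tangent N :=
  'd (cmap (chart_at (f x)) \o f \o cinv (chart_at x)) (cmap (chart_at x) x) v.

Definition fdiff (M : manifold) (W : normedModType R) (f : M -> W) (x : M)
    (v : tangent M) : W :=
  'd (f \o cinv (chart_at x)) (cmap (chart_at x) x) v.

Definition velocity (M : manifold) (g : R^o -> M) (t : R) : tangent M :=
  'd (cmap (chart_at (g t)) \o g) (t : R^o) (1 : R^o).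

Definition prod_chart (M N : manifold) (p : M * N) :
    chart (M * N)%type (mdim M + mdim N)%N :=
  {| cdom := cdom (chart_at p.1) `*` cdom (chart_at p.2);
     cmap := fun q => row_mx (cmap (chart_at p.1) q.1) (cmap (chart_at p.2) q.2);
     cinv := fun z => (cinv (chart_at p.1) (lsubmx z),
                       cinv (chart_at p.2) (rsubmx z)) |}.

Definition prod_manifold (M N : manifold) : manifold :=
  @Manifold (M * N)%type (mdim M + mdim N)%N (@prod_chart M N).

End Manifold.

Arguments chart : clear implicits.
Arguments manifold : clear implicits.

Section Forms.
Context {R : realType}.

(* underlying data of a differential k-form *)
Definition form (M : manifold R) (k : nat) := M -> ('I_k -> tangent M) -> R.

Definition form2 (M : manifold R) (w : M -> tangent M -> tangent M -> R) :
    form M 2 :=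
  fun x v => w x (v 0) (v 1).

Definition form_app2 (M : manifold R) (w : form M 2) (x : M) (u v : tangent M) : R :=
  w x (fun i => if i == 0 then u else v).

Definition form_app1 (M : manifold R) (A : form M 1) (x : M) (v : tangent M) : R :=
  A x (fun=> v).

(* coefficients of w in the chart at a: the pull-back of w by its inverse *)
Definition form_local (M : manifold R) (k : nat) (w : form M k) (a : M)
    (z : 'rV[R]_(mdim M)) (v : 'I_k -> 'rV[R]_(mdim M)) : R :=
  let y := cinv (chart_at a) z in
  w y (fun i => 'd (cmap (chart_at y) \o cinv (chart_at a)) z (v i)).

Definition multilinear_form (V : lmodType R) (k : nat) (w : ('I_k -> V) -> R) :=
  let upd v i u := fun j : 'I_k => if j == i then u else v j in
  forall (i : 'I_k) (v : 'I_k -> V) (a : R) (u u' : V),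
    w (upd v i (a *: u + u')) = a * w (upd v i u) + w (upd v i u').

Definition alternating_form (V : lmodType R) (k : nat) (w : ('I_k -> V) -> R) :=
  forall (v : 'I_k -> V) (i j : 'I_k), i != j -> v i = v j -> w v = 0.

(* w restricts to a smooth differential form on the open set O *)
Definition is_form (M : manifold R) (k : nat) (O : set M) (w : form M k) : Prop :=
  (forall x, O x -> multilinear_form (w x) /\ alternating_form (w x)) /\
  forall (a : M) (v : 'I_k -> 'rV[R]_(mdim M)),
    smooth_on (cmap (chart_at a) @` (cdom (chart_at a) `&` O))
      (fun z => form_local w a z v : R^o).

Definition form_pull (M N : manifold R) (f : M -> N) (k : nat) (w : form N k) :
    form M k :=
  fun x v => w (f x) (fun i => mdiff f x (v i)).

Definition dform (M : manifold R) (k : nat) (w : form M k) : form M k.+1 :=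
  fun x v => \sum_(i < k.+1) (-1) ^+ i *
    ('d (fun z => form_local w x z (fun j => v (lift i j)) : R^o)
        (cmap (chart_at x) x) (v i) : R).

End Forms.

Section Lie.
Context {R : realType}.

Record lie_group := LieGroup {
  lmfd :> manifold R;
  lmul : lmfd -> lmfd -> lmfd;
  linv : lmfd -> lmfd;
  lone : lmfd }.

Definition is_lie_group (G : lie_group) : Prop :=
  [/\ is_manifold G,
      [/\ forall a b c : G, lmul a (lmul b c) = lmul (lmul a b) c,
          forall a : G, lmul (lone G) a = a &
          forall a : G, lmul (linv a) a = lone G],
      @smooth_map R (prod_manifold G G) G (fun p => lmul p.1 p.2) &
      @smooth_map R G G (@linv G)].

Definition simply_connected (T : topologicalType) : Prop :=
  [/\ [set: T] !=set0,
      forall x y : T, exists p : R -> T,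
        [/\ {within `[0, 1], continuous p}, p 0 = x & p 1 = y] &
      forall p : R -> T, {within `[0, 1], continuous p} -> p 0 = p 1 ->
        exists H : R * R -> T,
          [/\ {within `[0, 1] `*` `[0, 1], continuous H},
              forall s, s \in `[0, 1] -> H (s, 0) = p s /\ H (s, 1) = p 0 &
              forall t, t \in `[0, 1] -> H (0, t) = p 0 /\ H (1, t) = p 0]].

Variable G : lie_group.
Local Notation "a ** b" := (@lmul G a b) (at level 40, left associativity).

(* the Lie algebra is T_e G *)
Definition lie_alg := tangent G.

Definition Ad (g : G) (xi : lie_alg) : lie_alg :=
  mdiff (fun h : G => g ** h ** linv g) (lone G) xi.

(* [xi, zeta] = d/dt Ad_(exp (t xi)) zeta at t = 0 *)
Definition lie_bracket (xi zeta : lie_alg) : lie_alg :=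
  fdiff (fun g => Ad g zeta : 'rV[R]_(mdim G)) (lone G) xi.

Definition simple_lie_algebra : Prop :=
  (exists xi zeta, lie_bracket xi zeta != 0) /\
  forall h : {vspace 'rV[R]_(mdim G)},
    (forall xi zeta, zeta \in h -> lie_bracket xi zeta \in h) ->
    h = 0%VS \/ h = fullv.

(* exp xi is the value at time 1 of the one-parameter subgroup with velocity xi *)
Definition lie_exp (xi : lie_alg) : G :=
  xget (fun=> lone G) [set c : R -> G |
    [/\ forall s t, c (s + t) = c s ** c t,
        smooth_curve (c : R^o -> G) & velocity (c : R^o -> G) 0 = xi]] 1.

Definition thetaL (g : G) (v : tangent G) : lie_alg :=
  mdiff (fun h => linv g ** h) g v.

Definition thetaR (g : G) (v : tangent G) : lie_alg :=
  mdiff (fun h => h ** linv g) g v.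

Variable B : lie_alg -> lie_alg -> R.

Definition invariant_inner_product : Prop :=
  [/\ forall (a : R) xi xi' zeta,
        B (a *: xi + xi') zeta = a * B xi zeta + B xi' zeta,
      forall xi zeta, B xi zeta = B zeta xi,
      forall xi, xi != 0 -> 0 < B xi xi &
      forall g xi zeta, B (Ad g xi) (Ad g zeta) = B xi zeta].

(* 1/12 B(theta^L, [theta^L, theta^L]), with
   [theta, theta](u, v) = 2 [theta u, theta v] and
   B(theta, beta)(u, v, w) =
     B(theta u, beta(v, w)) - B(theta v, beta(u, w)) + B(theta w, beta(u, v)). *)
Definition canonical3 : form G 3 := fun g v =>
  let th i := thetaL g (v i) in
  let br i j := 2 *: lie_bracket (th i) (th j) in
  12^-1 * (B (th 0) (br 1 2) - B (th 1) (br 0 2) + B (th 2) (br 0 1)).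

Record ham_data := HamData {
  hmfd :> manifold R;
  hact : G -> hmfd -> hmfd;
  hform : form hmfd 2;
  hmom : hmfd -> G }.

Arguments hform : clear implicits.

(* xi_M(m) *)
Definition gen_field (M : ham_data) (xi : lie_alg) (m : M) : tangent M :=
  velocity (fun t : R^o => hact (lie_exp ((t : R) *: xi)) m) 0.

Definition is_quasi_hamiltonian (M : ham_data) : Prop :=
  [/\ is_manifold M,
      [/\ forall m : M, hact (lone G) m = m,
          forall g h (m : M), hact (g ** h) m = hact g (hact h m) &
          @smooth_map R (prod_manifold G M) M (fun p => hact p.1 p.2)],
      is_form setT (hform M) /\
        (forall g m v, form_pull (@hact M g) (hform M) m v = hform M m v),
      smooth_map (@hmom M) /\
        (forall g (m : M), hmom (hact g m) = g ** hmom m ** linv g) &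
      [/\ forall m v, dform (hform M) m v = form_pull (@hmom M) canonical3 m v,
          forall xi m v, form_app2 (hform M) m (gen_field xi m) v =
            2^-1 * B (thetaL (hmom m) (mdiff (@hmom M) m v)
                      + thetaR (hmom m) (mdiff (@hmom M) m v)) xi &
          forall m v, (forall w, form_app2 (hform M) m v w = 0) <->
            exists2 xi, Ad (hmom m) xi + xi = 0 & v = gen_field xi m]].

Definition fusion_form (M1 M2 : ham_data) :
    form (prod_manifold M1 M2) 2 := fun p v =>
  let P := prod_manifold M1 M2 in
  let al u := thetaL (hmom p.1) (mdiff (fun q : P => hmom q.1) p u) in
  let be u := thetaR (hmom p.2) (mdiff (fun q : P => hmom q.2) p u) in
  form_pull (fun q : P => q.1) (hform M1) p v
  + form_pull (fun q : P => q.2) (hform M2) p v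
  - 2^-1 * (B (al (v 0)) (be (v 1)) - B (al (v 1)) (be (v 0))).

Definition fusion (M1 M2 : ham_data) : ham_data :=
  @HamData (prod_manifold M1 M2)
    (fun g p => (hact g p.1, hact g p.2))
    (@fusion_form M1 M2)
    (fun p => hmom p.1 ** hmom p.2).

End Lie.

Arguments hform {R G} h _ _.

Arguments lie_group : clear implicits.

Section LineBundle.
Context {R : realType}.
Local Notation C := R[i].

Definition csmooth (M : manifold R) (O : set M) (c : M -> C) : Prop :=
  smooth_fun O (fun x => complex.Re (c x) : R^o) /\
  smooth_fun O (fun x => complex.Im (c x) : R^o).

Definition cdiff (M : manifold R) (c : M -> C) (x : M) (v : tangent M) : C :=
  Complex (fdiff (fun x => complex.Re (c x) : R^o) x v)
          (fdiff (fun x => complex.Im (c x) : R^o) x v).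

Definition two_pi_i : C := Complex 0 (2 * pi).

(* A Hermitian line bundle with connection is given by local trivializations:
   [lframe L V e A] says that e is one of the given smooth unitary frames over the
   open set V, and that nabla e = 2 pi i A e for the real 1-form A on V. *)
Record line_bundle (M : manifold R) := LineBundle {
  lfiber : M -> vectType C;
  lherm : forall m, lfiber m -> lfiber m -> C;
  lframe : set M -> (forall m, lfiber m) -> form M 1 -> Prop }.

Arguments lframe {M} l _ _ _.

Definition hermitian_inner (V : vectType C) (h : V -> V -> C) : Prop :=
  [/\ forall (a : C) u u' v, h (a *: u + u') v = a * h u v + h u' v,
      forall u v, h u v = (h v u)^* &
      forall u, u != 0 -> 0 < h u u].

(* L is a Hermitian line bundle with connection over the open set W.  In the last
   clause e' = g e, and nabla e' = 2 pi i A' e' means dg = 2 pi i (A' - A) g. *)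
Definition is_line_bundle (M : manifold R) (W : set M) (L : line_bundle M) :
    Prop :=
  [/\ forall m, W m ->
        \dim {: lfiber L m} = 1%N /\ hermitian_inner (@lherm M L m),
      forall V e A, lframe L V e A ->
        [/\ open V, V `<=` W, forall m, V m -> lherm (e m) (e m) = 1 &
            is_form V A],
      forall m, W m -> exists V e A, lframe L V e A /\ V m &
      forall V e A V' e' A', lframe L V e A -> lframe L V' e' A' ->
        exists g : M -> C,
          [/\ csmooth (V `&` V') g,
              forall m, (V `&` V') m -> e' m = g m *: e m &
              forall m v, (V `&` V') m ->
                cdiff g m v =
                two_pi_i * (form_app1 A' m v - form_app1 A m v)%:C%C * g m]].

Definition dual_vec (V : vectType C) (a : V) : 'Hom(V, C^o) :=
  linfun (fun v : V => coord (in_tuple [:: a]) ord0 v : C^o).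

(* The tensor product V (x) W of lines is Hom(V^*, W). *)
Definition tens (V W : vectType C) (a : V) (b : W) : 'Hom('Hom(V, C^o), W) :=
  linfun (fun l : 'Hom(V, C^o) => l a *: b).

(* The Hermitian inner product of Hom(V, W), V and W lines; vpick picks a
   nonzero vector of V, on which the value does not depend. *)
Definition hom_herm (V W : vectType C) (hV : V -> V -> C) (hW : W -> W -> C)
    (f g : 'Hom(V, W)) : C :=
  let v := vpick (fullv : {vspace V}) in hW (f v) (g v) / hV v v.

Definition std_herm (a b : C^o) : C := a * b^*.

Definition lb_dual (M : manifold R) (L : line_bundle M) : line_bundle M :=
  @LineBundle M
    (fun m => 'Hom(lfiber L m, C^o))
    (fun m => hom_herm (@lherm M L m) std_herm)
    (fun V f A' => exists e A, lframe L V e A /\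
       forall m, V m -> f m = dual_vec (e m) /\ forall v, A' m v = - A m v).

Definition lb_tensor (M : manifold R) (L L' : line_bundle M) : line_bundle M :=
  @LineBundle M
    (fun m => 'Hom('Hom(lfiber L m, C^o), lfiber L' m))
    (fun m => hom_herm (hom_herm (@lherm M L m) std_herm) (@lherm M L' m))
    (fun V f A'' => exists V1 e1 A1 V2 e2 A2,
       [/\ lframe L V1 e1 A1, lframe L' V2 e2 A2, V = V1 `&` V2 &
           forall m, V m ->
             f m = tens (e1 m) (e2 m) /\ forall v, A'' m v = A1 m v + A2 m v]).

Definition lb_pull (M N : manifold R) (f : M -> N) (L : line_bundle N) :
    line_bundle M :=
  @LineBundle M
    (fun m => lfiber L (f m))
    (fun m => @lherm N L (f m))
    (fun V e A => exists V' e' A',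
       [/\ lframe L V' e' A', V = f @^-1` V' &
           forall m, V m -> e m = e' (f m) /\ forall v, A m v = form_pull f A' m v]).

Definition smooth_section (M : manifold R) (L : line_bundle M) (W : set M)
    (s : forall m, lfiber L m) : Prop :=
  forall V e A, lframe L V e A -> exists c : M -> C,
    csmooth (W `&` V) c /\ forall m, (W `&` V) m -> s m = c m *: e m.

Definition unitary_section (M : manifold R) (L : line_bundle M) (W : set M)
    (s : forall m, lfiber L m) : Prop :=
  smooth_section W s /\ forall m, W m -> lherm (s m) (s m) = 1.

(* nabla s = 0 on W: if s = c e then nabla s = (dc + 2 pi i c A) e *)
Definition parallel_section (M : manifold R) (L : line_bundle M) (W : set M)
    (s : forall m, lfiber L m) : Prop :=
  forall V e A, lframe L V e A -> exists c : M -> C,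
    [/\ csmooth (W `&` V) c,
        forall m, (W `&` V) m -> s m = c m *: e m &
        forall m v, (W `&` V) m ->
          cdiff c m v + two_pi_i * c m * (form_app1 A m v)%:C%C = 0].

(* isomorphism of Hermitian line bundles over W *)
Definition lb_iso (M : manifold R) (W : set M) (L L' : line_bundle M) : Prop :=
  exists phi : forall m, 'Hom(lfiber L m, lfiber L' m),
    (forall m, W m -> forall a b, lherm (phi m a) (phi m b) = lherm a b) /\
    forall V e A, lframe L V e A ->
      smooth_section (W `&` V) (fun m => phi m (e m)).

(* curv(nabla) = F on W *)
Definition has_curvature (M : manifold R) (W : set M) (L : line_bundle M)
    (F : form M 2) : Prop :=
  forall V e A, lframe L V e A ->
    forall m v, (W `&` V) m -> F m v = dform A m v.

End LineBundle.

Arguments lframe {R M} l _ _ _.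

Section Gerbe.
Context {R : realType}.
Local Notation C := R[i].

Definition lb_delta1 (M : manifold R) (I : Type) (E : I -> line_bundle M)
    (i j : I) : line_bundle M :=
  lb_tensor (E j) (lb_dual (E i)).

Definition lb_delta2 (M : manifold R) (I : Type) (L : I -> I -> line_bundle M)
    (i j k : I) : line_bundle M :=
  lb_tensor (lb_tensor (L j k) (lb_dual (L i k))) (L i j).

Record gerbe (M : manifold R) := Gerbe {
  gidx : Type;
  gcov : gidx -> set M;
  glb : gidx -> gidx -> line_bundle M;
  gtheta : forall i j k m, lfiber (lb_delta2 glb i j k) m;
  gform : gidx -> form M 2 }.

(* delta theta = 1 at m: choosing nonzero vectors a_ij of the fibers of L_ij and
   writing theta_ijk = c_ijk a_jk (x) a_ik^-1 (x) a_ij, the canonical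
   trivialization of delta (delta L) turns delta theta into the scalar
   c_jkl c_ikl^-1 c_ijl c_ijk^-1. *)
Definition theta_coord (M : manifold R) (Gb : gerbe M) (m : M)
    (a : forall i j : gidx Gb, lfiber (glb i j) m)
    (i j k : gidx Gb) (c : C) : Prop :=
  gtheta i j k m = c *: tens (tens (a j k) (dual_vec (a i k))) (a i j).

Definition delta_theta_trivial (M : manifold R) (Gb : gerbe M) : Prop :=
  forall (i j k l : gidx Gb) (m : M),
    gcov i m -> gcov j m -> gcov k m -> gcov l m ->
    forall a : forall i j : gidx Gb, lfiber (glb i j) m,
    [/\ a i j != 0, a i k != 0 & a i l != 0] ->
    [/\ a j k != 0, a j l != 0 & a k l != 0] ->
    forall c0 c1 c2 c3 : C,
      theta_coord a j k l c0 -> theta_coord a i k l c1 ->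
      theta_coord a i j l c2 -> theta_coord a i j k c3 ->
      c0 * c1^-1 * c2 * c3^-1 = 1.

Definition is_gerbe (M : manifold R) (Gb : gerbe M) : Prop :=
  let U2 i j := gcov i `&` gcov j : set M in
  let U3 i j k := U2 i j `&` gcov k : set M in
  [/\ (forall i : gidx Gb, open (gcov i)) /\
        (forall m, exists i : gidx Gb, gcov i m),
      forall i j : gidx Gb, is_line_bundle (U2 i j) (glb i j) /\
        lb_iso (U2 i j) (glb i j) (lb_dual (glb j i)),
      forall i j k : gidx Gb,
        unitary_section (L := lb_delta2 (@glb _ Gb) i j k) (U3 i j k)
          (@gtheta _ Gb i j k) /\
        parallel_section (L := lb_delta2 (@glb _ Gb) i j k) (U3 i j k)
          (@gtheta _ Gb i j k),
      delta_theta_trivial Gb &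
      (forall i : gidx Gb, is_form (gcov i) (gform i)) /\
        (forall i j : gidx Gb, has_curvature (U2 i j) (glb i j)
           (fun m v => gform j m v - gform i m v))].

Definition gerbe_curvature (M : manifold R) (Gb : gerbe M) (eta : form M 3) :
    Prop :=
  forall (i : gidx Gb) m v, gcov i m -> dform (gform i) m v = eta m v.

Definition gerbe_pull (M N : manifold R) (f : M -> N) (Gb : gerbe N) : gerbe M :=
  @Gerbe M (gidx Gb)
    (fun i => f @^-1` gcov i)
    (fun i j => lb_pull f (glb i j))
    (fun i j k m => gtheta i j k (f m))
    (fun i => form_pull f (gform i)).

Record quasi_line_bundle (M : manifold R) (Gb : gerbe M) := QuasiLineBundle {
  qlb : gidx Gb -> line_bundle M;
  qpsi : forall i j m,
    lfiber (lb_tensor (lb_dual (lb_delta1 qlb i j)) (glb i j)) m }.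

(* delta psi = theta at m, read as for delta theta: if
   psi_ij = c_ij (e_j (x) e_i^-1)^-1 (x) a_ij, the factors e cancel in delta psi and
   theta_ijk = c_jk c_ik^-1 c_ij a_jk (x) a_ik^-1 (x) a_ij. *)
Definition psi_coord (M : manifold R) (Gb : gerbe M) (Q : quasi_line_bundle Gb)
    (m : M) (e : forall i : gidx Gb, lfiber (qlb Q i) m)
    (a : forall i j : gidx Gb, lfiber (glb i j) m)
    (i j : gidx Gb) (c : C) : Prop :=
  qpsi Q i j m =
    c *: tens (dual_vec (tens (e j) (dual_vec (e i)))) (a i j).

Definition delta_psi_theta (M : manifold R) (Gb : gerbe M)
    (Q : quasi_line_bundle Gb) : Prop :=
  forall (i j k : gidx Gb) (m : M), gcov i m -> gcov j m -> gcov k m ->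
    forall (e : forall i : gidx Gb, lfiber (qlb Q i) m)
           (a : forall i j : gidx Gb, lfiber (glb i j) m),
    [/\ e i != 0, e j != 0 & e k != 0] ->
    [/\ a i j != 0, a i k != 0 & a j k != 0] ->
    forall c0 c1 c2 : C,
      psi_coord e a j k c0 -> psi_coord e a i k c1 -> psi_coord e a i j c2 ->
      theta_coord a i j k (c0 * c1^-1 * c2).

(* the last clause expresses that psi identifies delta nabla^E with nabla *)
Definition is_quasi_line_bundle (M : manifold R) (Gb : gerbe M)
    (Q : quasi_line_bundle Gb) : Prop :=
  let U2 i j := gcov i `&` gcov j : set M in
  let D i j := lb_tensor (lb_dual (lb_delta1 (qlb Q) i j)) (glb i j) in
  [/\ forall i, is_line_bundle (gcov i) (qlb Q i),
      forall i j, unitary_section (L := D i j) (U2 i j) (qpsi Q i j),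
      delta_psi_theta Q &
      forall i j, parallel_section (L := D i j) (U2 i j) (qpsi Q i j)].

(* the error 2-form gform i - curv(nabla^E_i) equals w on gcov i *)
Definition has_error_form (M : manifold R) (Gb : gerbe M)
    (Q : quasi_line_bundle Gb) (w : form M 2) : Prop :=
  forall (i : gidx Gb) V e A, lframe (qlb Q i) V e A ->
    forall m v, (gcov i `&` V) m -> w m v = gform i m v - dform A m v.

Definition prequantizable (G : lie_group R) (Gb : gerbe G) (M : ham_data G) :
    Prop :=
  exists Q : quasi_line_bundle (gerbe_pull (@hmom R G M) Gb),
    is_quasi_line_bundle Q /\ has_error_form Q (hform M).

End Gerbe.

(* Main.v *)
(* On G x G one has Mult^* eta = pr_1^* eta + pr_2^* eta - (1/2) d beta with
   beta = B(pr_1^* theta^L, pr_2^* theta^R).  Hence the gerbe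
   Mult^* Gb - pr_1^* Gb - pr_2^* Gb, with (1/2) beta added to its 2-forms, is flat.
   It is canonically trivial over G x {e} and {e} x G.  Because G is simply connected,
   a flat bundle on Y x G that is trivialised over Y x {e} is trivial, and therefore local
   trivialisations of the gerbe over sets U x G, normalised along U x {e}, glue; together
   with a compactness argument this gives a flat trivialisation over all of G x G.
   Pulled back by (Psi_1, Psi_2) and tensored with the two given quasi-line bundles, it is
   a quasi-line bundle for (Psi_1 Psi_2)^* Gb, and (1/2) beta produces the extra term of the
   fusion 2-form in the error 2-form.

   Tensor products of line bundles are avoided by choosing, without any continuity, unit
   vectors of the fibres of the L_ij in which theta = 1: a local frame becomes a circle-valued
   function, and bundles and gerbes become additive cocycles of such functions, considered up
   to locally constant ones. *)

From HB Require Import structures.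
From mathcomp Require Import all_boot all_order all_algebra.
From mathcomp Require Import all_classical all_reals all_analysis.
From mathcomp Require Import complex ring lra.
Require Import Defs.

Set Implicit Arguments.
Unset Strict Implicit.
Unset Printing Implicit Defensive.

Import Order.TTheory GRing.Theory Num.Theory.
Import numFieldNormedType.Exports.

Local Open Scope classical_set_scope.
Local Open Scope ring_scope.

(** * Calculus on normed spaces *)

(** The class of a flat circle gerbe on G x G lies in H^2(G x G; U(1)). As H_1(G) = 0, the mixed
    Kunneth terms vanish and the class is determined by its restrictions to the two axes. The gluing
    argument is this Kunneth statement made explicit, with functions in place of cohomology classes.
    The cocycle condition for the gluing comes for free: over a simply connected factor, an
    isomorphism of trivialisations with prescribed values along one slice is unique. The obstacle is
    to spread a trivialisation from G x {h} to G x N. Local trivialisations exist near each point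
    (g, h), on a box whose second side depends on g; compactness of G gives one N for all g.
    Connectedness of G then reaches every h, and a second gluing with the factors exchanged reaches
    all of G x G. The discontinuous choices of unit vectors are harmless because they enter through
    differences only: two frames of the same line bundle differ by a smooth phase, whatever the
    reference vectors are. *)

Section Differentials.
Context {R : realType}.
Implicit Types V W Z : normedModType R.

(** Serves where the derivative is guessed in advance: for functions that agree near a point, and
    for integrals depending on a parameter. *)
Lemma diff_intro V W (f : V -> W) (L : {linear V -> W}) (x : V) :
  continuous L ->
  (forall e : R, 0 < e ->
    \forall h \near 0, `|f (h + x) - f x - L h| <= e * `|h|) ->
  differentiable f x /\ 'd f x = L :> (V -> W).
Proof.
move=> cL fL.
have E : f \o shift x = cst (f x) + L +o_ 0 id.
  apply/eqaddoP => e e0; near=> h.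
  rewrite -[X in `|X|]/(f (h + x) - (f x + L h)) opprD addrA.
  by near: h; exact: fL.
have dE := diff_unique cL E.
split=> //; apply/diff_locallyP; rewrite dE; split=> //.
Unshelve. all: by end_near. Qed.

Lemma diff_le V W (f : V -> W) (x : V) : differentiable f x ->
  forall e : R, 0 < e ->
  \forall h \near 0, `|f (h + x) - f x - 'd f x h| <= e * `|h|.
Proof.
move=> /diff_locallyP[_ /eqaddoP fE] e e0; have := fE e e0.
apply: filterS => h; rewrite -[X in `|X|]/(f (h + x) - (f x + 'd f x h)).
by rewrite opprD addrA.
Qed.

Lemma diff_near V W (f g : V -> W) (x : V) :
  (\forall y \near x, f y = g y) -> differentiable f x ->
  differentiable g x /\ 'd g x = 'd f x :> (V -> W).
Proof.
move=> fg df; apply: diff_intro; first exact: diff_continuous.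
move=> e e0; have dfle := diff_le df e0.
have fgx := nbhs_singleton fg.
move: fg; rewrite (near_shift 0 x) subr0 => fg.
near=> h; rewrite -fgx.
have -> : g (h + x) = f (h + x).
  by near: h; apply: filterS fg => h; rewrite /= => ->.
by near: h.
Unshelve. all: by end_near. Qed.

Lemma diff_near_eq V W (f g : V -> W) (x v : V) :
  (\forall y \near x, f y = g y) -> differentiable f x -> 'd g x v = 'd f x v.
Proof. by move=> fg df; have [_ ->] := diff_near fg df. Qed.

End Differentials.

(** * Functions of class C^k *)

Section CkTheory.
Context {R : realType}.
Implicit Types V W Z : normedModType R.

Lemma Ck_sub V W k (O O' : set V) (f : V -> W) :
  O' `<=` O -> Ck k O f -> Ck k O' f.
Proof.
move=> sO; elim: k f => [|k IH] f /=; first by move=> h x /sO; exact: h.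
by move=> [h1 h2]; split=> [x /sO|v]; [exact: h1|exact: IH].
Qed.

Lemma Ck_eq V W k (O : set V) (f g : V -> W) :
  open O -> (forall x, O x -> f x = g x) -> Ck k O f -> Ck k O g.
Proof.
move=> oO; elim: k f g => [|k IH] f g fg /=.
  move=> h x Ox; have nfg : \forall y \near x, f y = g y.
    by apply: filterS (open_nbhs_nbhs (conj oO Ox)) => y; exact: fg.
  rewrite /prop_for /continuous_at -(fg _ Ox); apply: cvg_trans (h x Ox).
  exact: near_eq_cvg.
have nfg x : O x -> \forall y \near x, f y = g y.
  by move=> Ox; apply: filterS (open_nbhs_nbhs (conj oO Ox)) => y; exact: fg.
move=> [h1 h2]; split=> [x Ox|v].
  by have [] := diff_near (nfg x Ox) (h1 x Ox).
apply: IH (h2 v) => x Ox; apply/esym.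
by apply: diff_near_eq (nfg x Ox) _; exact: h1.
Qed.

Lemma Ck_leS V W k (O : set V) (f : V -> W) : Ck k.+1 O f -> Ck k O f.
Proof.
elim: k f => [|k IH] f /=.
  by move=> [h _] x Ox; exact/differentiable_continuous/h.
by move=> [h1 h2]; split=> // v; apply: IH; exact: h2.
Qed.

Lemma Ck_le V W k l (O : set V) (f : V -> W) : (k <= l)%N -> Ck l O f -> Ck k O f.
Proof.
move=> /subnK <-; elim: (l - k)%N => [//|n IH] /=.
by move=> /(@Ck_leS V W (n + k)); exact: IH.
Qed.

Lemma Ck_local V W k (O : set V) (f : V -> W) :
  (forall x, O x -> exists O', [/\ open O', O' x & Ck k O' f]) -> Ck k O f.
Proof.
elim: k f => [|k IH] f /= h.
  by move=> x /h[ O' [_ O'x]]; exact.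
split=> [x /h[ O' [_ O'x []]]|v]; first by move/(_ x O'x).
by apply: IH => x /h[ O' [ oO' O'x [_ h']]]; exists O'.
Qed.

Lemma Ck_cst V W k (O : set V) (a : W) : Ck k O (fun=> a).
Proof.
elim: k a => [|k IH] a /=; first by move=> x _; exact: cst_continuous.
split=> [x _|v]; first exact: differentiable_cst.
rewrite (_ : (fun x => _) = fun=> 0); first exact: IH.
by apply/funext => x; rewrite diff_cst.
Qed.

Lemma Ck_lin V W k (O : set V) (f : {linear V -> W}) : continuous f -> Ck k O f.
Proof.
move=> cf; case: k => [|k] /=; first by move=> x _; exact: cf.
split=> [x _|v]; first exact: linear_differentiable.
rewrite (_ : (fun x => _) = fun=> f v); first exact: Ck_cst.
by apply/funext => x; rewrite diff_lin.
Qed.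

Lemma Ck_linc V W Z k (O : set V) (f : V -> W) (g : {linear W -> Z}) :
  open O -> continuous g -> Ck k O f -> Ck k O (g \o f).
Proof.
move=> oO cg; elim: k f => [|k IH] f /=.
  by move=> h x Ox; apply: continuous_comp; [exact: h|exact: cg].
move=> [h1 h2]; split=> [x Ox|v].
  by apply: differentiable_comp; [exact: h1|exact: linear_differentiable].
apply: Ck_eq (IH _ (h2 v)) => // x Ox.
rewrite diff_comp ?diff_lin//=; first exact: h1.
exact: linear_differentiable.
Qed.

Lemma Ck_add V W k (O : set V) (f g : V -> W) :
  open O -> Ck k O f -> Ck k O g -> Ck k O (fun x => f x + g x).
Proof.
move=> oO; elim: k f g => [|k IH] f g /=.
  by move=> h h' x Ox; apply: continuousD; [exact: h|exact: h'].
move=> [h1 h2] [h1' h2']; split=> [x Ox|v].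
  by apply: differentiableD; [exact: h1|exact: h1'].
apply: Ck_eq (IH _ _ (h2 v) (h2' v)) => // x Ox.
by rewrite (@diffD _ _ _ f g)//; [exact: h1|exact: h1'].
Qed.

Lemma Ck_sum V W k (O : set V) n (f : 'I_n -> V -> W) :
  open O -> (forall i, Ck k O (f i)) -> Ck k O (fun x => \sum_i f i x).
Proof.
move=> oO; elim: n f => [|n IH] f h.
  rewrite (_ : (fun x => _) = fun=> 0); first exact: Ck_cst.
  by apply/funext => x; rewrite big_ord0.
rewrite (_ : (fun x => _) = fun x => f ord0 x + \sum_i f (lift ord0 i) x).
  by apply: Ck_add => //; exact: IH.
by apply/funext => x; rewrite big_ord_recl.
Qed.

Lemma is_diff_scale V W (c : V -> R^o) (f : V -> W) (x : V) :
  differentiable c x -> differentiable f x ->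
  differentiable (fun y => c y *: f y) x /\
  forall v, 'd (fun y => c y *: f y) x v = 'd c x v *: f x + c x *: 'd f x v.
Proof.
move=> dc df.
have cb : continuous (fun p : R^o * W => p.1 *: p.2) by exact: scale_continuous.
have lb : bilinear_for *:%R *:%R (fun (a : R^o) (b : W) => a *: b).
  split=> b a u v /=; first by rewrite scalerDl scalerA.
  by rewrite scalerDr !scalerA [b * a]mulrC.
pose sM := bilinear_isBilinear.Build _ _ _ _ _ _ _ lb.
pose sB : {bilinear R^o -> W -> W} := HB.pack (fun (a : R^o) (b : W) => a *: b) sM.
have dp : differentiable (fun y => (c y, f y)) x by exact: differentiable_pair.
have db := @differentiable_bilin _ _ _ _ sB (c x, f x) cb.
split; first exact: (differentiable_comp dp db).
move=> v; rewrite (_ : (fun y => c y *: f y) =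
  (fun p : R^o * W => sB p.1 p.2) \o (fun y => (c y, f y)))//.
have E := congr1 (fun h => h ('d (fun y => (c y, f y)) x v))
  (@diff_bilin _ _ _ _ sB (c x, f x) cb).
rewrite (diff_comp dp db) [LHS]E /= (diff_pair dc df) /=.
by rewrite addrC.
Qed.

Lemma Ck_scale V W k (O : set V) (c : V -> R^o) (f : V -> W) :
  open O -> Ck k O c -> Ck k O f -> Ck k O (fun x => c x *: f x).
Proof.
move=> oO; elim: k c f => [|k IH] c f.
  by move=> h h' x Ox; apply: continuousZ; [exact: h|exact: h'].
move=> hc hf; have [h1 h2] := hc; have [h1' h2'] := hf; split=> [x Ox|v].
  by have [] := is_diff_scale (h1 x Ox) (h1' x Ox).
apply: (@Ck_eq _ _ _ _ (fun x => 'd c x v *: f x + c x *: 'd f x v)) => //.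
  by move=> x Ox; have [_ ->] := is_diff_scale (h1 x Ox) (h1' x Ox).
apply: Ck_add => //; apply: IH.
- exact: h2.
- exact: (@Ck_leS _ _ k _ f hf).
- exact: (@Ck_leS _ _ k _ c hc).
- exact: h2'.
Qed.

(** Coordinates with continuous functionals; this is what the chain rule asks of the middle
    space. *)
Definition fin_basis W := exists n (b : 'I_n -> W) (l : 'I_n -> {linear W -> R^o}),
  (forall i, continuous (l i)) /\ forall w, w = \sum_i l i w *: b i.

Lemma fin_basisR : fin_basis R^o.
Proof.
exists 1%N, (fun=> 1), (fun=> idfun); split=> [i|w]; first by move=> x.
by rewrite big_ord_recl big_ord0 addr0 [RHS]mulr1.
Qed.

Lemma coord_is_linear n (i : 'I_n) :
  linear (fun v : 'rV[R]_n => v 0 i : R^o).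
Proof. by move=> a u v; rewrite !mxE. Qed.

Definition coordl n (i : 'I_n) : {linear 'rV[R]_n -> R^o} :=
  HB.pack (fun v : 'rV[R]_n => v 0 i : R^o)
    (GRing.isLinear.Build R 'rV[R]_n R^o *:%R (fun v => v 0 i) (@coord_is_linear n i)).

Lemma coordl_continuous n (i : 'I_n) : continuous (@coordl n i).
Proof. by move=> x; exact: coord_continuous. Qed.

Lemma fin_basis_rV n : fin_basis 'rV[R]_n.
Proof.
exists n, (fun i => delta_mx 0 i), (@coordl n); split.
  exact: coordl_continuous.
exact: row_sum_delta.
Qed.

(** [Ck] differentiates in fixed directions only, while the chain rule produces the moving direction
    'd f x v. Its expansion in a fixed basis of W turns the derivative of the composite into a sum
    of products to which the induction applies. *)
Lemma Ck_comp V W Z k (O : set V) (O' : set W) (f : V -> W) (g : W -> Z) :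
  fin_basis W -> open O -> open O' -> (forall x, O x -> O' (f x)) ->
  Ck k O f -> Ck k O' g -> Ck k O (g \o f).
Proof.
move=> [n [b [l [cl bE]]]] oO oO' fO.
elim: k f fO g => [|k IH] f fO g hf hg.
  by move=> x Ox; apply: continuous_comp; [exact: hf|exact/hg/fO].
have [h1 h2] := hf; have [h1' h2'] := hg; split=> [x Ox|v].
  by apply: differentiable_comp; [exact: h1|exact/h1'/fO].
apply: (@Ck_eq _ _ _ _ (fun x => \sum_i l i ('d f x v) *: 'd g (f x) (b i))) => //.
  move=> x Ox; rewrite (diff_comp (h1 x Ox) (h1' _ (fO x Ox))).
  rewrite /= {2}(bE ('d f x v)) linear_sum.
  by apply: eq_bigr => i _; rewrite linearZ.
apply: Ck_sum => // i; apply: Ck_scale => //.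
  by apply: (@Ck_linc _ _ _ _ _ (fun x => 'd f x v) (l i)) => //; exact: h2.
apply: (IH f fO (fun y => 'd g y (b i))); last exact: h2'.
exact: (@Ck_leS _ _ k _ f hf).
Qed.

End CkTheory.

(** * Smoothness at a point *)

Section SmoothAt.
Context {R : realType}.
Implicit Types V W Z : normedModType R.

(** [smooth_on] is meaningful on open sets only; quantifying over a neighbourhood gives a pointwise
    notion that combines with [near] statements. *)
Definition smooth_at V W (f : V -> W) (z : V) :=
  exists O, [/\ open O, O z & smooth_on O f].

Lemma smooth_onP V W (O : set V) (f : V -> W) : open O ->
  smooth_on O f <-> forall x, O x -> smooth_at f x.
Proof.
move=> oO; split=> [h x Ox|h k]; first by exists O.
by apply: Ck_local => x /h[ O' [ oO' O'x h']]; exists O'; split=> //; exact: h'.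
Qed.

Lemma smooth_at_near V W (f : V -> W) z :
  smooth_at f z -> \forall y \near z, smooth_at f y.
Proof.
move=> [ O [ oO Oz h]]; apply: filterS (open_nbhs_nbhs (conj oO Oz)) => y Oy.
by exists O.
Qed.

Lemma smooth_at_diff V W (f : V -> W) z : smooth_at f z -> differentiable f z.
Proof. by move=> [ O [ oO Oz /(_ 1%N) [h _]]]; exact: h. Qed.

Lemma smooth_at_continuous V W (f : V -> W) z :
  smooth_at f z -> {for z, continuous f}.
Proof. by move=> /smooth_at_diff /differentiable_continuous. Qed.

Lemma smooth_at_eq V W (f g : V -> W) z :
  (\forall y \near z, f y = g y) -> smooth_at f z -> smooth_at g z.
Proof.
move=> fg [ O [ oO Oz h]].
have : nbhs z [set y | f y = g y] by exact: fg.
rewrite nbhsE => -[U [oU Uz] fgU].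
exists (O `&` U); split; [exact: openI|by []|move=> k].
apply: (@Ck_eq _ _ _ _ _ f); first exact: openI.
  by move=> x [_ /fgU].
by apply: Ck_sub (h k) => x [].
Qed.

Lemma smooth_at_D V W (f : V -> W) z v :
  smooth_at f z -> smooth_at (fun x => 'd f x v) z.
Proof.
move=> [ O [ oO Oz h]]; exists O; split=> // k.
by have [_] := h k.+1; exact.
Qed.

Lemma smooth_at_cst V W (a : W) (z : V) : smooth_at (fun=> a) z.
Proof. by exists setT; split=> // [|k]; [exact: openT|exact: Ck_cst]. Qed.

Lemma smooth_at_lin V W (f : {linear V -> W}) z : continuous f -> smooth_at f z.
Proof. by move=> cf; exists setT; split=> // [|k]; [exact: openT|exact: Ck_lin]. Qed.

Lemma smooth_at_id V (z : V) : smooth_at id z.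
Proof. by apply: (@smooth_at_lin _ _ idfun) => x. Qed.

Lemma smooth_at_linc V W Z (f : V -> W) (g : {linear W -> Z}) z :
  continuous g -> smooth_at f z -> smooth_at (fun x => g (f x)) z.
Proof.
by move=> cg [ O [ oO Oz h]]; exists O; split=> // k; exact: Ck_linc.
Qed.

Lemma smooth_at_add V W (f g : V -> W) z :
  smooth_at f z -> smooth_at g z -> smooth_at (fun x => f x + g x) z.
Proof.
move=> [ O [ oO Oz h]] [ O' [ oO' Oz' h']]; exists (O `&` O'); split=> //.
  exact: openI.
move=> k; apply: Ck_add; first exact: openI.
  by apply: Ck_sub (h k) => x [].
by apply: Ck_sub (h' k) => x [].
Qed.

Lemma smooth_at_scale V W (c : V -> R^o) (f : V -> W) z :
  smooth_at c z -> smooth_at f z -> smooth_at (fun x => c x *: f x) z.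
Proof.
move=> [ O [ oO Oz h]] [ O' [ oO' Oz' h']]; exists (O `&` O'); split=> //.
  exact: openI.
move=> k; apply: Ck_scale; first exact: openI.
  by apply: Ck_sub (h k) => x [].
by apply: Ck_sub (h' k) => x [].
Qed.

Lemma smooth_at_mul V (f g : V -> R^o) z :
  smooth_at f z -> smooth_at g z -> smooth_at (fun x => f x * g x : R^o) z.
Proof. exact: smooth_at_scale. Qed.

Lemma smooth_at_opp V W (f : V -> W) z :
  smooth_at f z -> smooth_at (fun x => - f x) z.
Proof.
move=> h; apply: (@smooth_at_eq _ _ (fun x => (-1 : R) *: f x)).
  by apply: nearW => x; rewrite scaleN1r.
by apply: smooth_at_scale => //; exact: smooth_at_cst.
Qed.

Lemma smooth_at_sub V W (f g : V -> W) z :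
  smooth_at f z -> smooth_at g z -> smooth_at (fun x => f x - g x) z.
Proof. by move=> h h'; apply: smooth_at_add => //; exact: smooth_at_opp. Qed.

Lemma smooth_at_sum V W n (f : 'I_n -> V -> W) z :
  (forall i, smooth_at (f i) z) -> smooth_at (fun x => \sum_i f i x) z.
Proof.
elim: n f => [|n IH] f h.
  apply: smooth_at_eq (smooth_at_cst 0 z).
  by apply: nearW => x; rewrite big_ord0.
apply: (@smooth_at_eq _ _ (fun x => f ord0 x + \sum_i f (lift ord0 i) x)).
  by apply: nearW => x; rewrite big_ord_recl.
by apply: smooth_at_add => //; exact: IH.
Qed.

Lemma smooth_at_comp V W Z (f : V -> W) (g : W -> Z) z : fin_basis W ->
  smooth_at f z -> smooth_at g (f z) -> smooth_at (fun x => g (f x)) z.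
Proof.
move=> bW sf [ O' [ oO' O'fz hg]].
have cf := smooth_at_continuous sf.
have := cf O' (open_nbhs_nbhs (conj oO' O'fz)).
rewrite /= nbhs_filterE nbhsE => -[U [oU Uz] UO].
move: sf => [ O [ oO Oz hf]].
exists (O `&` U); split=> //; first exact: openI.
move=> k; apply: (@Ck_comp _ _ _ _ _ _ O' f g) => //; first exact: openI.
  by move=> x [_ /UO].
by apply: Ck_sub (hf k) => x [].
Qed.

Lemma smooth_at_coord V n (f : V -> 'rV[R]_n) z i :
  smooth_at f z -> smooth_at (fun x => f x 0 i : R^o) z.
Proof.
by move=> h; apply: (@smooth_at_linc _ _ _ f (@coordl _ _ i)) => //; exact: coordl_continuous.
Qed.

Lemma smooth_at_differential V W Z (f : V -> W) (g : W -> Z) (u : V -> W) z :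
  fin_basis W -> smooth_at f z -> smooth_at g (f z) -> smooth_at u z ->
  smooth_at (fun x => 'd g (f x) (u x)) z.
Proof.
move=> bW sf sg su; have [n [b [l [cl bE]]]] := bW.
apply: (@smooth_at_eq _ _ (fun x => \sum_i l i (u x) *: 'd g (f x) (b i))).
  apply: nearW => x; rewrite [in RHS](bE (u x)) linear_sum.
  by apply: eq_bigr => i _; rewrite linearZ.
apply: smooth_at_sum => i; apply: smooth_at_scale.
  exact: (@smooth_at_linc _ _ _ u (l i)).
by apply: (@smooth_at_comp _ _ _ f (fun y => 'd g y (b i))) => //; exact: smooth_at_D.
Qed.

End SmoothAt.

(** * Derivatives given by explicit formulas *)

Section HasDiff.
Context {R : realType}.
Implicit Types V W Z : normedModType R.

(** The derivative is a bare function, known up to pointwise equality, so that the rules of calculus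
    compose formulas with no linear structure to carry along. *)
Definition hasd V W (f : V -> W) (x : V) (L : V -> W) :=
  differentiable f x /\ forall v, 'd f x v = L v.

Lemma hasd_self V W (f : V -> W) x : differentiable f x -> hasd f x ('d f x).
Proof. by []. Qed.

Lemma hasd_ext V W (f : V -> W) x L L' : L =1 L' -> hasd f x L -> hasd f x L'.
Proof. by move=> LL' [df E]; split=> // v; rewrite E LL'. Qed.

Lemma hasd_near V W (f g : V -> W) x L :
  (\forall y \near x, f y = g y) -> hasd f x L -> hasd g x L.
Proof.
move=> fg [df E]; split=> [|v]; first exact: (proj1 (diff_near fg df)).
by rewrite (diff_near_eq v fg df).
Qed.

Lemma hasd_cst V W (a : W) (x : V) : hasd (fun=> a) x (fun=> 0).
Proof. by split=> [|v]; [exact: differentiable_cst|rewrite diff_cst]. Qed.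

Lemma hasd_lin V W (f : {linear V -> W}) x : continuous f -> hasd f x f.
Proof. by move=> cf; split=> [|v]; [exact: linear_differentiable|rewrite diff_lin]. Qed.

Lemma hasd_id V (x : V) : hasd id x id.
Proof. by apply: (@hasd_lin _ _ idfun) => y. Qed.

Lemma hasd_add V W (f g : V -> W) x L L' : hasd f x L -> hasd g x L' ->
  hasd (fun y => f y + g y) x (fun v => L v + L' v).
Proof.
move=> [df E] [dg E']; split=> [|v]; first exact: differentiableD.
by rewrite -E -E'; exact: (congr1 (fun h => h v) (diffD df dg)).
Qed.

Lemma hasd_opp V W (f : V -> W) x L : hasd f x L ->
  hasd (fun y => - f y) x (fun v => - L v).
Proof.
move=> [df E]; split=> [|v]; first exact: differentiableN.
by rewrite -E; exact: (congr1 (fun h => h v) (diffN df)).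
Qed.

Lemma hasd_sub V W (f g : V -> W) x L L' : hasd f x L -> hasd g x L' ->
  hasd (fun y => f y - g y) x (fun v => L v - L' v).
Proof. by move=> h h'; apply: hasd_add => //; exact: hasd_opp. Qed.

Lemma hasd_scale V W (c : V -> R^o) (f : V -> W) x L L' :
  hasd c x L -> hasd f x L' ->
  hasd (fun y => c y *: f y) x (fun v => L v *: f x + c x *: L' v).
Proof.
move=> [dc E] [df E']; have [d E2] := is_diff_scale dc df.
by split=> // v; rewrite E2 E E'.
Qed.

Lemma hasd_mul V (c f : V -> R^o) x L L' :
  hasd c x L -> hasd f x L' ->
  hasd (fun y => c y * f y : R^o) x (fun v => L v * f x + c x * L' v).
Proof. exact: hasd_scale. Qed.

Lemma hasd_sum V W m (f : 'I_m -> V -> W) x L : (forall i, hasd (f i) x (L i)) ->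
  hasd (fun y => \sum_i f i y) x (fun v => \sum_i L i v).
Proof.
elim: m f L => [|m IH] f L h.
  apply: hasd_near (hasd_ext _ (hasd_cst 0 x)).
    by apply: nearW => y; rewrite big_ord0.
  by move=> v; rewrite big_ord0.
apply: hasd_near (hasd_ext _ (hasd_add (h ord0) (IH _ _ (fun i => h (lift ord0 i))))).
  by apply: nearW => y; rewrite big_ord_recl.
by move=> v; rewrite big_ord_recl.
Qed.

Lemma hasd_comp V W Z (f : V -> W) (g : W -> Z) x L L' :
  hasd f x L -> hasd g (f x) L' -> hasd (fun y => g (f y)) x (fun v => L' (L v)).
Proof.
move=> [df E] [dg E']; split=> [|v]; first exact: (differentiable_comp df dg).
by rewrite -E -E'; exact: (congr1 (fun h => h v) (diff_comp df dg)).
Qed.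

Lemma hasd_coord V n (f : V -> 'rV[R]_n) x L i : hasd f x L ->
  hasd (fun y => f y 0 i : R^o) x (fun v => L v 0 i).
Proof.
by move=> h; apply: (hasd_comp h (hasd_lin (f x) (@coordl_continuous R n i))).
Qed.

Lemma hasd_diff V W (f : V -> W) x L v : hasd f x L -> 'd f x v = L v.
Proof. by move=> [_]. Qed.

End HasDiff.

(** * Symmetry of second derivatives *)

Section Schwarz.
Context {R : realType}.
Implicit Types V : normedModType R.

Lemma line_is_derive V (f : V -> R^o) (x v : V) (t : R) :
  differentiable f (x + t *: v) ->
  is_derive (t : R^o) 1 (fun s : R^o => f (x + s *: v)) ('d f (x + t *: v) v).
Proof.
move=> df.
have dz : differentiable (fun s : R^o => s *: v) (t : R^o).
  exact: (@differentiableZl _ _ _ id).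
have dl : differentiable (fun s : R^o => x + s *: v) (t : R^o).
  by apply: differentiableD => //; exact: differentiable_cst.
have dc := differentiable_comp dl df.
apply: DeriveDef; first exact: diff_derivable.
rewrite deriveE // (diff_comp dl df) /=; congr ('d f _ _).
rewrite (@diffD _ _ _ (cst x) (fun s : R^o => s *: v)) //=.
rewrite diff_cst /= add0r (@diffZl _ _ _ id)// diff_val /=.
by rewrite scale1r.
Qed.

Lemma MVT01 (g dg : R -> R) :
  (forall t : R, 0 <= t <= 1 -> is_derive (t : R^o) 1 (g : R^o -> R^o) (dg t)) ->
  exists2 t : R, 0 < t < 1 & g 1 - g 0 = dg t.
Proof.
move=> h.
have [t t01 E] : exists2 t, t \in `]0, 1[%R & g 1 - g 0 = dg t * (1 - 0).
  apply: MVT => //.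
    by move=> t; rewrite in_itv /= => /andP[t0 t1]; apply: h; rewrite !ltW.
  apply: derivable_within_continuous => t; rewrite in_itv /= => t01.
  by have [] := h _ t01.
by exists t; [move: t01; rewrite in_itv|rewrite E subr0 mulr1].
Qed.

Lemma mean_value V (f : V -> R^o) (x v : V) :
  (forall t : R, 0 <= t <= 1 -> differentiable f (x + t *: v)) ->
  exists2 t : R, 0 < t < 1 & f (x + v) - f x = 'd f (x + t *: v) v.
Proof.
move=> df.
have [t t01 E] := MVT01 (fun t t01 => line_is_derive (df t t01)).
by exists t => //; move: E; rewrite scale1r scale0r addr0.
Qed.

(** The mean value theorem is applied twice: to t |-> f(z + h u + t h v) - f(z + t h v), then to the
    derivative of f in the direction v, along h u. The second difference becomes exactly h^2 times a
    mixed derivative at a nearby point. *)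
Lemma second_difference V (f : V -> R^o) (z u v : V) (e : R) : 0 < e ->
  smooth_at f z ->
  exists2 d, 0 < d & forall h : R, 0 < h < d ->
    `|f (z + h *: u + h *: v) - f (z + h *: u) - (f (z + h *: v) - f z)
      - h ^+ 2 * 'd (fun y => 'd f y v : R^o) z u| <= h ^+ 2 * e.
Proof.
move=> e0 sf; set g := fun y => 'd f y v : R^o.
have sg : smooth_at g z by exact: smooth_at_D.
have c2 := smooth_at_continuous (smooth_at_D u sg).
have : \forall y \near z, [/\ smooth_at f y, smooth_at g y &
    `|'d g z u - 'd g y u| < e].
  near=> y; split; [near: y|near: y|near: y].
  - exact: smooth_at_near.
  - exact: smooth_at_near.
  - by move/cvgrPdist_lt : c2; exact.
move=> /nbhs_ballP[r /= r0 hr].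
have k0 : 0 < `|u| + `|v| + 1.
  by apply: (lt_le_trans ltr01); rewrite lerDr addr_ge0.
(* Below this bound the parallelogram spanned by h u and h v at z stays in the ball of radius r; the
   summand 1 keeps the denominator positive. *)
exists (r / (`|u| + `|v| + 1)); first by rewrite divr_gt0.
move=> h /andP[h0]; rewrite ltr_pdivlMr // => hd.
have inb (s t : R) : 0 <= s <= 1 -> 0 <= t <= 1 ->
    ball z r (z + s *: (h *: u) + t *: (h *: v)).
  move=> /andP[s0 s1] /andP[t0 t1]; rewrite -ball_normE /=.
  rewrite -addrA opprD addrA subrr add0r normrN.
  apply: le_lt_trans hd; apply: le_trans (ler_normD _ _) _.
  rewrite !normrZ !ger0_norm // ?(ltW h0) //.
  rewrite !mulrA -[X in _ <= X]mulrC ![in X in _ <= X]mulrDl mul1r.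
  rewrite -[X in X <= _]addr0; apply: lerD; last exact: ltW.
  have hu : 0 <= h * `|u| by rewrite mulr_ge0 // ltW.
  have hv : 0 <= h * `|v| by rewrite mulr_ge0 // ltW.
  by apply: lerD; rewrite -mulrA [X in _ <= X]mulrC ler_piMl.
have i0 : 0 <= (0 : R) <= 1 by rewrite lexx ler01.
have i1 : 0 <= (1 : R) <= 1 by rewrite lexx ler01.
have D (t : R) : 0 <= t <= 1 -> is_derive (t : R^o) 1
    (fun t : R^o => f (z + h *: u + t *: (h *: v)) - f (z + t *: (h *: v)) : R^o)
    ('d f (z + h *: u + t *: (h *: v)) (h *: v) - 'd f (z + t *: (h *: v)) (h *: v)).
  move=> t01; apply: is_deriveB; apply: line_is_derive.
    have := inb 1 t i1 t01; rewrite scale1r => /hr[/smooth_at_diff] //.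
  have := inb 0 t i0 t01; rewrite scale0r addr0 => /hr[/smooth_at_diff] //.
have dfZ y : 'd f y (h *: v) = h * 'd f y v by rewrite linearZ.
have dgZ y : 'd g y (h *: u) = h * 'd g y u by rewrite linearZ.
have [t /andP[t0 t1]] := MVT01 D.
rewrite !scale1r !scale0r !addr0 !dfZ => E.
have t01 : 0 <= t <= 1 by rewrite !ltW.
have [|s /andP[s0 s1]] := @mean_value _ g (z + t *: (h *: v)) (h *: u).
  move=> s s01; rewrite addrAC; apply: smooth_at_diff.
  by have /hr[] := inb s t s01 t01.
rewrite dgZ /g => E2.
have E3 : f (z + h *: u + h *: v) - f (z + h *: u) - (f (z + h *: v) - f z) =
    h ^+ 2 * 'd g (z + t *: (h *: v) + s *: (h *: u)) u.
  rewrite expr2 -mulrA -E2 mulrBr.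
  rewrite (addrAC z (t *: _)) -E; ring.
rewrite E3 -mulrBr normrM ger0_norm ?sqr_ge0 // ler_wpM2l ?sqr_ge0 //.
rewrite distrC (addrAC z).
have s01 : 0 <= s <= 1 by rewrite !ltW.
by have /hr[_ _ /ltW] := inb s t s01 t01.
Unshelve. all: by end_near. Qed.

(** The second difference is symmetric in u and v, and for small h each mixed derivative is within e
    / 2 of its quotient by h^2. *)
Lemma schwarz_real V (f : V -> R^o) (z u v : V) : smooth_at f z ->
  'd (fun y => 'd f y v : R^o) z u = 'd (fun y => 'd f y u : R^o) z v.
Proof.
move=> sf; apply/eqP; rewrite -subr_eq0 -normr_le0; apply/ler_addgt0Pl => e e0.
rewrite addr0.
have e20 : 0 < e / 2 by rewrite divr_gt0.
have [d1 d10 h1] := second_difference u v e20 sf.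
have [d2 d20 h2] := second_difference v u e20 sf.
pose h := Num.min d1 d2 / 2.
have h0 : 0 < h by rewrite divr_gt0 // lt_min d10.
have hd : h < Num.min d1 d2 by rewrite ltr_pdivrMr // ltr_pMr ?ltr1n // lt_min d10.
move: hd; rewrite lt_min => /andP[hd1 hd2].
have aux (a b c d p q : R) :
    `|d - c - (b - a) - h ^+ 2 * p| <= h ^+ 2 * (e / 2) ->
    `|d - b - (c - a) - h ^+ 2 * q| <= h ^+ 2 * (e / 2) -> `|q - p| <= e.
  rewrite !ler_norml => /andP[A1 A2] /andP[B1 B2].
  have h20 : 0 < h ^+ 2 by rewrite exprn_gt0.
  have : h ^+ 2 * `|q - p| <= h ^+ 2 * e.
    rewrite -[X in X * `|_|]gtr0_norm // -normrM ler_norml mulrBr.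
    by apply/andP; split; nra.
  by rewrite (ler_pM2l h20) ler_norml.
have {h1} := h1 h; rewrite h0 hd1 => /(_ isT) B1.
have {h2} := h2 h; rewrite h0 hd2 (addrAC z (h *: v)) => /(_ isT) B2.
exact: aux B2 B1.
Qed.

Lemma schwarz V n (f : V -> 'rV[R]_n) (z u v : V) : smooth_at f z ->
  'd (fun y => 'd f y v) z u = 'd (fun y => 'd f y u) z v.
Proof.
move=> sf; apply/rowP => i.
have E (g : V -> 'rV[R]_n) y w : differentiable g y ->
    'd g y w 0 i = 'd (fun y => g y 0 i : R^o) y w.
  move=> dg; rewrite (_ : (fun y => g y 0 i : R^o) = @coordl R n i \o g) //.
  have dl := @linear_differentiable _ _ _ _ (g y) (@coordl_continuous R n i).
  by rewrite (diff_comp dg dl) diff_lin //; exact: coordl_continuous.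
rewrite !E; try by apply: smooth_at_diff; exact: smooth_at_D.
have K w w' : 'd (fun y => 'd f y w 0 i : R^o) z w' =
    'd (fun y => 'd (fun y => f y 0 i : R^o) y w : R^o) z w'.
  apply: (@diff_near_eq _ _ _ (fun y => 'd (fun y => f y 0 i : R^o) y w : R^o)
     (fun y => 'd f y w 0 i : R^o)).
    by apply: filterS (smooth_at_near sf) => y /smooth_at_diff dy; rewrite E.
  apply: smooth_at_diff; apply: smooth_at_D; exact: smooth_at_coord.
apply: (etrans (K v u)); apply: (etrans _ (esym (K u v))).
by apply: schwarz_real; exact: smooth_at_coord.
Qed.

End Schwarz.

(** * Integration over the unit interval *)

Section UnitInterval.
Context {R : realType}.
Local Notation mu := (@lebesgue_measure R).

Definition cont01 (g : R -> R) := {within `[0, 1], continuous g}.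

Definition int01 (g : R -> R) : R := (\int[mu]_(t in `[0, 1]) g t)%R.

Lemma cont01_integrable g : cont01 g -> mu.-integrable `[0, 1] (EFin \o g).
Proof. by move=> cg; apply: continuous_compact_integrable; first exact: segment_compact. Qed.

Lemma cont01_add f g : cont01 f -> cont01 g -> cont01 (fun t => f t + g t).
Proof. by move=> cf cg t; apply: continuousD; [exact: cf|exact: cg]. Qed.

Lemma cont01_sub f g : cont01 f -> cont01 g -> cont01 (fun t => f t - g t).
Proof. by move=> cf cg t; apply: continuousB; [exact: cf|exact: cg]. Qed.

Lemma cont01_scale c g : cont01 g -> cont01 (fun t => c * g t).
Proof. by move=> cg t; apply: continuousM; [exact: cst_continuous|exact: cg]. Qed.

Lemma cont01_cst c : cont01 (fun=> c).
Proof. by move=> t; exact: cst_continuous. Qed.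

Lemma int01_eq f g : (forall t, 0 <= t <= 1 -> f t = g t) -> int01 f = int01 g.
Proof. by move=> fg; apply: eq_Rintegral => t; rewrite inE /= in_itv /=; exact: fg. Qed.

Lemma int01_add f g : cont01 f -> cont01 g ->
  int01 (fun t => f t + g t) = int01 f + int01 g.
Proof. by move=> cf cg; apply: RintegralD => //; exact: cont01_integrable. Qed.

Lemma int01_scale c g : cont01 g -> int01 (fun t => c * g t) = c * int01 g.
Proof. by move=> cg; apply: RintegralZl => //; exact: cont01_integrable. Qed.

Lemma int01_sub f g : cont01 f -> cont01 g ->
  int01 (fun t => f t - g t) = int01 f - int01 g.
Proof. by move=> cf cg; apply: RintegralB => //; exact: cont01_integrable. Qed.

Lemma int01_cst c : int01 (fun=> c) = c.
Proof.
by rewrite /int01 Rintegral_cst//= lebesgue_measure_itv/= lte_fin ltr01 oppr0 adde0 mulr1.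
Qed.

Lemma cont01_sum m (f : 'I_m -> R -> R) :
  (forall i, cont01 (f i)) -> cont01 (fun t => \sum_i f i t).
Proof.
elim: m f => [|m IH] f cf.
  rewrite (_ : (fun=> _) = fun=> 0); first exact: cont01_cst.
  by apply/funext => t; rewrite big_ord0.
rewrite (_ : (fun=> _) = fun t => f ord0 t + \sum_i f (lift ord0 i) t).
  by apply: cont01_add => //; exact: IH.
by apply/funext => t; rewrite big_ord_recl.
Qed.

Lemma int01_sum m (f : 'I_m -> R -> R) :
  (forall i, cont01 (f i)) -> int01 (fun t => \sum_i f i t) = \sum_i int01 (f i).
Proof.
elim: m f => [|m IH] f cf.
  rewrite big_ord0 -[RHS]int01_cst.
  by apply: int01_eq => t _; rewrite big_ord0.
rewrite big_ord_recl -IH // -int01_add //; last exact: cont01_sum.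
by apply: int01_eq => t _; rewrite big_ord_recl.
Qed.

Lemma int01_le g c : cont01 g -> (forall t, 0 <= t <= 1 -> `|g t| <= c) ->
  `|int01 g| <= c.
Proof.
move=> cg gc; apply: le_trans (le_normr_Rintegral _ (cont01_integrable cg)) _ => //.
rewrite -[leRHS]int01_cst; apply: le_Rintegral => //.
- by apply: integrable_norm => //; exact: cont01_integrable.
- by apply: cont01_integrable; exact: cont01_cst.
Qed.

Lemma int01_FTC (G g : R -> R) : cont01 g ->
  (forall t : R, 0 <= t <= 1 -> is_derive (t : R^o) 1 (G : R^o -> R^o) (g t)) ->
  int01 g = G 1 - G 0.
Proof.
move=> cg dG; rewrite /int01 /Rintegral.
have cG t : 0 <= t <= 1 -> {for t, continuous G}.
  by move=> t01; apply/differentiable_continuous/derivable1_diffP; case: (dG t t01).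
rewrite (@continuous_FTC2 R g G) //.
  split.
  - by move=> t; rewrite in_itv /= => /andP[t0 t1]; have [|] := dG t; rewrite ?ltW.
  - by apply: cvg_at_right_filter; apply: cG; rewrite lexx ler01.
  - by apply: cvg_at_left_filter; apply: cG; rewrite lexx ler01.
move=> t; rewrite in_itv /= => /andP[t0 t1]; rewrite derive1E.
by have [|] := dG t; rewrite ?ltW.
Qed.

End UnitInterval.

Section NearAux.
Context {R : realType}.
Implicit Types V W : normedModType R.

Lemma continuous_near0 V W (f : V -> W) (z : V) :
  (forall e : R, 0 < e -> \forall h \near (0 : V), `|f (h + z) - f z| <= e) ->
  {for z, continuous f}.
Proof.
move=> h; rewrite /prop_for /continuous_at; apply/cvgrPdist_le => e e0.
suff : \forall y \near z, `|f z - f y| <= e by [].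
rewrite (near_shift 0 z) subr0.
by apply: filterS (h e e0) => k; rewrite /= distrC.
Qed.

Lemma near0_forall V m (P : 'I_m -> V -> Prop) :
  (forall i, \forall h \near (0 : V), P i h) ->
  \forall h \near (0 : V), forall i, P i h.
Proof. by move=> h; apply: filter_forall. Qed.

Lemma near0_small V (z : V) (U : set V) : open U -> U z ->
  \forall h \near (0 : V), forall k : V, `|k| <= `|h| -> U (k + z).
Proof.
move=> oU Uz.
have : nbhs z U by apply: open_nbhs_nbhs.
move=> /nbhs_ballP[d /= d0 hd]; near=> h => k kh.
apply: hd; rewrite -ball_normE /= opprD addrCA subrr addr0 normrN.
apply: le_lt_trans kh _; near: h; exact: nbhs0_lt.
Unshelve. all: by end_near. Qed.

Lemma coord_le_norm n (v : 'rV[R]_n) i : `|v 0 i| <= `|v|.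
Proof. by rewrite [leRHS]mx_normrE; apply: (le_bigmax _ _ (ord0, i)). Qed.

End NearAux.

(** * The Poincare lemma on a ball, in degrees 1 and 2 *)

Section Radial.
Context {R : realType} {n : nat}.
Variables (z0 : 'rV[R]_n) (r : R).
Hypothesis r0 : 0 < r.
Local Notation V := 'rV[R]_n.
Local Notation O := (ball z0 r : set V).

Definition radial (z : V) (t : R) : V := z0 + t *: (z - z0).

(** Each derivative in z brings out a factor t, so a family closed under differentiation needs all
    the weights t^a. *)
Definition radial_int (a : nat) (f : V -> R) (z : V) : R :=
  int01 (fun t => t ^+ a * f (radial z t)).

Lemma radial_ball z t : O z -> 0 <= t <= 1 -> O (radial z t).
Proof.
rewrite -ball_normE /= => zr /andP[t0 t1].
rewrite /radial opprD addrA subrr add0r normrN normrZ ger0_norm //.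
by apply: le_lt_trans zr; rewrite distrC ler_piMl.
Qed.

Lemma radialD z h t : radial (h + z) t = t *: h + radial z t.
Proof. by rewrite /radial -addrA scalerDr addrCA. Qed.

Lemma radial_continuous z : continuous (radial z : R^o -> V).
Proof.
move=> t; rewrite /radial.
apply: (@continuousD _ _ _ (cst z0) (fun t : R^o => t *: (z - z0))).
  exact: cst_continuous.
exact: scalel_continuous.
Qed.

Lemma radial_cont01 a (f : V -> R^o) z :
  (forall x, O x -> {for x, continuous f}) -> O z ->
  cont01 (fun t => t ^+ a * f (radial z t)).
Proof.
move=> cf Oz; apply: continuous_in_subspaceT => t; rewrite inE /= in_itv /= => t01.
apply: (@continuousM _ _ (fun t : R => t ^+ a) (fun t => f (radial z t))).
  exact: exprn_continuous.
apply: (@continuous_comp _ _ _ (radial z) f); first exact: radial_continuous.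
by apply: cf; exact: radial_ball.
Qed.

(** Continuity along the segment from z0 to z is made uniform in t by the covering form of
    compactness of [0, 1]. *)
Lemma radial_uniform (f : V -> R^o) z (e : R) : 0 < e ->
  (forall x, O x -> {for x, continuous f}) -> O z ->
  \forall h \near (0 : V), forall t, 0 <= t <= 1 ->
    `|f (h + radial z t) - f (radial z t)| < e.
Proof.
move=> e0 cf Oz.
have /compact_near_coveringP/near_covering_withinP := @segment_compact R 0 1.
move=> /(_ V (nbhs (0 : V)) (fun h t => `|f (h + radial z t) - f (radial z t)| < e) _).
move=> K; have {K} : \forall h \near (0 : V), `[0, 1] `<=` (fun t =>
    `|f (h + radial z t) - f (radial z t)| < e).
  apply: K => t /=; rewrite in_itv /= => t01.
  have cft := cf _ (radial_ball Oz t01).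
  have e20 : 0 < e / 2 by rewrite divr_gt0.
  have /cvgrPdist_lt/(_ _ e20) N := cft.
  have c1 : (fun p : R * V => p.2 + radial z p.1) @ (t, (0 : V)) --> radial z t.
    rewrite -[X in _ --> X]add0r; apply: cvgD; first exact: cvg_snd.
    by apply: continuous_comp; [exact: cvg_fst|exact: radial_continuous].
  have c2 : (fun p : R * V => radial z p.1) @ (t, (0 : V)) --> radial z t.
    by apply: continuous_comp; [exact: cvg_fst|exact: radial_continuous].
  suff : \forall p \near (t, 0 : V), p.1 \in `[0, 1] ->
    `|f (p.2 + radial z p.1) - f (radial z p.1)| < e by [].
  have N1 : \forall p \near (t, 0 : V),
    `|f (radial z t) - f (p.2 + radial z p.1)| < e / 2 := c1 _ N.
  have N2 : \forall p \near (t, 0 : V),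
    `|f (radial z t) - f (radial z p.1)| < e / 2 := c2 _ N.
  apply: filterS (filterI N1 N2) => -[s h] /= [A B] _.
  rewrite (le_lt_trans (ler_distD (f (radial z t)) _ _)) // [ltRHS]splitr ltrD //.
  by rewrite distrC.
by apply: filterS => h hh t t01; apply: hh; rewrite /= in_itv.
Qed.

Lemma radial_uniform_ball (f : V -> R^o) z (e : R) : 0 < e ->
  (forall x, O x -> {for x, continuous f}) -> O z ->
  \forall h \near (0 : V), forall k : V, `|k| <= `|h| ->
    O (k + z) /\ forall t, 0 <= t <= 1 ->
    `|f (k + radial z t) - f (radial z t)| < e.
Proof.
move=> e0 cf Oz; have /nbhs_ballP[d /= d0 hd] := radial_uniform e0 cf Oz.
have b0 : ball (0 : V) d 0 by exact: ballxx.
have := near0_small (@ball_open _ _ (0 : V) d) b0.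
have := near0_small (@ball_open _ _ z0 r) Oz.
apply: filterS2 => h h1 h2 k kh; split; first exact: h1.
by have := h2 k kh; rewrite addr0 => /hd.
Qed.

Lemma radial_int_bound a (f g : V -> R^o) y z (e : R) :
  (forall x, O x -> {for x, continuous f}) ->
  (forall x, O x -> {for x, continuous g}) -> O y -> O z ->
  (forall t, 0 <= t <= 1 -> `|f (radial y t) - g (radial z t)| <= e) ->
  `|radial_int a f y - radial_int a g z| <= e.
Proof.
move=> cf cg Oy Oz h; have cy := radial_cont01 (a := a) cf Oy; have cz := radial_cont01 (a := a) cg Oz.
rewrite /radial_int -int01_sub //; apply: int01_le.
  exact: cont01_sub.
move=> t /andP[t0 t1]; rewrite -mulrBr normrM ger0_norm; last exact: exprn_ge0.
apply: le_trans (h t _); last by rewrite t0.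
by rewrite ler_piMl // exprn_ile1.
Qed.

Lemma radial_int_continuous a (f : V -> R^o) :
  (forall x, O x -> {for x, continuous f}) ->
  forall z, O z -> {for z, continuous (radial_int a f : V -> R^o)}.
Proof.
move=> cf z Oz; apply: continuous_near0 => e e0.
apply: filterS (radial_uniform_ball e0 cf Oz) => h hh.
have [Oh _] := hh h (lexx _).
apply: radial_int_bound => // t t01.
rewrite radialD; have [|_ /(_ t t01)/ltW] := hh (t *: h) => //.
by case/andP: t01 => t0 t1; rewrite normrZ ger0_norm // ler_piMl.
Qed.

Definition partial (i : 'I_n) (f : V -> R^o) (z : V) : R^o := 'd f z (delta_mx 0 i).

Lemma diff_partial (f : V -> R^o) z (v : V) :
  'd f z v = \sum_i v 0 i * partial i f z.
Proof.
rewrite {1}(row_sum_delta v) linear_sum; apply: eq_bigr => i _.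
by rewrite linearZ.
Qed.

Lemma radial_int_lin_is_linear a (f : V -> R^o) z :
  linear (fun v : V => \sum_i v 0 i * radial_int a (partial i f) z : R^o).
Proof.
move=> c u v; rewrite scaler_sumr -big_split /=; apply: eq_bigr => i _.
by rewrite !mxE mulrDl -mulrA.
Qed.

(** At each t the mean value theorem replaces the increment of f by partial derivatives at a point
    between, and [radial_uniform_ball] bounds their variation for all t at once; this justifies
    differentiation under the integral sign. *)
Lemma radial_int_diff a (f : V -> R^o) z : Ck 1 O f -> O z ->
  differentiable (radial_int a f : V -> R^o) z /\
  forall v, 'd (radial_int a f : V -> R^o) z v =
    \sum_i v 0 i * radial_int a.+1 (partial i f) z.
Proof.
move=> [df cdf] Oz.
have cf x : O x -> {for x, continuous f} by move=> /df/differentiable_continuous.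
have cp i x : O x -> {for x, continuous (partial i f)} by exact: cdf.
pose L : {linear V -> R^o} := HB.pack
  (fun v : V => \sum_i v 0 i * radial_int a.+1 (partial i f) z : R^o)
  (GRing.isLinear.Build R V R^o *:%R _ (@radial_int_lin_is_linear a.+1 f z)).
suff [d E] : differentiable (radial_int a f : V -> R^o) z /\
    'd (radial_int a f : V -> R^o) z = L :> (V -> R^o).
  by split=> // v; rewrite E.
apply: diff_intro.
  move=> v; apply: smooth_at_continuous; rewrite /L /=.
  apply: smooth_at_sum => i; apply: smooth_at_mul; last exact: smooth_at_cst.
  exact: (smooth_at_coord i (smooth_at_id v)).
move=> e e0.
(* One share of e for each of the n coordinates; n.+1 keeps the quotient meaningful for n = 0. *)
have en0 : 0 < e / n.+1%:R by rewrite divr_gt0.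
have : \forall h \near (0 : V), forall i k, `|k| <= `|h| ->
    O (k + z) /\ forall t, 0 <= t <= 1 ->
    `|partial i f (k + radial z t) - partial i f (radial z t)| < e / n.+1%:R.
  apply: near0_forall => i; exact (radial_uniform_ball en0 (cp i) Oz).
have := radial_uniform_ball en0 cf Oz; apply: filterS2 => h Oh' hh.
have Oh k : `|k| <= `|h| -> O (k + z) by move=> /Oh'[].
have c1 := radial_cont01 (a := a) cf (Oh h (lexx _)).
have c2 := radial_cont01 (a := a) cf Oz.
have c3 i := radial_cont01 (a := a.+1) (cp i) Oz.
have c4 : cont01 (fun t => \sum_i h 0 i * (t ^+ a.+1 * partial i f (radial z t))).
  by apply: cont01_sum => i; exact: cont01_scale.
have -> : L h = int01 (fun t => \sum_i h 0 i * (t ^+ a.+1 * partial i f (radial z t))).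
  rewrite int01_sum; last by move=> i; exact: cont01_scale.
  by apply: eq_bigr => i _; rewrite int01_scale.
rewrite /radial_int -int01_sub // -int01_sub //; last first.
  exact: cont01_sub.
apply: int01_le.
  by apply: cont01_sub => //; exact: cont01_sub.
move=> t t01; have [t0 t1] := andP t01.
have th s : 0 <= s <= 1 -> `|s *: (t *: h)| <= `|h|.
  move=> /andP[s0 s1]; rewrite !normrZ !ger0_norm // mulrA.
  by rewrite ler_piMl // mulr_ile1.
have [|s /andP[s0 s1]] := @mean_value _ _ f (radial z t) (t *: h).
  move=> s /andP[s0 s1]; apply: df.
  rewrite addrC scalerA mulrC -scalerA -radialD; apply: radial_ball => //.
  by apply: Oh; rewrite normrZ ger0_norm // ler_piMl.
rewrite [radial z t + t *: h]addrC -radialD => E.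
rewrite -mulrBr E diff_partial.
have -> : t ^+ a * (\sum_i (t *: h) 0 i * partial i f (radial z t + s *: (t *: h))) -
   \sum_i h 0 i * (t ^+ a.+1 * partial i f (radial z t)) =
   t ^+ a.+1 * \sum_i h 0 i * (partial i f (s *: (t *: h) + radial z t) - partial i f (radial z t)).
  have aux (p q x : R) : t ^+ a * (t * x * p) - x * (t ^+ a.+1 * q) =
      t ^+ a.+1 * (x * (p - q)) by rewrite exprS; ring.
  rewrite !mulr_sumr -sumrB; apply: eq_bigr => i _.
  by rewrite (addrC (radial z t)) -aux mxE.
rewrite normrM ger0_norm ?exprn_ge0 //.
apply: (@le_trans _ _ (\sum_(i < n) (e / n.+1%:R * `|h|))).
  apply: le_trans (ler_piMl _ _) _; rewrite ?exprn_ile1 //.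
  apply: le_trans (ler_norm_sum _ _ _) _; apply: ler_sum => i _.
  rewrite normrM mulrC; apply: ler_pM => //; last exact: coord_le_norm.
  have [|_ /(_ t t01)/ltW //] := hh i (s *: (t *: h)).
  by apply: th; rewrite !ltW.
rewrite sumr_const card_ord -mulrnAl ler_wpM2r //.
rewrite -[_ *+ n]mulr_natr -mulrA ler_piMr ?ltW //.
by rewrite mulrC ltr_pdivrMr // mul1r ltr_nat.
Qed.

Lemma Ck_radial_int a k (f : V -> R^o) : Ck k O f ->
  Ck k O (radial_int a f : V -> R^o).
Proof.
elim: k a f => [|k IH] a f.
  by move=> cf x Ox; exact: radial_int_continuous.
move=> hf; have f1 : Ck 1 O f by exact: Ck_le hf.
have [df hd] := hf; split=> [x Ox|v].
  by have [] := radial_int_diff a f1 Ox.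
apply: (@Ck_eq _ _ _ _ _ (fun z => \sum_i (v 0 i : R^o) *: (radial_int a.+1 (partial i f) z : R^o))).
- exact: ball_open.
- by move=> x Ox; have [_ ->] := radial_int_diff a f1 Ox.
- apply: Ck_sum; first exact: ball_open.
  move=> i; apply: Ck_scale; [exact: ball_open|exact: Ck_cst|].
  by apply: IH; exact: hd.
Qed.

Lemma radial_int_sub a (f g : V -> R^o) z :
  (forall x, O x -> {for x, continuous f}) ->
  (forall x, O x -> {for x, continuous g}) -> O z ->
  radial_int a (fun x => f x - g x) z = radial_int a f z - radial_int a g z.
Proof.
move=> cf cg Oz; rewrite /radial_int -int01_sub; try exact: radial_cont01.
by apply: int01_eq => t _; rewrite mulrBr.
Qed.

Lemma radial_int_eq a (f g : V -> R^o) z : O z -> (forall x, O x -> f x = g x) ->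
  radial_int a f z = radial_int a g z.
Proof.
by move=> Oz fg; apply: int01_eq => t t01; rewrite fg //; exact: radial_ball.
Qed.

(** Integration of d/dt (t^(a+1) f(z0 + t (z - z0))) from 0 to 1; the exponent a + 1 > 0 kills the
    boundary term at 0. *)
Lemma radial_FTC a (f : V -> R^o) z : Ck 1 O f -> O z ->
  a.+1%:R * radial_int a f z +
    \sum_i (z - z0) 0 i * radial_int a.+1 (partial i f) z = f z.
Proof.
move=> [df cdf] Oz.
have cf x : O x -> {for x, continuous f} by move=> /df/differentiable_continuous.
have cp i x : O x -> {for x, continuous (partial i f)} by exact: cdf.
have c1 := radial_cont01 (a := a) cf Oz.
have c2 i := radial_cont01 (a := a.+1) (cp i) Oz.
transitivity (int01 (fun t => a.+1%:R * (t ^+ a * f (radial z t)) +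
    \sum_i (z - z0) 0 i * (t ^+ a.+1 * partial i f (radial z t)))).
  rewrite int01_add; first last.
  - by apply: cont01_sum => i; exact: cont01_scale.
  - exact: cont01_scale.
  rewrite int01_scale // int01_sum; last by move=> i; exact: cont01_scale.
  by congr (_ + _); apply: eq_bigr => i _; rewrite int01_scale.
pose G t := t ^+ a.+1 * f (radial z t).
suff -> : f z = G 1 - G 0.
  apply: int01_FTC; last first.
  move=> t t01.
  have d1 : is_derive (t : R^o) 1 (fun t : R^o => t ^+ a.+1 : R^o) (a.+1%:R * t ^+ a).
    apply: DeriveDef; first exact: exprn_derivable.
    transitivity (a.+1%:R *: t ^+ a *: (1 : R^o)).
      exact: (@exp_derive R a.+1 t 1).
    by rewrite -![_ *: _]/(_ * _) mulr1.
  have d2 := line_is_derive (df _ (radial_ball Oz t01)).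
  apply: (is_derive_eq (is_deriveM d1 d2)).
  rewrite diff_partial -![_ *: _]/(_ * _) addrC; congr (_ + _).
    by rewrite -[LHS]/(_ * _) mulrC mulrA.
  by rewrite mulr_sumr; apply: eq_bigr => i _; rewrite mulrCA.
  by apply: cont01_add; [exact: cont01_scale|apply: cont01_sum => i; exact: cont01_scale].
by rewrite /G expr0n /= mul0r subr0 expr1n mul1r /radial scale1r addrC subrK.
Qed.

Lemma smooth_radial_int a (f : V -> R^o) :
  smooth_on O f -> smooth_on O (radial_int a f : V -> R^o).
Proof. by move=> sf k; exact: Ck_radial_int. Qed.

Lemma hasd_coord_shift i (z : V) :
  hasd (fun x : V => (x - z0) 0 i : R^o) z (fun v => v 0 i).
Proof.
apply: hasd_ext (hasd_coord i (hasd_sub (hasd_id z) (hasd_cst z0 z))).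
by move=> v; rewrite subr0.
Qed.

(* The homotopy operator of the Poincare lemma. *)
Definition radial_contr a (F : 'I_n -> V -> R^o) (z : V) : R^o :=
  \sum_j ((z - z0) 0 j : R^o) *: (radial_int a (F j) z : R^o).

Lemma smooth_radial_contr a F : (forall j, smooth_on O (F j)) ->
  smooth_on O (radial_contr a F).
Proof.
move=> sF; apply/smooth_onP; first exact: ball_open.
move=> z Oz; apply: smooth_at_sum => j; apply: smooth_at_scale.
  apply: smooth_at_coord; apply: smooth_at_sub; first exact: smooth_at_id.
  exact: smooth_at_cst.
by apply: (smooth_onP _ _).1 Oz; [exact: ball_open|exact: smooth_radial_int].
Qed.

Lemma partial_radial_contr a F i z : (forall j, smooth_on O (F j)) -> O z ->
  partial i (radial_contr a F) z = radial_int a (F i) z +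
    \sum_j (z - z0) 0 j * radial_int a.+1 (partial i (F j)) z.
Proof.
move=> sF Oz.
have dI j : hasd (radial_int a (F j) : V -> R^o) z
    (fun v => \sum_i v 0 i * radial_int a.+1 (partial i (F j)) z).
  exact: radial_int_diff (sF j 1%N) Oz.
have D := hasd_sum (fun j => hasd_scale (hasd_coord_shift j z) (dI j)).
apply: (etrans (hasd_diff (delta_mx 0 i) D)); rewrite big_split /=; congr (_ + _).
  rewrite (bigD1 i) //= mxE !eqxx scale1r big1 ?addr0 // => j ji.
  by rewrite mxE (negbTE ji) andbF scale0r.
apply: eq_bigr => j _; congr (_ * _).
rewrite (bigD1 i) //= mxE !eqxx mul1r big1 ?addr0 // => k ki.
by rewrite mxE (negbTE ki) andbF mul0r.
Qed.

(** In the i-th derivative of the radial contraction, closedness exchanges the i-th derivative of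
    al_j for the j-th derivative of al_i; what results is the left side of [radial_FTC] for al_i
    with a = 0. *)
Lemma poincare1 (al : 'I_n -> V -> R^o) : (forall i, smooth_on O (al i)) ->
  (forall i j z, O z -> partial i (al j) z = partial j (al i) z) ->
  exists2 f : V -> R^o, smooth_on O f & forall i z, O z -> partial i f z = al i z.
Proof.
move=> sal cl; exists (radial_contr 0 al); first exact: smooth_radial_contr.
move=> i z Oz; rewrite partial_radial_contr // -(radial_FTC 0 (sal i 1%N) Oz) mul1r.
congr (_ + _); apply: eq_bigr => j _; congr (_ * _).
by apply: radial_int_eq => // x; exact: cl.
Qed.

(** On 2-forms the homotopy operator contracts with the radial field and integrates with weight t.
    Antisymmetry doubles the undifferentiated term and closedness merges the differentiated ones,
    which gives the left side of [radial_FTC] with a = 1. *)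
Lemma poincare2 (F : 'I_n -> 'I_n -> V -> R^o) : (forall i j, smooth_on O (F i j)) ->
  (forall i j z, O z -> F i j z = - F j i z) ->
  (forall i j k z, O z ->
     partial i (F j k) z + partial j (F k i) z + partial k (F i j) z = 0) ->
  exists2 A : 'I_n -> V -> R^o, (forall i, smooth_on O (A i)) &
    forall i j z, O z -> partial i (A j) z - partial j (A i) z = F i j z.
Proof.
move=> sF aF cF; exists (fun k => radial_contr 1 (F^~ k)).
  by move=> k; apply: smooth_radial_contr => j; exact: sF.
move=> i k z Oz; rewrite !partial_radial_contr //; try by move=> ?; exact: sF.
have cts i' j' x : O x -> {for x, continuous (F i' j')}.
  by move=> Ox; exact: (sF i' j' 0%N).
have ctsp l i' j' x : O x -> {for x, continuous (partial l (F i' j'))}.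
  by move=> Ox; have [_] := sF i' j' 1%N; exact.
have pN l j m x : O x -> partial l (F j m) x = - partial l (F m j) x.
  move=> Ox; rewrite /partial.
  have dm : differentiable (F m j) x by have [+ _] := sF m j 1%N; exact.
  suff H : hasd (F j m) x (fun v => - 'd (F m j) x v) by exact: hasd_diff H.
  apply: hasd_near (hasd_opp (hasd_self dm)).
  have : nbhs x O by apply: open_nbhs_nbhs; split=> //; exact: ball_open.
  by apply: filterS => y Oy; rewrite [RHS]aF.
rewrite -(radial_FTC 1 (sF i k 1%N) Oz).
have -> : radial_int 1 (F k i) z = - radial_int 1 (F i k) z.
  rewrite -[RHS]mulN1r /radial_int -int01_scale; last exact: (radial_cont01 (a := 1) (cts i k) Oz).
  apply: int01_eq => t t01; rewrite aF; last exact: radial_ball.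
  by rewrite mulN1r mulrN.
rewrite opprD opprK addrACA; congr (_ + _); first by rewrite mulr_natl mulr2n.
rewrite -sumrB; apply: eq_bigr => j _; rewrite -mulrBr; congr (_ * _).
rewrite -radial_int_sub //; try exact: ctsp.
apply: radial_int_eq => // x Ox; have := cF i j k x Ox.
rewrite (pN j k i) // (pN k i j) // => /eqP; rewrite addrAC subr_eq0 => /eqP <-.
by [].
Qed.

End Radial.

(** * Smooth maps of manifolds *)

Section Atlas.
Context {R : realType}.

(** The chart axioms by themselves, the form in which they pass to products and hold for Euclidean
    space. *)
Definition atlas (M : manifold R) : Prop :=
  (forall x : M, let c := chart_at x in
    [/\ open (cdom c), cdom c x, open (cimg c) &
        [/\ forall y, cdom c y -> cinv c (cmap c y) = y,
            forall y, cdom c y -> {for y, continuous (cmap c)} &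
            forall z, cimg c z -> {for z, continuous (cinv c)}]]) /\
  (forall x y : M, let c := chart_at x in let c' := chart_at y in
    smooth_on (cmap c @` (cdom c `&` cdom c')) (cmap c' \o cinv c)).

Lemma is_manifold_atlas (M : manifold R) : is_manifold M -> atlas M.
Proof. by case. Qed.

Section Charts.
Variables (M : manifold R) (hM : atlas M).
Implicit Types (a p q : M).
Local Notation dom a := (cdom (chart_at a)).
Local Notation phi a := (cmap (chart_at a)).
Local Notation psi a := (cinv (chart_at a)).

Lemma dom_self a : dom a a. Proof. by have [h _] := hM; have [] := h a. Qed.
Lemma dom_open a : open (dom a). Proof. by have [h _] := hM; have [] := h a. Qed.
Lemma img_open a : open (cimg (chart_at a)).
Proof. by have [h _] := hM; have [] := h a. Qed.
Lemma psiK a p : dom a p -> psi a (phi a p) = p.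
Proof. by have [h _] := hM; have [_ _ _ [+ _ _]] := h a; exact. Qed.
Lemma phi_cont a p : dom a p -> {for p, continuous (phi a)}.
Proof. by have [h _] := hM; have [_ _ _ [_ + _]] := h a; exact. Qed.
Lemma psi_cont a z : cimg (chart_at a) z -> {for z, continuous (psi a)}.
Proof. by have [h _] := hM; have [_ _ _ [_ _ +]] := h a; exact. Qed.
Lemma img_phi a p : dom a p -> cimg (chart_at a) (phi a p).
Proof. by move=> d; exists p. Qed.

Lemma near_psi a p (P : M -> Prop) : dom a p -> (\forall q \near p, P q) ->
  \forall z \near phi a p, P (psi a z).
Proof.
move=> dp hP; have c := psi_cont (img_phi dp).
by apply: (c P); rewrite psiK.
Qed.

Lemma near_phi a p (P : 'rV[R]_(mdim M) -> Prop) : dom a p ->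
  (\forall z \near phi a p, P z) -> \forall q \near p, P (phi a q).
Proof. by move=> dp hP; exact: (phi_cont dp hP). Qed.

Lemma near_dom a p : dom a p -> \forall q \near p, dom a q.
Proof. by move=> d; apply: open_nbhs_nbhs; split=> //; exact: dom_open. Qed.

Lemma near_img a p : dom a p -> \forall z \near phi a p,
  [/\ dom a (psi a z), phi a (psi a z) = z & cimg (chart_at a) z].
Proof.
move=> d; have : nbhs (phi a p) (cimg (chart_at a)).
  by apply: open_nbhs_nbhs; split; [exact: img_open|exact: img_phi].
by apply: filterS => z [q dq <-]; rewrite psiK //; split=> //; exact: img_phi.
Qed.

Lemma open_phi a (U : set M) : open U -> open (phi a @` (dom a `&` U)).
Proof.
move=> oU; rewrite openE => z [p [dp Up] <-].
have nU : nbhs p U by apply: open_nbhs_nbhs.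
rewrite /interior; near=> y.
have [y1 y2 _] : [/\ dom a (psi a y), phi a (psi a y) = y & cimg (chart_at a) y].
  by near: y; exact: near_img.
exists (psi a y) => //; split=> //.
by near: y; exact: (near_psi dp nU).
Unshelve. all: by end_near. Qed.

Lemma trans_smooth a b p : dom a p -> dom b p ->
  smooth_at (phi b \o psi a) (phi a p).
Proof.
move=> dap dbp; have [_ h] := hM.
apply: (smooth_onP _ _).1 (h a b) _ _; last by exists p.
exact/open_phi/dom_open.
Qed.

(** Read in the chart at p itself, to match [fdiff]; [sfunP] gives access to any other chart. *)
Definition sfun (W : normedModType R) (f : M -> W) p :=
  smooth_at (f \o psi p) (phi p p).

Lemma smooth_at_chart (W : normedModType R) (f : M -> W) a b p :
  dom a p -> dom b p -> smooth_at (f \o psi a) (phi a p) ->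
  smooth_at (f \o psi b) (phi b p).
Proof.
move=> da db h.
apply: (@smooth_at_eq _ _ _ (fun z => (f \o psi a) ((phi a \o psi b) z))).
  by near=> z => /=; rewrite psiK //; near: z; exact/near_psi/near_dom.
apply: smooth_at_comp; first exact: fin_basis_rV.
  exact: trans_smooth.
by rewrite /= psiK.
Unshelve. all: by end_near. Qed.

Lemma sfunP (W : normedModType R) (f : M -> W) a p : dom a p ->
  sfun f p <-> smooth_at (f \o psi a) (phi a p).
Proof. by move=> d; split; apply: smooth_at_chart => //; exact: dom_self. Qed.

Lemma smooth_funP (W : normedModType R) (f : M -> W) (U : set M) : open U ->
  smooth_fun U f <-> forall p, U p -> sfun f p.
Proof.
move=> oU; split=> [h p Up|h a].
  apply: (smooth_onP _ _).1 (h p) _ _; first exact: open_phi.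
  by exists p => //; split=> //; exact: dom_self.
apply/smooth_onP; first exact: open_phi.
by move=> z [p [dp Up] <-]; apply/(sfunP _ dp)/h.
Qed.

Lemma sfun_eq (W : normedModType R) (f g : M -> W) p :
  (\forall q \near p, f q = g q) -> sfun f p -> sfun g p.
Proof. by move=> fg; apply: smooth_at_eq; exact: (near_psi (dom_self p) fg). Qed.

Lemma fdiff_near (W : normedModType R) (f g : M -> W) p v :
  (\forall q \near p, f q = g q) -> sfun f p -> fdiff g p v = fdiff f p v.
Proof.
move=> fg sf; apply: diff_near_eq; last exact: smooth_at_diff.
exact: (near_psi (dom_self p) fg).
Qed.

Lemma hasd_fdiff (W : normedModType R) (f : M -> W) p : sfun f p ->
  hasd (f \o psi p) (phi p p) (fdiff f p).
Proof. by move=> /smooth_at_diff; exact: hasd_self. Qed.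

End Charts.

Section Maps.
Variables (M N P : manifold R) (hM : atlas M) (hN : atlas N) (hP : atlas P).
Local Notation dom a := (cdom (chart_at a)).
Local Notation phi a := (cmap (chart_at a)).
Local Notation psi a := (cinv (chart_at a)).

(** Continuity is a separate clause: it ensures that points near p are sent into the domain of the
    chart at f p, outside of which [cmap] carries no information. *)
Definition smap (M N : manifold R) (f : M -> N) (p : M) :=
  {for p, continuous f} /\ smooth_at (phi (f p) \o f \o psi p) (phi p p).

Lemma smap_chart (f : M -> N) a b p : dom a p -> dom b (f p) -> smap f p ->
  smooth_at (phi b \o f \o psi a) (phi a p).
Proof.
move=> da db [cf sf].
have nb : \forall q \near p, dom (f p) (f q).
  by apply: cf; apply: near_dom => //; exact: dom_self.
apply: (@smooth_at_eq _ _ _ (fun z => (phi b \o psi (f p)) ((phi (f p) \o f \o psi a) z))).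
  near=> z => /=; rewrite psiK //.
  by near: z; exact: (near_psi hM da nb).
apply: smooth_at_comp; first exact: fin_basis_rV.
  exact: (smooth_at_chart (f := phi (f p) \o f) hM (dom_self hM p)).
by rewrite /= psiK //; apply: trans_smooth => //; exact: dom_self.
Unshelve. all: by end_near. Qed.

Lemma smapP (f : M -> N) : smooth_map f <-> forall p, smap f p.
Proof.
split=> [[cf h] p|h].
  split; first exact: cf.
  apply: (smooth_onP _ _).1 (h p (f p)) _ _.
    by apply: open_phi => //; apply: open_comp => [q _|]; [exact: cf|exact: dom_open].
  by exists p => //; split; exact: dom_self.
have cf : continuous f by move=> p; have [] := h p.
split=> // a b; apply/smooth_onP.
  by apply: open_phi => //; apply: open_comp => [q _|]; [exact: cf|exact: dom_open].
by move=> z [p [da db] <-]; apply: smap_chart.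
Qed.

Lemma smap_sfun (W : normedModType R) (f : M -> N) (g : N -> W) p :
  smap f p -> sfun g (f p) -> sfun (g \o f) p.
Proof.
move=> sf sg; have [cf s] := sf.
have nb : \forall q \near p, dom (f p) (f q).
  by apply: cf; apply: near_dom => //; exact: dom_self.
apply: (@smooth_at_eq _ _ _ (fun z => (g \o psi (f p)) ((phi (f p) \o f \o psi p) z))).
  near=> z => /=; rewrite psiK //.
  by near: z; exact: (near_psi hM (dom_self hM p) nb).
apply: smooth_at_comp => //; first exact: fin_basis_rV.
by rewrite /= psiK //; exact: dom_self.
Unshelve. all: by end_near. Qed.

Lemma hasd_mdiff (f : M -> N) p : smap f p ->
  hasd (phi (f p) \o f \o psi p) (phi p p) (mdiff f p).
Proof. by move=> [_ /smooth_at_diff]; exact: hasd_self. Qed.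

Lemma fdiff_comp (W : normedModType R) (f : M -> N) (g : N -> W) p v :
  smap f p -> sfun g (f p) -> fdiff (g \o f) p v = fdiff g (f p) (mdiff f p v).
Proof.
move=> sf sg; have [cf s] := sf.
have nb : \forall q \near p, dom (f p) (f q).
  by apply: cf; apply: near_dom => //; exact: dom_self.
have h2 : hasd (g \o psi (f p)) ((phi (f p) \o f \o psi p) (phi p p)) (fdiff g (f p)).
  have -> : (phi (f p) \o f \o psi p) (phi p p) = phi (f p) (f p).
    by rewrite /= psiK //; exact: dom_self.
  exact: hasd_fdiff.
have h3 := hasd_comp (hasd_mdiff sf) h2.
apply: hasd_diff (hasd_near _ h3).
near=> z => /=; rewrite psiK //.
by near: z; exact: (near_psi hM (dom_self hM p) nb).
Unshelve. all: by end_near. Qed.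

End Maps.

Section MapsComp.
Variables (M N P : manifold R) (hM : atlas M) (hN : atlas N) (hP : atlas P).
Local Notation dom a := (cdom (chart_at a)).
Local Notation phi a := (cmap (chart_at a)).
Local Notation psi a := (cinv (chart_at a)).

Lemma sfun_phi a p : dom a p -> sfun (phi a : M -> 'rV[R]_(mdim M)) p.
Proof. by move=> d; apply: trans_smooth => //; exact: dom_self. Qed.

Lemma smap_comp (f : M -> N) (g : N -> P) p :
  smap f p -> smap g (f p) -> smap (g \o f) p.
Proof.
move=> sf sg; have [cf _] := sf; have [cg sg'] := sg; split.
  exact: continuous_comp.
have sg2 : sfun (phi (g (f p)) \o g) (f p) by [].
exact: (smap_sfun hM hN sf sg2).
Qed.

Lemma mdiff_comp (f : M -> N) (g : N -> P) p v :
  smap f p -> smap g (f p) -> mdiff (g \o f) p v = mdiff g (f p) (mdiff f p v).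
Proof.
move=> sf sg; have [_ sg'] := sg.
have sg2 : sfun (phi (g (f p)) \o g) (f p) by [].
exact: (fdiff_comp hM hN v sf sg2).
Qed.

Lemma smap_cst (b : N) p : @smap M N (fun=> b) p.
Proof. by split; [exact: cst_continuous|exact: smooth_at_cst]. Qed.

Lemma smap_id p : smap (@id M) p.
Proof.
split; first exact: cvg_id.
by apply: trans_smooth => //; exact: dom_self.
Qed.

Lemma mdiff_id p v : mdiff (@id M) p v = v.
Proof.
apply: hasd_diff; apply: hasd_near (hasd_id _).
near=> z => /=; apply/esym.
suff [] : [/\ dom p (psi p z), phi p (psi p z) = z & cimg (chart_at p) z] by [].
by near: z; apply: near_img => //; exact: dom_self.
Unshelve. all: by end_near. Qed.

Lemma mdiff_cst (b : N) (p : M) v : @mdiff R M N (fun=> b) p v = 0.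
Proof. exact: hasd_diff (hasd_cst _ _). Qed.

End MapsComp.

(** * Euclidean space, and charts as smooth maps *)

Section Euclid.

Lemma smooth_at_ext (V W : normedModType R) (f g : V -> W) z :
  f =1 g -> smooth_at f z -> smooth_at g z.
Proof. by move=> fg; have -> : g = f by apply/funext => x; rewrite fg. Qed.

Lemma near_mono (V : normedModType R) (z : V) (P Q : V -> Prop) :
  (forall x, P x -> Q x) -> (\forall x \near z, P x) -> \forall x \near z, Q x.
Proof. by move=> PQ; apply: filterS. Qed.

Lemma near_mono2 (V : normedModType R) (z : V) (P P' Q : V -> Prop) :
  (forall x, P x -> P' x -> Q x) ->
  (\forall x \near z, P x) -> (\forall x \near z, P' x) -> \forall x \near z, Q x.
Proof. by move=> PQ; apply: filterS2. Qed.

Lemma near_comp (V W : normedModType R) (f : V -> W) (z : V) (w : W) (P : W -> Prop) :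
  {for z, continuous f} -> f z = w ->
  (\forall x \near w, P x) -> \forall x \near z, P (f x).
Proof. by move=> cf <- h; exact: (cf P h). Qed.

Lemma continuous_pair (S T U : topologicalType) (f : S -> T) (g : S -> U) p :
  {for p, continuous f} -> {for p, continuous g} ->
  {for p, continuous (fun x => (f x, g x))}.
Proof. by move=> cf cg; exact: cvg_pair. Qed.

Lemma lin_rV_smooth m (W : normedModType R) (f : {linear 'rV[R]_m -> W}) z :
  smooth_at f z.
Proof.
apply: (@smooth_at_ext _ _ (fun v : 'rV[R]_m => \sum_i (v 0 i : R^o) *: f (delta_mx 0 i))).
  move=> v; rewrite {2}(row_sum_delta v) linear_sum.
  by apply: eq_bigr => i _; rewrite linearZ.
apply: smooth_at_sum => i; apply: smooth_at_scale; last exact: smooth_at_cst.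
exact: (smooth_at_coord i (smooth_at_id z)).
Qed.

Lemma lin_rV_hasd m (W : normedModType R) (f : {linear 'rV[R]_m -> W}) z : hasd f z f.
Proof. by apply: hasd_lin => v; exact/smooth_at_continuous/lin_rV_smooth. Qed.

(** With Euclidean space as a manifold, charts and their inverses become smooth maps, and the
    coefficients of a form in a chart become a pull-back. *)
Definition euclid n : manifold R :=
  @Manifold R 'rV[R]_n n (fun=> {| cdom := setT; cmap := id; cinv := id |}).

Lemma atlas_euclid n : atlas (euclid n).
Proof.
split=> [x|x y] /=.
  split; [exact: openT|by []|rewrite /cimg /= image_id; exact: openT|].
  by split=> // z _; exact: cvg_id.
have -> : [set id z | z in setT `&` setT] = [set: 'rV[R]_n].
  by rewrite setIid image_id.
by apply/smooth_onP; [exact: openT|move=> z _; exact: smooth_at_id].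
Qed.

Lemma smap_phi (M : manifold R) (hM : atlas M) (a p : M) : cdom (chart_at a) p ->
  @smap M (euclid (mdim M)) (cmap (chart_at a)) p.
Proof.
move=> d; split; first exact: phi_cont.
by apply: trans_smooth => //; exact: dom_self.
Qed.

Lemma smap_psi (M : manifold R) (hM : atlas M) (a p : M) : cdom (chart_at a) p ->
  @smap (euclid (mdim M)) M (cinv (chart_at a)) (cmap (chart_at a) p).
Proof.
move=> d; split; first exact/(psi_cont hM)/img_phi.
by rewrite /= (psiK hM) //; apply: trans_smooth => //; exact: dom_self.
Qed.

End Euclid.

(** * Product manifolds *)

Section Product.
Variables (M N : manifold R) (hM : atlas M) (hN : atlas N).
Local Notation P := (prod_manifold M N).
Local Notation m := (mdim M).
Local Notation n := (mdim N).

Lemma inl_is_linear : linear (fun u : 'rV[R]_m => row_mx u (0 : 'rV[R]_n)).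
Proof. by move=> a u v; rewrite scale_row_mx add_row_mx scaler0 addr0. Qed.
Definition inll : {linear 'rV[R]_m -> 'rV[R]_(m + n)} :=
  HB.pack (fun u : 'rV[R]_m => row_mx u (0 : 'rV[R]_n))
    (GRing.isLinear.Build R _ _ *:%R _ inl_is_linear).
Lemma inr_is_linear : linear (fun u : 'rV[R]_n => row_mx (0 : 'rV[R]_m) u).
Proof. by move=> a u v; rewrite scale_row_mx add_row_mx scaler0 addr0. Qed.
Definition inrl : {linear 'rV[R]_n -> 'rV[R]_(m + n)} :=
  HB.pack (fun u : 'rV[R]_n => row_mx (0 : 'rV[R]_m) u)
    (GRing.isLinear.Build R _ _ *:%R _ inr_is_linear).

Lemma row_mxE u v : row_mx u v = inll u + inrl v.
Proof. by rewrite /= add_row_mx addr0 add0r. Qed.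

Definition lsubl : {linear 'rV[R]_(m + n) -> 'rV[R]_m} := lsubmx.
Definition rsubl : {linear 'rV[R]_(m + n) -> 'rV[R]_n} := rsubmx.

Lemma smooth_row_mx (V : normedModType R) (f : V -> 'rV[R]_m) (g : V -> 'rV[R]_n) z :
  smooth_at f z -> smooth_at g z -> smooth_at (fun x => row_mx (f x) (g x)) z.
Proof.
move=> sf sg; apply: (@smooth_at_eq _ _ _ (fun x => inll (f x) + inrl (g x))).
  by apply: nearW => x; rewrite row_mxE.
by apply: smooth_at_add; apply: smooth_at_linc => // x;
  exact/smooth_at_continuous/lin_rV_smooth.
Qed.

Lemma hasd_row_mx (V : normedModType R) (f : V -> 'rV[R]_m) (g : V -> 'rV[R]_n) z L L' :
  hasd f z L -> hasd g z L' ->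
  hasd (fun x => row_mx (f x) (g x)) z (fun v => row_mx (L v) (L' v)).
Proof.
move=> hf hg; apply: (@hasd_near _ _ _ (fun x => inll (f x) + inrl (g x))).
  by apply: nearW => x; rewrite row_mxE.
apply: hasd_ext (hasd_add (hasd_comp hf (lin_rV_hasd inll (f z)))
  (hasd_comp hg (lin_rV_hasd inrl (g z)))).
by move=> v; rewrite row_mxE.
Qed.

Lemma lsub_smooth z : smooth_at (lsubmx : 'rV[R]_(m + n) -> 'rV[R]_m) z.
Proof. exact: (@lin_rV_smooth _ _ lsubl). Qed.
Lemma rsub_smooth z : smooth_at (rsubmx : 'rV[R]_(m + n) -> 'rV[R]_n) z.
Proof. exact: (@lin_rV_smooth _ _ rsubl). Qed.

Lemma continuous_row_mx (T : topologicalType) (f : T -> 'rV[R]_m) (g : T -> 'rV[R]_n) p :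
  {for p, continuous f} -> {for p, continuous g} ->
  {for p, continuous (fun x => row_mx (f x) (g x))}.
Proof.
move=> cf cg.
rewrite (_ : (fun x => _) = (fun x => inll (f x) + inrl (g x))); last first.
  by apply/funext => x; rewrite row_mxE.
by apply: continuousD; (apply: continuous_comp; first by []);
  exact/smooth_at_continuous/lin_rV_smooth.
Qed.

Lemma atlas_prod : atlas P.
Proof.
have cl z : {for z, continuous (lsubmx : 'rV[R]_(m + n) -> 'rV[R]_m)}.
  exact/smooth_at_continuous/lsub_smooth.
have cr z : {for z, continuous (rsubmx : 'rV[R]_(m + n) -> 'rV[R]_n)}.
  exact/smooth_at_continuous/rsub_smooth.
have dO (x : P) : open (cdom (chart_at x)).
  rewrite openE => -[q1 q2] [/= d1 d2].
  exists (cdom (chart_at x.1), cdom (chart_at x.2)) => //=.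
  by split; apply: near_dom.
have iE (x : P) z : cimg (chart_at x) z <->
    cimg (chart_at x.1) (lsubmx z) /\ cimg (chart_at x.2) (rsubmx z).
  split=> [[q /= [d1 d2] <-]|[[q1 d1 E1] [q2 d2 E2]]].
    by rewrite row_mxKl row_mxKr; split; [exists q.1|exists q.2].
  by exists (q1, q2) => //=; rewrite E1 E2 hsubmxK.
split=> [x|x y] /=.
  split.
  - exact: dO.
  - by split; exact: dom_self.
  - rewrite openE => z /iE[i1 i2]; rewrite /interior.
    have n1 : \forall z' \near z, cimg (chart_at x.1) (lsubmx z').
      by apply: cl; apply: open_nbhs_nbhs; split=> //; exact: img_open.
    have n2 : \forall z' \near z, cimg (chart_at x.2) (rsubmx z').
      by apply: cr; apply: open_nbhs_nbhs; split=> //; exact: img_open.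
    by apply: filterS2 n1 n2 => z' j1 j2; apply/iE.
  - split=> [[q1 q2] [d1 d2]|[q1 q2] [d1 d2]|z /iE[i1 i2]] /=.
    + by rewrite row_mxKl row_mxKr !psiK.
    + apply: (@continuous_row_mx _ (fun q : M * N => cmap (chart_at x.1) q.1)
        (fun q : M * N => cmap (chart_at x.2) q.2)).
      * by apply: (@continuous_comp _ _ _ fst); [exact: cvg_fst|exact: phi_cont].
      * by apply: (@continuous_comp _ _ _ snd); [exact: cvg_snd|exact: phi_cont].
    + apply: (@continuous_pair _ M N (fun z => cinv (chart_at x.1) (lsubmx z)) (fun z => cinv (chart_at x.2) (rsubmx z))).
      * by apply: (@continuous_comp _ _ _ lsubmx); [exact: cl|exact: psi_cont].
      * by apply: (@continuous_comp _ _ _ rsubmx); [exact: cr|exact: psi_cont].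
apply/smooth_onP.
  rewrite openE => z [q [[d1 d2] [d1' d2']] /= E]; rewrite /interior.
  have n1 : \forall z' \near z, (cmap (chart_at x.1) @` (cdom (chart_at x.1) `&` cdom (chart_at y.1))) (lsubmx z').
    apply: cl; rewrite -E row_mxKl; apply: open_nbhs_nbhs; split; last by exists q.1.
    exact/open_phi/dom_open.
  have n2 : \forall z' \near z, (cmap (chart_at x.2) @` (cdom (chart_at x.2) `&` cdom (chart_at y.2))) (rsubmx z').
    apply: cr; rewrite -E row_mxKr; apply: open_nbhs_nbhs; split; last by exists q.2.
    exact/open_phi/dom_open.
  apply: filterS2 n1 n2 => z' [q1 [a1 b1] e1] [q2 [a2 b2] e2].
  by exists (q1, q2) => //=; rewrite e1 e2 hsubmxK.
move=> z [q [[d1 d2] [d1' d2']] /= <-].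
apply: smooth_row_mx.
  apply: (@smooth_at_comp _ _ _ _ lsubmx (cmap (chart_at y.1) \o cinv (chart_at x.1))).
  - exact: fin_basis_rV.
  - exact: lsub_smooth.
  - by rewrite row_mxKl; exact: trans_smooth.
apply: (@smooth_at_comp _ _ _ _ rsubmx (cmap (chart_at y.2) \o cinv (chart_at x.2))).
- exact: fin_basis_rV.
- exact: rsub_smooth.
- by rewrite row_mxKr; exact: trans_smooth.
Qed.

Lemma fst_near (p : P) : \forall z \near cmap (chart_at p) p,
  (cmap (chart_at p.1) \o fst \o cinv (chart_at p)) z = lsubmx z.
Proof.
have E : lsubmx (cmap (chart_at p) p) = cmap (chart_at p.1) p.1 by rewrite /= row_mxKl.
have := near_comp (smooth_at_continuous (lsub_smooth (cmap (chart_at p) p))) E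
  (near_img hM (dom_self hM p.1)).
by apply: near_mono => z /= [].
Qed.

Lemma snd_near (p : P) : \forall z \near cmap (chart_at p) p,
  (cmap (chart_at p.2) \o snd \o cinv (chart_at p)) z = rsubmx z.
Proof.
have E : rsubmx (cmap (chart_at p) p) = cmap (chart_at p.2) p.2 by rewrite /= row_mxKr.
have := near_comp (smooth_at_continuous (rsub_smooth (cmap (chart_at p) p))) E
  (near_img hN (dom_self hN p.2)).
by apply: near_mono => z /= [].
Qed.

Lemma smap_fst (p : P) : @smap P M fst p.
Proof.
split; first exact: cvg_fst.
apply: smooth_at_eq (lsub_smooth _).
by apply: near_mono (fst_near p) => z ->.
Qed.

Lemma smap_snd (p : P) : @smap P N snd p.
Proof.
split; first exact: cvg_snd.
apply: smooth_at_eq (rsub_smooth _).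
by apply: near_mono (snd_near p) => z ->.
Qed.

Lemma mdiff_fst (p : P) v : @mdiff R P M fst p v = lsubmx v.
Proof.
apply: hasd_diff; apply: hasd_near (lin_rV_hasd lsubl _).
by apply: near_mono (fst_near p) => z ->.
Qed.

Lemma mdiff_snd (p : P) v : @mdiff R P N snd p v = rsubmx v.
Proof.
apply: hasd_diff; apply: hasd_near (lin_rV_hasd rsubl _).
by apply: near_mono (snd_near p) => z ->.
Qed.

Lemma smap_pair (L : manifold R) (f : L -> M) (g : L -> N) p :
  smap f p -> smap g p -> @smap L P (fun x => (f x, g x)) p.
Proof.
move=> [cf sf] [cg sg]; split; first exact: cvg_pair.
exact: (smooth_row_mx sf sg).
Qed.

Lemma mdiff_pair (L : manifold R) (f : L -> M) (g : L -> N) p v :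
  smap f p -> smap g p ->
  @mdiff R L P (fun x => (f x, g x)) p v = row_mx (mdiff f p v) (mdiff g p v).
Proof. by move=> sf sg; apply: hasd_diff (hasd_row_mx (hasd_mdiff sf) (hasd_mdiff sg)). Qed.

End Product.

End Atlas.

(** * Differential forms *)

Section LinearFamilies.
Context {R : realType}.
Implicit Types V W : normedModType R.

Lemma linear_coords n (W : lmodType R) (A : 'rV[R]_n -> W) : linear A ->
  forall u, A u = \sum_j (u 0 j : R^o) *: A (delta_mx 0 j).
Proof.
move=> lA u.
pose Al : {linear 'rV[R]_n -> W} := HB.pack A (GRing.isLinear.Build R _ _ *:%R _ lA).
rewrite -[A u]/(Al u) {1}(row_sum_delta u) linear_sum.
by apply: eq_bigr => i _; rewrite linearZ.
Qed.

(** A product rule for A x (u x) in which A is differentiated with its argument frozen; expanding u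
    x in the standard basis reduces it to scalar multiples of the functions x |-> A x (delta_mx 0
    j). *)
Lemma hasd_lin_family V W n (A : V -> 'rV[R]_n -> W) (L : 'rV[R]_n -> V -> W)
    (u : V -> 'rV[R]_n) (U : V -> 'rV[R]_n) z :
  (\forall x \near z, linear (A x)) -> (forall c, hasd (A ^~ c) z (L c)) ->
  hasd u z U ->
  hasd (fun x => A x (u x)) z (fun w => L (u z) w + A z (U w)).
Proof.
move=> lA hA hu; have lAz := nbhs_singleton lA.
(* L is linear in c because derivatives are unique and A x is linear for x near z. *)
have LE c w : L c w = \sum_j (c 0 j : R^o) *: L (delta_mx 0 j) w.
  suff [_ E] : hasd (A ^~ c) z (fun w => \sum_j (c 0 j : R^o) *: L (delta_mx 0 j) w).
    by have [_ <-] := hA c.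
  apply: (@hasd_near _ _ _ (fun x => \sum_j (c 0 j : R^o) *: A x (delta_mx 0 j))).
    by apply: filterS lA => x lx; rewrite -linear_coords.
  apply: hasd_ext (hasd_sum (fun j => hasd_scale (hasd_cst (c 0 j : R^o) z) (hA (delta_mx 0 j)))).
  by move=> v; apply: eq_bigr => j _; rewrite scale0r add0r.
apply: (@hasd_near _ _ _ (fun x => \sum_j (u x 0 j : R^o) *: A x (delta_mx 0 j))).
  by apply: filterS lA => x lx; rewrite -linear_coords.
apply: hasd_ext (hasd_sum (fun j => hasd_scale (hasd_coord j hu) (hA (delta_mx 0 j)))).
move=> w; rewrite big_split /= addrC LE; congr (_ + _).
by rewrite [RHS]linear_coords.
Qed.

Lemma multilinear_formP k n (w : ('I_k -> 'rV[R]_n) -> R) :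
  multilinear_form w <-> forall i v a u u',
    w (fun j => if j == i then a *: u + u' else v j) =
    a * w (fun j => if j == i then u else v j) + w (fun j => if j == i then u' else v j).
Proof. by split=> h i v a u u'; exact: h. Qed.

Lemma multilin_linear k n (w : ('I_k -> 'rV[R]_n) -> R) i v : multilinear_form w ->
  linear (fun u => w (fun j => if j == i then u else v j) : R^o).
Proof. by move=> h a u u'; exact: h. Qed.

(** Induction on the number j of arguments that are allowed to move; the next one is expanded in the
    standard basis, which leaves finitely many functions with one moving argument fewer. *)
Lemma smooth_multilin V k n (w : V -> ('I_k -> 'rV[R]_n) -> R^o)
    (u : 'I_k -> V -> 'rV[R]_n) z :
  (forall v, smooth_at (w ^~ v) z) -> (\forall x \near z, multilinear_form (w x)) ->
  (forall i, smooth_at (u i) z) -> smooth_at (fun x => w x (fun i => u i x)) z.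
Proof.
move=> sw mw su.
suff H j v : (j <= k)%N ->
    smooth_at (fun x => w x (fun i => if (i < j)%N then u i x else v i)) z.
  apply: smooth_at_eq (H k (fun=> 0) (leqnn k)).
  by apply: nearW => x; congr (w x); apply/funext => i; rewrite ltn_ord.
elim: j v => [|j IH] v jk.
  apply: smooth_at_eq (sw v); apply: nearW => x.
  by congr (w x).
pose i0 := Ordinal jk.
apply: (@smooth_at_eq _ _ _ (fun x => \sum_l (u i0 x 0 l : R^o) *:
    w x (fun i => if (i < j)%N then u i x else if i == i0 then delta_mx 0 l else v i))).
  apply: filterS mw => x mx.
  pose t (i : 'I_k) := if (i < j)%N then u i x else v i.
  have E c : (fun i : 'I_k => if (i < j)%N then u i x else if i == i0 then c else v i) =
      (fun i => if i == i0 then c else t i).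
    apply/funext => i; rewrite /t; case: eqP => [->|//]; by rewrite /= ltnn.
  under eq_bigr do rewrite E.
  rewrite -(linear_coords (@multilin_linear k _ (w x) i0 t mx)).
  congr (w x); apply/funext => i; rewrite /t; case: eqP => [->|/eqP ii0].
    by rewrite /= ltnSn.
  by rewrite ltnS [(i <= j)%N]leq_eqVlt -[(i == j :> nat)]/(i == i0) (negbTE ii0).
apply: smooth_at_sum => l; apply: smooth_at_scale; first exact/smooth_at_coord/su.
exact: IH (ltnW jk).
Qed.

End LinearFamilies.

Section Forms.
Context {R : realType}.

Local Notation dom a := (cdom (chart_at a)).
Local Notation phi a := (cmap (chart_at a)).
Local Notation psi a := (cinv (chart_at a)).

(** The preferred chart changes with the point, so derivatives at a moving point have to be compared
    in fixed charts a and b. *)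
Lemma chain_chart (M N : manifold R) (hM : atlas M) (hN : atlas N) (W : normedModType R) (f : M -> N) (g : N -> W) a b p v :
  dom a p -> dom b (f p) -> smap f p -> sfun g (f p) ->
  'd (g \o f \o psi a) (phi a p) v =
  'd (g \o psi b) (phi b (f p)) ('d (phi b \o f \o psi a) (phi a p) v).
Proof.
move=> da db sf sg; have [cf _] := sf.
have h1 := hasd_self (smooth_at_diff (smap_chart hM hN da db sf)).
have h2 : hasd (g \o psi b) ((phi b \o f \o psi a) (phi a p)) ('d (g \o psi b) (phi b (f p))).
  have -> : (phi b \o f \o psi a) (phi a p) = phi b (f p) by rewrite /= psiK.
  by apply: hasd_self; apply/smooth_at_diff/(sfunP hN _ db).
apply: hasd_diff (hasd_near _ (hasd_comp h1 h2)).
have nb : \forall q \near p, dom b (f q) by apply: cf; apply: near_dom.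
apply: near_mono (near_psi hM da nb) => z dz /=.
by rewrite (psiK hN).
Qed.

Section Local.
Variables (M N : manifold R) (hM : atlas M) (hN : atlas N).

Lemma form_local_pull (f : M -> N) k (w : form N k) a b p :
  dom a p -> dom b (f p) -> (\forall q \near p, smap f q) ->
  \forall z \near phi a p, forall v, form_local (form_pull f w) a z v =
    form_local w b ((phi b \o f \o psi a) z)
      (fun i => 'd (phi b \o f \o psi a) z (v i)).
Proof.
move=> da db sf; have [cf _] := nbhs_singleton sf.
have nb : \forall q \near p, dom b (f q) by apply: cf; apply: near_dom.
apply: near_mono2 (near_psi hM da (filterI sf nb)) (near_img hM da) => z [sz bz] [az Ez _] v.
rewrite /form_local /form_pull /= (psiK hN) //; congr (w _); apply/funext => i.
set q := psi a z in sz bz az Ez *.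
rewrite -{1 2}Ez.
have E1 := chain_chart (f := id) (g := phi (f q) \o f) hM hM (v i) az (dom_self hM q) (smap_id hM q).
rewrite /mdiff -[LHS]E1; last first.
  by apply: (smap_sfun hM hN sz); apply: sfun_phi => //; exact: dom_self.
have E2 := chain_chart (g := phi (f q)) hM hN (v i) az bz sz.
rewrite -[in RHS]Ez; apply: E2.
by apply: sfun_phi => //; exact: dom_self.
Qed.

Lemma form_local_chart k (w : form M k) a b p : dom a p -> dom b p ->
  \forall z \near phi a p, forall v, form_local w a z v =
    form_local w b ((phi b \o psi a) z) (fun i => 'd (phi b \o psi a) z (v i)).
Proof.
move=> da db; apply: near_mono2 (near_psi hM da (near_dom hM db)) (near_img hM da) => z bz [az Ez _] v.
rewrite /form_local /= (psiK hM) //; congr (w _); apply/funext => i.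
set q := psi a z in bz az Ez *.
rewrite -[in LHS]Ez -[in RHS]Ez.
have E := chain_chart (f := id) (g := phi q) hM hM (v i) az bz (smap_id hM q).
rewrite /q Ez in E *; apply: E.
by apply: sfun_phi => //; exact: dom_self.
Qed.

(** The pointwise counterpart of [is_form]. The algebraic clauses are asked on a neighbourhood,
    since derivatives of the coefficients involve the form at nearby points. *)
Definition sform k (w : form M k) (p : M) :=
  (\forall q \near p, multilinear_form (w q) /\ alternating_form (w q)) /\
  forall v, smooth_at (fun z => form_local w p z v : R^o) (phi p p).

Lemma multilinear_local k (w : form M k) a z : multilinear_form (w (psi a z)) ->
  multilinear_form (form_local w a z).
Proof.
move=> mw; apply/multilinear_formP => i v c u u'; rewrite /form_local.
have E y : (fun j => 'd (phi (psi a z) \o psi a) z (if j == i then y else v j)) =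
    (fun j => if j == i then 'd (phi (psi a z) \o psi a) z y
              else 'd (phi (psi a z) \o psi a) z (v j)).
  by apply/funext => j; case: ifP.
by rewrite !E linearP; exact: mw.
Qed.

Lemma sform_chart k (w : form M k) a p v : dom a p -> sform w p ->
  smooth_at (fun z => form_local w a z v : R^o) (phi a p).
Proof.
move=> da [mw sw].
have dp := dom_self hM p.
have tr := trans_smooth hM da dp.
have cl := form_local_chart w da dp.
apply: (@smooth_at_eq _ _ _ (fun z => form_local w p ((phi p \o psi a) z)
    (fun i => 'd (phi p \o psi a) z (v i)) : R^o)).
  by apply: near_mono cl => z ->.
apply: (smooth_multilin (w := fun z u => form_local w p ((phi p \o psi a) z) u : R^o)).
- move=> u; apply: (@smooth_at_comp _ _ _ _ _ (fun y => form_local w p y u : R^o) _ (fin_basis_rV _) tr).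
  by rewrite /= (psiK hM da).
- have nm : \forall z \near phi a p, multilinear_form (w (psi a z)).
    by apply: (@near_psi _ M hM a p (fun q => multilinear_form (w q)) da); apply: filterS mw => q [].
  apply: near_mono2 (near_psi hM da (near_dom hM dp)) nm => z dz mz.
  by apply: multilinear_local; rewrite /= (psiK hM).
- by move=> i; exact: smooth_at_D.
Qed.

Lemma is_formP k (w : form M k) (U : set M) : open U ->
  is_form U w <-> forall p, U p -> sform w p.
Proof.
move=> oU; split=> [[h1 h2] p Up|h].
  split; first by apply: filterS (open_nbhs_nbhs (conj oU Up)) => q; exact: h1.
  move=> v; apply: (smooth_onP _ _).1 (h2 p v) _ _; first exact: open_phi.
  by exists p => //; split=> //; exact: dom_self.
split=> [x Ux|a v].
  by have [/nbhs_singleton] := h x Ux.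
apply/smooth_onP; first exact: open_phi.
by move=> z [p [dp Up] <-]; apply: sform_chart => //; exact: h.
Qed.

Lemma sform_eq k (w w' : form M k) p : (\forall q \near p, w q = w' q) ->
  sform w p -> sform w' p.
Proof.
move=> ww [mw sw]; split; first by apply: filterS2 ww mw => q <-.
move=> v; apply: smooth_at_eq (sw v).
by apply: near_mono (near_psi hM (dom_self hM p) ww) => z E; rewrite /form_local E.
Qed.

Lemma dform_eq k (w w' : form M k) p v : (\forall q \near p, w q = w' q) ->
  sform w p -> dform w' p v = dform w p v.
Proof.
move=> ww [mw sw]; apply: eq_bigr => i _; apply: congr1.
apply: (diff_near_eq _ _ (smooth_at_diff (sw _))).
by apply: near_mono (near_psi hM (dom_self hM p) ww) => z E; rewrite /form_local E.
Qed.

End Local.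

Section Algebra.
Variables (M : manifold R) (hM : atlas M).
Local Notation dom a := (cdom (chart_at a)).
Local Notation phi a := (cmap (chart_at a)).
Local Notation psi a := (cinv (chart_at a)).

Definition fadd k (A B : form M k) : form M k := fun p v => A p v + B p v.
Definition fscale k (c : R) (A : form M k) : form M k := fun p v => c * A p v.
Definition fopp k (A : form M k) : form M k := fun p v => - A p v.

Lemma sform_add k (A B : form M k) p : sform A p -> sform B p -> sform (fadd A B) p.
Proof.
move=> [mA sA] [mB sB]; split.
  apply: filterS2 mA mB => q [m1 a1] [m2 a2]; split.
    by apply/multilinear_formP => i v c u u'; rewrite /fadd m1 m2; ring.
  by move=> v i j ij vij; rewrite /fadd (a1 _ _ _ ij) // (a2 _ _ _ ij) // addr0.
by move=> v; exact: (smooth_at_add (sA v) (sB v)).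
Qed.

Lemma sform_scale k c (A : form M k) p : sform A p -> sform (fscale c A) p.
Proof.
move=> [mA sA]; split.
  apply: filterS mA => q [m1 a1]; split.
    by apply/multilinear_formP => i v a u u'; rewrite /fscale m1; ring.
  by move=> v i j ij vij; rewrite /fscale (a1 _ _ _ ij) // mulr0.
by move=> v; exact: (smooth_at_mul (smooth_at_cst (c : R^o) _) (sA v)).
Qed.

Lemma fopp_scale k (A : form M k) : fopp A = fscale (-1) A.
Proof. by apply/funext => p; apply/funext => v; rewrite /fopp /fscale mulN1r. Qed.

Lemma sform_opp k (A : form M k) p : sform A p -> sform (fopp A) p.
Proof. by rewrite fopp_scale; exact: sform_scale. Qed.

Lemma dform_add k (A B : form M k) p v : sform A p -> sform B p ->
  dform (fadd A B) p v = dform A p v + dform B p v.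
Proof.
move=> [_ sA] [_ sB]; rewrite /dform -big_split /=; apply: eq_bigr => i _.
rewrite -mulrDr; congr (_ * _).
set t := fun j => v (lift i j).
have hA := hasd_self (smooth_at_diff (sA t)).
have hB := hasd_self (smooth_at_diff (sB t)).
exact: (hasd_diff (v i) (hasd_add hA hB)).
Qed.

Lemma dform_scale k c (A : form M k) p v : sform A p ->
  dform (fscale c A) p v = c * dform A p v.
Proof.
move=> [_ sA]; rewrite /dform mulr_sumr; apply: eq_bigr => i _.
rewrite mulrCA; congr (_ * _).
set f := fun z => form_local A p z (fun j => v (lift i j)) : R^o.
have h : hasd f (phi p p) ('d f (phi p p)) by exact: (hasd_self (smooth_at_diff (sA _))).
have h2 := hasd_mul (hasd_cst (c : R^o) (phi p p)) h.
by rewrite -[RHS]add0r -[X in X + _](mul0r (f (phi p p))); exact: (hasd_diff (v i) h2).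
Qed.

Lemma dform_opp k (A : form M k) p v : sform A p -> dform (fopp A) p v = - dform A p v.
Proof. by move=> sA; rewrite fopp_scale dform_scale // mulN1r. Qed.

End Algebra.

Definition vec2 (V : Type) (u v : V) (i : 'I_2) : V := if i == 0 then u else v.
Definition vec3 (V : Type) (u v w : V) (i : 'I_3) : V :=
  if i == 0 then u else if i == 1 then v else w.

Lemma ord2P (i : 'I_2) : i = 0 \/ i = 1.
Proof. by case: i => [[|[|]]] // h; [left|right]; exact: val_inj. Qed.

Lemma ord3P (i : 'I_3) : [\/ i = 0, i = 1 | i = 2%:R].
Proof.
by case: i => [[|[|[|]]]] // h;
  [apply: Or31|apply: Or32|apply: Or33]; exact: val_inj.
Qed.

Lemma vec2E (V : Type) (v : 'I_2 -> V) : v = vec2 (v 0) (v 1).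
Proof. by apply/funext => i; have [->|->] := ord2P i. Qed.

Lemma vec3E (V : Type) (v : 'I_3 -> V) : v = vec3 (v 0) (v 1) (v 2%:R).
Proof. by apply/funext => i; have [->|->|->] := ord3P i. Qed.

Lemma vec2_map (V W : Type) (f : V -> W) u v : (fun i => f (vec2 u v i)) = vec2 (f u) (f v).
Proof. by apply/funext => i; have [->|->] := ord2P i. Qed.

Lemma vec3_map (V W : Type) (f : V -> W) u v w :
  (fun i => f (vec3 u v w i)) = vec3 (f u) (f v) (f w).
Proof. by apply/funext => i; have [->|->|->] := ord3P i. Qed.

Lemma dform1E (M : manifold R) (A : form M 1) p u v : dform A p (vec2 u v) =
  'd (fun z => form_local A p z (fun=> v) : R^o) (cmap (chart_at p) p) u
  - 'd (fun z => form_local A p z (fun=> u) : R^o) (cmap (chart_at p) p) v.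
Proof.
rewrite /dform big_ord_recl big_ord_recl big_ord0 addr0 expr0 mul1r expr1 mulN1r.
rewrite (_ : (fun j : 'I_1 => vec2 u v (lift ord0 j)) = fun=> v); last first.
  by apply/funext => j; rewrite (ord1 j).
rewrite (_ : (fun j : 'I_1 => vec2 u v (lift (lift ord0 ord0) j)) = fun=> u) //.
by apply/funext => j; rewrite (ord1 j).
Qed.

Lemma dform2E (M : manifold R) (w : form M 2) p a b c : dform w p (vec3 a b c) =
  'd (fun z => form_local w p z (vec2 b c) : R^o) (cmap (chart_at p) p) a
  - 'd (fun z => form_local w p z (vec2 a c) : R^o) (cmap (chart_at p) p) b
  + 'd (fun z => form_local w p z (vec2 a b) : R^o) (cmap (chart_at p) p) c.
Proof.
rewrite /dform !big_ord_recl big_ord0 addr0 /= expr0 mul1r expr1 mulN1r.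
rewrite (_ : (-1) ^+ _ = 1 :> R) ?mul1r ?addrA; last by rewrite -signr_odd.
rewrite (_ : (fun j => _) = vec2 b c); last by apply/funext => j; have [->|->] := ord2P j.
rewrite (_ : (fun j => _) = vec2 a c); last by apply/funext => j; have [->|->] := ord2P j.
by rewrite (_ : (fun j => _) = vec2 a b); last by apply/funext => j; have [->|->] := ord2P j.
Qed.

(** * Exterior derivative and pull-back *)

Section Pull.
Variables (M N : manifold R) (hM : atlas M) (hN : atlas N).
Local Notation dom a := (cdom (chart_at a)).
Local Notation phi a := (cmap (chart_at a)).
Local Notation psi a := (cinv (chart_at a)).

Lemma sform_pull (f : M -> N) k (w : form N k) p :
  (\forall q \near p, smap f q) -> sform w (f p) -> sform (form_pull f w) p.
Proof.
move=> sf [mw sw]; have sfp := nbhs_singleton sf; have [cf _] := sfp; split.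
  have : \forall q \near p, multilinear_form (w (f q)) /\ alternating_form (w (f q)).
    exact: (cf _ mw).
  apply: filterS => q [m1 a1]; split.
    apply/multilinear_formP => i v c u u'; rewrite /form_pull.
    have E y : (fun j => mdiff f q (if j == i then y else v j)) =
       (fun j => if j == i then mdiff f q y else mdiff f q (v j)).
      by apply/funext => j; case: ifP.
    by rewrite !E {1}/mdiff linearP; exact: m1.
  by move=> v i j ij vij; apply: (a1 _ _ _ ij); rewrite vij.
move=> v; set F := phi (f p) \o f \o psi p.
have sF : smooth_at F (phi p p) by apply: smap_chart => //; exact: dom_self.
have cl := form_local_pull hM hN w (dom_self hM p) (dom_self hN (f p)) sf.
apply: (@smooth_at_eq _ _ _ (fun z => form_local w (f p) (F z) (fun i => 'd F z (v i)) : R^o)).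
  by apply: near_mono cl => z ->.
apply: (smooth_multilin (w := fun z u => form_local w (f p) (F z) u : R^o)).
- move=> u; apply: (@smooth_at_comp _ _ _ _ _ (fun y => form_local w (f p) y u : R^o) _ (fin_basis_rV _) sF).
  by rewrite /F /= (psiK hM); [exact: sw|exact: dom_self].
- have nd : \forall q \near p, dom (f p) (f q) by apply: cf; apply: near_dom => //; exact: dom_self.
  have nw : \forall y \near f p, multilinear_form (w y) by apply: filterS mw => y [].
  have nm : \forall q \near p, multilinear_form (w (f q)) by exact: (cf _ nw).
  apply: near_mono2 (near_psi hM (dom_self hM p) nd) (near_psi hM (dom_self hM p) nm) => z dz mz.
  by apply: multilinear_local; rewrite /F /= (psiK hN).
- by move=> i; exact: smooth_at_D.
Qed.

Section Multilinear2.
Variables (n : nat) (w : ('I_2 -> 'rV[R]_n) -> R).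
Hypotheses (mw : multilinear_form w) (aw : alternating_form w).

Lemma multilin2l v : linear (fun u => w (vec2 u v) : R^o).
Proof.
move=> a u u'; have /multilinear_formP/(_ 0 (vec2 0 v) a u u') := mw.
have E x : (fun j : 'I_2 => if j == 0 then x else vec2 0 v j) = vec2 x v.
  by apply/funext => j; have [->|->] := ord2P j.
by rewrite !E.
Qed.

Lemma multilin2r u : linear (fun v => w (vec2 u v) : R^o).
Proof.
move=> a v v'; have /multilinear_formP/(_ 1 (vec2 u 0) a v v') := mw.
have E x : (fun j : 'I_2 => if j == 1 then x else vec2 u 0 j) = vec2 u x.
  by apply/funext => j; have [->|->] := ord2P j.
by rewrite !E.
Qed.

Lemma multilin2_anti u v : w (vec2 u v) = - w (vec2 v u).
Proof.
have z x : w (vec2 x x) = 0 by apply: (aw (i := 0) (j := 1)).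
have hl x y t : w (vec2 (x + y) t) = w (vec2 x t) + w (vec2 y t).
  by have /= := multilin2l t 1 x y; rewrite !scale1r.
have hr t x y : w (vec2 t (x + y)) = w (vec2 t x) + w (vec2 t y).
  by have /= := multilin2r t 1 x y; rewrite !scale1r.
have := z (u + v); rewrite hl !hr !z add0r addr0 => /eqP.
by rewrite addr_eq0 => /eqP.
Qed.

End Multilinear2.

Lemma multilin1 n (w : ('I_1 -> 'rV[R]_n) -> R) : multilinear_form w ->
  linear (fun u => w (fun=> u) : R^o).
Proof.
move=> mw a u u'; have /multilinear_formP/(_ 0 (fun=> 0) a u u') := mw.
have E x : (fun j : 'I_1 => if j == 0 then x else 0) = (fun=> x : 'rV[R]_n).
  by apply/funext => j; rewrite ord1.
by rewrite !E.
Qed.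

(** In charts the derivative of the pulled-back form has a part with first derivatives of F, which
    is the claim, and a part with second derivatives of F, which is symmetric and disappears on
    antisymmetrisation. *)
Lemma dform_pull1 (f : M -> N) (w : form N 1) p u v :
  (\forall q \near p, smap f q) -> sform w (f p) ->
  dform (form_pull f w) p (vec2 u v) =
  dform w (f p) (vec2 (mdiff f p u) (mdiff f p v)).
Proof.
move=> sf [mw sw]; have sfp := nbhs_singleton sf; have [cf _] := sfp.
set F := phi (f p) \o f \o psi p.
have sF : smooth_at F (phi p p) by apply: smap_chart => //; exact: dom_self.
have FE : F (phi p p) = phi (f p) (f p) by rewrite /F /= psiK //; exact: dom_self.
have cl := form_local_pull hM hN w (dom_self hM p) (dom_self hN (f p)) sf.
have nd : \forall q \near p, dom (f p) (f q) by apply: cf; apply: near_dom => //; exact: dom_self.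
have nw : \forall y \near f p, multilinear_form (w y) by apply: filterS mw => y [].
have nm : \forall q \near p, multilinear_form (w (f q)) by exact: (cf _ nw).
have nl : \forall z \near phi p p, linear (fun u => form_local w (f p) (F z) (fun=> u) : R^o).
  apply: near_mono2 (near_psi hM (dom_self hM p) nd) (near_psi hM (dom_self hM p) nm) => z dz mz; apply: multilin1.
  by apply: multilinear_local; rewrite /F /= (psiK hN).
set D := mdiff f p.
have hF : hasd F (phi p p) D by exact: hasd_mdiff.
pose L c a := 'd (fun y => form_local w (f p) y (fun=> c) : R^o) (phi (f p) (f p)) (D a).
pose S x a := 'd (fun z => 'd F z x) (phi p p) a.
pose O c := form_local w (f p) (F (phi p p)) (fun=> c).
have hL c : hasd (fun z => form_local w (f p) (F z) (fun=> c) : R^o) (phi p p) (L c).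
  apply: (@hasd_comp _ _ _ _ F (fun y => form_local w (f p) y (fun=> c) : R^o) _ _ _ hF).
  rewrite FE; exact: (hasd_self (smooth_at_diff (sw _))).
have hS x : hasd (fun z => 'd F z x) (phi p p) (S x).
  by apply: hasd_self; apply: smooth_at_diff; exact: smooth_at_D.
have hD x : hasd (fun z => form_local (form_pull f w) p z (fun=> x) : R^o) (phi p p)
   (fun a => L (D x) a + O (S x a)).
  apply: (@hasd_near _ _ _ (fun z => form_local w (f p) (F z) (fun=> 'd F z x) : R^o)).
    by apply: near_mono cl => z ->.
  exact: (hasd_lin_family nl hL (hS x)).
have aux (x y a b : R) : a = b -> (x + a) - (y + b) = x - y by move=> ->; ring.
apply: (etrans (dform1E _ _ _ _)).
apply: (etrans (congr2 (fun x y => x - y) (hasd_diff u (hD v)) (hasd_diff v (hD u)))).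
apply: (etrans _ (esym (dform1E _ _ _ _))).
by apply: aux; congr (O _); exact: schwarz.
Qed.

(** Six terms contain a second derivative of F; its symmetry and the antisymmetry of w cancel them
    in pairs. *)
Lemma dform_pull2 (f : M -> N) (w : form N 2) p a b c :
  (\forall q \near p, smap f q) -> sform w (f p) ->
  dform (form_pull f w) p (vec3 a b c) =
  dform w (f p) (vec3 (mdiff f p a) (mdiff f p b) (mdiff f p c)).
Proof.
move=> sf [mw sw]; have sfp := nbhs_singleton sf; have [cf _] := sfp.
set F := phi (f p) \o f \o psi p.
have sF : smooth_at F (phi p p) by apply: smap_chart => //; exact: dom_self.
have FE : F (phi p p) = phi (f p) (f p) by rewrite /F /= psiK //; exact: dom_self.
have cl := form_local_pull hM hN w (dom_self hM p) (dom_self hN (f p)) sf.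
have nd : \forall q \near p, dom (f p) (f q) by apply: cf; apply: near_dom => //; exact: dom_self.
have nw : \forall y \near f p, multilinear_form (w y) by apply: filterS mw => y [].
have nm : \forall q \near p, multilinear_form (w (f q)) by exact: (cf _ nw).
have nl : \forall z \near phi p p, multilinear_form (form_local w (f p) (F z)).
  apply: near_mono2 (near_psi hM (dom_self hM p) nd) (near_psi hM (dom_self hM p) nm) => z dz mz.
  by apply: multilinear_local; rewrite /F /= (psiK hN).
have aw : alternating_form (form_local w (f p) (F (phi p p))).
  have [_ az] := nbhs_singleton mw.
  move=> v i j ij vij; rewrite /form_local FE (psiK hN); last exact: dom_self.
  by apply: (az _ _ _ ij); rewrite vij.
have mz := nbhs_singleton nl.
set D := mdiff f p.
have hF : hasd F (phi p p) D by exact: hasd_mdiff.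
pose L x y h := 'd (fun q => form_local w (f p) q (vec2 x y) : R^o) (phi (f p) (f p)) (D h).
pose S x a := 'd (fun z => 'd F z x) (phi p p) a.
pose O x y := form_local w (f p) (F (phi p p)) (vec2 x y).
have hS x : hasd (fun z => 'd F z x) (phi p p) (S x).
  by apply: hasd_self; apply: smooth_at_diff; exact: smooth_at_D.
have hL x y : hasd (fun z => form_local w (f p) (F z) (vec2 x y) : R^o) (phi p p) (L x y).
  apply: (@hasd_comp _ _ _ _ F (fun q => form_local w (f p) q (vec2 x y) : R^o) _ _ _ hF).
  rewrite FE; exact: (hasd_self (smooth_at_diff (sw _))).
have hL1 x y : hasd (fun z => form_local w (f p) (F z) (vec2 ('d F z x) y) : R^o) (phi p p)
    (fun h => L (D x) y h + O (S x h) y).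
  apply: (hasd_lin_family (A := fun z q => form_local w (f p) (F z) (vec2 q y) : R^o)
     (L := fun q => L q y) _ _ (hS x)) => [|q]; last exact: hL.
  by apply: near_mono nl => z mw'; exact: multilin2l.
have hD x y : hasd (fun z => form_local (form_pull f w) p z (vec2 x y) : R^o) (phi p p)
   (fun h => L (D x) (D y) h + O (S x h) (D y) + O (D x) (S y h)).
  apply: (@hasd_near _ _ _ (fun z => form_local w (f p) (F z) (vec2 ('d F z x) ('d F z y)) : R^o)).
    apply: near_mono cl => z E; apply: (etrans _ (esym (E _))).
    by congr (form_local w (f p) _ _); exact/esym/vec2_map.
  apply: (hasd_lin_family (A := fun z q => form_local w (f p) (F z) (vec2 ('d F z x) q) : R^o)
     (L := fun q h => L (D x) q h + O (S x h) q) _ _ (hS y)) => [|q]; last exact: hL1.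
  by apply: near_mono nl => z mw'; exact: multilin2r.
have sym x h : S x h = S h x by exact: schwarz.
have anti x y : O x y = - O y x by exact: multilin2_anti.
clearbody O S.
have aux (x y z a1 a2 b1 b2 c1 c2 : R) : a1 = b1 -> a2 = - c1 -> b2 = c2 ->
    (x + a1 + a2) - (y + b1 + b2) + (z + c1 + c2) = x - y + z.
  by move=> -> -> ->; ring.
apply: (etrans (dform2E _ _ _ _ _)).
apply: (etrans (congr2 (fun x y => x + y)
  (congr2 (fun x y => x - y) (hasd_diff a (hD b c)) (hasd_diff b (hD a c)))
  (hasd_diff c (hD a b)))).
apply: (etrans _ (esym (dform2E _ _ _ _ _))).
apply: aux.
- by rewrite (sym a b).
- by rewrite anti (sym c a).
- by rewrite (sym b c).
Qed.

End Pull.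
End Forms.

(** * Local primitives of closed forms *)

Section PoincareManifold.
Context {R : realType}.

Lemma near_all (V : normedModType R) (z : V) (P : V -> Prop) :
  (forall x, P x) -> \forall x \near z, P x.
Proof. by move=> h; exact: nearW. Qed.

Lemma form_pull_dform1 (M N : manifold R) (hM : atlas M) (hN : atlas N)
    (f : M -> N) (w : form N 1) p :
  (\forall q \near p, smap f q) -> sform w (f p) ->
  dform (form_pull f w) p = form_pull f (dform w) p.
Proof.
move=> sf sw; apply/funext => v; rewrite (vec2E v) (dform_pull1 hM hN) //.
by rewrite /form_pull vec2_map.
Qed.

Lemma form_pull_dform2 (M N : manifold R) (hM : atlas M) (hN : atlas N)
    (f : M -> N) (w : form N 2) p :
  (\forall q \near p, smap f q) -> sform w (f p) ->
  dform (form_pull f w) p = form_pull f (dform w) p.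
Proof.
move=> sf sw; apply/funext => v; rewrite (vec3E v) (dform_pull2 hM hN) //.
by rewrite /form_pull vec3_map.
Qed.

Lemma form_pull_comp (M N P : manifold R) (hM : atlas M) (hN : atlas N)
    (f : M -> N) (g : N -> P) k (w : form P k) p :
  smap f p -> smap g (f p) ->
  form_pull (g \o f) w p = form_pull f (form_pull g w) p.
Proof.
move=> sf sg; apply/funext => v; rewrite /form_pull /=; congr (w _).
by apply/funext => i; exact: mdiff_comp.
Qed.

Lemma form_pull_cst (M N : manifold R) (b : N) k (w : form N k.+1) (p : M) :
  multilinear_form (w b) -> form_pull (fun=> b) w p = fun=> 0.
Proof.
move=> mw; apply/funext => v; rewrite /form_pull.
rewrite (_ : (fun i => _) = fun=> 0); last by apply/funext => i; exact: mdiff_cst.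
have /multilinear_formP/(_ 0 (fun=> 0) 1 0 0) := mw.
have E (c : tangent N) : c = 0 ->
    (fun j : 'I_k.+1 => if j == 0 then c else 0) = (fun=> 0 : tangent N).
  by move=> ->; apply/funext => j; rewrite if_same.
rewrite (E 0) // (E (1 *: 0 + 0)); last by rewrite scaler0 addr0.
by rewrite mul1r -[X in X = _]addr0 => /addrI.
Qed.

Section Chart.
Variables (M : manifold R) (hM : atlas M).
Local Notation dom a := (cdom (chart_at a)).
Local Notation phi a := (cmap (chart_at a)).
Local Notation psi a := (cinv (chart_at a)).
Local Notation E := (euclid (R := R) (mdim M)).
Let hE : atlas E := atlas_euclid _.

Lemma euclid_local n k (w : form (euclid (R := R) n) k) a : form_local w a = w.
Proof.
apply/funext => z; apply/funext => v; rewrite /form_local /=; congr (w z).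
apply/funext => i; exact: (hasd_diff (v i) (hasd_id z)).
Qed.

(** Holds by computation, since the chart of [euclid] is the identity; statements on pull-backs thus
    apply to local coefficients. *)
Lemma form_local_pullE k (w : form M k) a : form_local w a = form_pull (psi a : E -> M) w.
Proof. by []. Qed.

Lemma mdiff_phiK a q v : dom a q ->
  'd (phi q \o psi a) (phi a q) (@mdiff R M E (phi a) q v) = v.
Proof.
move=> da; have dq := dom_self hM q.
have h := chain_chart (f := id) (g := phi q) hM hM v dq da (smap_id hM q) (sfun_phi hM dq).
by apply: (etrans (esym h)); exact: mdiff_id.
Qed.

Lemma form_pull_local k (w : form M k) a q : dom a q ->
  @form_pull R M E (phi a) k (form_local w a) q = w q.
Proof.
move=> da; apply/funext => v; rewrite /form_pull /form_local (psiK hM da); congr (w q).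
by apply/funext => i; exact: mdiff_phiK.
Qed.

Lemma near_smap_psi a q : dom a q ->
  \forall z \near (phi a q : E), @smap R E M (psi a) z.
Proof.
move=> da; have := near_img hM da; apply: filterS => z [dz Ez _].
by have := smap_psi hM dz; rewrite Ez.
Qed.

Lemma near_smap_phi a q : dom a q -> \forall q' \near q, @smap R M E (phi a) q'.
Proof. by move=> da; apply: filterS (near_dom hM da) => q' dq'; exact: smap_phi. Qed.

Lemma sform_local k (w : form M k) a q : dom a q -> sform w q ->
  sform (form_local w a : form E k) (phi a q).
Proof.
move=> da sw; apply: (sform_pull hE hM (f := psi a : E -> M)); first exact: near_smap_psi.
by rewrite (psiK hM).
Qed.

Lemma sform_smooth n k (w : form (euclid (R := R) n) k) z v : sform w z ->
  smooth_at (fun z => w z v : R^o) z.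
Proof. by move=> [_ /(_ v)]; rewrite euclid_local. Qed.

Lemma closed_form1_primitive (A : form M 1) (p : M) :
  (\forall q \near p, sform A q /\ forall v, dform A q v = 0) ->
  exists f : M -> R^o, \forall q \near p,
    sfun f q /\ forall v, fdiff f q v = form_app1 A q v.
Proof.
move=> cA; have dp := dom_self hM p.
pose Ah : form E 1 := form_local A p.
have : \forall z \near phi p p, sform Ah z /\ forall v, dform Ah z v = 0.
  apply: near_mono2 (near_psi hM dp cA) (near_img hM dp) => z [sz cz] [dz Ez _].
  split; first by rewrite -Ez; exact: sform_local.
  move=> v; rewrite /Ah form_local_pullE (form_pull_dform1 hE hM) //; first exact: cz.
  by rewrite -Ez; exact: near_smap_psi.
move=> /nbhs_ballP[r /= r0 hr].
pose al i z : R^o := Ah z (fun=> delta_mx 0 i).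
have sal i : smooth_on (ball (phi p p) r) (al i).
  apply/smooth_onP; first exact: ball_open.
  by move=> z /hr[sz _]; exact: sform_smooth.
have cal i j z : ball (phi p p) r z -> partial i (al j) z = partial j (al i) z.
  move=> /hr[sz /(_ (vec2 (delta_mx 0 i) (delta_mx 0 j)))].
  by move=> h; apply/subr0_eq; rewrite -{}h dform1E euclid_local.
have [fh sfh fE] := poincare1 sal cal.
exists (fh \o phi p).
have nb : \forall z \near phi p p, ball (phi p p) r z by exact: nbhsx_ballx.
apply: filterS2 (near_dom hM dp) (near_phi hM dp nb) => q dq bq.
have sfq : @sfun R E R^o fh (phi p q).
  by apply: (smooth_onP _ _).1 sfh _ bq; exact: ball_open.
have spq : @smap R M E (phi p) q by exact: smap_phi.
split; first exact: (smap_sfun hM hE spq sfq).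
move=> v; rewrite (fdiff_comp hM hE v spq sfq).
rewrite /form_app1 -(form_pull_local A dq) /form_pull.
set u := mdiff _ _ _.
have [mq _] := hr _ bq; have [/nbhs_singleton[ml _] _] := mq.
rewrite [RHS](linear_coords (multilin1 ml) u).
apply: (etrans (diff_partial fh (phi p q) u)).
by apply: eq_bigr => i _; rewrite fE.
Qed.

(** In the chart at p the coefficients of w form a closed antisymmetric array on a ball. The
    primitive given by [poincare2] is carried back along the chart, under which the exterior
    derivative is natural. *)
Lemma closed_form2_primitive (w : form M 2) (p : M) :
  (\forall q \near p, sform w q /\ forall v, dform w q v = 0) ->
  exists A : form M 1, \forall q \near p, sform A q /\ dform A q = w q.
Proof.
move=> cw; have dp := dom_self hM p.
pose wh : form E 2 := form_local w p.
have : \forall z \near phi p p, sform wh z /\ forall v, dform wh z v = 0.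
  apply: near_mono2 (near_psi hM dp cw) (near_img hM dp) => z [sz cz] [dz Ez _].
  split; first by rewrite -Ez; exact: sform_local.
  move=> v; rewrite /wh form_local_pullE (form_pull_dform2 hE hM) //; first exact: cz.
  by rewrite -Ez; exact: near_smap_psi.
move=> /nbhs_ballP[r /= r0 hr].
pose e i : 'rV[R]_(mdim M) := delta_mx 0 i.
pose F i j z : R^o := wh z (vec2 (e i) (e j)).
have mwh z : ball (phi p p) r z -> multilinear_form (wh z) /\ alternating_form (wh z).
  by move=> /hr[[/nbhs_singleton]].
have sF i j : smooth_on (ball (phi p p) r) (F i j).
  apply/smooth_onP; first exact: ball_open.
  by move=> z /hr[sz _]; exact: sform_smooth.
have aF i j z : ball (phi p p) r z -> F i j z = - F j i z.
  by move=> /mwh[ml al]; exact: multilin2_anti.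
have pN i j k z : ball (phi p p) r z -> partial i (F j k) z = - partial i (F k j) z.
  move=> bz; suff H : hasd (F j k) z (fun v => - 'd (F k j) z v) by exact: hasd_diff H.
  have sz : smooth_at (F k j) z by apply: (smooth_onP _ _).1 (sF k j) _ bz; exact: ball_open.
  apply: hasd_near (hasd_opp (hasd_self (smooth_at_diff sz))).
  have : nbhs z (ball (phi p p) r) by apply: open_nbhs_nbhs; split=> //; exact: ball_open.
  by apply: near_mono => y by_; rewrite [RHS]aF.
have cF i j k z : ball (phi p p) r z ->
    partial i (F j k) z + partial j (F k i) z + partial k (F i j) z = 0.
  move=> bz; have [_ /(_ (vec3 (e i) (e j) (e k)))] := hr _ bz.
  by rewrite dform2E euclid_local => h; rewrite (pN j k i) // -[RHS]h.
have [a sa aE] := poincare2 sF aF cF.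
pose Ah : form E 1 := fun z v => \sum_i v 0 0 i * a i z.
have nb : \forall z \near phi p p, ball (phi p p) r z by exact: nbhsx_ballx.
have sAh z : ball (phi p p) r z -> sform Ah z.
  move=> bz; split.
    apply: near_all => y; split.
      apply/multilinear_formP => i v c u u'; rewrite /Ah mulr_sumr -big_split /=.
      by apply: eq_bigr => l _; rewrite ord1 /= !mxE mulrDl mulrA.
    by move=> v i j; rewrite !ord1.
  move=> v; rewrite euclid_local; apply: smooth_at_sum => i.
  apply: smooth_at_mul; first exact: smooth_at_cst.
  by apply: (smooth_onP _ _).1 (sa i) _ bz; exact: ball_open.
have dAh z u v : ball (phi p p) r z -> dform Ah z (vec2 u v) = wh z (vec2 u v).
  move=> bz; rewrite dform1E euclid_local.
  have D x : hasd (fun z => Ah z (fun=> x) : R^o) z (fun y => \sum_i (x 0 i : R^o) * 'd (a i) z y).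
    apply: hasd_ext (hasd_sum (fun i => hasd_scale (hasd_cst (x 0 i : R^o) z) (hasd_self _))).
      by move=> y; apply: eq_bigr => i _; rewrite scale0r add0r.
    by move=> i; apply: smooth_at_diff; apply: (smooth_onP _ _).1 (sa i) _ bz; exact: ball_open.
  apply: (etrans (congr2 (fun x y => x - y) (hasd_diff u (D v)) (hasd_diff v (D u)))).
  have [ml _] := mwh _ bz.
  rewrite (linear_coords (multilin2l ml v) u).
  under [in RHS]eq_bigr do rewrite (linear_coords (multilin2r ml _) v).
  have E1 (x y : 'rV[R]_(mdim M)) : \sum_i x 0 i * 'd (a i) z y =
      \sum_i \sum_j x 0 i * (y 0 j * partial j (a i) z).
    apply: eq_bigr => i _.
    exact: (etrans (congr1 (fun c => x 0 i * c) (diff_partial (a i) z y)) (mulr_sumr _ _ _ _)).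
  apply: (etrans (congr2 (fun x y => x - y) (E1 v u) (E1 u v))).
  rewrite exchange_big /= -sumrB; apply: eq_bigr => i _.
  rewrite -sumrB scaler_sumr; apply: eq_bigr => j _.
  rewrite -[wh z _]/(F i j z) -(aE i j z bz).
  rewrite -![_ *: _]/(_ * _); ring.
exists (@form_pull R M E (phi p) 1 Ah).
apply: filterS2 (near_dom hM dp) (near_phi hM dp nb) => q dq bq.
have nq := near_smap_phi dq.
split; first by apply: (sform_pull hM hE nq); exact: sAh.
rewrite (form_pull_dform1 hM hE nq); last exact: sAh.
rewrite -(form_pull_local w dq); apply/funext => v; rewrite /form_pull.
by rewrite (vec2E v) vec2_map dAh.
Qed.

End Chart.
End PoincareManifold.

(** * Identities in abelian groups *)

(** Syntax for deciding identities in an abelian group by reflection: an expression is determined by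
    the integer coefficients of its atoms. The cocycle computations below are of this kind. *)
Inductive zexpr := ZVar of nat | ZAdd of zexpr & zexpr | ZOpp of zexpr | ZZero.

Section ZmodReflection.
Variable T : zmodType.

Fixpoint zeval (env : seq T) (e : zexpr) : T :=
  match e with
  | ZVar n => nth 0 env n
  | ZAdd a b => zeval env a + zeval env b
  | ZOpp a => - zeval env a
  | ZZero => 0
  end.

Fixpoint zcoef (e : zexpr) (i : nat) : int :=
  match e with
  | ZVar n => if n == i then 1 else 0
  | ZAdd a b => zcoef a i + zcoef b i
  | ZOpp a => - zcoef a i
  | ZZero => 0
  end.

Lemma zevalE env e : zeval env e = \sum_(i < size env) nth 0 env i *~ zcoef e i.
Proof.
elim: e => [n|a IHa b IHb|a IHa|] /=.
- have [ns|ns] := ltnP n (size env); last first.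
    rewrite nth_default // big1 // => i _; case: eqP => [E|//].
    by move: (ltn_ord i); rewrite -E ltnNge ns.
  rewrite (bigD1 (Ordinal ns)) //= eqxx mulr1z big1 ?addr0 // => i.
  by rewrite -val_eqE /= eq_sym => /negbTE ->.
- by rewrite IHa IHb -big_split /=; apply: eq_bigr => i _; rewrite mulrzDr.
- by rewrite IHa -sumrN; apply: eq_bigr => i _; rewrite mulrNz.
- by rewrite big1.
Qed.

Lemma zmod_reflect env e1 e2 :
  all (fun i => zcoef e1 i == zcoef e2 i) (iota 0 (size env)) ->
  zeval env e1 = zeval env e2.
Proof.
move=> /allP h; rewrite !zevalE; apply: eq_bigr => i _.
by rewrite (eqP (h i _)) // mem_iota /=.
Qed.

End ZmodReflection.

Ltac zmod_in x env :=
  lazymatch env with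
  | nil => constr:(false)
  | x :: _ => constr:(true)
  | _ :: ?e => zmod_in x e
  end.
Ltac zmod_index x env :=
  lazymatch env with
  | x :: _ => constr:(0%N)
  | _ :: ?e => let n := zmod_index x e in constr:(S n)
  end.
Ltac zmod_env t env :=
  lazymatch t with
  | (?a + ?b)%R => let e := zmod_env a env in zmod_env b e
  | (- ?a)%R => zmod_env a env
  | 0%R => env
  | _ => lazymatch zmod_in t env with true => env | false => constr:(t :: env) end
  end.
Ltac zmod_reify t env :=
  lazymatch t with
  | (?a + ?b)%R => let x := zmod_reify a env in let y := zmod_reify b env in
      constr:(ZAdd x y)
  | (- ?a)%R => let x := zmod_reify a env in constr:(ZOpp x)
  | 0%R => constr:(ZZero)
  | _ => let n := zmod_index t env in constr:(ZVar n)
  end.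
Ltac zmod :=
  lazymatch goal with
  | |- @eq ?T ?a ?b =>
      let e0 := zmod_env a (@nil T) in let e := zmod_env b e0 in
      let x := zmod_reify a e in let y := zmod_reify b e in
      exact (@zmod_reflect _ e x y isT)
  end.

(** * Flat bundles and flat gerbes *)

Section Connected.

(** If P passes between any two points of a small neighbourhood, then P and its complement are both
    open. *)
Lemma connected_transfer (X : topologicalType) (P : X -> Prop) (x0 : X) :
  connected [set: X] ->
  (forall x : X, exists2 N, nbhs x N & forall y z, N y -> N z -> P y -> P z) ->
  P x0 -> forall x, P x.
Proof.
move=> cX tr Px0.
have oP : open [set x | P x].
  rewrite openE => x Px; have [N nN h] := tr x.
  have Nx := nbhs_singleton nN.
  by apply: filterS nN => y Ny; exact: (h x y Nx Ny Px).
have oPC : open [set x | ~ P x].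
  rewrite openE => x Px; have [N nN h] := tr x.
  have Nx := nbhs_singleton nN.
  by apply: filterS nN => y Ny Py; apply: Px; exact: (h y x Ny Nx Py).
have E : [set x | P x] = setT.
  apply: cX; first by exists x0.
    by exists [set x | P x] => //; rewrite setTI.
  exists [set x | P x]; last by rewrite setTI.
  by rewrite -openC.
by move=> x; rewrite -[P x]/([set x | P x] x) E.
Qed.

Lemma connected_real (R : realType) : connected [set: R].
Proof. by apply/connected_intervalP => *. Qed.

End Connected.

(** * Locally constant functions *)

Section LocallyConstant.
Variable T : zmodType.

(** T carries no topology: it plays the role of a discrete group of coefficients. *)
Definition lc (Y : topologicalType) (p : Y -> T) (y : Y) :=
  \forall y' \near y, p y' = p y.

Section Basic.
Variable Y : topologicalType.
Implicit Types (p q : Y -> T) (y : Y).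

Lemma lc_cst c y : lc (fun=> c) y. Proof. exact: nearW. Qed.

Lemma lc_of p y c : (\forall y' \near y, p y' = c) -> lc p y.
Proof. by move=> h; apply: filterS (h) => y' ->; rewrite (nbhs_singleton h). Qed.

Lemma lc_eq p q y : (\forall y' \near y, p y' = q y') -> lc p y -> lc q y.
Proof.
move=> pq h; apply: (@lc_of _ _ (p y)).
by apply: filterS2 pq h => y' <- ->.
Qed.

Lemma lc_add p q y : lc p y -> lc q y -> lc (fun z => p z + q z) y.
Proof. by move=> h h'; apply: filterS2 h h' => z -> ->. Qed.

Lemma lc_opp p y : lc p y -> lc (fun z => - p z) y.
Proof. by move=> h; apply: filterS h => z ->. Qed.

Lemma lc_sub p q y : lc p y -> lc q y -> lc (fun z => p z - q z) y.
Proof. by move=> h h'; apply: lc_add => //; exact: lc_opp. Qed.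

Lemma lc_near p y : lc p y -> \forall y' \near y, lc p y'.
Proof.
move=> h; have : nbhs y [set y' | p y' = p y] by exact: h.
rewrite nbhsE => -[U [oU Uy] UP].
apply: filterS (open_nbhs_nbhs (conj oU Uy)) => z Uz.
apply: (@lc_of _ _ (p y)).
by apply: filterS (open_nbhs_nbhs (conj oU Uz)) => w /UP.
Qed.

Lemma lc_ext p q y : p =1 q -> lc p y -> lc q y.
Proof. by move=> pq; apply: lc_eq; exact: nearW. Qed.

End Basic.

Lemma lc_comp (Y Z : topologicalType) (f : Z -> Y) (p : Y -> T) z :
  {for z, continuous f} -> lc p (f z) -> lc (p \o f) z.
Proof. by move=> cf h; exact: (cf _ h). Qed.

End LocallyConstant.

(** * Flat bundles and transport along paths *)

Section Segments.
Variables (R : realType) (T : zmodType).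

(** A retraction of the line onto [a, b]; composing with it replaces statements on [0, 1] with its
    subspace topology by statements on the whole line. *)
Definition clamp (a b t : R) : R := Num.max a (Num.min b t).

Lemma clamp_continuous a b : continuous (clamp a b).
Proof.
move=> t; apply: continuous_max; first exact: cst_continuous.
by apply: continuous_min; [exact: cst_continuous|exact: cvg_id].
Qed.

Lemma clamp_id a b t : a <= t <= b -> clamp a b t = t.
Proof. by move=> /andP[at_ tb]; rewrite /clamp min_r // max_r. Qed.

Lemma clamp_itv a b t : a <= b -> a <= clamp a b t <= b.
Proof.
move=> ab; rewrite /clamp le_max lexx /= ge_max ab /=.
by rewrite ge_min lexx.
Qed.

Lemma lc_segment (h : R -> T) a b : a <= b ->
  (forall t, lc (h \o clamp a b) t) -> h a = h b.
Proof.
move=> ab lk; pose k t := h (clamp a b t).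
have := @connected_transfer R (fun t => k t = k a) a (@connected_real R) _ erefl b.
rewrite /k !clamp_id ?lexx ?ab // => -> // t.
exists [set t' | k t' = k t]; first exact: lk.
by move=> y z /= ey ez; rewrite -/(k y) -/(k z) ey ez.
Qed.

(* A flat bundle over Y, trivialised set-theoretically: rho y represents its
   parallel sections near y, up to a constant. *)
Definition flat (Y : topologicalType) (W : set Y) (rho : Y -> Y -> T) :=
  forall y, W y -> \forall y' \near y, W y' -> lc (fun z => rho y z - rho y' z) y'.

Definition parallel (Y : topologicalType) (W : set Y) (rho : Y -> Y -> T) (f : Y -> T) :=
  forall y, W y -> lc (fun z => f z - rho y z) y.

(** S t says that a parallel function exists on [0, t]. Near t one representative rho t is parallel
    everywhere, so S passes between nearby end points, by restriction or by extension with rho t. *)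
Lemma parallel_segment (rho : R -> R -> T) : flat setT rho ->
  exists2 g : R -> T, parallel (`[0, 1] : set R) rho g & g 0 = 0.
Proof.
move=> fr.
pose S t := exists g : R -> T, forall x, 0 <= x <= t -> lc (fun z => g z - rho x z) x.
have [g hg] : S 1.
  apply: (@connected_transfer R S (-1)) => [|t|]; first exact: connected_real.
    have /nbhs_ballP[d /= d0 hd] := fr t I.
    exists (ball t d); first exact: nbhsx_ballx.
    have conv y z x : ball t d y -> ball t d z -> y <= x <= z -> ball t d x.
      rewrite -!ball_normE /= => h1 h2 /andP[yx xz].
      move: h1 h2; rewrite !ltr_norml => /andP[a1 a2] /andP[b1 b2].
      by apply/andP; split; lra.
    move=> s s' bs bs' [g hg].
    have [s's|ss'] := leP s' s.
      exists g => x /andP[x0 xs']; apply: hg; rewrite x0 /=; exact: le_trans s's.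
    pose r := rho t; pose c := g s - r s.
    (* Beyond s the solution continues as the local representative r, shifted by c so that the two
       pieces agree at s. *)
    exists (fun x => if x <= s then g x else r x + c) => x /andP[x0 xs'].
    have rx : s <= x -> lc (fun z => r z - rho x z) x.
      move=> sx; apply: hd => //; apply: (conv s s') => //; by rewrite sx.
    have [xs|sx|xs] := ltgtP x s.
    - apply: (@lc_eq _ _ (fun z => g z - rho x z)); last by apply: hg; rewrite x0 ltW.
      by near=> z; rewrite ifT // ltW //; near: z; exact: lt_nbhsl.
    - apply: (@lc_eq _ _ (fun z => c + (r z - rho x z))).
        near=> z; rewrite ifF ?[r z + c]addrC ?addrA //; apply/negbTE; rewrite -ltNge.
        by near: z; exact: lt_nbhsr.
      by apply: lc_add; [exact: lc_cst|apply: rx; exact: ltW].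
    - have gx : lc (fun z => g z - rho x z) x by apply: hg; rewrite x0 xs lexx.
      have gr : lc (fun z => g z - r z) x.
        have rx' : lc (fun z => r z - rho x z) x by apply: rx; rewrite xs.
        by apply: lc_ext (lc_sub gx rx') => z; zmod.
      apply: (@lc_eq _ _ (fun z => g z - rho x z)) gx.
      apply: filterS gr => z gz; case: ifP => // _.
      by rewrite /c -xs -gz; congr (_ - _); zmod.
  (* The starting point -1 makes the interval [0, -1] empty. *)
  exists (fun=> 0) => x /andP[x0 x1]; exfalso.
  by move: (le_trans x0 x1); rewrite lerN10 || (rewrite oppr_ge0 ler10).
exists (fun z => g z - g 0); last by rewrite subrr.
move=> x /=; rewrite in_itv /= => x01; have := hg x x01.
by move=> /lc_sub/(_ (lc_cst (g 0) x)); apply: lc_ext => z; zmod.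
Unshelve. all: by end_near. Qed.

Lemma flat_comp (Y Z : topologicalType) (phi : Z -> Y) (W : set Y) rho :
  continuous phi -> flat W rho ->
  flat (phi @^-1` W) (fun z w => rho (phi z) (phi w)).
Proof.
move=> cphi fr z Wz.
have n1 : \forall z' \near z, W (phi z') ->
    lc (fun w => rho (phi z) w - rho (phi z') w) (phi z') := cphi z _ (fr (phi z) Wz).
apply: filterS n1 => z' h Wz'.
exact: (lc_comp (p := fun w => rho (phi z) w - rho (phi z') w) (cphi z') (h Wz')).
Qed.

Lemma parallel_comp (Y Z : topologicalType) (phi : Z -> Y) (W : set Y) rho f :
  continuous phi -> parallel W rho f ->
  parallel (phi @^-1` W) (fun z w => rho (phi z) (phi w)) (f \o phi).
Proof.
move=> cphi pf z Wz.
exact: (lc_comp (p := fun w => f w - rho (phi z) w) (cphi z) (pf _ Wz)).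
Qed.

Lemma flatS (Y : topologicalType) (W W' : set Y) rho : W' `<=` W -> flat W rho -> flat W' rho.
Proof. by move=> s f y /s Wy; apply: filterS (f y Wy) => y' h /s; exact: h. Qed.

Section Lifts.
Variables (Y : topologicalType).

(* l is a parallel section of rho along the restriction of the path p to [0, 1] *)
Definition lift (rho : Y -> Y -> T) (p : R -> Y) (l : R -> T) :=
  forall t, lc (fun s => l (clamp 0 1 s) - rho (p (clamp 0 1 t)) (p (clamp 0 1 s))) t.

Lemma clamp01 t : 0 <= clamp 0 1 t <= 1. Proof. exact: clamp_itv. Qed.
Lemma clamp010 : clamp 0 1 0 = 0. Proof. by rewrite clamp_id // lexx ler01. Qed.
Lemma clamp011 : clamp 0 1 1 = 1. Proof. by rewrite clamp_id // lexx ler01. Qed.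

Lemma lift_exists (W : set Y) rho (p : R -> Y) c : flat W rho -> continuous p ->
  (forall t, W (p t)) -> exists2 l, lift rho p l & l 0 = c.
Proof.
move=> fr cp Wp.
have f1 : flat setT (fun s t : R => rho (p s) (p t)).
  by apply: flatS (flat_comp cp fr) => t _; exact: Wp.
have [g pg g0] := parallel_segment f1.
exists (fun t => g t + c); last by rewrite g0 add0r.
move=> t; have := pg (clamp 0 1 t); rewrite /= in_itv /= => /(_ (clamp01 t)) h.
have h2 := lc_comp (f := clamp 0 1) (@clamp_continuous 0 1 t) (lc_add h (lc_cst c _)).
by apply: lc_ext h2 => s /=; zmod.
Qed.

Lemma lift_unique rho (p : R -> Y) l l' : lift rho p l -> lift rho p l' ->
  l 0 = l' 0 -> l 1 = l' 1.
Proof.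
move=> h h' e.
have E : l 0 - l' 0 = l 1 - l' 1.
  apply: (@lc_segment (fun t => l t - l' t)) => // t.
  by apply: lc_ext (lc_sub (h t) (h' t)) => z /=; zmod.
by apply/eqP; rewrite -subr_eq0 -E e subrr.
Qed.

Lemma parallel_lift (W : set Y) rho f (p : R -> Y) : parallel W rho f ->
  continuous p -> (forall t, W (p t)) -> lift rho p (f \o p).
Proof.
move=> pf cp Wp t.
apply: (lc_comp (f := p \o clamp 0 1) (p := fun w => f w - rho (p (clamp 0 1 t)) w)).
  by apply: continuous_comp; [exact: clamp_continuous|exact: cp].
exact: pf.
Qed.

Lemma lift_reparam rho (p q : R -> Y) (a : R -> R) l : continuous a ->
  (forall t, 0 <= t <= 1 -> 0 <= a t <= 1 /\ p (a t) = q t) ->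
  lift rho p l -> lift rho q (l \o a).
Proof.
move=> ca ha hl t; pose b := a \o clamp 0 1.
have E s : clamp 0 1 (b s) = b s.
  by rewrite clamp_id //; have [] := ha _ (clamp01 s).
have hb := lc_comp (f := b) _ (hl (b t)).
apply: (lc_ext _ (hb _)); last first.
  by apply: continuous_comp; [exact: clamp_continuous|exact: ca].
move=> s /=; rewrite -![a (clamp 0 1 _)]/(b _) !E.
by have [_ <-] := ha _ (clamp01 t); have [_ <-] := ha _ (clamp01 s).
Qed.

End Lifts.

(** Around (y, p t) one representative r serves on a whole box A x B. Inside it L y' and r differ by
    a constant along the path, for each y' in A; so the property passes from t to nearby times, and
    the line is connected. *)
Lemma lift_family (Y X : topologicalType) (V : set Y) (F : set X)
    (rho : Y * X -> Y * X -> T) (p : R -> X) (L : Y -> R -> T) :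
  open V -> flat (V `*` F) rho -> continuous p -> (forall t, F (p t)) ->
  (forall y, V y -> lift (fun x x' => rho (y, x) (y, x')) p (L y)) ->
  (forall y, V y -> lc (fun y' => L y' 0 - rho (y, p 0) (y', p 0)) y) ->
  forall y, V y -> lc (fun y' => L y' 1 - rho (y, p 1) (y', p 1)) y.
Proof.
move=> oV fr cp Fp hL h0 y Vy.
pose cl := clamp 0 1.
pose S (t : R) := lc (fun y' => L y' (cl t) - rho (y, p (cl t)) (y', p (cl t))) y.
suff : S 1 by rewrite /S /cl clamp011.
have cpcl : continuous (p \o cl).
  by move=> t; apply: continuous_comp; [exact: clamp_continuous|exact: cp].
apply: (@connected_transfer R S 0) => [|t|]; first exact: connected_real.
  set r := rho (y, p (cl t)).
  have [[A B] /= [nA nB] AB] := fr (y, p (cl t)) (conj Vy (Fp _)).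
  have /nbhs_ballP[d /= d0 hd] := cpcl t _ nB.
  have nV : nbhs y V by apply: open_nbhs_nbhs.
  exists (ball t d); first exact: nbhsx_ballx.
  have conv a z x : ball t d a -> ball t d z -> a <= x <= z -> ball t d x.
    rewrite -!ball_normE /= => h1 h2 /andP[yx xz].
    move: h1 h2; rewrite !ltr_norml => /andP[a1 a2] /andP[b1 b2].
    by apply/andP; split; lra.
  have key s s' y' : ball t d s -> ball t d s' -> s <= s' -> A y' -> V y' ->
      L y' (cl s) - r (y', p (cl s)) = L y' (cl s') - r (y', p (cl s')).
    move=> bs bs' ss' Ay' Vy'.
    apply: (@lc_segment (fun x => L y' (cl x) - r (y', p (cl x)))) => // x.
    apply: (lc_comp (f := clamp s s') (p := fun x => L y' (cl x) - r (y', p (cl x)))).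
      exact: clamp_continuous.
    have bx := conv _ _ _ bs bs' (clamp_itv x ss').
    move: (clamp s s' x) bx => {}x bx.
    have Bx := hd _ bx.
    have h1 : lc (fun z => r z - rho (y', p (cl x)) z) (y', p (cl x)).
      by apply: (AB (y', p (cl x))) => //; split=> //=; exact: Fp.
    have h2 : lc (fun s => r (y', p (cl s)) - rho (y', p (cl x)) (y', p (cl s))) x.
      apply: (lc_comp (f := fun s => (y', p (cl s))) (p := fun z => r z - rho (y', p (cl x)) z)) h1.
      by apply: cvg_pair; [exact: cst_continuous|exact: cpcl].
    by apply: lc_ext (lc_sub (hL y' Vy' x) h2) => z; rewrite /cl; zmod.
  have tr s : ball t d s -> S s <-> lc (fun y' => L y' (cl s) - r (y', p (cl s))) y.
    move=> bs; have h1 : lc (fun z => r z - rho (y, p (cl s)) z) (y, p (cl s)).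
      apply: (AB (y, p (cl s))) => //; last by split=> //=; exact: Fp.
      by split; [exact: (nbhs_singleton nA)|exact: (hd _ bs)].
    have h2 : lc (fun y' => r (y', p (cl s)) - rho (y, p (cl s)) (y', p (cl s))) y.
      apply: (lc_comp (f := fun y' => (y', p (cl s))) (p := fun z => r z - rho (y, p (cl s)) z)) h1.
      by apply: cvg_pair; [exact: cvg_id|exact: cst_continuous].
    by split=> h; [apply: lc_ext (lc_sub h h2)|apply: lc_ext (lc_add h h2)] => z; zmod.
  move=> s s' bs bs' /(tr _ bs) h; apply/(tr _ bs').
  apply: lc_eq h; apply: filterS2 nA nV => y' Ay' Vy'.
  by case: (leP s s') => [/key->//|/ltW/key->].
by rewrite /S /cl clamp010; exact: h0.
Qed.

Lemma paste_continuous (X : topologicalType) (f g : R -> X) (a : R) :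
  continuous f -> continuous g -> f a = g a ->
  continuous (fun t => if t <= a then f t else g t).
Proof.
move=> cf cg fga t U nU.
suff : \forall s \near t, U (if s <= a then f s else g s) by [].
have nf : nbhs (f t) U -> \forall s \near t, U (f s) by exact: cf.
have ng : nbhs (g t) U -> \forall s \near t, U (g s) by exact: cg.
move: nU; have [ta|ta|ta] := ltgtP t a => nU.
- near=> s; rewrite ifT; first by near: s; exact: nf.
  by apply: ltW; near: s; exact: lt_nbhsl.
- near=> s; rewrite ifF; first by near: s; exact: ng.
  by apply/negbTE; rewrite -ltNge; near: s; exact: lt_nbhsr.
- near=> s; case: ifP => _; near: s; first exact: nf.
  by apply: ng; rewrite ta -fga -ta.
Unshelve. all: by end_near. Qed.

(** Relative to a subset F with base point f0. Paths and homotopies live on the whole line and plane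
    and stay in F there, while their boundary conditions concern [0, 1] only. *)
Definition simply_conn (X : topologicalType) (F : set X) (f0 : X) :=
  (forall x, F x -> exists p : R -> X,
    [/\ continuous p, forall t, F (p t), p 0 = f0 & p 1 = x]) /\
  (forall p : R -> X, continuous p -> (forall t, F (p t)) -> p 0 = f0 -> p 1 = f0 ->
    exists H : R * R -> X, [/\ continuous H, forall z, F (H z),
      forall s, 0 <= s <= 1 -> H (s, 0) = p s /\ H (s, 1) = f0 &
      forall t, 0 <= t <= 1 -> H (0, t) = f0 /\ H (1, t) = f0]).

Section SimplyConnected.
Variables (X : topologicalType) (F : set X) (f0 : X).
Hypothesis scF : simply_conn F f0.

(** The homotopy pulls rho back to the square. L s is the transport of 0 up the vertical segment at
    s. Along the top edge K is constant, so L s 1 + l s is locally constant in s; on the two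
    vertical sides K is constant too and L s 1 = 0. Comparing s = 0 with s = 1 gives the claim. *)
Lemma lift_loop rho (p : R -> X) l : flat F rho -> continuous p ->
  (forall t, F (p t)) -> p 0 = f0 -> p 1 = f0 -> lift rho p l -> l 1 = l 0.
Proof.
move=> fr cp Fp p0 p1 hl.
have [H [cH FH Hs Ht]] := (scF.2 p cp Fp p0 p1).
pose cl := clamp 0 1.
pose K (z : R * R) := H (cl z.1, cl z.2).
have ccl : continuous cl by exact: clamp_continuous.
have cK : continuous K.
  move=> z; apply: (@continuous_comp _ _ _ (fun z : R * R => (cl z.1, cl z.2))); last exact: cH.
  apply: (@continuous_pair _ _ _ (cl \o fst) (cl \o snd)).
    by apply: continuous_comp; [exact: cvg_fst|exact: ccl].
  by apply: continuous_comp; [exact: cvg_snd|exact: ccl].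
(* The term with l makes 0 a parallel section of r along the bottom edge, where K follows p. *)
pose r (z w : R * R) := rho (K z) (K w) - l (cl w.1).
have fK : flat setT r.
  move=> z _; have := flat_comp cK fr (FH _ : F (K z)).
  apply: filterS => w h _; have := h (FH _); apply: lc_ext => v.
  by rewrite /r; zmod.
have fKs s : flat setT (fun t t' => r (s, t) (s, t')).
  have cs : continuous (fun t : R => (s, t)).
    move=> t; apply: (@continuous_pair _ _ _ (cst s) id); first exact: cst_continuous.
    exact: cvg_id.
  by apply: flatS (flat_comp cs fK) => t.
have exL s : exists g, lift (fun t t' => r (s, t) (s, t')) id g /\ g 0 = 0.
  have [|//|g hg g0] := lift_exists 0 (fKs s) (p := id); last by exists g.
  by move=> t; exact: cvg_id.
have [L hL] := choice exL.
have L0 s : L s 0 = 0 by have [] := hL s.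
have fK' : flat ([set: R] `*` [set: R]) r by apply: flatS fK.
have cid : continuous (@id R) by move=> t; exact: cvg_id.
have key : forall s, [set: R] s -> lc (fun s' => L s' 1 - r (s, 1) (s', 1)) s.
  apply: (lift_family openT fK' cid) => // s _; first by have [] := hL s.
  apply: lc_ext (hl s) => s'; rewrite L0 /r /K /= /cl clamp010.
  by have [-> _] := Hs _ (clamp01 s); have [-> _] := Hs _ (clamp01 s'); zmod.
have r1 s s' : r (s, 1) (s', 1) = rho f0 f0 - l (cl s').
  rewrite /r /K /= /cl clamp011.
  by have [_ ->] := Hs _ (clamp01 s); have [_ ->] := Hs _ (clamp01 s').
have E : L 0 1 + l (cl 0) = L 1 1 + l (cl 1).
  apply: (@lc_segment (fun s => L s 1 + l (cl s))) => // s.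
  apply: (lc_comp (f := clamp 0 1) (p := fun s => L s 1 + l (cl s))); first exact: ccl.
  have := lc_add (key (clamp 0 1 s) I) (lc_cst (rho f0 f0) _).
  by apply: lc_ext => s'; rewrite r1; zmod.
have side s : (s = 0) \/ (s = 1) -> L s 1 = 0.
  move=> hs; rewrite -(L0 s); apply/esym.
  apply: lc_segment => // t; have [+ _] := hL s => /(_ t).
  move=> /lc_add/(_ (lc_cst (rho f0 f0 - l (cl s)) _)); apply: lc_ext => t' /=.
  have HE u : H (cl s, cl u) = f0.
    have [h0 h1] := Ht _ (clamp01 u).
    by case: hs => ->; rewrite /cl ?clamp010 ?clamp011.
  by rewrite /r /K /= !HE; zmod.
move: E; rewrite !side; [|by right|by left].
by rewrite /cl clamp010 clamp011 !add0r.
Qed.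

(** p followed by q reversed is a loop at f0, to which [lift_loop] applies; its two halves, slowed
    down, lift p and q. *)
Lemma lift_path_indep rho (p q : R -> X) l m : flat F rho ->
  continuous p -> continuous q -> (forall t, F (p t)) -> (forall t, F (q t)) ->
  p 0 = f0 -> q 0 = f0 -> p 1 = q 1 -> lift rho p l -> lift rho q m ->
  l 0 = m 0 -> l 1 = m 1.
Proof.
move=> fr cp cq Fp Fq p0 q0 pq hl hm lm.
pose a (t : R) : R := 2 * t; pose b (t : R) : R := 2 - 2 * t.
have ca : continuous a.
  exact: mulrl_continuous.
have sub_cont (x : R) (f : R -> R) : continuous f -> continuous (fun t => x - f t).
  move=> cf t; apply: (@continuous_comp _ _ _ f (fun u : R => x - u)); first exact: cf.
  exact: (smooth_at_continuous (smooth_at_sub (@smooth_at_cst R R^o R^o x (f t)) (smooth_at_id _))).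
have cb : continuous b := sub_cont _ _ ca.
pose c (t : R) := if t <= 2^-1 then p (a t) else q (b t).
have e1 : a 2^-1 = 1 by rewrite /a divff.
have e2 : b 2^-1 = 1 by rewrite /b divff // -[X in X - _]/(1 + 1) addrK.
have cc : continuous c.
  apply: (@paste_continuous X (p \o a) (q \o b)).
  - by move=> t; apply: continuous_comp; [exact: ca|exact: cp].
  - by move=> t; apply: continuous_comp; [exact: cb|exact: cq].
  - by rewrite /= e1 e2.
have Fc t : F (c t) by rewrite /c; case: ifP.
have c0 : c 0 = f0 by rewrite /c ifT ?invr_ge0 // /a mulr0.
have c1 : c 1 = f0.
  by rewrite /c ifF; [rewrite /b mulr1 subrr|apply/negbTE; rewrite -ltNge; lra].
have [n hn n0] := lift_exists (l 0) fr cc Fc.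
have n1 := lift_loop fr cc Fc c0 c1 hn.
have ch : continuous (fun t : R => t / 2).
  exact: mulrr_continuous.
have ch' : continuous (fun t : R => 1 - t / 2) := sub_cont _ _ ch.
have hp : lift rho p (n \o (fun t => t / 2)).
  apply: lift_reparam ch _ hn => t /andP[t0 t1]; split; first by apply/andP; split; lra.
  by rewrite /c ifT; [rewrite /a mulrCA divff ?mulr1|lra].
have hq : lift rho q (n \o (fun t => 1 - t / 2)).
  apply: lift_reparam ch' _ hn => t /andP[t0 t1]; split; first by apply/andP; split; lra.
  have [|lt] := leP (1 - t / 2) 2^-1.
    rewrite /c => le; rewrite le.
    have tE : t = 1 by lra.
    by rewrite tE -pq; congr p; rewrite /a; lra.
  by rewrite /c leNgt lt /=; congr q; rewrite /b; lra.
rewrite (lift_unique hl hp) ?(lift_unique hm hq) /=.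
- by congr n; lra.
- by rewrite mul0r subr0 n1 n0.
- by rewrite mul0r n0.
Qed.

End SimplyConnected.

End Segments.

(** * Flat bundles over products *)

Section Good.
Variables (R : realType) (T : zmodType).

(** The base point ranges over the whole of N because slices at different points of N will serve for
    normalisation. *)
Definition loc_good (X : topologicalType) := forall (x : X) U, nbhs x U ->
  exists N : set X, [/\ open N, N x, N `<=` U & forall x', N x' -> simply_conn R N x'].

(** By path independence pq may be replaced by the concatenation c of p and q, whose two halves are
    lifted like p and q. *)
Lemma lift_concat (X : topologicalType) (F : set X) f0 (rho : X -> X -> T)
    (p q pq : R -> X) l m n : simply_conn R F f0 ->
  flat F rho -> continuous p -> continuous q -> continuous pq ->
  (forall t, F (p t)) -> (forall t, F (q t)) -> (forall t, F (pq t)) ->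
  p 0 = f0 -> pq 0 = f0 -> p 1 = q 0 -> pq 1 = q 1 ->
  lift rho p l -> lift rho q m -> lift rho pq n -> n 0 = l 0 ->
  n 1 = l 1 + m 1 - m 0.
Proof.
move=> sc fr cp cq cpq Fp Fq Fpq p0 pq0 p1 pq1 hl hm hn n0.
pose a (t : R) : R := 2 * t; pose b (t : R) : R := 2 * t - 1.
have ca : continuous a by exact: mulrl_continuous.
have shift_cont (x : R) : continuous (fun u : R => u + x).
  move=> u.
  exact: (smooth_at_continuous (smooth_at_add (@smooth_at_id R R^o u) (@smooth_at_cst R R^o R^o x _))).
have cb : continuous b.
  move=> t; apply: (@continuous_comp _ _ _ a (fun u : R => u - 1)); first exact: ca.
  exact: shift_cont.
pose c (t : R) := if t <= 2^-1 then p (a t) else q (b t).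
have e1 : a 2^-1 = 1 by rewrite /a divff.
have e2 : b 2^-1 = 0 by rewrite /b divff // subrr.
have cc : continuous c.
  apply: (@paste_continuous _ X (p \o a) (q \o b)).
  - by move=> t; apply: continuous_comp; [exact: ca|exact: cp].
  - by move=> t; apply: continuous_comp; [exact: cb|exact: cq].
  - by rewrite /= e1 e2.
have Fc t : F (c t) by rewrite /c; case: ifP.
have c0 : c 0 = f0 by rewrite /c ifT ?invr_ge0 // /a mulr0.
have c1 : c 1 = q 1.
  rewrite /c ifF; first by congr q; rewrite /b; lra.
  by apply/negbTE; rewrite -ltNge; lra.
have [k hk k0] := lift_exists (l 0) fr cc Fc.
have kn : k 1 = n 1.
  by apply: (lift_path_indep sc fr cc cpq Fc Fpq c0 pq0 _ hk hn); rewrite ?c1 ?pq1 ?k0 ?n0.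
have ch : continuous (fun t : R => t / 2) by exact: mulrr_continuous.
have ch' : continuous (fun t : R => (t + 1) / 2).
  move=> t; apply: (@continuous_comp _ _ _ (fun t : R => t + 1) (fun u : R => u / 2)).
    exact: shift_cont.
  exact: ch.
have hp : lift rho p (k \o (fun t => t / 2)).
  apply: lift_reparam ch _ hk => t /andP[t0 t1]; split; first by apply/andP; split; lra.
  by rewrite /c ifT; [rewrite /a mulrCA divff ?mulr1|lra].
have hq : lift rho q (k \o (fun t => (t + 1) / 2)).
  apply: lift_reparam ch' _ hk => t /andP[t0 t1]; split; first by apply/andP; split; lra.
  have [|lt] := leP ((t + 1) / 2) 2^-1.
    rewrite /c => le; rewrite le.
    have tE : t = 0 by lra.
    by rewrite tE -p1; congr p; rewrite /a; lra.
  by rewrite /c leNgt lt /=; congr q; rewrite /b; lra.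
have h1 := lift_unique hp hl; rewrite /= mul0r k0 in h1.
move: hq; set kk := k \o _ => hq.
have kk0 : kk 0 = k 2^-1 by rewrite /kk /= add0r mul1r.
have kk1 : kk 1 = k 1 by rewrite /kk /= divff.
have h2 : k 1 - m 1 = k 2^-1 - m 0.
  (* kk and m lift the same path q, so their difference is locally constant, that is, a lift for the
     zero bundle; uniqueness of such lifts compares its two ends. *)
  have h := lift_unique (l := fun t => kk t - m t + (m 0 - kk 0)) (l' := fun=> 0)
    (rho := fun _ _ => 0) (p := q).
  apply/eqP; rewrite -subr_eq0 -kk0 -kk1; apply/eqP.
  rewrite -[RHS]h //; first by rewrite opprB.
  - move=> t; apply: lc_ext (lc_add (lc_sub (hq t) (hm t)) (lc_cst (m 0 - kk 0) _)) => z.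
    by cbv beta; zmod.
  - by move=> t; exact: lc_cst.
  - by rewrite addrA subrK subrr.
rewrite -kn -(h1 erefl) mul1r.
by rewrite -[k 1](subrK (m 1)) h2 addrAC.
Qed.

Lemma slice_continuous (Y X : topologicalType) (y : Y) : continuous (fun x : X => (y, x)).
Proof.
by move=> x; apply: (@continuous_pair _ _ _ (cst y) id); [exact: cst_continuous|exact: cvg_id].
Qed.

Lemma slice_continuous' (Y X : topologicalType) (x : X) : continuous (fun y : Y => (y, x)).
Proof.
by move=> y; apply: (@continuous_pair _ _ _ id (cst x)); [exact: cvg_id|exact: cst_continuous].
Qed.

Section GoodLemma.
Variables (Y X : topologicalType) (V : set Y) (F : set X) (f0 : X).
Variable rho : Y * X -> Y * X -> T.
Hypotheses (lgX : loc_good X) (oV : open V) (oF : open F) (Ff0 : F f0).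
Hypotheses (scF : simply_conn R F f0) (frho : flat (V `*` F) rho).

Lemma flat_slice y : V y -> flat F (fun x x' => rho (y, x) (y, x')).
Proof.
by move=> Vy; apply: flatS (flat_comp (@slice_continuous Y X y) frho) => x Fx.
Qed.

Lemma parallel_slice y f : V y -> parallel (V `*` F) rho f ->
  parallel F (fun x x' => rho (y, x) (y, x')) (fun x => f (y, x)).
Proof.
move=> Vy pf x Fx.
exact: (parallel_comp (@slice_continuous Y X y) pf (y := x) (conj Vy Fx)).
Qed.

Lemma parallel_unique f f' : parallel (V `*` F) rho f -> parallel (V `*` F) rho f' ->
  (forall y, V y -> f (y, f0) = f' (y, f0)) ->
  forall y x, V y -> F x -> f (y, x) = f' (y, x).
Proof.
move=> pf pf' e y x Vy /(scF.1)[p [cp Fp p0 p1]].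
have h := parallel_lift (parallel_slice Vy pf) cp Fp.
have h' := parallel_lift (parallel_slice Vy pf') cp Fp.
by have := lift_unique h h'; rewrite /= p0 p1; apply; exact: e.
Qed.

(** The value at (y, x) is the transport of c y along a path P x chosen for x. The choice is
    discontinuous in x, but simple connectivity makes the value independent of it. Near (y, x),
    [lift_family] controls the dependence on y along the fixed path P x, and [lift_concat] with a
    path inside a small set N controls the dependence on x. *)
Lemma parallel_extend (c : Y -> T) :
  (forall y, V y -> lc (fun y' => c y' - rho (y, f0) (y', f0)) y) ->
  exists2 f, parallel (V `*` F) rho f & forall y, V y -> f (y, f0) = c y.
Proof.
move=> hc.
have exP x : exists p : R -> X, F x ->
    [/\ continuous p, forall t, F (p t), p 0 = f0 & p 1 = x].
  have [Fx|nFx] := pselect (F x); last by exists (fun=> f0).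
  by have [p hp] := scF.1 x Fx; exists p.
have [P hP] := choice exP.
have exL (z : Y * X) : exists l : R -> T, V z.1 -> F z.2 ->
    lift (fun x x' => rho (z.1, x) (z.1, x')) (P z.2) l /\ l 0 = c z.1.
  have [[Vz Fz]|nz] := pselect (V z.1 /\ F z.2); last first.
    by exists (fun=> 0) => Vz Fz; case: nz.
  have [cp Fp _ _] := hP _ Fz.
  by have [l hl l0] := lift_exists (c z.1) (flat_slice Vz) cp Fp; exists l.
have [L hL] := choice exL.
exists (fun z => L z 1) => [[y x] [/= Vy Fx]|y Vy]; last first.
  have [cp Fp p0 p1] := hP _ Ff0.
  have [hl l0] := hL (y, f0) Vy Ff0; rewrite -l0 /=.
  apply: (lift_loop scF (flat_slice Vy) cp Fp p0 p1 hl).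
set r := rho (y, x).
have [[A B] /= [nA nB] AB] := frho (conj Vy Fx : (V `*` F) (y, x)).
have nBF : nbhs x (B `&` F) by apply: filterI => //; exact: open_nbhs_nbhs.
have [N [oN Nx NB scN]] := lgX nBF.
have [cp Fp p0 p1] := hP _ Fx.
have hc' y' : V y' -> lc (fun y'' => L (y'', x) 0 - rho (y', P x 0) (y'', P x 0)) y'.
  move=> Vy'; apply: lc_eq (hc y' Vy').
  apply: filterS (open_nbhs_nbhs (conj oV Vy')) => y'' Vy''.
  by have [_ ->] := hL (y'', x) Vy'' Fx; rewrite p0.
have base := lift_family (L := fun y' => L (y', x)) oV frho cp Fp
  (fun y' Vy' => (hL (y', x) Vy' Fx).1) hc' Vy.
rewrite p1 in base.
have step y' x' : A y' -> V y' -> N x' ->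
    L (y', x') 1 - r (y', x') = L (y', x) 1 - r (y', x).
  move=> Ay' Vy' Nx'; have [_ Fx'] := NB _ Nx'.
  have [q [cq Nq q0 q1]] := (scN x Nx).1 x' Nx'.
  have Fq t : F (q t) by have [] := NB _ (Nq t).
  have [cp' Fp' p0' p1'] := hP _ Fx'.
  have [hl l0] := hL (y', x) Vy' Fx; have [hl' l0'] := hL (y', x') Vy' Fx'.
  have hm : lift (fun u v => rho (y', u) (y', v)) q (fun t => r (y', q t)).
    apply: (parallel_lift (W := N) (f := fun u => r (y', u))) => // u Nu.
    have [Bu Fu] := NB _ Nu.
    have h : lc (fun z => r z - rho (y', u) z) (y', u) by apply: (AB (y', u)).
    exact: (lc_comp (f := fun v : X => (y', v)) (@slice_continuous Y X y' u) h).
  have := lift_concat scF (flat_slice Vy') cp cq cp' Fp Fq Fp' p0 p0' _ _ hl hm hl'.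
  rewrite p1 q0 p1' q1 => -> //; last by rewrite l0 l0'.
  by zmod.
apply: (@lc_of _ _ _ _ (L (y, x) 1 - r (y, x))).
have nAV : nbhs y (A `&` V) by apply: filterI => //; exact: open_nbhs_nbhs.
exists ([set y' | (A `&` V) y' /\ L (y', x) 1 - r (y', x) = L (y, x) 1 - r (y, x)], N).
  split=> /=; last exact: open_nbhs_nbhs.
  by apply: filterS2 nAV base => y' Ay' e; split.
by move=> [y' x'] /= [[[Ay' Vy'] <-] Nx']; rewrite step.
Qed.

End GoodLemma.
End Good.

(** * Flat gerbes and the gluing of their trivialisations *)

Section FlatGerbe.
Variables (R : realType) (T : zmodType) (X : topologicalType) (Mo : Type).
Variables (D : Mo -> set X) (Cmp : Mo -> Mo -> X -> (X -> T) -> Prop).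

(* A flat T-gerbe on X: a model is a local trivialisation, and [Cmp a b x p] says
   that p represents, near x, a flat isomorphism from the model a to the model b. *)
Definition flat_gerbe : Prop :=
  [/\ (forall a, open (D a)) /\ (forall x, exists a, D a x),
      forall a b x, D a x -> D b x -> exists p, Cmp a b x p,
      (forall a x, D a x -> Cmp a a x (fun=> 0)) /\
      (forall a b x p, Cmp a b x p -> Cmp b a x (fun z => - p z)) /\
      (forall a b c x p q, Cmp a b x p -> Cmp b c x q -> Cmp a c x (fun z => p z + q z)),
      (forall a b x p, Cmp a b x p -> \forall x' \near x, Cmp a b x' p) &
      (forall a b x p q, Cmp a b x p -> Cmp a b x q <-> lc (fun z => q z - p z) x)].

Hypothesis fg : flat_gerbe.

(** Over Y a model comes with a T-valued shift, so that trivialisations can be twisted by flat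
    bundles while the models stay the same. *)
Definition obj (Y : Type) := (Mo * (Y -> T))%type.

Definition twist Y (o : obj Y) (f : Y -> T) : obj Y := (o.1, fun z => o.2 z + f z).

Definition pullo Y Z (h : Z -> Y) (o : obj Y) : obj Z := (o.1, o.2 \o h).

Section Hom.
Variables (Y : topologicalType) (phi : Y -> X).
Implicit Types (o : obj Y) (y : Y) (f : Y -> T).

(** An isomorphism from o to o' is a function modulo locally constant ones: the shift of o' minus
    that of o, corrected by the comparison p of their models. *)
Definition hom y o o' f := exists2 p, Cmp o.1 o'.1 (phi y) p &
  lc (fun z => o'.2 z - o.2 z - p (phi z) - f z) y.

Lemma hom_ext y o o' f g : hom y o o' f -> lc (fun z => g z - f z) y -> hom y o o' g.
Proof.
move=> [p cp h] e; exists p => //.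
by apply: lc_ext (lc_sub h e) => z; zmod.
Qed.

Lemma hom_twistr y o o' f g : hom y o o' f -> hom y o (twist o' g) (fun z => f z + g z).
Proof. by move=> [p cp h]; exists p => //; apply: lc_ext h => z /=; zmod. Qed.

Lemma hom_twistl y o o' f g : hom y o o' f -> hom y (twist o g) o' (fun z => f z - g z).
Proof. by move=> [p cp h]; exists p => //; apply: lc_ext h => z /=; zmod. Qed.

Lemma hom_opp y o o' f : hom y o o' f -> hom y o' o (fun z => - f z).
Proof.
have [_ _ [_ [opp _]] _ _] := fg.
move=> [p cp h]; exists (fun z => - p z); first exact: opp.
by apply: lc_ext (lc_opp h) => z; zmod.
Qed.

Lemma hom_comp y o o' o'' f g : hom y o o' f -> hom y o' o'' g ->
  hom y o o'' (fun z => f z + g z).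
Proof.
have [_ _ [_ [_ comp]] _ _] := fg.
move=> [p cp h] [q cq k]; exists (fun z => p z + q z); first exact: comp cp cq.
by apply: lc_ext (lc_add h k) => z; zmod.
Qed.

Hypothesis cphi : continuous phi.

Lemma hom_near y o o' f : hom y o o' f -> \forall y' \near y, hom y' o o' f.
Proof.
have [_ _ _ nr _] := fg.
move=> [p cp h].
have n1 : \forall y' \near y, Cmp o.1 o'.1 (phi y') p := cphi (nr _ _ _ _ cp).
by apply: filterS2 n1 (lc_near h) => y' c l; exists p.
Qed.

Lemma hom_unique y o o' f g : hom y o o' f -> hom y o o' g -> lc (fun z => g z - f z) y.
Proof.
have [_ _ _ _ un] := fg.
move=> [p cp h] [q cq k].
have e := lc_comp (cphi (x := y)) ((un _ _ _ _ q cp).1 cq).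
by apply: lc_ext (lc_sub (lc_sub h k) e) => z /=; zmod.
Qed.

Lemma hom_exists y o o' : D o.1 (phi y) -> D o'.1 (phi y) -> exists f, hom y o o' f.
Proof.
have [_ ex _ _ _] := fg.
move=> d d'; have [p cp] := ex _ _ _ d d'.
exists (fun z => o'.2 z - o.2 z - p (phi z)); exists p => //.
by apply: lc_ext (lc_cst 0 y) => z; zmod.
Qed.

(* A flat trivialisation of the pull-back of the gerbe by phi over W. *)
Definition sec (W : set Y) (s : Y -> obj Y) := forall y, W y ->
  D (s y).1 (phi y) /\ \forall y' \near y, W y' -> hom y' (s y) (s y') (fun=> 0).

(** The isomorphisms between two trivialisations form a flat bundle: by [hom_unique] the
    representatives at nearby points differ by locally constant functions. *)
Lemma sec_flat W s t : sec W s -> sec W t ->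
  exists rho : Y -> Y -> T, flat W rho /\ forall y, W y -> hom y (s y) (t y) (rho y).
Proof.
move=> hs ht.
have ex y : exists r, W y -> hom y (s y) (t y) r.
  have [Wy|nW] := pselect (W y); last by exists (fun=> 0).
  by have [r hr] := hom_exists (hs y Wy).1 (ht y Wy).1; exists r.
have [rho hrho] := choice ex; exists rho; split=> // y Wy.
have := hom_near (hrho y Wy); have [_ s2] := hs y Wy; have [_ t2] := ht y Wy.
move=> n; have n3 : \forall y' \near y, W y' ->
    hom y' (s y) (s y') (fun=> 0) /\ hom y' (t y) (t y') (fun=> 0).
  by apply: filterS2 s2 t2 => y' h h' Wy'; split; [exact: h|exact: h'].
apply: filterS2 n n3 => y' h /[swap] Wy' /(_ Wy')[hs' ht'].
have := hom_unique (hom_comp hs' (hrho y' Wy')) (hom_comp h ht').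
by apply: lc_ext => z; zmod.
Qed.

(** Turns the search for an isomorphism of trivialisations over W into the search for a parallel
    section of a flat bundle. *)
Lemma parallel_hom W s t rho f : (forall y, W y -> hom y (s y) (t y) (rho y)) ->
  parallel W rho f <-> forall y, W y -> hom y (s y) (t y) f.
Proof.
move=> hr; split=> h y Wy; first exact: hom_ext (hr y Wy) (h y Wy).
exact: hom_unique (hr y Wy) (h y Wy).
Qed.

Lemma secS W W' s : W' `<=` W -> sec W s -> sec W' s.
Proof.
move=> WW h y /WW Wy; have [d n] := h y Wy; split=> //.
by apply: filterS n => y' k /WW; exact: k.
Qed.

Lemma sec_const W a : W `<=` phi @^-1` D a -> sec W (fun=> (a, fun=> 0)).
Proof.
have [_ _ [refl _] _ _] := fg.
move=> Wa y Wy; split; first exact: Wa.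
apply: nearW => y' Wy'; exists (fun=> 0); first exact: (refl a _ (Wa _ Wy')).
by apply: lc_ext (lc_cst 0 y') => z; zmod.
Qed.

Lemma sec_twist W s rho : sec W s -> flat W rho -> sec W (fun y => twist (s y) (rho y)).
Proof.
move=> hs hr y Wy; have [d n] := hs y Wy; split=> //.
apply: filterS2 n (hr y Wy) => y' h r Wy'.
apply: hom_ext (hom_twistl (rho y) (hom_twistr (rho y') (h Wy'))) _.
by apply: lc_ext (r Wy') => z; zmod.
Qed.

End Hom.

Lemma hom_pull (Y Z : topologicalType) (phi : Y -> X) (h : Z -> Y) z o o' f :
  continuous h -> hom phi (h z) o o' f ->
  hom (phi \o h) z (pullo h o) (pullo h o') (f \o h).
Proof.
move=> ch [p cp l]; exists p => //.
exact: (lc_comp (ch z) l).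
Qed.

Lemma sec_pull (Y Z : topologicalType) (phi : Y -> X) (h : Z -> Y) W s :
  continuous h -> sec phi W s -> sec (phi \o h) (h @^-1` W) (fun z => pullo h (s (h z))).
Proof.
move=> ch hs z Wz; have [d n] := hs _ Wz; split=> //.
have n' : \forall z' \near z, W (h z') -> hom phi (h z') (s (h z)) (s (h z')) (fun=> 0).
  exact: ch z _ n.
apply: filterS n' => z' k Wz'.
exact: (hom_pull ch (k Wz')).
Qed.

Section Glue.
Variables (Y Z : topologicalType) (phi : Y * Z -> X) (F : set Z) (f0 : Z).
Hypotheses (cphi : continuous phi) (lgZ : loc_good R Z) (oF : open F) (Ff0 : F f0).
Hypothesis scF : simply_conn R F f0.

Let in0 (y : Y) : Y * Z := (y, f0).

Let in0_cont : continuous in0. Proof. exact: slice_continuous'. Qed.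

Let phi0_cont : continuous (phi \o in0).
Proof. by move=> y; apply: continuous_comp; [exact: in0_cont|exact: cphi]. Qed.

(** The discrepancy rho along the slice is a flat bundle on V; spread over V x F by the first
    projection, it twists s into a trivialisation that matches s0 along the slice. *)
Lemma sec_normalise V s s0 : open V -> sec phi (V `*` F) s -> sec (phi \o in0) V s0 ->
  exists2 t, sec phi (V `*` F) t &
    forall y, V y -> hom (phi \o in0) y (pullo in0 (t (in0 y))) (s0 y) (fun=> 0).
Proof.
move=> oV hs hs0.
have hs' : sec (phi \o in0) V (fun y => pullo in0 (s (in0 y))).
  by apply: secS (sec_pull in0_cont hs) => y Vy.
have [rho [fr hr]] := sec_flat phi0_cont hs' hs0.
exists (fun z => twist (s z) (rho z.1 \o fst)).
  apply: sec_twist => //.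
  by apply: flatS (flat_comp (phi := fst) _ fr) => [z []//|z]; exact: cvg_fst.
move=> y Vy; apply: hom_ext (hom_twistl (rho y) (hr y Vy)) _.
by apply: lc_ext (lc_cst 0 y) => z; zmod.
Qed.

(** The local trivialisations are normalised to match s0 along f0. By [parallel_extend] any two of
    them are related by an isomorphism that vanishes on the slice, and by [parallel_unique] by only
    one, which forces the cocycle condition. *)
Lemma glue (s0 : Y -> obj Y) : sec (phi \o in0) setT s0 ->
  (forall y, exists V, [/\ open V, V y & exists s, sec phi (V `*` F) s]) ->
  exists s, sec phi (setT `*` F) s.
Proof.
move=> hs0 ex.
have ex' y : exists Vs : set Y * (Y * Z -> obj (Y * Z)),
   [/\ open Vs.1, Vs.1 y, sec phi (Vs.1 `*` F) Vs.2 &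
     forall y, Vs.1 y -> hom (phi \o in0) y (pullo in0 (Vs.2 (in0 y))) (s0 y) (fun=> 0)].
  have [V [oV Vy [s hs]]] := ex y.
  have [t ht h0] := sec_normalise oV hs (secS (@subsetT _ V) hs0).
  by exists (V, t).
have [VS hVS] := choice ex'; pose V y := (VS y).1; pose S y := (VS y).2.
have oV y : open (V y) by have [] := hVS y.
have VV y : V y y by have [] := hVS y.
have hS y : sec phi (V y `*` F) (S y) by have [] := hVS y.
have hS0 a y : V a y -> hom (phi \o in0) y (pullo in0 (S a (in0 y))) (s0 y) (fun=> 0).
  by have [_ _ _] := hVS a; exact.
have exf (ab : Y * Y) : exists f : Y * Z -> T,
    (forall z, ((V ab.1 `&` V ab.2) `*` F) z -> hom phi z (S ab.1 z) (S ab.2 z) f) /\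
    forall y, (V ab.1 `&` V ab.2) y -> f (y, f0) = 0.
  case: ab => a b /=; have oW := openI (oV a) (oV b).
  have sa : sec phi ((V a `&` V b) `*` F) (S a) by apply: secS (hS a) => z [[]].
  have sb : sec phi ((V a `&` V b) `*` F) (S b) by apply: secS (hS b) => z [[]].
  have [rho [fr hr]] := sec_flat cphi sa sb.
  (* The value 0 on the slice is admissible because both trivialisations are identified with s0
     there by the function 0. *)
  have [|f pf f0E] := parallel_extend lgZ oW oF Ff0 scF fr (c := fun=> 0).
    move=> y [ay by_].
    have h0 := hom_comp (hS0 a y ay) (hom_opp (hS0 b y by_)).
    have hy := hom_pull (z := y) in0_cont (hr (y, f0) (conj (conj ay by_) Ff0)).
    have := hom_unique phi0_cont hy h0.
    by rewrite /in0; apply: lc_ext => z /=; zmod.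
  by exists f; split=> //; apply/(parallel_hom cphi _ hr).
have [f hf] := choice exf.
have cocycle a b c y z : V a y -> V b y -> V c y -> F z ->
    f (a, c) (y, z) = f (a, b) (y, z) + f (b, c) (y, z).
  move=> ay by_ cy Fz; pose W := V a `&` V b `&` V c.
  have oW : open W by do 2?apply: openI.
  have sa : sec phi (W `*` F) (S a) by apply: secS (hS a) => x [[[]]].
  have sc : sec phi (W `*` F) (S c) by apply: secS (hS c) => x [[[]]].
  have [rho [fr hr]] := sec_flat cphi sa sc.
  have pac : parallel (W `*` F) rho (f (a, c)).
    apply/(parallel_hom cphi _ hr) => x [[[? ?] ?] ?].
    by apply: (hf (a, c)).1.
  have pabc : parallel (W `*` F) rho (fun z => f (a, b) z + f (b, c) z).
    apply/(parallel_hom cphi _ hr) => x [[[? ?] ?] ?].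
    by apply: hom_comp; [apply: (hf (a, b)).1|apply: (hf (b, c)).1].
  apply: (parallel_unique scF pac pabc) => // x [[? ?] ?].
  by rewrite (hf (a, c)).2 // (hf (a, b)).2 // (hf (b, c)).2 // addr0.
(* The cocycle is split by a discontinuous choice: at w the reference is the trivialisation indexed
   by w.1 itself, and f (z.1, w.1) w carries S z.1 to it. Shifts need not be continuous, only flat
   relative to each other. *)
exists (fun z => twist (S z.1 z) (fun w => f (z.1, w.1) w)) => -[y x] [_ /= Fx].
have [d n] := hS y (y, x) (conj (VV y) Fx); split=> //.
have nV : \forall z \near (y, x), V y z.1.
  by apply: cvg_fst; exact: open_nbhs_nbhs.
apply: filterS2 n nV => -[y' x'] /= h Vy' [_ Fx'].
have h1 := h (conj Vy' Fx').
have h2 := (hf (y, y')).1 (y', x') (conj (conj Vy' (VV y')) Fx').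
have h3 := hom_twistl (fun w => f (y, w.1) w) (hom_twistr (fun w => f (y', w.1) w) (hom_comp h1 h2)).
apply: hom_ext h3 _.
apply: (@lc_of _ _ _ _ 0).
have nF : \forall z \near (y', x'), F z.2.
  by apply: cvg_snd; exact: open_nbhs_nbhs.
have nV1 : \forall z \near (y', x'), V y z.1 /\ V y' z.1.
  have nVV : nbhs y' (V y `&` V y') by apply: open_nbhs_nbhs; split; [exact: openI|].
  exact: cvg_fst nVV.
apply: filterS2 nF nV1 => -[u v] /= Fv [Vu V'u].
by rewrite (cocycle y y' u) //; zmod.
Qed.

End Glue.

End FlatGerbe.

(** * Flat gerbes on G x G *)

Section ProductGerbe.
Variables (R : realType) (T : zmodType) (G : topologicalType) (Mo : Type).
Variables (D : Mo -> set (G * G)) (Cmp : Mo -> Mo -> G * G -> (G * G -> T) -> Prop).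
Hypothesis fg : flat_gerbe D Cmp.
Hypotheses (cG : compact [set: G]) (lgG : loc_good R G).
Variable e : G.
Hypothesis scG : simply_conn R [set: G] e.

Local Notation slice1 := (fun h : G => fun g : G => (g, h)).
Local Notation slice2 := (fun g : G => fun h : G => (g, h)).

Lemma simply_conn_connected : connected [set: G].
Proof.
move=> S [x Sx] [ O oO SO] [C cC SC]; apply/seteqP; split=> // y _.
rewrite setTI in SO; rewrite setTI in SC.
have [p [cp _ p0 p1]] := scG.1 x I; have [q [cq _ q0 q1]] := scG.1 y I.
have tr (r : R -> G) : continuous r -> r 0 = e -> forall s t, S (r s) -> S (r t).
  move=> cr r0 s t; apply: (connected_transfer (P := fun u => S (r u) -> S (r t)) (x0 := t)) => //.
    exact: connected_real.
  move=> u; have [Su|nSu] := pselect (S (r u)).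
    exists [set v | S (r v)].
      by apply: (cr u); rewrite SO; apply: open_nbhs_nbhs; split => //; rewrite -SO.
    by move=> a b /= Sa Sb h _; exact: h.
  exists [set v | ~ S (r v)]; last by move=> a b /= Sa Sb _ /Sb.
  apply: (cr u (~` S)); rewrite SC; apply: open_nbhs_nbhs; split; first exact: closed_openC.
  by rewrite -SC.
have Se : S e by rewrite -p0; apply: (tr p cp p0 1); rewrite p1.
by rewrite -q1; apply: (tr q cq q0 0); rewrite q0.
Qed.

(** Compactness of the first factor yields one neighbourhood of h0 such that every g has a V whose
    product with it lies in the domain of a model. Inside it a simply connected N is chosen, and
    constant models serve as the local trivialisations for [glue] over G x N, normalised on the
    slice at h1. *)
Lemma local_extension h0 : exists N : set G, [/\ open N, N h0 & forall h1, N h1 ->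
  (exists s, sec D Cmp (slice1 h1) setT s) -> exists s, sec D Cmp id (setT `*` N) s].
Proof.
have [[oD covD] _ _ _ _] := fg.
pose P (E : set G) g := exists V a, [/\ open V, V g & V `*` E `<=` D a].
(* The tube argument is phrased with the filter of small neighbourhoods E of h0, so that compactness
   returns one E for all g. *)
have : \forall E \near powerset_filter_from (nbhs h0), [set: G] `<=` P E.
  apply: (compact_near_coveringP [set: G]).1 => // g _.
  have [a Dx] := covD (g, h0).
  have [[A B] /= [nA nB] AB] := open_nbhs_nbhs (conj (oD a) Dx).
  rewrite nbhsE in nA; have [V [oV Vg] VA] := nA.
  exists (V, [set E | E `<=` B]) => /=.
    split; first exact: open_nbhs_nbhs.
    exact: small_set_sub.
  move=> [g' E] /= [Vg' EB]; exists V, a; split=> // -[x y] /= [Vx Ey].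
  by apply: AB; split=> /=; [exact: VA|exact: EB].
rewrite near_powerset_filter_fromP; last first.
  by move=> E E' EE' h g /h [V [a [oV Vg VE]]]; exists V, a; split=> // -[x y] [Vx Ey]; apply: VE; split=> //; exact: EE'.
move=> [U nU hU]; have [N [oN Nh0 NU scN]] := lgG nU.
exists N; split=> // h1 Nh1 [s hs].
apply: (glue fg (phi := id) (f0 := h1) _ lgG oN Nh1 (scN _ Nh1) hs) => [z|g].
  exact: cvg_id.
have [V [a [oV Vg VE]]] := hU g I; exists V; split=> //.
exists (fun=> (a, fun=> 0)); apply: (sec_const fg) => -[x y] [Vx Ny].
by apply: VE; split=> //; exact: NU.
Qed.

(** Triviality over G x {h} spreads to nearby h through [local_extension], hence from e to every h.
    This trivialises the gerbe over each G x N, and after an exchange of the factors these pieces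
    glue with F = G, normalised along {e} x G. *)
Lemma product_section :
  (exists s, sec D Cmp (slice1 e) setT s) -> (exists s, sec D Cmp (slice2 e) setT s) ->
  exists s, sec D Cmp id setT s.
Proof.
move=> h1 [s2 hs2].
have all1 : forall h, exists s, sec D Cmp (slice1 h) setT s.
  apply: (connected_transfer (x0 := e)) => [||//]; first exact: simply_conn_connected.
  move=> h; have [N [oN Nh hN]] := local_extension h.
  exists N; first exact: open_nbhs_nbhs.
  move=> y z Ny Nz /(hN y Ny)[s hs].
  exists (fun g => pullo (slice1 z) (s (g, z))).
  by apply: secS (sec_pull (@slice_continuous' G G z) hs) => g.
pose sw (z : G * G) := (z.2, z.1).
have csw : continuous sw.
  by move=> z; apply: (@continuous_pair _ _ _ snd fst); [exact: cvg_snd|exact: cvg_fst].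
have [s hs] : exists s, sec D Cmp sw (setT `*` setT) s.
  apply: (glue fg (phi := sw) (f0 := e) csw lgG openT I scG hs2) => h.
  have [N [oN Nh hN]] := local_extension h; exists N; split=> //.
  have [s hs] := hN h Nh (all1 h).
  exists (fun z => pullo sw (s (sw z))).
  by apply: secS (sec_pull csw hs) => z [].
exists (fun z => pullo sw (s (sw z))).
have -> : (id : G * G -> G * G) = sw \o sw by apply: funext => -[].
by apply: secS (sec_pull csw hs) => z.
Qed.

End ProductGerbe.

(** * Simple connectivity, globally and locally *)

Section SimplyConnectedManifolds.
Context {R : realType}.

Lemma simply_connected_conn (T : topologicalType) (e : T) :
  @simply_connected R T -> simply_conn R [set: T] e.
Proof.
move=> [_ pc lp].
have ext (p : R -> T) : {within `[0, 1], continuous p} -> continuous (p \o clamp 0 1).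
  move=> cp t; have h := clamp_itv t (@ler01 R).
  have cl := @clamp_continuous R 0 1 t.
  move=> U nU; move/subspace_continuousP: cp => /(_ (clamp 0 1 t)).
  rewrite /= in_itv /= => /(_ h) /(_ U nU) w.
  have w' : \forall s \near t, (0 <= clamp 0 1 s <= 1) -> U (p (clamp 0 1 s)).
    have : \forall u \near clamp 0 1 t, (`[0, 1]%classic : set R) u -> U (p u) by exact: w.
    move=> w0.
    have w1 : \forall s \near t, (`[0, 1]%classic : set R) (clamp 0 1 s) -> U (p (clamp 0 1 s)).
      exact: cl _ w0.
    by apply: filterS w1 => s /=; rewrite in_itv.
  have : \forall s \near t, U (p (clamp 0 1 s)).
    by apply: filterS w' => s; apply; exact: clamp01.
  by [].
split=> [x _|p cp _ p0 p1].
  have [p [cp p0 p1]] := pc e x.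
  exists (p \o clamp 0 1); split=> //; first exact: ext.
    by rewrite /= clamp010.
  by rewrite /= clamp011.
have [|//|H [cH Hs Ht]] := lp p.
- by apply: continuous_subspaceT.
- by rewrite p0 p1.
pose cl2 (z : R * R) := (clamp 0 1 z.1, clamp 0 1 z.2).
have ccl : continuous cl2.
  move=> z; apply: (@continuous_pair _ _ _ (clamp 0 1 \o fst) (clamp 0 1 \o snd)).
    by apply: continuous_comp; [exact: cvg_fst|exact: clamp_continuous].
  by apply: continuous_comp; [exact: cvg_snd|exact: clamp_continuous].
exists (H \o cl2); split=> // [z|s s01|t t01].
- have h z' : (`[0, 1] `*` `[0, 1] : set (R * R)) (cl2 z').
    by split=> /=; rewrite in_itv /= clamp_itv.
  move=> U nU; move/subspace_continuousP: cH => /(_ (cl2 z) (h z) U nU) w.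
  have w' : \forall u \near cl2 z, (`[0, 1] `*` `[0, 1] : set (R * R)) u -> U (H u).
    exact: w.
  have w2 : \forall u \near z, (`[0, 1] `*` `[0, 1] : set (R * R)) (cl2 u) -> U (H (cl2 u)).
    exact: ccl z _ w'.
  have : \forall u \near z, U (H (cl2 u)) by apply: filterS w2 => u; apply.
  by [].
- rewrite /= /cl2 /= clamp010 clamp011 clamp_id //.
  by have [|-> ->] := Hs s; rewrite ?in_itv //= p0.
- rewrite /= /cl2 /= clamp010 clamp011 clamp_id //.
  by have [|-> ->] := Ht t; rewrite ?in_itv //= p0.
Qed.

Lemma scale_continuous (V : normedModType R) (S : topologicalType) (c : S -> R) (f : S -> V) :
  continuous c -> continuous f -> continuous (fun s => c s *: f s).
Proof. by move=> cc cf s; apply: cvgZ; [exact: cc|exact: cf]. Qed.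

Lemma add_continuous2 (V : normedModType R) (S : topologicalType) (f g : S -> V) :
  continuous f -> continuous g -> continuous (fun s => f s + g s).
Proof. by move=> cf cg s; apply: cvgD; [exact: cf|exact: cg]. Qed.

Lemma ball_line (V : normedModType R) (z a b : V) r t : ball z r a -> ball z r b ->
  0 <= t <= 1 -> ball z r (a + t *: (b - a)).
Proof.
rewrite -!ball_normE /= => ha hb /andP[t0 t1].
have -> : z - (a + t *: (b - a)) = (1 - t) *: (z - a) + t *: (z - b).
  have -> : b - a = (z - a) - (z - b) by zmod.
  by rewrite scalerBl scale1r (scalerBr t (z - a)) !opprD opprK !addrA.
apply: le_lt_trans (ler_normD _ _) _.
rewrite !normrZ !ger0_norm ?subr_ge0 //.
have [->|tn] := eqVneq t 0; first by rewrite subr0 mul1r mul0r addr0.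
have tp : 0 < t by rewrite lt_def tn.
have h1 : (1 - t) * `|z - a| <= (1 - t) * r by rewrite ler_wpM2l ?subr_ge0 // ltW.
have h2 : t * `|z - b| < t * r by rewrite ltr_pM2l.
by apply: lt_le_trans (ler_ltD h1 h2) _; rewrite -mulrDl subrK mul1r.
Qed.

(** Balls in a chart are convex: segments join their points, and loops contract along segments to
    their base point. *)
Lemma loc_good_manifold (M : manifold R) : atlas M -> loc_good R M.
Proof.
move=> hM x U nU; pose c := chart_at x.
have dx := dom_self hM x.
have nb : nbhs (cmap c x) [set z | cimg c z /\ U (cinv c z)].
  apply: filterI; first by apply: open_nbhs_nbhs; split; [exact: img_open|exact: img_phi].
  exact: (near_psi hM dx nU).
have /nbhs_ballP[r /= r0 hr] := nb.
pose B := ball (cmap c x) r : set 'rV[R]_(mdim M).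
pose N := cdom c `&` cmap c @^-1` B.
have K z : B z -> cdom c (cinv c z) /\ cmap c (cinv c z) = z.
  by move=> Bz; have [[y dy <-] _] := hr _ Bz; rewrite (psiK hM dy).
have NB z : B z -> N (cinv c z) by move=> /[dup] Bz /K[d e]; split=> //=; rewrite e.
have cNB (S : topologicalType) (f : S -> 'rV[R]_(mdim M)) : continuous f ->
    (forall s, B (f s)) -> continuous (cinv c \o f).
  move=> cf Bf s; apply: continuous_comp; first exact: cf.
  by apply: (psi_cont hM); have [] := hr _ (Bf s).
have oB : open B by exact: ball_open.
exists N; split.
- rewrite openE => y [dy By].
  have n1 := near_dom hM dy.
  have n2 : \forall q \near y, B (cmap c q).
    apply: (near_phi hM dy); exact: open_nbhs_nbhs.
  by apply: filterS2 n1 n2 => q.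
- by split=> //; exact: ballxx.
- by move=> y [dy By]; have [_] := hr _ By; rewrite (psiK hM dy).
move=> x' [dx' Bx']; have ex' := psiK hM dx'.
set z' := cmap c x' in Bx' ex'.
split=> [y [dy By]|p cp Np p0 p1].
  pose f t := z' + clamp 0 1 t *: (cmap c y - z').
  exists (cinv c \o f); split.
  - apply: cNB => [|t]; last by apply: ball_line => //; exact: clamp01.
    apply: add_continuous2; first exact: cst_continuous.
    by apply: scale_continuous; [exact: clamp_continuous|exact: cst_continuous].
  - by move=> t; apply: NB; apply: ball_line => //; exact: clamp01.
  - by rewrite /= /f clamp010 scale0r addr0.
  - by rewrite /= /f clamp011 scale1r addrC subrK psiK.
have cq : continuous (cmap c \o p).
  move=> t; apply: continuous_comp; first exact: cp.
  by apply: (phi_cont hM); have [] := Np t.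
pose f (st : R * R) := cmap c (p st.1) + clamp 0 1 st.2 *: (z' - cmap c (p st.1)).
have cq1 : continuous (fun st : R * R => cmap c (p st.1)).
  move=> st; apply: (@continuous_comp _ _ _ fst (cmap c \o p)); [exact: cvg_fst|exact: cq].
have Bf st : B (f st).
  by apply: ball_line => //; [have [] := Np st.1|exact: clamp01].
exists (cinv c \o f); split.
- apply: cNB => //.
  apply: add_continuous2 => //.
  apply: scale_continuous.
    by move=> st; apply: continuous_comp; [exact: cvg_snd|exact: clamp_continuous].
  have -> : (fun st : R * R => z' - cmap c (p st.1)) = fun st => z' + -1 *: cmap c (p st.1).
    by apply: funext => st; rewrite scaleN1r.
  apply: add_continuous2; first exact: cst_continuous.
  by apply: scale_continuous => //; exact: cst_continuous.
- by move=> st; apply: NB.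
- move=> s _; rewrite /= /f /= clamp010 clamp011 scale0r addr0 scale1r addrC subrK.
  by split=> //; apply: (psiK hM); have [] := Np s.
- by move=> t _; rewrite /= /f /= p0 p1 subrr scaler0 addr0.
Qed.

End SimplyConnectedManifolds.

(** * Lie groups and the canonical 3-form *)

Section Multiplication.
Context {R : realType}.
Variables (G : manifold R) (hG : atlas G) (mu : G -> G -> G) (iv : G -> G) (e : G).
Local Notation PG := (prod_manifold G G).
Local Notation n := (mdim G).
Local Notation E := (euclid (R := R) n).
Hypothesis smu : forall p : PG, @smap R PG G (fun p => mu p.1 p.2) p.
Hypothesis siv : forall g : G, @smap R G G iv g.
Hypotheses (mueg : forall a, mu e a = a) (muge : forall a, mu a e = a).
Hypotheses (muK : forall a b, mu a (mu (iv a) b) = b) (muV : forall a, mu (iv a) a = e).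

Let phi := cmap (chart_at e).
Let psi := cinv (chart_at e).
Let z0 := phi e.
Let w0 : 'rV[R]_(n + n) := row_mx z0 z0.

(** [mu] and [iv] stay abstract so that the same computations serve the multiplication of G and its
    opposite, that is, the left and the right Maurer-Cartan forms. *)
Definition mulc (z : 'rV[R]_(n + n)) : 'rV[R]_n := phi (mu (psi (lsubmx z)) (psi (rsubmx z))).
Definition divc (z : 'rV[R]_(n + n)) : 'rV[R]_n :=
  phi (mu (iv (psi (lsubmx z))) (psi (rsubmx z))).

(** The bilinear term of the Taylor expansion of the multiplication at the unit; its
    antisymmetrisation is the Lie bracket. *)
Definition mul2 (u v : 'rV[R]_n) : 'rV[R]_n :=
  'd (fun z => 'd mulc z (inrl G G v)) w0 (inll G G u).

(** The left Maurer-Cartan form in the chart: the derivative in y of x^-1 y at y = x. *)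
Definition thetac (x v : 'rV[R]_n) : 'rV[R]_n := 'd divc (row_mx x x) (inrl G G v).

Let de : cdom (chart_at e) e. Proof. exact: dom_self. Qed.

Let psi0 : psi z0 = e. Proof. exact: psiK. Qed.

Lemma mulc_smooth : smooth_at mulc w0.
Proof.
apply: (@smap_chart R PG G (atlas_prod hG hG) hG (fun p => mu p.1 p.2) (e, e) e (e, e)) => //.
by rewrite /= mueg.
Qed.

Let ive : iv e = e. Proof. by rewrite -[LHS]muge muV. Qed.

Lemma divc_smooth : smooth_at divc w0.
Proof.
apply: (@smap_chart R PG G (atlas_prod hG hG) hG (fun p => mu (iv p.1) p.2) (e, e) e (e, e)) => //.
  by rewrite /= muV.
have h : @smap R PG PG (fun p => (iv p.1, p.2)) (e, e).
  apply: smap_pair.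
    by apply: (smap_comp (atlas_prod hG hG) hG (f := fst) (g := iv)); [exact: smap_fst|exact: siv].
  exact: smap_snd.
exact: (smap_comp (atlas_prod hG hG) (atlas_prod hG hG) h (smu _)).
Qed.

Lemma hasd_inr (x y : 'rV[R]_n) : hasd (fun y => row_mx x y) y (inrl G G).
Proof. exact: hasd_row_mx (hasd_cst x y) (hasd_id y). Qed.

Lemma hasd_inl (x y : 'rV[R]_n) : hasd (fun x => row_mx x y) x (inll G G).
Proof. exact: hasd_row_mx (hasd_id x) (hasd_cst y x). Qed.

Lemma hasd_diag (x : 'rV[R]_n) : hasd (fun x => row_mx x x) x (fun v => row_mx v v).
Proof. exact: hasd_row_mx (hasd_id x) (hasd_id x). Qed.

Lemma hasd_continuous (V W : normedModType R) (f : V -> W) x L : hasd f x L ->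
  {for x, continuous f}.
Proof. by move=> [d _]; exact: differentiable_continuous. Qed.

Lemma near_phipsi : \forall x \near z0, phi (psi x) = x /\ cdom (chart_at e) (psi x).
Proof. by apply: near_mono (near_img hG de) => x [? ? ?]; split. Qed.

Lemma diff_mulc_inr v : 'd mulc w0 (inrl G G v) = v.
Proof.
have h := hasd_comp (hasd_inr z0 z0) (hasd_self (smooth_at_diff mulc_smooth)).
rewrite -(hasd_diff v h); apply: hasd_diff; apply: hasd_near (hasd_id z0).
apply: near_mono near_phipsi => x [xE _].
by rewrite /mulc row_mxKl row_mxKr psi0 mueg.
Qed.

Lemma thetac0 v : thetac z0 v = v.
Proof.
have h := hasd_comp (hasd_inr z0 z0) (hasd_self (smooth_at_diff divc_smooth)).
rewrite /thetac -(hasd_diff v h); apply: hasd_diff; apply: hasd_near (hasd_id z0).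
apply: near_mono near_phipsi => x [xE _].
by rewrite /divc row_mxKl row_mxKr psi0 ive mueg.
Qed.

Lemma near_w0 (f : 'rV[R]_n -> 'rV[R]_(n + n)) (P : 'rV[R]_(n + n) -> Prop) x :
  {for x, continuous f} -> f x = w0 -> (\forall z \near w0, P z) ->
  \forall y \near x, P (f y).
Proof. exact: near_comp. Qed.

Lemma thetac_smooth v : smooth_at (thetac ^~ v) z0.
Proof.
apply: (smooth_at_differential (fin_basis_rV _)) => /=.
- exact: smooth_row_mx (smooth_at_id z0) (smooth_at_id z0).
- exact: divc_smooth.
- exact: smooth_at_cst.
Qed.

Lemma near_near (V : normedModType R) (z : V) (P : V -> Prop) :
  (\forall x \near z, P x) -> \forall x \near z, \forall y \near x, P y.
Proof. exact: nbhs_interior. Qed.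

(** Derivative at y = x of the identity x (x^-1 y) = y: left translation by x inverts the
    Maurer-Cartan form. *)
Lemma thetac_inv v : \forall x \near z0, 'd mulc (row_mx x z0) (inrl G G (thetac x v)) = v.
Proof.
have cd := hasd_continuous (hasd_diag z0).
have cl := hasd_continuous (hasd_inl z0 z0).
have s1 := near_w0 cd erefl (smooth_at_near divc_smooth).
have s2 := near_w0 cl erefl (smooth_at_near mulc_smooth).
have dm : \forall z \near w0, cdom (chart_at e) (mu (iv (psi (lsubmx z))) (psi (rsubmx z))).
  have cm : {for w0, continuous (fun z => mu (iv (psi (lsubmx z))) (psi (rsubmx z)))}.
    have sp : smap (cinv (chart_at ((e, e) : PG)) : euclid (R := R) (n + n) -> PG) w0.
      exact: (@smap_psi R PG (atlas_prod hG hG) (e, e) (e, e)).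
    have h : @smap R PG PG (fun p => (iv p.1, p.2)) (cinv (chart_at ((e, e) : PG)) w0).
      apply: smap_pair.
        by apply: (smap_comp (atlas_prod hG hG) hG (f := fst) (g := iv)); [exact: smap_fst|exact: siv].
      exact: smap_snd.
    have h' := smap_comp (atlas_prod hG hG) (atlas_prod hG hG) h (smu _).
    by have [c _] := smap_comp (@atlas_euclid R _) (atlas_prod hG hG) sp h'; exact: c.
  have := cm (cdom (chart_at e)); rewrite /= row_mxKl row_mxKr psi0 muV; apply.
  by apply: near_dom.
have s3 := near_w0 cd erefl (near_near dm).
have s4 := near_near near_phipsi.
have main x : smooth_at divc (row_mx x x) -> smooth_at mulc (row_mx x z0) ->
    (\forall z \near row_mx x x,
      cdom (chart_at e) (mu (iv (psi (lsubmx z))) (psi (rsubmx z)))) ->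
    (\forall y \near x, phi (psi y) = y /\ cdom (chart_at e) (psi y)) ->
    'd mulc (row_mx x z0) (inrl G G (thetac x v)) = v.
  move=> sd sm nd np.
  have dx : divc (row_mx x x) = z0 by rewrite /divc row_mxKl row_mxKr muV.
  have h1 := hasd_comp (hasd_inr x x) (hasd_self (smooth_at_diff sd)).
  have h2 := hasd_row_mx (hasd_cst x x) h1.
  have sm' : smooth_at mulc (row_mx x (divc (row_mx x x))) by rewrite dx.
  have h3 := hasd_comp h2 (hasd_self (smooth_at_diff sm')).
  rewrite dx in h3.
  rewrite -[LHS](hasd_diff v h3); apply: hasd_diff; apply: hasd_near (hasd_id x).
  have nd' := near_comp (hasd_continuous (hasd_inr x x)) erefl nd.
  apply: near_mono2 np nd' => y [yE _] dy.
  rewrite /mulc /divc !row_mxKl !row_mxKr; rewrite row_mxKl row_mxKr in dy.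
  by rewrite [X in mu _ X](psiK hG dy) muK yE.
apply: (near_mono2 _ s4 (near_mono2 _ s3 (near_mono2 (fun x h h' => conj h h') s1 s2))); last first.
  by move=> x h h'; exact: (conj h h').
by move=> x h [h' [h'' h3]]; apply: main.
Qed.

Lemma hasd_mulc2 v : hasd (fun x => 'd mulc (row_mx x z0) (inrl G G v)) z0 (mul2 ^~ v).
Proof.
have s := smooth_at_D (inrl G G v) mulc_smooth.
have h := hasd_comp (hasd_inl z0 z0) (hasd_self (smooth_at_diff s)).
exact: h.
Qed.

(** [thetac_inv] is differentiated at the unit in the direction u. Left translation and the
    Maurer-Cartan form are both the identity there, so the product rule says that mul2 u v and the
    wanted derivative add up to 0. *)
Lemma hasd_thetac v : hasd (thetac ^~ v) z0 (fun u => - mul2 u v).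
Proof.
have hu := hasd_self (smooth_at_diff (thetac_smooth v)).
apply: hasd_ext hu => u.
have lA : \forall x \near z0, linear (fun c => 'd mulc (row_mx x z0) (inrl G G c)).
  by apply: near_all => x a c c'; rewrite !linearP.
have h := hasd_lin_family lA hasd_mulc2 (hasd_self (smooth_at_diff (thetac_smooth v))).
have e0 := hasd_diff u h.
have hn := thetac_inv v.
have hn' : \forall x \near z0, v = 'd mulc (row_mx x z0) (inrl G G (thetac x v)).
  by apply: near_mono hn => x ->.
have k := etrans (esym e0) (hasd_diff u (hasd_near hn' (hasd_cst v z0))).
have k' : mul2 u v + 'd (thetac ^~ v) z0 u = 0.
  exact: (etrans (congr2 +%R (congr1 (mul2 u) (esym (thetac0 v))) (esym (diff_mulc_inr _))) k).
exact: (esym (addr0_eq k')).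
Qed.

(** Ties the chart formula to the invariant definition by [mdiff]; since x^-1 x = e, the preferred
    chart at the target is the one at e. *)
Lemma mdiff_thetac : \forall x \near z0, forall v,
  mdiff (fun h => mu (iv (psi x)) h) (psi x) (@mdiff R E G psi x v) = thetac x v.
Proof.
have cd := hasd_continuous (hasd_diag z0).
have s1 := near_w0 cd erefl (smooth_at_near divc_smooth).
have s2 := near_smap_psi hG de.
apply: near_mono2 s1 s2 => x sd sp v.
have sL : smap (fun h => mu (iv (psi x)) h) (psi x).
  apply: (smap_comp hG (atlas_prod hG hG) (f := fun h => (iv (psi x), h) : PG) (g := fun p => mu p.1 p.2)).
    by apply: smap_pair; [exact: smap_cst|exact: smap_id].
  exact: smu.
rewrite -(mdiff_comp (@atlas_euclid R n) hG v sp sL).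
rewrite /mdiff /= muV.
have h1 := hasd_comp (hasd_inr x x) (hasd_self (smooth_at_diff sd)).
have h2 : hasd (phi \o (fun y => mu (iv (psi x)) (psi y))) x
    (fun v => 'd divc (row_mx x x) (inrl G G v)).
  apply: hasd_near h1; apply: near_all => y.
  by rewrite /divc row_mxKl row_mxKr.
exact: (hasd_diff v h2).
Qed.

End Multiplication.

Section Bilinear.
Context {R : realType} {n : nat}.
Variable B : 'rV[R]_n -> 'rV[R]_n -> R.
Hypothesis Bl : forall z, linear (fun x => B x z : R^o).
Hypothesis Br : forall z, linear (fun x => B z x : R^o).

Lemma bilin_coords x y : B x y = \sum_i (x 0 i : R^o) *:
  (\sum_j (y 0 j : R^o) *: (B (delta_mx 0 i) (delta_mx 0 j) : R^o)).
Proof.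
rewrite (linear_coords (Bl y)); apply: eq_bigr => i _.
by rewrite (linear_coords (Br _)).
Qed.

Lemma smooth_bilin (V : normedModType R) (f g : V -> 'rV[R]_n) z :
  smooth_at f z -> smooth_at g z -> smooth_at (fun x => B (f x) (g x) : R^o) z.
Proof.
move=> sf sg; apply: (@smooth_at_ext R V R^o (fun x => \sum_i (f x 0 i : R^o) *:
  (\sum_j (g x 0 j : R^o) *: (B (delta_mx 0 i) (delta_mx 0 j) : R^o)))).
  by move=> x; rewrite -bilin_coords.
apply: smooth_at_sum => i; apply: smooth_at_scale; first exact: smooth_at_coord.
apply: smooth_at_sum => j; apply: smooth_at_scale; first exact: smooth_at_coord.
exact: smooth_at_cst.
Qed.

Lemma hasd_bilin (V : normedModType R) (f g : V -> 'rV[R]_n) z L L' :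
  hasd f z L -> hasd g z L' ->
  hasd (fun x => B (f x) (g x) : R^o) z (fun v => B (L v) (g z) + B (f z) (L' v)).
Proof.
move=> hf hg.
have lA : \forall x \near z, linear (fun c => B (f x) c : R^o).
  by apply: near_all => x; exact: Br.
suff h c : hasd (fun x => B (f x) c : R^o) z (fun v => B (L v) c).
  exact: (@hasd_lin_family R V R^o n (fun x c => B (f x) c) _ g L' z lA h hg).
pose Al : {linear 'rV[R]_n -> R^o} := HB.pack (fun x => B x c : R^o)
  (GRing.isLinear.Build R _ _ *:%R _ (Bl c)).
exact: (hasd_comp hf (lin_rV_hasd Al (f z))).
Qed.

End Bilinear.

(** * Adjoint action, Lie bracket and Maurer-Cartan forms *)

Section LieGroup.
Context {R : realType}.
Variables (G : lie_group R) (hG : is_lie_group G).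
Local Notation "a ** b" := (@lmul R G a b) (at level 40, left associativity).
Local Notation PG := (prod_manifold G G).
Local Notation n := (mdim G).
Local Notation e := (lone G).

Lemma lie_atlas : atlas G.
Proof. by have [/is_manifold_atlas] := hG. Qed.
Let aG := lie_atlas.

Lemma lmulA (a b c : G) : a ** (b ** c) = a ** b ** c.
Proof. by have [_ [h _ _] _ _] := hG. Qed.
Lemma lmul1 (a : G) : e ** a = a.
Proof. by have [_ [_ h _] _ _] := hG. Qed.
Lemma lmulV (a : G) : linv a ** a = e.
Proof. by have [_ [_ _ h] _ _] := hG. Qed.
Lemma lmulK (a b : G) : linv a ** (a ** b) = b.
Proof. by rewrite lmulA lmulV lmul1. Qed.
Lemma rmulV (a : G) : a ** linv a = e.
Proof. by rewrite -[LHS](lmulK (linv a)) (lmulA (linv a)) lmulV lmul1 lmulV. Qed.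
Lemma rmul1 (a : G) : a ** e = a.
Proof. by rewrite -(lmulV a) lmulA rmulV lmul1. Qed.
Lemma lmulKV (a b : G) : a ** (linv a ** b) = b.
Proof. by rewrite lmulA rmulV lmul1. Qed.
Lemma rmulK (a b : G) : b ** a ** linv a = b.
Proof. by rewrite -lmulA rmulV rmul1. Qed.
Lemma rmulKV (a b : G) : b ** linv a ** a = b.
Proof. by rewrite -lmulA lmulV rmul1. Qed.
Lemma linvK (a : G) : linv (linv a) = a.
Proof. by rewrite -[RHS](lmulK (linv a)) lmulV rmul1. Qed.
Lemma linvM (a b : G) : linv (a ** b) = linv b ** linv a.
Proof. by rewrite -[RHS](lmulK (a ** b)) -(lmulA a) (lmulA b) rmulV lmul1 rmulV rmul1. Qed.

Lemma smap_mul (p : PG) : @smap R PG G (fun p => p.1 ** p.2) p.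
Proof.
have [_ _ h _] := hG.
exact: ((smapP (atlas_prod aG aG) aG _).1 h p).
Qed.
Lemma smap_inv (g : G) : smap (@linv R G) g.
Proof. by have [_ _ _ h] := hG; exact: ((smapP aG aG _).1 h g). Qed.

Section Compose.
Variables (M : manifold R) (hM : atlas M).

Lemma smap_lmul (f g : M -> G) (p : M) : smap f p -> smap g p ->
  smap (fun q => f q ** g q) p.
Proof.
move=> sf sg.
exact: (smap_comp hM (atlas_prod aG aG) (smap_pair sf sg) (smap_mul (f p, g p))).
Qed.

End Compose.

Lemma smap_mulr (a b g : G) : smap (fun h => a ** h ** b) g.
Proof.
apply: smap_lmul => //; last exact: smap_cst.
by apply: smap_lmul => //; [exact: smap_cst|exact: smap_id].
Qed.
Lemma smap_l (a g : G) : smap (fun h => a ** h) g.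
Proof. by apply: smap_lmul => //; [exact: smap_cst|exact: smap_id]. Qed.
Lemma smap_r (b g : G) : smap (fun h => h ** b) g.
Proof. by apply: smap_lmul => //; [exact: smap_id|exact: smap_cst]. Qed.

(** The opposite multiplication; its left Maurer-Cartan form is the right one of G. *)
Let mu' (a b : G) := b ** a.

Let smu' (p : PG) : @smap R PG G (fun p => mu' p.1 p.2) p.
Proof.
by apply: smap_lmul; [exact: atlas_prod|exact: smap_snd|exact: smap_fst].
Qed.

Local Notation mulL := (mul2 (@lmul R G) e).
Local Notation thL := (thetac (@lmul R G) (@linv R G) e).
Local Notation thR := (thetac mu' (@linv R G) e).
Let phi := cmap (chart_at e).
Let psi := cinv (chart_at e).
Let z0 := phi e.
Let w0 : 'rV[R]_(n + n) := row_mx z0 z0.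
Let de : cdom (chart_at e) e. Proof. exact: dom_self. Qed.

Let psi0 : psi z0 = e. Proof. exact: psiK. Qed.

Definition swapl : {linear 'rV[R]_(n + n) -> 'rV[R]_(n + n)} :=
  HB.pack (fun z : 'rV[R]_(n + n) => row_mx (rsubmx z) (lsubmx z))
    (GRing.isLinear.Build R _ _ *:%R _
      (fun a u v => etrans (congr2 row_mx (linearP rsubmx a u v) (linearP lsubmx a u v))
         (esym (etrans (congr1 (fun x => x + _) (scale_row_mx a _ _)) (add_row_mx _ _ _ _))))).

Let L_smooth := mulc_smooth aG smap_mul lmul1.

(** Exchanging the factors exchanges the two differentiations, which commute by [schwarz]. *)
Lemma mul2_swap u v : mul2 mu' e u v = mulL v u.
Proof.
have sw0 : swapl w0 = w0 by rewrite /= row_mxKl row_mxKr.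
have swr x : swapl (inrl G G x) = inll G G x by rewrite /= row_mxKl row_mxKr.
have swl x : swapl (inll G G x) = inrl G G x by rewrite /= row_mxKl row_mxKr.
have cs : {for w0, continuous swapl}.
  exact: (hasd_continuous (lin_rV_hasd swapl w0)).
have E : \forall z \near w0, 'd (mulc (@lmul R G) e) (swapl z) (inll G G v) =
    'd (mulc mu' e) z (inrl G G v).
  apply: near_mono (near_comp cs sw0 (smooth_at_near L_smooth)) => z sz.
  have h := hasd_comp (lin_rV_hasd swapl z) (hasd_self (smooth_at_diff sz)).
  have h' : hasd (mulc mu' e) z (fun x => 'd (mulc (@lmul R G) e) (swapl z) (swapl x)).
    by apply: hasd_near h; apply: near_all => x; rewrite /mulc /= row_mxKl row_mxKr.
  exact: (esym (etrans (hasd_diff _ h') (congr1 _ (swr v)))).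
have s : smooth_at (fun z => 'd (mulc (@lmul R G) e) z (inll G G v)) (swapl w0).
  by rewrite sw0; exact: smooth_at_D.
have h := hasd_near E (hasd_comp (lin_rV_hasd swapl w0) (hasd_self (smooth_at_diff s))).
apply: (etrans (hasd_diff _ h)).
rewrite swl sw0.
exact: schwarz.
Qed.

Lemma hasd_thL v : hasd (thL ^~ v) z0 (fun u => - mulL u v).
Proof. exact: (hasd_thetac aG smap_mul smap_inv lmul1 rmul1 lmulKV lmulV). Qed.

Lemma hasd_thR v : hasd (thR ^~ v) z0 (fun u => - mulL v u).
Proof.
apply: hasd_ext (hasd_thetac aG smu' smap_inv rmul1 lmul1 _ rmulV v).
  by move=> u; rewrite mul2_swap.
by move=> a b; rewrite /mu' rmulKV.
Qed.

Lemma thL0 v : thL z0 v = v.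
Proof. exact: (thetac0 aG smap_mul smap_inv lmul1 rmul1 lmulV). Qed.

Lemma thR0 v : thR z0 v = v.
Proof. exact: (thetac0 aG smu' smap_inv rmul1 lmul1 rmulV). Qed.

Lemma thetaL_chart : \forall x \near z0, forall v,
  thetaL (psi x) (@mdiff R (euclid n) G psi x v) = thL x v.
Proof. exact: (mdiff_thetac aG smap_mul smap_inv lmulV). Qed.

Lemma thetaR_chart : \forall x \near z0, forall v,
  thetaR (psi x) (@mdiff R (euclid n) G psi x v) = thR x v.
Proof. exact: (mdiff_thetac aG smu' smap_inv rmulV). Qed.

Lemma mdiff_linear (M N : manifold R) (f : M -> N) p : linear (@mdiff R M N f p).
Proof. by move=> a u v; rewrite /mdiff linearP. Qed.

Lemma thR_linear x : linear (thR x).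
Proof. by move=> a u v; rewrite /thetac !linearP. Qed.

(** Conjugation by g is left translation followed by right division by g, so Ad_g is the right
    Maurer-Cartan form at g applied to the left translate of zeta. *)
Lemma Ad_chart zeta : \forall x \near z0,
  Ad (psi x) zeta = thR x ('d (mulc (@lmul R G) e) (row_mx x z0) (inrl G G zeta)).
Proof.
have cl := hasd_continuous (hasd_inl (G := G) z0 z0).
have cd := hasd_continuous (hasd_diag (G := G) z0).
have s1 := near_comp cl erefl (smooth_at_near L_smooth).
have s2 := near_comp cd erefl (smooth_at_near (divc_smooth aG smu' smap_inv rmulV)).
have dm : \forall z \near w0, cdom (chart_at e) (psi (lsubmx z) ** psi (rsubmx z)).
  have sp : smap (cinv (chart_at ((e, e) : PG)) : euclid (R := R) (n + n) -> PG) w0.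
    exact: (@smap_psi R PG (atlas_prod aG aG) (e, e) (e, e)).
  have [c _] := smap_comp (@atlas_euclid R _) (atlas_prod aG aG) sp (smap_mul _).
  have cw : ((fun p : PG => p.1 ** p.2) \o cinv (chart_at ((e, e) : PG))) w0 = e.
    by rewrite /= row_mxKl row_mxKr -[cinv _ _]/(psi z0) psi0 lmul1.
  have := c (cdom (chart_at e)); rewrite cw; apply.
  by apply: near_dom.
have s3 := near_comp cl erefl (near_near dm).
have s4 := near_phipsi aG e.
have main x : smooth_at (divc mu' (@linv R G) e) (row_mx x x) ->
    smooth_at (mulc (@lmul R G) e) (row_mx x z0) ->
    (\forall z \near row_mx x z0, cdom (chart_at e) (psi (lsubmx z) ** psi (rsubmx z))) ->
    phi (psi x) = x ->
    Ad (psi x) zeta = thR x ('d (mulc (@lmul R G) e) (row_mx x z0) (inrl G G zeta)).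
  move=> sd sm nd xE.
  have mx : mulc (@lmul R G) e (row_mx x z0) = x.
    by rewrite /mulc row_mxKl row_mxKr -/phi -/psi psi0 rmul1.
  have h1 := hasd_comp (hasd_inr x z0) (hasd_self (smooth_at_diff sm)).
  have h2 := hasd_row_mx (hasd_cst x z0) h1.
  have sd' : smooth_at (divc mu' (@linv R G) e) (row_mx x (mulc (@lmul R G) e (row_mx x z0))).
    by rewrite mx.
  have h3 := hasd_comp h2 (hasd_self (smooth_at_diff sd')).
  rewrite mx in h3.
  rewrite /Ad /mdiff rmul1 rmulV.
  have h4 : hasd ((phi \o (fun h => psi x ** h ** linv (psi x))) \o psi) z0
     (fun v => thR x ('d (mulc (@lmul R G) e) (row_mx x z0) (inrl G G v))).
    apply: hasd_near h3.
    have nd' := near_comp (hasd_continuous (hasd_inr x z0)) erefl nd.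
    apply: near_mono nd' => y; rewrite row_mxKl row_mxKr => dy.
    have pk : psi (phi (psi x ** psi y)) = psi x ** psi y := psiK aG dy.
    by rewrite /divc /mulc !row_mxKl !row_mxKr /= -/phi -/psi pk.
  exact: (hasd_diff zeta h4).
have s12 := near_mono2 (fun x h h' => conj h h') s1 s2.
have s34 := near_mono2 (fun x h h' => conj h h') s3 s4.
by apply: near_mono2 s12 s34 => x [a b] [c [d _]]; exact: main.
Qed.

(** Product rule in [Ad_chart]: the translation contributes mulL xi zeta, the right Maurer-Cartan
    form - mulL zeta xi. *)
Lemma hasd_Ad zeta : hasd (fun x => Ad (psi x) zeta) z0 (fun xi => mulL xi zeta - mulL zeta xi).
Proof.
have lA : \forall x \near z0, linear (thR x) by apply: near_all; exact: thR_linear.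
have h := hasd_lin_family lA hasd_thR (hasd_mulc2 aG smap_mul lmul1 zeta).
have E : \forall x \near z0,
    thR x ('d (mulc (@lmul R G) e) (row_mx x z0) (inrl G G zeta)) = Ad (psi x) zeta.
  by apply: near_mono (Ad_chart zeta) => x ->.
have h' := hasd_near E h; apply: hasd_ext h' => xi.
by rewrite (diff_mulc_inr aG smap_mul lmul1) thR0 addrC.
Qed.

Lemma lie_bracketE xi zeta : lie_bracket xi zeta = mulL xi zeta - mulL zeta xi.
Proof. exact: hasd_diff (hasd_Ad zeta). Qed.

Lemma sfun_Ad zeta : sfun (fun g => Ad g zeta : 'rV[R]_n) e.
Proof.
rewrite /sfun.
have E : \forall x \near z0,
    thR x ('d (mulc (@lmul R G) e) (row_mx x z0) (inrl G G zeta)) = Ad (psi x) zeta.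
  by apply: near_mono (Ad_chart zeta) => x ->.
apply: (smooth_at_eq E).
apply: (smooth_at_differential (fin_basis_rV _)
  (f := fun x => row_mx x x) (g := divc mu' (@linv R G) e)
  (u := fun x => inrl G G ('d (mulc (@lmul R G) e) (row_mx x z0) (inrl G G zeta)))).
- exact: smooth_row_mx (smooth_at_id z0) (smooth_at_id z0).
- exact: (divc_smooth aG smu' smap_inv rmulV).
- apply: (smooth_at_comp (fin_basis_rV _) (g := inrl G G)); last exact: lin_rV_smooth.
  apply: (smooth_at_differential (fin_basis_rV _) (f := fun x => row_mx x z0)
     (g := mulc (@lmul R G) e) (u := fun=> inrl G G zeta)) => //.
    exact: smooth_row_mx (smooth_at_id z0) (smooth_at_cst _ _).
  exact: smooth_at_cst.
Qed.

Lemma lie_bracket_anti (xi zeta : 'rV[R]_n) :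
  lie_bracket (G := G) xi zeta = - lie_bracket (G := G) zeta xi :> 'rV[R]_n.
Proof. by rewrite !lie_bracketE opprB. Qed.

Lemma mdiff_pt (M N : manifold R) (f : M -> N) p q v : p = q -> mdiff f p v = mdiff f q v.
Proof. by move=> ->. Qed.

Lemma mdiff_ext (M N : manifold R) (f g : M -> N) p v : f =1 g -> mdiff f p v = mdiff g p v.
Proof. by move=> /funext ->. Qed.

Lemma Ad1 (zeta : lie_alg G) : Ad e zeta = zeta.
Proof.
rewrite /Ad.
have -> : (fun h => e ** h ** linv e) = id.
  by apply/funext => h; rewrite lmul1 -[linv e]lmul1 rmulV rmul1.
exact: mdiff_id.
Qed.

Lemma AdM (a b : G) (zeta : lie_alg G) : Ad (a ** b) zeta = Ad a (Ad b zeta).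
Proof.
rewrite /Ad -[in RHS](mdiff_pt (fun h => a ** h ** linv a) (p := b ** e ** linv b)); last first.
  by rewrite rmul1 rmulV.
rewrite -(mdiff_comp aG aG zeta (smap_mulr b (linv b) e) (smap_mulr a (linv a) _)).
apply: mdiff_ext => h /=.
by rewrite linvM !lmulA.
Qed.

Lemma AdVK (a : G) (zeta : lie_alg G) : Ad (linv a) (Ad a zeta) = zeta.
Proof. by rewrite -AdM lmulV Ad1. Qed.

Lemma Ad_linear (a : G) : linear (@Ad R G a). Proof. exact: mdiff_linear. Qed.

(** With c h = g^-1 h g one has Ad_g Ad_(c h) zeta = Ad_h Ad_g zeta. This is differentiated at h = e
    in the direction Ad_g xi, which c sends to xi. *)
Lemma Ad_bracket (g : G) (xi zeta : lie_alg G) :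
  lie_bracket (Ad g xi) (Ad g zeta) = Ad g (lie_bracket xi zeta).
Proof.
pose c (h : G) := linv g ** h ** g.
pose Al : {linear 'rV[R]_n -> 'rV[R]_n} := HB.pack (@Ad R G g)
  (GRing.isLinear.Build R _ _ *:%R _ (Ad_linear g)).
pose F (h : G) : 'rV[R]_n := Ad h zeta.
have c0 : c e = e by rewrite /c rmul1 lmulV.
have sF : sfun F (c e) by rewrite c0; exact: sfun_Ad.
have sc : smap c e by exact: smap_mulr.
have sFc : sfun (F \o c) e by exact: (smap_sfun aG aG sc sF).
have h := hasd_comp (hasd_fdiff sFc) (lin_rV_hasd Al _).
have E : \forall x \near z0, Al ((F \o c) (psi x)) = Ad (psi x) (Ad g zeta).
  apply: near_all => x; rewrite -[LHS]/(Ad g (F (c (psi x)))) /F /c.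
  by rewrite -!AdM !lmulA rmulV lmul1.
apply: (etrans (hasd_diff _ (hasd_near E h))).
rewrite -[LHS]/(Ad g (fdiff (F \o c) e (Ad g xi))) (fdiff_comp aG aG _ sc sF) c0.
congr (Ad g _); rewrite -[LHS]/(lie_bracket (mdiff c e (Ad g xi)) zeta).
congr (lie_bracket _ _).
rewrite -[RHS](AdVK g) /Ad.
by apply: mdiff_ext => h'; rewrite linvK.
Qed.

Lemma thetaL_l (a g : G) v : thetaL (a ** g) (mdiff (fun h => a ** h) g v) = thetaL g v.
Proof.
rewrite /thetaL -(mdiff_comp aG aG v (smap_l a g) (smap_l _ _)).
apply: mdiff_ext => h /=.
by rewrite linvM -!lmulA lmulK.
Qed.

Lemma thetaR_r (b g : G) v : thetaR (g ** b) (mdiff (fun h => h ** b) g v) = thetaR g v.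
Proof.
rewrite /thetaR -(mdiff_comp aG aG v (smap_r b g) (smap_r _ _)).
apply: mdiff_ext => h /=.
by rewrite linvM !lmulA rmulK.
Qed.

Lemma thetaL_r (b g : G) v : thetaL (g ** b) (mdiff (fun h => h ** b) g v) = Ad (linv b) (thetaL g v).
Proof.
rewrite /thetaL /Ad -(mdiff_pt (fun h => linv b ** h ** linv (linv b)) (p := linv g ** g)); last first.
  by rewrite lmulV.
rewrite -(mdiff_comp aG aG v (smap_r b g) (smap_l _ _)).
rewrite -(mdiff_comp aG aG v (smap_l (linv g) g) (smap_mulr (linv b) _ _)).
by apply: mdiff_ext => h /=; rewrite linvM linvK !lmulA.
Qed.

Lemma thetaL1 v : thetaL e v = v.
Proof.
rewrite /thetaL; have -> : (fun h => linv e ** h) = id.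
  by apply/funext => h; rewrite -[linv e]lmul1 rmulV lmul1.
exact: mdiff_id.
Qed.

End LieGroup.

(** * The canonical 3-form under multiplication *)

Section FusionForm.
Context {R : realType}.
Variables (G : lie_group R) (hG : is_lie_group G).
Variable B : lie_alg G -> lie_alg G -> R.
Hypothesis hB : invariant_inner_product B.
Local Notation "a ** b" := (@lmul R G a b) (at level 40, left associativity).
Local Notation PG := (prod_manifold G G).
Local Notation n := (mdim G).
Local Notation e := (lone G).
Local Notation br := (@lie_bracket R G).
Let aG := lie_atlas hG.
Let aP := atlas_prod aG aG.

Local Notation thL := (thetac (@lmul R G) (@linv R G) e).
Local Notation thR := (thetac (fun a b => @lmul R G b a) (@linv R G) e).
Local Notation mulL := (mul2 (@lmul R G) e).
Let phi := cmap (chart_at e).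
Let psi := cinv (chart_at e).
Let z0 := phi e.
Let w0 : 'rV[R]_(n + n) := row_mx z0 z0.
Let de : cdom (chart_at e) e. Proof. exact: dom_self. Qed.
Let psi0 : psi z0 = e. Proof. exact: psiK. Qed.

Lemma inner_linearl z : linear (fun x : 'rV[R]_n => B x z : R^o).
Proof. by have [h _ _ _] := hB; move=> a u v; exact: h. Qed.

Lemma inner_sym x y : B x y = B y x. Proof. by have [_ h _ _] := hB; exact: h. Qed.

Lemma inner_linearr z : linear (fun x : 'rV[R]_n => B z x : R^o).
Proof. by move=> a u v; rewrite !(inner_sym z); exact: inner_linearl. Qed.

Lemma inner_Dl x x' z : B (x + x' : 'rV[R]_n) z = B x z + B x' z.
Proof. by have := inner_linearl z 1 x x'; rewrite !scale1r. Qed.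

Lemma inner_Zl a x z : B (a *: x : 'rV[R]_n) z = a * B x z.
Proof.
have h0 : B (0 : 'rV[R]_n) z = 0.
  by have := inner_linearl z (-1) 0 0; rewrite scaleN1r addr0 oppr0 scaleN1r addNr.
by have := inner_linearl z a x 0; rewrite addr0 h0 addr0.
Qed.

Lemma inner_Nl x z : B (- x : 'rV[R]_n) z = - B x z.
Proof. by rewrite -scaleN1r inner_Zl mulN1r. Qed.

Lemma inner_Dr x x' z : B z (x + x' : 'rV[R]_n) = B z x + B z x'.
Proof. by rewrite !(inner_sym z) inner_Dl. Qed.

Lemma inner_Zr a x z : B z (a *: x : 'rV[R]_n) = a * B z x.
Proof. by rewrite !(inner_sym z) inner_Zl. Qed.

Lemma inner_Nr x z : B z (- x : 'rV[R]_n) = - B z x.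
Proof. by rewrite !(inner_sym z) inner_Nl. Qed.

(** Derivative at the unit, in the direction x, of the Ad-invariance of B. *)
Lemma inner_bracket x a c : B (br x a) c + B a (br x c) = 0.
Proof.
have h := hasd_bilin inner_linearl inner_linearr (hasd_Ad hG a) (hasd_Ad hG c).
have E : \forall y \near z0, (B a c : R^o) = B (Ad (psi y) a) (Ad (psi y) c).
  by apply: near_all => y; have [_ _ _ ->] := hB.
have e1 := hasd_diff x h.
have e2 := hasd_diff x (hasd_near E (hasd_cst _ z0)).
have Ade y : Ad (cinv (chart_at e) (cmap (chart_at e) e)) y = y.
  by rewrite -[cinv _ _]/(psi z0) psi0 (Ad1 hG).
have k := etrans (esym e1) e2; rewrite !Ade in k.
by rewrite (lie_bracketE hG x a) (lie_bracketE hG x c); exact: k.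
Qed.

(** The Cartan 3-form on the Lie algebra, totally antisymmetric by the invariance of B. *)
Definition tri (x y z : 'rV[R]_n) : R := B x (br y z).

Lemma tri_swap23 x y z : tri x y z = - tri x z y.
Proof. by rewrite /tri (lie_bracket_anti hG) inner_Nr. Qed.

Lemma tri_swap12 x y z : tri x y z = - tri y x z.
Proof.
have h := inner_bracket z y x; rewrite /tri.
rewrite (lie_bracket_anti hG y z) (lie_bracket_anti hG x z) !inner_Nr opprK.
by apply/eqP; rewrite eq_sym -subr_eq0 opprK addrC (inner_sym x) h.
Qed.

Lemma tri_D1 x x' y z : tri (x + x') y z = tri x y z + tri x' y z.
Proof. exact: inner_Dl. Qed.

Lemma tri_D2 x y y' z : tri x (y + y') z = tri x y z + tri x y' z.
Proof. by rewrite !(tri_swap12 x) tri_D1 opprD. Qed.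

Lemma tri_D3 x y z z' : tri x y (z + z') = tri x y z + tri x y z'.
Proof. by rewrite !(tri_swap23 x y) tri_D2 opprD. Qed.

Lemma tri_Ad g x y z : tri (Ad g x) (Ad g y) (Ad g z) = tri x y z.
Proof. by rewrite /tri (Ad_bracket hG); have [_ _ _ ->] := hB. Qed.

(** By antisymmetry the three terms of the definition coincide, so the constant is 1/12 times 2
    times 3. *)
Lemma canonical3E g v :
  @canonical3 R G B g v = 2^-1 * tri (thetaL g (v 0)) (thetaL g (v 1)) (thetaL g (v 2%:R)).
Proof.
rewrite /canonical3 !inner_Zr.
set x := thetaL g (v 0); set y := thetaL g (v 1); set z := thetaL g (v _).
rewrite -[B x _]/(tri x y z) -[B y _]/(tri y x z) -[B z _]/(tri z x y).
rewrite (tri_swap12 y) (tri_swap12 z) (tri_swap23 x z).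
by field.
Qed.

Lemma canonical3_l a g v :
  @canonical3 R G B (a ** g) (fun i => mdiff (fun h => a ** h) g (v i)) = @canonical3 R G B g v.
Proof. by rewrite !canonical3E !(thetaL_l hG). Qed.

Lemma canonical3_r b g v :
  @canonical3 R G B (g ** b) (fun i => mdiff (fun h => h ** b) g (v i)) = @canonical3 R G B g v.
Proof. by rewrite !canonical3E !(thetaL_r hG) tri_Ad. Qed.

Lemma canonical3_1 v :
  @canonical3 R G B e v = 2^-1 * tri (v 0) (v 1) (v 2%:R).
Proof. by rewrite canonical3E !(thetaL1 hG). Qed.

(* beta = B(pr_1^* theta^L, pr_2^* theta^R) *)
Definition beta : form PG 2 := fun p v =>
  B (thetaL p.1 (@mdiff R PG G fst p (v 0))) (thetaR p.2 (@mdiff R PG G snd p (v 1)))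
  - B (thetaL p.1 (@mdiff R PG G fst p (v 1))) (thetaR p.2 (@mdiff R PG G snd p (v 0))).

Lemma beta_alg p : multilinear_form (@beta p) /\ alternating_form (@beta p).
Proof.
split; last by move=> v i j; case: (ord2P i) => ->; case: (ord2P j) => -> // _ E; rewrite /beta E subrr.
have l1 : linear (fun u : 'rV[R]_(n + n) => thetaL p.1 (@mdiff R PG G fst p u) : 'rV[R]_n).
  by move=> a u v; rewrite /thetaL !mdiff_linear.
have l2 : linear (fun u : 'rV[R]_(n + n) => thetaR p.2 (@mdiff R PG G snd p u) : 'rV[R]_n).
  by move=> a u v; rewrite /thetaR !mdiff_linear.
apply/multilinear_formP => i v a u u'; rewrite /beta.
case: (ord2P i) => -> /=.
  rewrite l1 l2 inner_Dl inner_Dr inner_Zl inner_Zr; ring.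
rewrite l1 l2 inner_Dl inner_Dr inner_Zl inner_Zr; ring.
Qed.

(** The form beta near (e, e), written with the Maurer-Cartan forms in the chart, whose derivatives
    at the unit are known. *)
Definition betac (z p q : 'rV[R]_(n + n)) : R :=
  B (thL (lsubmx z) (lsubmx p)) (thR (rsubmx z) (rsubmx q))
  - B (thL (lsubmx z) (lsubmx q)) (thR (rsubmx z) (rsubmx p)).

Lemma beta_local : \forall z \near w0, forall v,
  form_local beta (e, e) z v = betac z (v 0) (v 1).
Proof.
have cl : {for w0, continuous (lsubmx : 'rV[R]_(n + n) -> 'rV[R]_n)}.
  exact: smooth_at_continuous (lsub_smooth _).
have cr : {for w0, continuous (rsubmx : 'rV[R]_(n + n) -> 'rV[R]_n)}.
  exact: smooth_at_continuous (rsub_smooth _).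
have n1 := near_comp cl (row_mxKl z0 z0) (near_mono2 (fun x h h' => conj h h')
  (thetaL_chart hG) (near_smap_psi aG de)).
have n2 := near_comp cr (row_mxKr z0 z0) (near_mono2 (fun x h h' => conj h h')
  (thetaR_chart hG) (near_smap_psi aG de)).
have n3 := near_smap_psi aP (dom_self aP ((e, e) : PG)).
have n12 := near_mono2 (fun x h h' => conj h h') n1 n2.
apply: near_mono2 n12 n3 => z [[tL sl] [tR sr]] sp v.
rewrite form_local_pullE /form_pull /beta /betac.
have aE k := @atlas_euclid R k.
have sll : @smap R (euclid (n + n)) (euclid n) lsubmx z.
  by split; [exact: smooth_at_continuous (lsub_smooth _)|exact: lsub_smooth].
have srr : @smap R (euclid (n + n)) (euclid n) rsubmx z.
  by split; [exact: smooth_at_continuous (rsub_smooth _)|exact: rsub_smooth].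
have Lw w : thetaL (psi (lsubmx z)) (@mdiff R PG G fst (cinv (chart_at ((e, e) : PG)) z)
   (@mdiff R (euclid (n + n)) PG (cinv (chart_at ((e, e) : PG))) z w)) = thL (lsubmx z) (lsubmx w).
  rewrite -(mdiff_comp (aE _) aP w sp (smap_fst aG _)).
  have h : @mdiff R (euclid (n + n)) G (psi \o lsubmx) z w = @mdiff R (euclid n) G psi (lsubmx z) (lsubmx w).
    rewrite (mdiff_comp (aE _) (aE _) w sll sl).
    by congr (mdiff _ _ _); exact: (hasd_diff w (lin_rV_hasd (lsubl G G) z)).
  exact: (etrans (congr1 (thetaL (psi (lsubmx z))) h) (tL _)).
have Rw w : thetaR (psi (rsubmx z)) (@mdiff R PG G snd (cinv (chart_at ((e, e) : PG)) z)
   (@mdiff R (euclid (n + n)) PG (cinv (chart_at ((e, e) : PG))) z w)) = thR (rsubmx z) (rsubmx w).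
  rewrite -(mdiff_comp (aE _) aP w sp (smap_snd aG _)).
  have h : @mdiff R (euclid (n + n)) G (psi \o rsubmx) z w = @mdiff R (euclid n) G psi (rsubmx z) (rsubmx w).
    rewrite (mdiff_comp (aE _) (aE _) w srr sr).
    by congr (mdiff _ _ _); exact: (hasd_diff w (lin_rV_hasd (rsubl G G) z)).
  exact: (etrans (congr1 (thetaR (psi (rsubmx z))) h) (tR _)).
by rewrite /= !Lw !Rw.
Qed.

Let smL v : smooth_at (fun z : 'rV[R]_(n + n) => thL (lsubmx z) v) w0.
Proof.
apply: (smooth_at_comp (fin_basis_rV _) (g := thL ^~ v) (lsub_smooth _)).
rewrite row_mxKl; exact: (thetac_smooth aG (smap_mul hG) (smap_inv hG) (lmulV hG)).
Qed.

Let smR v : smooth_at (fun z : 'rV[R]_(n + n) => thR (rsubmx z) v) w0.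
Proof.
have smu' (p : PG) : @smap R PG G (fun p => p.2 ** p.1) p.
  by apply: (smap_lmul hG aP); [exact: smap_snd|exact: smap_fst].
apply: (smooth_at_comp (fin_basis_rV _) (g := thR ^~ v) (rsub_smooth _)).
rewrite row_mxKr; exact: (thetac_smooth aG smu' (smap_inv hG) (rmulV hG)).
Qed.

Lemma betac_smooth p q : smooth_at (fun z => betac z p q : R^o) w0.
Proof.
by apply: smooth_at_sub; apply: (smooth_bilin inner_linearl inner_linearr).
Qed.

Lemma near_allT (X : topologicalType) (x : X) (P : X -> Prop) :
  (forall y, P y) -> \forall y \near x, P y.
Proof. exact: nearW. Qed.

Lemma sform_beta1 : sform beta ((e, e) : PG).
Proof.
split; first exact: (@near_allT PG _ _ beta_alg).
move=> v; apply: smooth_at_eq (betac_smooth (v 0) (v 1)).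
by apply: near_mono beta_local => z ->.
Qed.

Lemma hasd_betac p q : hasd (fun z => betac z p q : R^o) w0 (fun w =>
  - B (mulL (lsubmx w) (lsubmx p)) (rsubmx q) - B (lsubmx p) (mulL (rsubmx q) (rsubmx w))
  + B (mulL (lsubmx w) (lsubmx q)) (rsubmx p) + B (lsubmx q) (mulL (rsubmx p) (rsubmx w))).
Proof.
have hL v : hasd (fun z : 'rV[R]_(n + n) => thL (lsubmx z) v) w0 (fun w => - mulL (lsubmx w) v).
  have hz : hasd (thL ^~ v) (lsubl G G w0) (fun u => - mulL u v).
    by rewrite /= row_mxKl; exact: hasd_thL.
  exact: (hasd_comp (lin_rV_hasd (lsubl G G) w0) hz).
have hR v : hasd (fun z : 'rV[R]_(n + n) => thR (rsubmx z) v) w0 (fun w => - mulL v (rsubmx w)).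
  have hz : hasd (thR ^~ v) (rsubl G G w0) (fun u => - mulL v u).
    by rewrite /= row_mxKr; exact: hasd_thR.
  exact: (hasd_comp (lin_rV_hasd (rsubl G G) w0) hz).
have tL0 v : thL (lsubmx w0) v = v by rewrite row_mxKl; exact: thL0.
have tR0 v : thR (rsubmx w0) v = v by rewrite row_mxKr; exact: thR0.
have h v v' := hasd_ext (fun w => congr2 +%R
    (congr1 (B (- mulL (lsubmx w) v)) (tR0 v')) (congr1 (B ^~ (- mulL v' (rsubmx w))) (tL0 v)))
  (hasd_bilin inner_linearl inner_linearr (hL v) (hR v')).
apply: hasd_ext (hasd_sub (h (lsubmx p) (rsubmx q)) (h (lsubmx q) (rsubmx p))) => w.
move: (mulL (lsubmx w) (lsubmx p)) (mulL (rsubmx q) (rsubmx w))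
  (mulL (lsubmx w) (lsubmx q)) (mulL (rsubmx p) (rsubmx w)) => x1 x2 x3 x4.
by rewrite !inner_Nl !inner_Nr opprD !opprK !addrA.
Qed.

(** The bilinear term m depends on the chart, its commutator does not: in the alternating sum each
    m(y, z) meets m(z, y), which leaves one value of [tri] for each way of taking the three
    arguments from both factors. The a's are the components in the first factor, the c's those in
    the second. *)
Lemma dbeta_comb (m : 'rV[R]_n -> 'rV[R]_n -> 'rV[R]_n) (a0 a1 a2 c0 c1 c2 : 'rV[R]_n) :
  (forall y z, br y z = m y z - m z y) ->
  (- B (m a0 a1) c2 - B a1 (m c2 c0) + B (m a0 a2) c1 + B a2 (m c1 c0))
  - (- B (m a1 a0) c2 - B a0 (m c2 c1) + B (m a1 a2) c0 + B a2 (m c0 c1))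
  + (- B (m a2 a0) c1 - B a0 (m c1 c2) + B (m a2 a1) c0 + B a1 (m c0 c2)) =
  - tri a0 a1 c2 - tri a0 c1 a2 - tri c0 a1 a2 - tri a0 c1 c2 - tri c0 a1 c2 - tri c0 c1 a2.
Proof.
move=> brE.
have T x y z : tri x y z = B x (m y z) - B x (m z y) by rewrite /tri brE inner_Dr inner_Nr.
have T1 : tri a0 a1 c2 = tri c2 a0 a1 by rewrite tri_swap23 tri_swap12 opprK.
have T2 : tri a0 c1 a2 = - tri c1 a0 a2 by rewrite tri_swap12.
have T3 : tri c0 a1 c2 = - tri a1 c0 c2 by rewrite tri_swap12.
have T4 : tri c0 c1 a2 = tri a2 c0 c1 by rewrite tri_swap23 tri_swap12 opprK.
rewrite T1 T2 T3 T4 !T !(inner_sym (m _ _)).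
ring.
Qed.

Lemma dbeta1 (v : 'I_3 -> 'rV[R]_(n + n)) :
  let a i := lsubmx (v i) in let c i := rsubmx (v i) in
  @dform R PG 2 beta (e, e) v =
  - tri (a 0) (a 1) (c 2%:R) - tri (a 0) (c 1) (a 2%:R) - tri (c 0) (a 1) (a 2%:R)
  - tri (a 0) (c 1) (c 2%:R) - tri (c 0) (a 1) (c 2%:R) - tri (c 0) (c 1) (a 2%:R).
Proof.
move=> a c; rewrite (vec3E v) dform2E.
have D p q u : 'd (fun z => form_local beta ((e, e) : PG) z (vec2 p q) : R^o) w0 u =
  - B (mulL (lsubmx u) (lsubmx p)) (rsubmx q) - B (lsubmx p) (mulL (rsubmx q) (rsubmx u))
  + B (mulL (lsubmx u) (lsubmx q)) (rsubmx p) + B (lsubmx q) (mulL (rsubmx p) (rsubmx u)).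
  have E : \forall z \near w0, (betac z p q : R^o) = form_local beta ((e, e) : PG) z (vec2 p q).
    by apply: near_mono beta_local => z ->.
  exact: (hasd_diff u (hasd_near E (hasd_betac p q))).
have D' p q u : 'd (fun z => form_local beta ((e, e) : PG) z (vec2 p q) : R^o)
    (cmap (chart_at ((e, e) : PG)) ((e, e) : PG)) u = _ := D p q u.
exact: (etrans (congr2 (fun x y => x + y) (congr2 (fun x y => x - y) (D' _ _ _) (D' _ _ _))
  (D' _ _ _)) (dbeta_comb _ _ _ _ _ _ (lie_bracketE hG))).
Qed.

(** The translations that leave theta^L of the first factor and theta^R of the second invariant;
    together they act transitively on G x G. *)
Definition tau (a b : G) (p : PG) : PG := (a ** p.1, p.2 ** b).

Lemma smap_tau a b p : smap (tau a b) p.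
Proof.
apply: smap_pair.
  by apply: (smap_lmul hG aP (f := fun=> a)); [exact: smap_cst|exact: smap_fst].
by apply: (smap_lmul hG aP (g := fun=> b)); [exact: smap_snd|exact: smap_cst].
Qed.

Lemma beta_tau a b : form_pull (tau a b) beta = beta.
Proof.
apply/funext => p; apply/funext => v; rewrite /form_pull /beta.
have Lw w : thetaL (tau a b p).1 (@mdiff R PG G fst (tau a b p) (mdiff (tau a b) p w)) =
    thetaL p.1 (@mdiff R PG G fst p w).
  rewrite -(mdiff_comp aP aP w (smap_tau a b p) (smap_fst aG _)).
  have E : mdiff (fst \o tau a b) p w = mdiff (fun h => a ** h) p.1 (@mdiff R PG G fst p w) :=
    mdiff_comp aP aG w (smap_fst aG _) (smap_l hG a _).
  exact: (etrans (congr1 (thetaL (a ** p.1)) E) (thetaL_l hG a p.1 _)).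
have Rw w : thetaR (tau a b p).2 (@mdiff R PG G snd (tau a b p) (mdiff (tau a b) p w)) =
    thetaR p.2 (@mdiff R PG G snd p w).
  rewrite -(mdiff_comp aP aP w (smap_tau a b p) (smap_snd aG _)).
  have E : mdiff (snd \o tau a b) p w = mdiff (fun h => h ** b) p.2 (@mdiff R PG G snd p w) :=
    mdiff_comp aP aG w (smap_snd aG _) (smap_r hG b _).
  exact: (etrans (congr1 (thetaR (p.2 ** b)) E) (thetaR_r hG b p.2 _)).
by rewrite !Lw !Rw.
Qed.

Lemma tauV a b p : tau a b (tau (linv a) (linv b) p) = p.
Proof. by case: p => g h; rewrite /tau /= (lmulKV hG) (rmulKV hG). Qed.

Lemma sform_beta (p : PG) : sform beta p.
Proof.
rewrite -(beta_tau (linv p.1) (linv p.2)); apply: sform_pull => //.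
  by apply: near_allT => q; exact: smap_tau.
by rewrite /tau (lmulV hG) (rmulV hG); exact: sform_beta1.
Qed.

Lemma mdiff_tauV a b p w : mdiff (tau a b) (tau (linv a) (linv b) p)
  (mdiff (tau (linv a) (linv b)) p w) = w.
Proof.
rewrite -(mdiff_comp aP aP w (smap_tau _ _ p) (smap_tau _ _ _)).
rewrite -[RHS](mdiff_id aP p); apply: mdiff_ext => q; exact: tauV.
Qed.

Lemma mdiff_mul1 w : @mdiff R PG G (fun p => p.1 ** p.2) (e, e) w = lsubmx w + rsubmx w.
Proof.
have e1 : w = inll G G (lsubmx w) + inrl G G (rsubmx w) by rewrite -row_mxE hsubmxK.
have s1 : @smap R G PG (fun h => (h, e)) e by apply: smap_pair; [exact: smap_id|exact: smap_cst].
have s2 : @smap R G PG (fun h => (e, h)) e by apply: smap_pair; [exact: smap_cst|exact: smap_id].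
have E1 u : @mdiff R PG G (fun p => p.1 ** p.2) (e, e) (inll G G u) = u.
  have k : mdiff (fun h : G => h ** e) e u = u.
    by rewrite (mdiff_ext (g := id)) => [|h]; [exact: mdiff_id|rewrite (rmul1 hG)].
  rewrite -[RHS]k (mdiff_comp aG aP u s1 (smap_mul hG _)).
  congr (mdiff _ _ _); rewrite mdiff_pair ?mdiff_id ?mdiff_cst //; exact: smap_id || exact: smap_cst.
have E2 u : @mdiff R PG G (fun p => p.1 ** p.2) (e, e) (inrl G G u) = u.
  have k : mdiff (fun h : G => e ** h) e u = u.
    by rewrite (mdiff_ext (g := id)) => [|h]; [exact: mdiff_id|rewrite (lmul1 hG)].
  rewrite -[RHS]k (mdiff_comp aG aP u s2 (smap_mul hG _)).
  congr (mdiff _ _ _); rewrite mdiff_pair ?mdiff_id ?mdiff_cst //; exact: smap_id || exact: smap_cst.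
rewrite [in LHS]e1.
have := mdiff_linear (fun p : PG => p.1 ** p.2) (e, e) 1 (inll G G (lsubmx w)) (inrl G G (rsubmx w)).
by rewrite !scale1r => ->; rewrite E1 E2.
Qed.

(* All the terms are invariant under left translation of the first factor and right
   translation of the second one, so it suffices to compare them at (e, e). *)
Lemma canonical3_mul (p : PG) v :
  form_pull (fun p : PG => p.1 ** p.2) (@canonical3 R G B) p v
  - @form_pull R PG G fst 3 (@canonical3 R G B) p v
  - @form_pull R PG G snd 3 (@canonical3 R G B) p v + 2^-1 * dform beta p v = 0.
Proof.
case: p v => g h v.
pose t := tau g h; pose w i := mdiff (tau (linv g) (linv h)) (g, h) (v i).
have te : tau (linv g) (linv h) (g, h) = (e, e) by rewrite /tau /= (lmulV hG) (rmulV hG).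
have vE i : v i = mdiff t (e, e) (w i).
  by rewrite -[LHS](mdiff_tauV g h (g, h)) te.
have tE : t (e, e) = (g, h) by rewrite /t /tau /= (rmul1 hG) (lmul1 hG).
have nt : \forall q \near ((e, e) : PG), smap t q by apply: near_allT => q; exact: smap_tau.
have st : smap t (e, e) by exact: smap_tau.
have D : dform beta (g, h) v = dform beta (e, e) w.
  have := form_pull_dform2 aP aP nt (sform_beta _); rewrite beta_tau => ->.
  by rewrite /form_pull tE; congr (dform _ _ _); apply/funext => i; rewrite vE.
have pt (f : PG -> G) i : mdiff f (g, h) (v i) = mdiff f (t (e, e)) (mdiff t (e, e) (w i)).
  by rewrite vE; exact: mdiff_pt.
have c3 (p q : G) u u' : p = q -> (forall i, u i = u' i) ->
    @canonical3 R G B p u = @canonical3 R G B q u'.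
  by move=> -> /funext ->.
have E1 : @form_pull R PG G fst 3 (@canonical3 R G B) (g, h) v =
    2^-1 * tri (lsubmx (w 0)) (lsubmx (w 1)) (lsubmx (w 2%:R)).
  apply: etrans (etrans (canonical3_l g e (fun i => lsubmx (w i))) (canonical3_1 _)).
  apply: c3 => [|i]; first by rewrite (rmul1 hG).
  rewrite pt.
  rewrite -(mdiff_comp aP aP (w i) st (smap_fst aG _)).
  have k : mdiff (fst \o t) (e, e) (w i) = mdiff (fun h => g ** h) e (@mdiff R PG G fst (e, e) (w i)) :=
    mdiff_comp aP aG (w i) (smap_fst aG ((e, e) : PG)) (smap_l hG g e).
  by rewrite k (mdiff_fst aG).
have E2 : @form_pull R PG G snd 3 (@canonical3 R G B) (g, h) v =
    2^-1 * tri (rsubmx (w 0)) (rsubmx (w 1)) (rsubmx (w 2%:R)).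
  apply: etrans (etrans (canonical3_r h _ (fun i => rsubmx (w i))) (canonical3_1 _)).
  apply: c3 => [|i]; first by rewrite (lmul1 hG).
  rewrite pt.
  rewrite -(mdiff_comp aP aP (w i) st (smap_snd aG _)).
  have k : mdiff (snd \o t) (e, e) (w i) = mdiff (fun g => g ** h) e (@mdiff R PG G snd (e, e) (w i)) :=
    mdiff_comp aP aG (w i) (smap_snd aG ((e, e) : PG)) (smap_r hG h e).
  by rewrite k (mdiff_snd aG).
have E3 : form_pull (fun p : PG => p.1 ** p.2) (@canonical3 R G B) (g, h) v =
    2^-1 * tri (lsubmx (w 0) + rsubmx (w 0)) (lsubmx (w 1) + rsubmx (w 1))
      (lsubmx (w 2%:R) + rsubmx (w 2%:R)).
  pose u i := lsubmx (w i) + rsubmx (w i).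
  apply: etrans (etrans (canonical3_r h _ (fun i => mdiff (fun h => g ** h) e (u i)))
    (etrans (canonical3_l g e u) (canonical3_1 u))).
  apply: c3 => [|i]; first by rewrite (rmul1 hG).
  rewrite pt.
  rewrite -(mdiff_comp aP aP (w i) st (smap_mul hG _)).
  have -> : (fun p : PG => p.1 ** p.2) \o t = (fun h' => h' ** h) \o ((fun h' => g ** h') \o (fun p : PG => p.1 ** p.2)).
    by apply/funext => q; rewrite /= !(lmulA hG).
  have s1 := smap_mul hG ((e, e) : PG).
  have s2 := smap_comp aP aG s1 (smap_l hG g _).
  rewrite (mdiff_comp aP aG _ s2 (smap_r hG h _)) (mdiff_comp aP aG _ s1 (smap_l hG g _)).
  have q1 : ((e, e) : PG).1 ** ((e, e) : PG).2 = e := lmul1 hG e.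
  have q2 : ((fun h' => g ** h') \o (fun p : PG => p.1 ** p.2)) (e, e) = g ** e :=
    congr1 (fun x => g ** x) q1.
  exact: (etrans (mdiff_pt (fun h' => h' ** h) _ q2)
    (congr1 (@mdiff R G G (fun h' => h' ** h) (g ** e))
      (etrans (mdiff_pt (fun h' => g ** h') _ q1)
        (congr1 (@mdiff R G G (fun h' => g ** h') e) (mdiff_mul1 (w i)))))).
rewrite E1 E2 E3 D dbeta1 !(tri_D1, tri_D2, tri_D3).
(* Of the eight terms of the expanded triple product, the two pure ones cancel with the pull-backs
   by the projections, the six mixed ones with the derivative of beta. *)
have comb (k x1 x2 x3 x4 x5 x6 x7 x8 : R) :
    k * (x1 + x2 + (x3 + x4) + (x5 + x6 + (x7 + x8))) - k * x1 - k * x8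
    + k * (- x2 - x3 - x5 - x4 - x6 - x7) = 0 by ring.
exact: comb.
Qed.

End FusionForm.

(** * Connections in set-theoretic trivialisations *)

Section Phase.
Variable R : realType.
Local Notation C := R[i].

Record phase := Phase { pval : C; _ : pval * pval^* == 1 }.
HB.instance Definition _ := [isSub for pval].
HB.instance Definition _ := [Choice of phase by <:].

Lemma phaseP (u : phase) : pval u * (pval u)^* = 1.
Proof. by case: u => z /= /eqP. Qed.

Lemma phase_inj : injective pval. Proof. exact: val_inj. Qed.

Lemma pval_neq0 (u : phase) : pval u != 0.
Proof.
apply/eqP => u0; have := phaseP u; rewrite u0 mul0r => /esym/eqP.
by rewrite oner_eq0.
Qed.

Fact phase1_subproof : (1 : C) * 1^* == 1. Proof. by rewrite conjC1 mulr1. Qed.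
Definition phase0 := Phase phase1_subproof.

Fact phaseM_subproof (u v : phase) : (pval u * pval v) * (pval u * pval v)^* == 1.
Proof. by rewrite rmorphM mulrACA !phaseP mulr1. Qed.
Definition phase_add (u v : phase) := Phase (phaseM_subproof u v).

Fact phaseV_subproof (u : phase) : (pval u)^* * ((pval u)^*)^* == 1.
Proof. by rewrite conjCK mulrC phaseP. Qed.
Definition phase_opp (u : phase) := Phase (phaseV_subproof u).

Fact phase_addA : associative phase_add.
Proof. by move=> u v w; apply: phase_inj; rewrite /= mulrA. Qed.
Fact phase_addC : commutative phase_add.
Proof. by move=> u v; apply: phase_inj; rewrite /= mulrC. Qed.
Fact phase_add0 : left_id phase0 phase_add.
Proof. by move=> u; apply: phase_inj; rewrite /= mul1r. Qed.
Fact phase_addN : left_inverse phase0 phase_opp phase_add.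
Proof. by move=> u; apply: phase_inj; rewrite /= mulrC phaseP. Qed.

(* The circle group is written additively. *)
HB.instance Definition _ := GRing.isZmodule.Build phase
  phase_addA phase_addC phase_add0 phase_addN.

Lemma pval0 : pval 0 = 1. Proof. by []. Qed.
Lemma pvalD u v : pval (u + v) = pval u * pval v. Proof. by []. Qed.
Lemma pvalNc u : pval (- u) = (pval u)^*. Proof. by []. Qed.
Lemma pvalN u : pval (- u) = (pval u)^-1.
Proof.
apply: (mulfI (pval_neq0 u)); rewrite mulfV ?pval_neq0 //.
exact: phaseP.
Qed.
Lemma pvalB u v : pval (u - v) = pval u / pval v.
Proof. by rewrite pvalD pvalN. Qed.

End Phase.

(** * Complex-valued functions *)

Section ComplexFunctions.
Context {R : realType}.
Local Notation C := R[i].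
Local Notation Re := complex.Re.
Local Notation Im := complex.Im.
Variables (M : manifold R) (hM : atlas M).

Definition csm (c : M -> C) (p : M) :=
  sfun (fun x => Re (c x) : R^o) p /\ sfun (fun x => Im (c x) : R^o) p.

Lemma csmoothP (c : M -> C) (U : set M) : open U ->
  csmooth U c <-> forall p, U p -> csm c p.
Proof.
move=> oU; split=> [[h1 h2] p Up|h].
  by split; [apply: (smooth_funP hM _ oU).1|apply: (smooth_funP hM _ oU).1].
by split; apply/(smooth_funP hM _ oU) => p /h[].
Qed.

Lemma csm_eq (c d : M -> C) p : (\forall q \near p, c q = d q) -> csm c p -> csm d p.
Proof.
move=> e [h h']; split.
  by apply: (sfun_eq hM _ h); apply: filterS e => q ->.
by apply: (sfun_eq hM _ h'); apply: filterS e => q ->.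
Qed.

Lemma cdiff_near (c d : M -> C) p v : (\forall q \near p, c q = d q) -> csm c p ->
  cdiff d p v = cdiff c p v.
Proof.
move=> e [h h'].
have e1 : \forall q \near p, (Re (c q) : R^o) = Re (d q) by apply: filterS e => q ->.
have e2 : \forall q \near p, (Im (c q) : R^o) = Im (d q) by apply: filterS e => q ->.
by rewrite /cdiff (fdiff_near hM v e1 h) (fdiff_near hM v e2 h').
Qed.

Lemma fdiff_mul (f g : M -> R^o) p v : sfun f p -> sfun g p ->
  fdiff (fun x => f x * g x : R^o) p v = fdiff f p v * g p + f p * fdiff g p v.
Proof.
move=> sf sg; have := hasd_diff v (hasd_mul (hasd_fdiff sf) (hasd_fdiff sg)).
by rewrite /= (psiK hM) //; exact: dom_self.
Qed.

Lemma fdiff_add (f g : M -> R^o) p v : sfun f p -> sfun g p ->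
  fdiff (fun x => f x + g x : R^o) p v = fdiff f p v + fdiff g p v.
Proof. by move=> sf sg; exact: hasd_diff (hasd_add (hasd_fdiff sf) (hasd_fdiff sg)). Qed.

Lemma fdiff_opp (f : M -> R^o) p v : sfun f p ->
  fdiff (fun x => - f x : R^o) p v = - fdiff f p v.
Proof. by move=> sf; exact: hasd_diff (hasd_opp (hasd_fdiff sf)). Qed.

Lemma ReM (a b : C) : Re (a * b) = Re a * Re b - Im a * Im b.
Proof. by case: a; case: b. Qed.

Lemma ImM (a b : C) : Im (a * b) = Re a * Im b + Im a * Re b.
Proof. by case: a => ? ?; case: b. Qed.

Lemma csm_mul (c d : M -> C) p : csm c p -> csm d p -> csm (fun x => c x * d x) p.
Proof.
move=> [h1 h2] [k1 k2]; split.
  apply: (sfun_eq hM (f := fun x => Re (c x) * Re (d x) - Im (c x) * Im (d x) : R^o)).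
    by apply: near_allT => q; rewrite ReM.
  exact: smooth_at_sub (smooth_at_mul h1 k1) (smooth_at_mul h2 k2).
apply: (sfun_eq hM (f := fun x => Re (c x) * Im (d x) + Im (c x) * Re (d x) : R^o)).
  by apply: near_allT => q; rewrite ImM.
exact: smooth_at_add (smooth_at_mul h1 k2) (smooth_at_mul h2 k1).
Qed.

Lemma cdiff_mul (c d : M -> C) p v : csm c p -> csm d p ->
  cdiff (fun x => c x * d x) p v = cdiff c p v * d p + c p * cdiff d p v.
Proof.
move=> [h1 h2] [k1 k2]; rewrite /cdiff.
have -> : (fun x => Re (c x * d x) : R^o) = fun x => Re (c x) * Re (d x) + - (Im (c x) * Im (d x)).
  by apply/funext => x; rewrite ReM.
have -> : (fun x => Im (c x * d x) : R^o) = fun x => Re (c x) * Im (d x) + Im (c x) * Re (d x).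
  by apply/funext => x; rewrite ImM.
have s1 := smooth_at_mul h1 k1; have s2 := smooth_at_mul h2 k2.
have s3 := smooth_at_mul h1 k2; have s4 := smooth_at_mul h2 k1.
have s5 := smooth_at_opp s2.
rewrite (fdiff_add v s1 s5) (fdiff_add v s3 s4) (fdiff_opp v s2) !fdiff_mul //.
case: (c p) => c1 c2; case: (d p) => d1 d2 /=.
move: (fdiff _ p v) (fdiff _ p v) (fdiff _ p v) (fdiff _ p v) => x1 x2 x3 x4.
by apply/eqP; rewrite eq_complex /=; apply/andP; split; apply/eqP; ring.
Qed.

Lemma csm_conj (c : M -> C) p : csm c p -> csm (fun x => (c x)^* ) p.
Proof.
move=> [h h']; split.
  by apply: (sfun_eq hM _ h); apply: near_allT => q; case: (c q).
apply: (sfun_eq hM (f := fun x => - Im (c x) : R^o)); last exact: smooth_at_opp.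
by apply: near_allT => q; case: (c q).
Qed.

Lemma cdiff_conj (c : M -> C) p v : csm c p -> cdiff (fun x => (c x)^* ) p v = (cdiff c p v)^*.
Proof.
move=> [h h']; rewrite /cdiff.
have -> : (fun x => Re ((c x)^* ) : R^o) = fun x => Re (c x) by apply/funext => x; case: (c x).
have -> : (fun x => Im ((c x)^* ) : R^o) = fun x => - Im (c x) by apply/funext => x; case: (c x).
by rewrite (fdiff_opp v h').
Qed.

Lemma csm_cst (a : C) p : csm (fun=> a) p.
Proof. by split; exact: smooth_at_cst. Qed.

Lemma cdiff_cst (a : C) p v : cdiff (fun _ : M => a) p v = 0.
Proof.
by rewrite /cdiff /fdiff; congr Complex; exact: (hasd_diff v (hasd_cst _ _)).
Qed.

End ComplexFunctions.

Section ComplexPull.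
Context {R : realType}.
Variables (M N : manifold R) (hM : atlas M) (hN : atlas N).

Lemma csm_pull (f : M -> N) c p : smap f p -> csm c (f p) -> csm (c \o f) p.
Proof.
by move=> sf [h h']; split; [exact: (smap_sfun hM hN sf h)|exact: (smap_sfun hM hN sf h')].
Qed.

Lemma cdiff_pull (f : M -> N) c p v : smap f p -> csm c (f p) ->
  cdiff (c \o f) p v = cdiff c (f p) (mdiff f p v).
Proof.
move=> sf [h h']; rewrite /cdiff.
by congr Complex; [exact: (fdiff_comp hM hN v sf h)|exact: (fdiff_comp hM hN v sf h')].
Qed.

End ComplexPull.

(** * Phases with prescribed logarithmic derivative *)

Section Par.
Context {R : realType}.
Local Notation C := R[i].
Variables (M : manifold R) (hM : atlas M).

(* near p, the unit function s satisfies ds = 2 pi i A s *)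
Definition Par (s : M -> phase R) (A : form M 1) (p : M) := \forall q \near p,
  csm (fun x => pval (s x)) q /\
  forall v, cdiff (fun x => pval (s x)) q v =
    two_pi_i * (form_app1 A q v)%:C%C * pval (s q).

Lemma Par_near s A p : Par s A p -> \forall q \near p, Par s A q.
Proof. exact: nbhs_interior. Qed.

Lemma Par_add s t A B p : Par s A p -> Par t B p ->
  Par (fun x => s x + t x) (fadd A B) p.
Proof.
move=> h k; apply: filterS2 h k => q [s1 d1] [s2 d2]; split; first exact: csm_mul.
move=> v; rewrite (cdiff_mul hM v s1 s2) d1 d2 /form_app1 /fadd rmorphD /=.
ring.
Qed.

Lemma Par_opp s A p : Par s A p -> Par (fun x => - s x) (fopp A) p.
Proof.
move=> h; apply: filterS h => q [s1 d1]; split; first exact: csm_conj.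
move=> v; rewrite (cdiff_conj v s1) d1 pvalNc /form_app1 /fopp.
case: (pval (s q)) => a b; rewrite /two_pi_i; apply/eqP.
rewrite eq_complex /=; apply/andP; split; apply/eqP; ring.
Qed.

Lemma Par_eq s t A B p : (\forall q \near p, s q = t q) ->
  (\forall q \near p, forall v, form_app1 A q v = form_app1 B q v) ->
  Par s A p -> Par t B p.
Proof.
move=> st AB h; have st' := nbhs_interior st.
have hh : \forall q \near p, (\forall q' \near q, s q' = t q') /\
    forall v, form_app1 A q v = form_app1 B q v.
  by apply: filterS2 st' AB => q ? ?; split.
apply: filterS2 hh h => q [e eA] [s1 d1].
have e' : \forall q' \near q, pval (s q') = pval (t q') by apply: filterS e => q' ->.
split; first exact: csm_eq e' s1.
by move=> v; rewrite (cdiff_near hM v e' s1) d1 eA (nbhs_singleton e).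
Qed.

Lemma fdiff0_lc (f : M -> R^o) p :
  (\forall q \near p, sfun f q /\ forall v, fdiff f q v = 0) -> \forall q \near p, f q = f p.
Proof.
move=> h; have dp := dom_self hM p; have hE := @atlas_euclid R (mdim M).
set z0 := cmap (chart_at p) p.
have : \forall z \near z0, differentiable (f \o cinv (chart_at p)) z /\
    forall w, 'd (f \o cinv (chart_at p)) z w = 0.
  apply: near_mono2 (near_psi hM dp h) (near_smap_psi hM dp) => z [sf f0] sp.
  split; last by move=> w; exact: (etrans (fdiff_comp hE hM w sp sf) (f0 _)).
  exact: (smooth_at_diff (smap_sfun hE hM sp sf)).
move=> /nbhs_ballP[r /= r0 hr].
have nb : \forall z \near z0, ball z0 r z by exact: nbhsx_ballx.
apply: filterS2 (near_dom hM dp) (near_phi hM dp nb) => q dq bq.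
have bt (t : R) : 0 <= t <= 1 -> ball z0 r (z0 + t *: (cmap (chart_at p) q - z0)).
  exact: (@radial_ball R (mdim M) z0 r).
have [|t /andP[t0 t1] E] := @mean_value R _ (f \o cinv (chart_at p)) z0 (cmap (chart_at p) q - z0).
  by move=> t /bt/hr[].
have tt : 0 <= t <= 1 by rewrite !ltW.
have E' := etrans E ((hr _ (bt t tt)).2 _).
have zE : z0 + (cmap (chart_at p) q - z0) = cmap (chart_at p) q by rewrite addrC subrK.
have := subr0_eq E'; rewrite zE => E2.
by move: E2; rewrite /= !(psiK hM).
Qed.

(** With A = 0 the real and imaginary parts of s have zero derivative near p. This is how statements
    on connections become statements on locally constant phases. *)
Lemma Par_lc s A p : Par s A p -> (\forall q \near p, forall v, form_app1 A q v = 0) -> lc s p.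
Proof.
move=> h A0.
have cd0 q : csm (fun x => pval (s x)) q /\ (forall v, cdiff (fun x => pval (s x)) q v =
    two_pi_i * (form_app1 A q v)%:C%C * pval (s q)) -> (forall v, form_app1 A q v = 0) ->
   (sfun (fun x => complex.Re (pval (s x)) : R^o) q /\
     forall v, fdiff (fun x => complex.Re (pval (s x)) : R^o) q v = 0) /\
   (sfun (fun x => complex.Im (pval (s x)) : R^o) q /\
     forall v, fdiff (fun x => complex.Im (pval (s x)) : R^o) q v = 0).
  move=> [[s1 s2] d] A0q.
  have d0 v : cdiff (fun x => pval (s x)) q v = 0 by rewrite d A0q rmorph0 mulr0 mul0r.
  by split; split=> // v; have := d0 v; rewrite /cdiff => -[].
have k1 : \forall q \near p, complex.Re (pval (s q)) = complex.Re (pval (s p)).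
  by apply: fdiff0_lc; apply: filterS2 h A0 => q hq A0q; exact: (cd0 q hq A0q).1.
have k2 : \forall q \near p, complex.Im (pval (s q)) = complex.Im (pval (s p)).
  by apply: fdiff0_lc; apply: filterS2 h A0 => q hq A0q; exact: (cd0 q hq A0q).2.
apply: filterS2 k1 k2 => q e1 e2; apply: phase_inj.
by move: e1 e2; case: (pval (s q)) => a b; case: (pval (s p)) => c d /= -> ->.
Qed.

Lemma lc_Par s A p : lc s p -> (\forall q \near p, forall v, form_app1 A q v = 0) -> Par s A p.
Proof.
move=> h A0.
have k : Par (fun=> s p) A p.
  apply: filterS A0 => q A0; split=> [|v]; first exact: csm_cst.
  by rewrite cdiff_cst A0 rmorph0 mulr0 mul0r.
apply: (Par_eq _ _ k); first by apply: filterS h => q ->.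
by apply: near_allT.
Qed.

End Par.

Section ParExists.
Context {R : realType}.

Lemma hasd_cos (x : R^o) : hasd (cos : R^o -> R^o) x (fun v => - sin x * v : R^o).
Proof.
have d : differentiable (cos : R^o -> R^o) x by apply/derivable1_diffP.
split=> // v; rewrite diff1E // derive1E derive_val mulrC.
by rewrite -[LHS]/(v * _).
Qed.

Lemma hasd_sin (x : R^o) : hasd (sin : R^o -> R^o) x (fun v => cos x * v : R^o).
Proof.
have d : differentiable (sin : R^o -> R^o) x by apply/derivable1_diffP.
split=> // v; rewrite diff1E // derive1E derive_val mulrC.
by rewrite -[LHS]/(v * _).
Qed.

Lemma hasd_trig (a b x : R^o) : hasd (fun y => a * cos y + b * sin y : R^o) x
  (fun v => (b * v) * cos x + (- a * v) * sin x : R^o).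
Proof.
apply: hasd_ext (hasd_add (hasd_mul (hasd_cst a x) (hasd_cos x))
  (hasd_mul (hasd_cst b x) (hasd_sin x))) => v.
by ring.
Qed.

(** The span of cos and sin is stable under differentiation, so the induction on k runs for all
    coefficients a and b at once. *)
Lemma Ck_trig k (a b : R) : Ck k setT (fun y : R^o => a * cos y + b * sin y : R^o).
Proof.
elim: k a b => [|k IH] a b; first by move=> x _; exact: hasd_continuous (hasd_trig a b x).
split=> [x _|v]; first by have [] := hasd_trig a b x.
have -> : (fun x => 'd (fun y : R^o => a * cos y + b * sin y : R^o) x v) =
    fun x => (b * v) * cos x + (- a * v) * sin x : R^o.
  by apply/funext => x; exact: hasd_diff (hasd_trig a b x).
exact: IH.
Qed.

Lemma smooth_cos (x : R^o) : smooth_at (cos : R^o -> R^o) x.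
Proof.
exists setT; split=> // [|k]; first exact: openT.
have -> : (cos : R^o -> R^o) = (fun y => 1 * cos y + 0 * sin y) by apply/funext => y; rewrite mul1r mul0r addr0.
exact: Ck_trig.
Qed.

Lemma smooth_sin (x : R^o) : smooth_at (sin : R^o -> R^o) x.
Proof.
exists setT; split=> // [|k]; first exact: openT.
have -> : (sin : R^o -> R^o) = (fun y => 0 * cos y + 1 * sin y) by apply/funext => y; rewrite mul1r mul0r add0r.
exact: Ck_trig.
Qed.

Fact expi_subproof (t : R) : Complex (cos t) (sin t) * (Complex (cos t) (sin t))^* == 1.
Proof.
by rewrite eq_complex /= mulrN opprK -!expr2 cos2Dsin2 mulrN addrC mulrC subrr !eqxx.
Qed.
Definition expi (t : R) : phase R := Phase (expi_subproof t).

Variables (M : manifold R) (hM : atlas M).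

(** s = exp(2 pi i f) for a local primitive f of A; the factor 2 pi matches the normalisation of
    connection forms. *)
Lemma Par_exists (A : form M 1) p :
  (\forall q \near p, sform A q /\ forall v, dform A q v = 0) -> exists s, Par s A p.
Proof.
move=> /(closed_form1_primitive hM)[f hf].
exists (fun q => expi (2 * pi * f q)).
apply: filterS hf => q [sf df].
have hg := hasd_mul (hasd_cst (2 * pi : R^o) _) (hasd_fdiff sf).
have sg : sfun (fun q => 2 * pi * f q : R^o) q by apply: smooth_at_mul => //; exact: smooth_at_cst.
have fq : (f \o cinv (chart_at q)) (cmap (chart_at q) q) = f q by rewrite /= (psiK hM) //; exact: dom_self.
split.
  split; apply: (smooth_at_comp (@fin_basisR R) sg); [exact: smooth_cos|exact: smooth_sin].
move=> v; rewrite /cdiff /=.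
have -> : fdiff (fun q => cos (2 * pi * f q) : R^o) q v = - sin (2 * pi * f q) * (2 * pi * form_app1 A q v).
  have := hasd_diff v (hasd_comp hg (hasd_cos _)); rewrite fq => k.
  by apply: (etrans k); rewrite df mul0r add0r.
have -> : fdiff (fun q => sin (2 * pi * f q) : R^o) q v = cos (2 * pi * f q) * (2 * pi * form_app1 A q v).
  have := hasd_diff v (hasd_comp hg (hasd_sin _)); rewrite fq => k.
  by apply: (etrans k); rewrite df mul0r add0r.
apply/eqP; rewrite eq_complex /two_pi_i /=; apply/andP; split; apply/eqP; ring.
Qed.

End ParExists.

Section ParPull.
Context {R : realType}.
Variables (M N : manifold R) (hM : atlas M) (hN : atlas N).

Lemma Par_pull (f : M -> N) s (A : form N 1) p :
  (\forall q \near p, smap f q) -> Par s A (f p) -> Par (s \o f) (form_pull f A) p.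
Proof.
move=> sf h; have [cf _] := nbhs_singleton sf.
have h' : \forall q \near p, csm (fun x => pval (s x)) (f q) /\ forall v,
    cdiff (fun x => pval (s x)) (f q) v = two_pi_i * (form_app1 A (f q) v)%:C%C * pval (s (f q)).
  exact: cf _ h.
apply: filterS2 sf h' => q sq [s1 d1]; split; first exact: (csm_pull hM hN sq s1).
by move=> v; apply: (etrans (cdiff_pull hM hN v sq s1)); rewrite d1.
Qed.

End ParPull.

(** * Hermitian lines, their duals and tensor products *)

Section Lines.
Context {R : realType}.
Local Notation C := R[i].

(** A Hermitian line with a unit vector that spans it. Duals and tensor products inherit this
    property with the induced vectors, which replaces dimension counts. *)
Definition uline (V : vectType C) (h : V -> V -> C) (a : V) :=
  [/\ forall v, exists c : C, v = c *: a, hermitian_inner h & h a a = 1].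

Lemma herm0 (V : vectType C) (h : V -> V -> C) v : hermitian_inner h -> h 0 v = 0.
Proof. by move=> [hl _ _]; have := hl (-1) 0 0 v; rewrite scaleN1r addr0 oppr0 mulN1r addNr. Qed.

Lemma hermZ (V : vectType C) (h : V -> V -> C) c d u v : hermitian_inner h ->
  h (c *: u) (d *: v) = c * d^* * h u v.
Proof.
move=> hh; have [hl hs _] := hh.
have hz c' x y : h (c' *: x) y = c' * h x y.
  by have := hl c' x 0 y; rewrite addr0 (herm0 _ hh) addr0.
by rewrite hz hs hz rmorphM /= -hs mulrA.
Qed.

Lemma uline_of_dim (V : vectType C) (h : V -> V -> C) a :
  \dim {: V} = 1%N -> hermitian_inner h -> h a a = 1 -> uline h a.
Proof.
move=> d hh ha; split=> // v.
have a0 : a != 0.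
  by apply/eqP => a0; move: ha; rewrite a0 herm0 // => /esym/eqP; rewrite oner_eq0.
have e : <[a]>%VS = fullv.
  by apply/eqP; rewrite eqEdim subvf /= d dim_vline a0.
have : v \in <[a]>%VS by rewrite e memvf.
by move=> /vlineP[c ->]; exists c.
Qed.

Section Line.
Variables (V : vectType C) (h : V -> V -> C) (a : V).
Hypothesis ua : uline h a.

Lemma uline_neq0 : a != 0.
Proof.
have [_ hh ha] := ua; apply/eqP => a0; move: ha.
by rewrite {1}a0 herm0 // => /esym/eqP; rewrite oner_eq0.
Qed.

Lemma herm_scale c d : h (c *: a) (d *: a) = c * d^*.
Proof. by have [_ hh ha] := ua; rewrite hermZ // ha mulr1. Qed.

Lemma unit_scalar b : h b b = 1 -> exists u : phase R, b = pval u *: a.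
Proof.
have [sp _ _] := ua; have [c ->] := sp b; rewrite herm_scale => /eqP cc.
by exists (Phase cc).
Qed.

Lemma uline_scale (u : phase R) : uline h (pval u *: a).
Proof.
have [sp hh _] := ua; split=> // [v|]; last by rewrite herm_scale phaseP.
have [c ->] := sp v; exists (c / pval u).
by rewrite scalerA divfK // pval_neq0.
Qed.

Lemma scale_inj c d : c *: a = d *: a -> c = d.
Proof.
move=> /eqP; rewrite -subr_eq0 -scalerBl scaler_eq0 (negbTE uline_neq0) orbF subr_eq0.
by move/eqP.
Qed.

End Line.

Lemma dual_vecE (V : vectType C) (a : V) c : a != 0 -> dual_vec a (c *: a) = c.
Proof.
move=> a0; rewrite /dual_vec lfunE /= linearZ /=.
have fa : free (in_tuple [:: a]) by rewrite seq1_free.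
have e : coord (in_tuple [:: a]) ord0 a = 1 by exact: (coord_free ord0 ord0 fa).
by rewrite [coord _ _ _]e -[RHS]mulr1.
Qed.

Lemma tensE (V W : vectType C) (a : V) (b : W) l : tens a b l = l a *: b.
Proof.
have lin : linear (fun l : 'Hom(V, C^o) => l a *: b).
  by move=> c u v; rewrite add_lfunE scale_lfunE scalerDl scalerA.
pose L : {linear 'Hom(V, C^o) -> W} := HB.pack (fun l : 'Hom(V, C^o) => l a *: b)
  (GRing.isLinear.Build C _ _ *:%R _ lin).
exact: (lfunE L l).
Qed.

Lemma hom_eq (V W : vectType C) (a : V) (f g : 'Hom(V, W)) :
  (forall v, exists c : C, v = c *: a) -> f a = g a -> f = g.
Proof.
move=> sp e; apply/lfunP => v; have [c ->] := sp v.
by rewrite !linearZ /= e.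
Qed.

Lemma dual_vecZ (V : vectType C) (a : V) c : (forall v, exists d : C, v = d *: a) ->
  a != 0 -> c != 0 -> dual_vec (c *: a) = c^-1 *: dual_vec a.
Proof.
move=> sp a0 c0; apply: (hom_eq sp); rewrite scale_lfunE.
have -> : dual_vec a a = 1 by rewrite -{2}[a]scale1r dual_vecE.
have -> : dual_vec (c *: a) a = c^-1.
  by rewrite -{2}[a]scale1r -(mulVf c0) -scalerA dual_vecE // scaler_eq0 negb_or c0.
by rewrite -[RHS]/(_ * _) mulr1.
Qed.

Lemma tensZl (V W : vectType C) (a : V) (b : W) c : tens (c *: a) b = c *: tens a b.
Proof. by apply/lfunP => l; rewrite scale_lfunE !tensE linearZ /= scalerA. Qed.

Lemma tensZr (V W : vectType C) (a : V) (b : W) c : tens a (c *: b) = c *: tens a b.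
Proof. by apply/lfunP => l; rewrite scale_lfunE !tensE !scalerA mulrC. Qed.

(** [hom_herm] evaluates at a picked nonzero vector c a; numerator and denominator both acquire the
    factor |c|^2, so the unit vector a may be used instead. *)
Lemma hom_hermE (V W : vectType C) (hV : V -> V -> C) (hW : W -> W -> C) a f g :
  uline hV a -> hermitian_inner hW -> hom_herm hV hW f g = hW (f a) (g a).
Proof.
move=> ua hh; have [sp hhV ha] := ua; rewrite /hom_herm.
set v := vpick _.
have v0 : v != 0.
  rewrite vpick0; apply/eqP => e.
  have := memvf a; rewrite e memv0; exact/negP/(uline_neq0 ua).
have [c vE] := sp v.
have c0 : c != 0 by apply: contraNneq v0 => c0; rewrite vE c0 scale0r.
rewrite vE !linearZ /= !hermZ // ha mulr1 mulrAC mulfV ?mul1r //.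
by rewrite mulf_neq0 // conjC_eq0.
Qed.

Lemma hom_herm_inner (V W : vectType C) (hV : V -> V -> C) (hW : W -> W -> C) a :
  uline hV a -> hermitian_inner hW -> hermitian_inner (hom_herm hV hW).
Proof.
move=> ua hh; have [sp _ _] := ua; have [hl hs hp] := hh.
split=> [c u u' v|u v|u u0]; rewrite !(hom_hermE _ _ ua hh).
- by rewrite add_lfunE scale_lfunE hl.
- exact: hs.
- apply: hp; apply: contraNneq u0 => ua0; apply/eqP.
  by apply: (hom_eq sp); rewrite ua0 zero_lfunE.
Qed.

Lemma std_herm_inner : hermitian_inner (@std_herm R).
Proof.
split=> [c u u' v|u v|u u0]; rewrite /std_herm.
- by rewrite mulrDl mulrA.
- by rewrite rmorphM /= conjCK mulrC.
- by rewrite mul_conjC_gt0.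
Qed.

Lemma uline_std : uline (@std_herm R) (1 : C^o).
Proof.
split; [|exact: std_herm_inner|by rewrite /std_herm conjC1 mulr1].
by move=> v; exists v; rewrite -[RHS]/(_ * _) mulr1.
Qed.

Lemma uline_dual (V : vectType C) (h : V -> V -> C) a : uline h a ->
  uline (hom_herm h (@std_herm R)) (dual_vec a).
Proof.
move=> ua; have [sp hh ha] := ua; have a0 := uline_neq0 ua.
have d1 : dual_vec a a = 1 by rewrite -{2}[a]scale1r dual_vecE.
split=> [l||].
- exists (l a); apply: (hom_eq sp).
  by rewrite scale_lfunE d1 -[RHS]/(_ * _) mulr1.
- exact: hom_herm_inner ua std_herm_inner.
- by rewrite (hom_hermE _ _ ua std_herm_inner) d1 /std_herm conjC1 mulr1.
Qed.

Lemma uline_tens (V W : vectType C) (hV : V -> V -> C) (hW : W -> W -> C) a b :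
  uline hV a -> uline hW b ->
  uline (hom_herm (hom_herm hV (@std_herm R)) hW) (tens a b).
Proof.
move=> ua ub; have a0 := uline_neq0 ua; have ud := uline_dual ua.
have [spd _ _] := ud; have [spb hhb hb] := ub.
have t1 : tens a b (dual_vec a) = b.
  by rewrite tensE -{2}[a]scale1r dual_vecE // scale1r.
split=> [l||].
- have [c lE] := spb (l (dual_vec a)); exists c.
  by apply: (hom_eq spd); rewrite scale_lfunE t1.
- exact: hom_herm_inner ud hhb.
- by rewrite (hom_hermE _ _ ud hhb) t1.
Qed.

Lemma tens_theta (V1 V2 V3 : vectType C) h (a1 : V1) (a2 : V2) (a3 : V3) (x y z : C) :
  uline h a2 -> y != 0 ->
  tens (tens (x *: a1) (dual_vec (y *: a2))) (z *: a3) =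
  (x / y * z) *: tens (tens a1 (dual_vec a2)) a3.
Proof.
move=> ua y0; have [sp _ _] := ua.
rewrite (dual_vecZ sp (uline_neq0 ua) y0) !(tensZl, tensZr) !scalerA.
by congr (_ *: _); ring.
Qed.

(** The outer dual inverts x, while y is inverted twice. *)
Lemma tens_psi (V1 V2 V3 : vectType C) h1 h2 (a1 : V1) (a2 : V2) (a3 : V3) (x y z : C) :
  uline h1 a1 -> uline h2 a2 -> x != 0 -> y != 0 ->
  tens (dual_vec (tens (x *: a1) (dual_vec (y *: a2)))) (z *: a3) =
  (y / x * z) *: tens (dual_vec (tens a1 (dual_vec a2))) a3.
Proof.
move=> u1 u2 x0 y0; have [sp _ _] := u2.
have ut := uline_tens u1 (uline_dual u2); have [spt _ _] := ut.
rewrite (dual_vecZ sp (uline_neq0 u2) y0) !(tensZl, tensZr) !scalerA.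
rewrite (dual_vecZ spt (uline_neq0 ut)) ?mulf_neq0 ?invr_neq0 //.
rewrite !(tensZl, tensZr) !scalerA invfM invrK.
by congr (_ *: _); ring.
Qed.

Lemma tens_psi1 (W : vectType C) (w : W) (x y z : C) : x != 0 -> y != 0 ->
  tens (dual_vec (tens (x : C^o) (dual_vec (y : C^o)))) (z *: w) =
  (y / x * z) *: tens (dual_vec (tens (1 : C^o) (dual_vec (1 : C^o)))) w.
Proof.
move=> x0 y0; rewrite -(tens_psi _ _ uline_std uline_std x0 y0).
have e (t : C) : t *: (1 : C^o) = (t : C^o) by rewrite -[LHS]/(_ * _) mulr1.
by rewrite !e.
Qed.

Lemma tens_psi1_coord (W : vectType C) h (w : W) (x y z c : C) : uline h w ->
  x != 0 -> y != 0 ->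
  tens (dual_vec (tens (1 : C^o) (dual_vec (1 : C^o)))) w =
  c *: tens (dual_vec (tens (x : C^o) (dual_vec (y : C^o)))) (z *: w) ->
  1 = c * (y / x * z).
Proof.
move=> uw x0 y0; rewrite (tens_psi1 _ _ x0 y0) scalerA -[LHS]scale1r.
exact: (scale_inj (uline_tens (uline_dual (uline_tens uline_std (uline_dual uline_std))) uw)).
Qed.

Lemma tens_psi_phase (W : vectType C) (w : W) (s t u : phase R) :
  tens (dual_vec (tens (1 : C^o) (dual_vec (1 : C^o)))) w =
  pval (s - t - u) *:
    tens (dual_vec (tens (pval s : C^o) (dual_vec (pval t : C^o)))) (pval u *: w).
Proof.
rewrite (tens_psi1 _ _ (pval_neq0 _) (pval_neq0 _)) scalerA.
by rewrite -pvalB -!pvalD (_ : _ + _ = 0) ?scale1r //; zmod.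
Qed.

End Lines.

Section ParOf.
Context {R : realType}.
Local Notation C := R[i].
Variables (M : manifold R) (hM : atlas M).

Lemma Par_of (c : M -> C) (s : M -> phase R) (A : form M 1) (W : set M) p :
  open W -> W p -> (forall q, W q -> c q = pval (s q)) -> csmooth W c ->
  (forall q v, W q -> cdiff c q v = two_pi_i * (form_app1 A q v)%:C%C * c q) -> Par s A p.
Proof.
move=> oW Wp cs sc dc; apply: filterS (open_nbhs_nbhs (conj oW Wp)) => q Wq.
have e : \forall q' \near q, c q' = pval (s q').
  by apply: filterS (open_nbhs_nbhs (conj oW Wq)) => q' /cs.
have s1 := (csmoothP hM c oW).1 sc q Wq.
split; first exact: csm_eq e s1.
by move=> v; rewrite (cdiff_near hM v e s1) dc // cs.
Qed.

End ParOf.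

(** * Gerbes as cocycles of phases *)

Section ScalarGerbe.
Context {R : realType}.
Local Notation C := R[i].
Variables (G : manifold R) (hG : atlas G).

(* Fr i j s A g: near g, the line bundle L_ij has a unitary frame with connection
   form A whose coordinate in a fixed set-theoretic trivialisation is s. *)
Definition scalar_gerbe (I : Type) (U : I -> set G) (w : I -> form G 2)
    (Fr : I -> I -> (G -> phase R) -> form G 1 -> G -> Prop) : Prop :=
  [/\ forall i j g, U i g -> U j g -> exists s A, Fr i j s A g,
      forall i j s A g, Fr i j s A g -> \forall g' \near g, Fr i j s A g',
      forall i j s A s' A' g, Fr i j s A g -> Fr i j s' A' g ->
        Par (fun x => s' x - s x) (fadd A' (fopp A)) g,
      forall i j k s A s' A' s'' A'' g, Fr i j s A g -> Fr j k s' A' g -> Fr i k s'' A'' g ->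
        Par (fun x => s' x + s x - s'' x) (fadd (fadd A' A) (fopp A'')) g &
      forall i j s A g, Fr i j s A g ->
        [/\ U i g, U j g, sform A g & forall v, dform A g v = w j g v - w i g v]].

Variables (Gb : gerbe G) (hGb : is_gerbe Gb).
Local Notation U := (@gcov R G Gb).

Definition frame_coord (ah : forall i j m, lfiber (@glb R G Gb i j) m) (i j : gidx Gb)
    (s : G -> phase R) (A : form G 1) (g : G) : Prop :=
  exists V e, [/\ lframe (glb i j) V e A, V g &
    forall m, V m -> e m = pval (s m) *: ah i j m].

Let openU i : open (U i). Proof. by have [[h _] _ _ _ _] := hGb; exact: h. Qed.
Let lbU i j : is_line_bundle (U i `&` U j) (@glb R G Gb i j).
Proof. by have [_ h _ _ _] := hGb; have [] := h i j. Qed.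

Lemma frame_unit i j V e A m : lframe (@glb R G Gb i j) V e A -> V m -> uline (@lherm R G (glb i j) m) (e m).
Proof.
move=> fV Vm; have [h1 h2 _ _] := lbU i j.
have [_ VU eu _] := h2 _ _ _ fV.
by have [d hh] := h1 m (VU m Vm); apply: uline_of_dim => //; exact: eu.
Qed.

Lemma raw_unit i j m : exists a : lfiber (@glb R G Gb i j) m,
  U i m -> U j m -> uline (@lherm R G (glb i j) m) a.
Proof.
have [[Ui Uj]|n] := pselect (U i m /\ U j m); last by exists 0 => Ui Uj; case: n.
have [_ _ h3 _] := lbU i j.
have [V [e [A [fV Vm]]]] := h3 m (conj Ui Uj).
by exists (e m) => _ _; exact: frame_unit fV Vm.
Qed.

Let a i j m := sval (cid (raw_unit i j m)).
Let ua i j m : U i m -> U j m -> uline (@lherm R G (glb i j) m) (a i j m).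
Proof. by rewrite /a; case: (cid _) => x /= h; exact: h. Qed.

Lemma theta_raw i j k m : exists c : phase R, U i m -> U j m -> U k m ->
  theta_coord (fun i j => a i j m) i j k (pval c).
Proof.
have [[Ui [Uj Uk]]|n] := pselect (U i m /\ U j m /\ U k m); last first.
  by exists 0 => Ui Uj Uk; case: n.
have [_ _ h _ _] := hGb; have [[_ un] _] := h i j k.
have ut := uline_tens (uline_tens (ua Uj Uk) (uline_dual (ua Ui Uk))) (ua Ui Uj).
have [c cE] := unit_scalar ut (un m (conj (conj Ui Uj) Uk)).
by exists c => _ _ _.
Qed.

Let c i j k m := sval (cid (theta_raw i j k m)).
Let cP i j k m : U i m -> U j m -> U k m -> theta_coord (fun i j => a i j m) i j k (pval (c i j k m)).
Proof. by rewrite /c; case: (cid _) => x /= h; exact: h. Qed.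

Let cocycle i j k l m : U i m -> U j m -> U k m -> U l m ->
  c j k l m - c i k l m + c i j l m - c i j k m = 0.
Proof.
move=> Ui Uj Uk Ul; have [_ _ _ h _] := hGb.
have nz i' j' : U i' m -> U j' m -> a i' j' m != 0 by move=> ui uj; exact: uline_neq0 (ua ui uj).
apply: phase_inj; rewrite !pvalD !pvalN.
apply: (h i j k l m Ui Uj Uk Ul (fun i j => a i j m)); try exact: cP.
  by split; exact: nz.
by split; exact: nz.
Qed.

Lemma gerbe_cover m : exists i, U i m.
Proof. by have [[_ h] _ _ _ _] := hGb; exact: h. Qed.

Let i0 m := sval (cid (gerbe_cover m)).
Let i0P m : U (i0 m) m. Proof. by rewrite /i0; case: (cid _). Qed.

(** An index i0 m valid at m splits the cocycle there: c i j k is the coboundary of (i, j) |-> c (i0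
    m) i j, and rescaling by it makes theta equal to 1. That i0 m jumps with m does not matter. *)
Let ah i j m : lfiber (@glb R G Gb i j) m := pval (c (i0 m) i j m) *: a i j m.

Lemma scalar_theta (i j k : gidx Gb) m : U i m -> U j m -> U k m ->
  gtheta i j k m = tens (tens (ah j k m) (dual_vec (ah i k m))) (ah i j m).
Proof.
move=> Ui Uj Uk; rewrite (cP Ui Uj Uk) /ah (tens_theta _ _ _ _ (ua Ui Uk) (pval_neq0 _)); congr (_ *: _).
rewrite -pvalB -pvalD; congr pval.
by rewrite -[LHS]subr0 -(cocycle (i0P m) Ui Uj Uk); zmod.
Qed.

Lemma uline_ah i j m : U i m -> U j m -> uline (@lherm R G (glb i j) m) (ah i j m).
Proof. by move=> ui uj; apply: uline_scale; exact: ua. Qed.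

Lemma frame_coord_exists i j V e A : lframe (@glb R G Gb i j) V e A ->
  exists s : G -> phase R, forall m, V m -> e m = pval (s m) *: ah i j m.
Proof.
move=> fV; have [_ h2 _ _] := lbU i j; have [_ VU eu _] := h2 _ _ _ fV.
have ex m : exists u : phase R, V m -> e m = pval u *: ah i j m.
  have [Vm|n] := pselect (V m); last by exists 0.
  have [Ui Uj] := VU m Vm.
  by have [u uE] := unit_scalar (uline_ah Ui Uj) (eu m Vm); exists u.
by have [s hs] := choice ex; exists s.
Qed.

Lemma gerbe_scalar : scalar_gerbe U (@gform R G Gb) (frame_coord ah).
Proof.
split.
- move=> i j g Ui Uj; have [_ _ h3 _] := lbU i j.
  have [V [e [A [fV Vm]]]] := h3 g (conj Ui Uj).
  have [s hs] := frame_coord_exists fV.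
  by exists s, A, V, e; split.
- move=> i j s A g [V [e [fV Vg hs]]].
  have [_ h2 _ _] := lbU i j; have [oV _ _ _] := h2 _ _ _ fV.
  by apply: filterS (open_nbhs_nbhs (conj oV Vg)) => g' Vg'; exists V, e; split.
- move=> i j s A s' A' g [V [e [fV Vg hs]]] [V' [e' [fV' Vg' hs']]].
  have [_ h2 _ h4] := lbU i j.
  have [oV VU _ _] := h2 _ _ _ fV; have [oV' _ _ _] := h2 _ _ _ fV'.
  have [f [sf fE df]] := h4 _ _ _ _ _ _ fV fV'.
  apply: (Par_of hG (c := f) (W := V `&` V')) => //; first exact: openI.
    move=> q [Vq V'q]; have [Ui Uj] := VU q Vq.
    have := fE q (conj Vq V'q); rewrite hs // hs' // scalerA => /(scale_inj (uline_ah Ui Uj)) E.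
    by rewrite pvalB E mulfK // pval_neq0.
- move=> i j k s A s' A' s'' A'' g [V1 [e1 [f1 V1g h1]]] [V2 [e2 [f2 V2g h2]]] [V3 [e3 [f3 V3g h3]]].
  have [_ g1 _ _] := lbU i j; have [oV1 VU1 _ _] := g1 _ _ _ f1.
  have [_ g2 _ _] := lbU j k; have [oV2 VU2 _ _] := g2 _ _ _ f2.
  have [_ g3 _ _] := lbU i k; have [oV3 VU3 _ _] := g3 _ _ _ f3.
  have [_ _ hth _ _] := hGb; have [_ par] := hth i j k.
  (* The three given frames form a frame F of delta L. As theta is 1 in the trivialisation [ah], its
     coordinate with respect to F is the phase - S, and parallelism of theta prescribes the
     derivative of S. *)
  pose F m := tens (tens (e2 m) (dual_vec (e3 m))) (e1 m).
  pose AF := fadd (fadd A' (fopp A'')) A.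
  have fF : lframe (lb_delta2 (@glb R G Gb) i j k) ((V2 `&` V3) `&` V1) F AF.
    exists (V2 `&` V3), (fun m => tens (e2 m) (dual_vec (e3 m))), (fadd A' (fopp A'')), V1, e1, A.
    split=> //; exists V2, e2, A', V3, (fun m => dual_vec (e3 m)), (fopp A''); split=> //.
    by exists e3, A''.
  have [d [sd dE dd]] := par _ _ _ fF.
  set W := U i `&` U j `&` U k `&` (V2 `&` V3 `&` V1) in sd dE dd.
  have oW : open W by do !apply: openI.
  have Wg : W g by have [? ?] := VU1 g V1g; have [? ?] := VU2 g V2g.
  pose S x := s' x - s'' x + s x.
  have dS q : W q -> d q = pval (- S q).
    move=> Wq; have [[[Ui Uj] Uk] [[V2q V3q] V1q]] := Wq.
    have := dE q Wq; rewrite (scalar_theta Ui Uj Uk) /F h1 // h2 // h3 //.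
    rewrite (tens_theta _ _ _ _ (uline_ah Ui Uk) (pval_neq0 _)) scalerA -[X in X = _ -> _]scale1r.
    move=> /(scale_inj (uline_tens (uline_tens (uline_ah Uj Uk) (uline_dual (uline_ah Ui Uk))) (uline_ah Ui Uj))).
    rewrite -pvalB -pvalD => E.
    by rewrite pvalN; apply: (mulIf (pval_neq0 (S q))); rewrite mulVf ?pval_neq0 // -E.
  have P1 : Par (fun x => - S x) (fopp AF) g.
    apply: (Par_of hG oW Wg dS sd) => q v Wq.
    have := dd q v Wq => /eqP; rewrite addr_eq0 => /eqP ->.
    rewrite /form_app1 /fopp rmorphN /=; ring.
  apply: (Par_eq hG _ _ (Par_opp hG P1)); apply: near_allT => q; first by rewrite /S; zmod.
  by move=> v; rewrite /form_app1 /AF /fadd /fopp; ring.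
- move=> i j s A g [V [e [fV Vg hs]]].
  have [_ h2 _ _] := lbU i j; have [oV VU _ isA] := h2 _ _ _ fV.
  have [Ui Uj] := VU g Vg; split=> //; first exact: ((is_formP hG _ oV).1 isA).
  have [_ _ _ _ [_ cv]] := hGb.
  by move=> v; rewrite -(cv i j _ _ _ fV).
Qed.

(** One and the same trivialisation [ah] has to serve both given spaces and their fusion product, so
    it is exported with the properties that characterise it. *)
Lemma gerbe_scalarise : exists ah : forall i j m, lfiber (@glb R G Gb i j) m,
  [/\ forall i j m, U i m -> U j m -> uline (@lherm R G (glb i j) m) (ah i j m),
      forall i j k m, U i m -> U j m -> U k m ->
        gtheta i j k m = tens (tens (ah j k m) (dual_vec (ah i k m))) (ah i j m),
      forall i j V e A, lframe (@glb R G Gb i j) V e A ->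
        exists s : G -> phase R, forall m, V m -> e m = pval (s m) *: ah i j m &
      scalar_gerbe U (@gform R G Gb) (frame_coord ah)].
Proof.
exists ah; split; [exact: uline_ah|exact: scalar_theta| |exact: gerbe_scalar].
exact: frame_coord_exists.
Qed.

End ScalarGerbe.

(** * Pre-quantizations as cocycles of phases *)

Section ScalarPreq.
Context {R : realType}.
Local Notation C := R[i].
Variables (G M : manifold R) (hG : atlas G) (hM : atlas M) (Psi : M -> G).
Hypothesis sPsi : forall m, smap Psi m.

(** [QFr i s A m] stands for a unitary frame of E_i near m with connection form A and coordinate s.
    In coordinates where psi is 1, its being parallel says that s' - s - t has connection form A' -
    A - Psi^* B, which is the third clause; the last one expresses the error 2-form. *)
Definition scalar_preq (I : Type) (U : I -> set G) (w : I -> form G 2)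
    (Fr : I -> I -> (G -> phase R) -> form G 1 -> G -> Prop) (om : form M 2)
    (QFr : I -> (M -> phase R) -> form M 1 -> M -> Prop) : Prop :=
  [/\ forall i m, U i (Psi m) -> exists s A, QFr i s A m,
      forall i s A m, QFr i s A m -> \forall m' \near m, QFr i s A m',
      forall i j s A s' A' t B m, QFr i s A m -> QFr j s' A' m -> Fr i j t B (Psi m) ->
        Par (fun x => s' x - s x - t (Psi x))
          (fadd (fadd A' (fopp A)) (fopp (form_pull Psi B))) m &
      forall i s A m, QFr i s A m -> [/\ U i (Psi m), sform A m &
        forall v, dform A m v = form_pull Psi (w i) m v - om m v]].

Variables (Gb : gerbe G) (hGb : is_gerbe Gb).
Local Notation U := (@gcov R G Gb).
Variable ah : forall i j m, lfiber (@glb R G Gb i j) m.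
Hypothesis uah : forall i j m, U i m -> U j m -> uline (@lherm R G (glb i j) m) (ah i j m).
Hypothesis thah : forall i j k m, U i m -> U j m -> U k m ->
  gtheta i j k m = tens (tens (ah j k m) (dual_vec (ah i k m))) (ah i j m).

Let cPsi : continuous Psi. Proof. by move=> m; have [] := sPsi m. Qed.
Let openU i : open (Psi @^-1` U i).
Proof.
have [[h _] _ _ _ _] := hGb; apply: open_comp; last exact: h.
by move=> m _; exact: cPsi.
Qed.

Section Forward.
Variable Q : quasi_line_bundle (gerbe_pull Psi Gb).
Hypothesis hQ : is_quasi_line_bundle Q.
Variable om : form M 2.
Hypothesis herr : has_error_form Q om.

Let lbQ i : is_line_bundle (Psi @^-1` U i) (qlb Q i).
Proof. by have [h _ _ _] := hQ; exact: h. Qed.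

Lemma quasi_raw_unit i m : exists a : lfiber (qlb Q i) m,
  U i (Psi m) -> uline (@lherm R M (qlb Q i) m) a.
Proof.
have [Ui|n] := pselect (U i (Psi m)); last by exists 0 => Ui.
have [h1 h2 h3 _] := lbQ i; have [V [e [A [fV Vm]]]] := h3 m Ui.
exists (e m) => _; have [_ _ eu _] := h2 _ _ _ fV.
by have [d hh] := h1 m Ui; apply: uline_of_dim => //; exact: eu.
Qed.

Let x i m := sval (cid (quasi_raw_unit i m)).
Let ux i m : U i (Psi m) -> uline (@lherm R M (qlb Q i) m) (x i m).
Proof. by rewrite /x; case: (cid _). Qed.

Lemma psi_raw i j m : exists c : phase R, U i (Psi m) -> U j (Psi m) ->
  psi_coord (Q := Q) (fun i => x i m) (fun i j => ah i j (Psi m)) i j (pval c).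
Proof.
have [[Ui Uj]|n] := pselect (U i (Psi m) /\ U j (Psi m)); last first.
  by exists 0 => Ui Uj; case: n.
have [_ h _ _] := hQ; have [_ un] := h i j.
have ut := uline_tens (uline_dual (uline_tens (ux Uj) (uline_dual (ux Ui)))) (uah Ui Uj).
have [c cE] := unit_scalar ut (un m (conj Ui Uj)).
by exists c => _ _.
Qed.

Let c i j m := sval (cid (psi_raw i j m)).
Let cP i j m : U i (Psi m) -> U j (Psi m) ->
  psi_coord (Q := Q) (fun i => x i m) (fun i j => ah i j (Psi m)) i j (pval (c i j m)).
Proof. by rewrite /c; case: (cid _). Qed.

(** As theta is 1 in [ah], the condition delta psi = theta makes c a 1-cocycle. *)
Let cocycle i j k m : U i (Psi m) -> U j (Psi m) -> U k (Psi m) ->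
  c j k m - c i k m + c i j m = 0.
Proof.
move=> Ui Uj Uk; have [_ _ h _] := hQ.
have nzx i' : U i' (Psi m) -> x i' m != 0 by move=> ui; exact: uline_neq0 (ux ui).
have nz i' j' : U i' (Psi m) -> U j' (Psi m) -> ah i' j' (Psi m) != 0.
  by move=> ui uj; exact: uline_neq0 (uah ui uj).
have E := h i j k m Ui Uj Uk (fun i => x i m) (fun i j => ah i j (Psi m))
  (And3 (nzx i Ui) (nzx j Uj) (nzx k Uk)) (And3 (nz i j Ui Uj) (nz i k Ui Uk) (nz j k Uj Uk))
  _ _ _ (cP Uj Uk) (cP Ui Uk) (cP Ui Uj).
have ut := uline_tens (uline_tens (uah Uj Uk) (uline_dual (uah Ui Uk))) (uah Ui Uj).
apply: phase_inj; rewrite pvalD pvalB; apply: (scale_inj ut).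
by rewrite scale1r -[LHS]E; exact: thah.
Qed.

Let i0 m := sval (cid (gerbe_cover hGb (Psi m))).
Let i0P m : U (i0 m) (Psi m). Proof. by rewrite /i0; case: (cid _). Qed.

(** At a point the cocycle c is the coboundary of i |-> c (i0 m) i, and this rescaling makes psi
    equal to 1; the sign is negative because psi involves the dual of E_j tensor E_i^-1. *)
Let xh i m : lfiber (qlb Q i) m := pval (- c (i0 m) i m) *: x i m.

Let uxh i m : U i (Psi m) -> uline (@lherm R M (qlb Q i) m) (xh i m).
Proof. by move=> ui; apply: uline_scale; exact: ux. Qed.

Let psi_xh i j m : U i (Psi m) -> U j (Psi m) ->
  qpsi Q i j m = tens (dual_vec (tens (xh j m) (dual_vec (xh i m)))) (ah i j (Psi m)).
Proof.
move=> Ui Uj; rewrite (cP Ui Uj) -[in RHS](scale1r (ah i j (Psi m))).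
rewrite (tens_psi _ _ (ux Uj) (ux Ui) (pval_neq0 _) (pval_neq0 _)); congr (_ *: _).
rewrite mulr1 -pvalB; congr pval.
by rewrite -[LHS]subr0 -(cocycle (i0P m) Ui Uj); zmod.
Qed.

Definition quasi_frame_coord (xh : forall i m, lfiber (qlb Q i) m) (i : gidx Gb)
    (s : M -> phase R) (A : form M 1) (m : M) : Prop :=
  exists V e, [/\ lframe (qlb Q i) V e A, V m & forall m', V m' -> e m' = pval (s m') *: xh i m'].

Lemma quasi_scalar : scalar_preq U (@gform R G Gb) (frame_coord ah) om (quasi_frame_coord xh).
Proof.
split.
- move=> i m Ui; have [_ h2 h3 _] := lbQ i; have [V [e [A [fV Vm]]]] := h3 m Ui.
  have [_ VU eu _] := h2 _ _ _ fV.
  have ex m' : exists u : phase R, V m' -> e m' = pval u *: xh i m'.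
    have [Vm'|n] := pselect (V m'); last by exists 0.
    by have [u uE] := unit_scalar (uxh (VU m' Vm')) (eu m' Vm'); exists u.
  by have [s hs] := choice ex; exists s, A, V, e.
- move=> i s A m [V [e [fV Vm hs]]]; have [_ h2 _ _] := lbQ i; have [oV _ _ _] := h2 _ _ _ fV.
  by apply: filterS (open_nbhs_nbhs (conj oV Vm)) => m' Vm'; exists V, e.
- move=> i j s A s' A' t B m [V1 [e1 [f1 V1m h1]]] [V2 [e2 [f2 V2m h2]]] [V' [e' [f' V'm h']]].
  have [_ g1 _ _] := lbQ i; have [oV1 VU1 _ _] := g1 _ _ _ f1.
  have [_ g2 _ _] := lbQ j; have [oV2 VU2 _ _] := g2 _ _ _ f2.
  have oV' : open (Psi @^-1` V').
    have [_ hlb _ _ _] := hGb; have [[_ g3 _ _] _] := hlb i j; have [oV' _ _ _] := g3 _ _ _ f'.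
    by apply: open_comp => // q _; exact: cPsi.
  have [_ _ _ hp] := hQ; have par := hp i j.
  (* A frame of the bundle that contains psi, built from e1, e2 and e'. As psi is 1 in the
     trivialisations [xh] and [ah], its coordinate with respect to F is the phase S. *)
  pose F q := tens (dual_vec (tens (e2 q) (dual_vec (e1 q)))) (e' (Psi q)).
  pose AF := fadd (fopp (fadd A' (fopp A))) (form_pull Psi B).
  have fF : lframe (lb_tensor (lb_dual (lb_delta1 (qlb Q) i j)) (@glb R M (gerbe_pull Psi Gb) i j))
      ((V2 `&` V1) `&` (Psi @^-1` V')) F AF.
    exists (V2 `&` V1), (fun q => dual_vec (tens (e2 q) (dual_vec (e1 q)))), (fopp (fadd A' (fopp A))),
      (Psi @^-1` V'), (fun q => e' (Psi q)), (form_pull Psi B).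
    split=> //; last by exists V', e', B.
    exists (fun q => tens (e2 q) (dual_vec (e1 q))), (fadd A' (fopp A)); split=> //.
    exists V2, e2, A', V1, (fun q => dual_vec (e1 q)), (fopp A); split=> //.
    by exists e1, A.
  have [d [sd dE dd]] := par _ _ _ fF.
  set W := (_ `&` _ `&` _) in sd dE dd.
  have oW : open W by do !apply: openI => //; exact: openU.
  have Wm : W m by have ? := VU1 m V1m; have ? := VU2 m V2m.
  pose S q := s' q - s q - t (Psi q).
  have dS q : W q -> d q = pval (S q).
    move=> Wq; have [[Ui Uj] [[V2q V1q] V'q]] := Wq.
    have := dE q Wq; rewrite (psi_xh Ui Uj) /F h1 // h2 // h' //.
    rewrite (tens_psi _ _ (uxh Uj) (uxh Ui) (pval_neq0 _) (pval_neq0 _)) scalerA -[X in X = _ -> _]scale1r.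
    move=> /(scale_inj (uline_tens (uline_dual (uline_tens (uxh Uj) (uline_dual (uxh Ui)))) (uah Ui Uj))).
    rewrite -pvalB -pvalD => E.
    apply: (mulIf (pval_neq0 (s q - s' q + t (Psi q)))); rewrite -E -pvalD -pval0.
    by congr pval; rewrite /S; zmod.
  have P1 : Par S (fopp AF) m.
    apply: (Par_of hM oW Wm dS sd) => q v Wq.
    have := dd q v Wq => /eqP; rewrite addr_eq0 => /eqP ->.
    rewrite /form_app1 /fopp rmorphN /=; ring.
  apply: (Par_eq hM _ _ P1); apply: near_allT => q //.
  by move=> v; rewrite /form_app1 /AF /fadd /fopp; ring.
- move=> i s A m [V [e [fV Vm hs]]]; have [_ h2 _ _] := lbQ i; have [oV VU _ isA] := h2 _ _ _ fV.
  split; [exact: VU|exact: ((is_formP hM _ oV).1 isA)|move=> v].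
  have -> := herr fV v (conj (VU m Vm) Vm).
  by rewrite opprB addrC subrK.
Qed.

Lemma quasi_scalarise : exists QFr,
  scalar_preq U (@gform R G Gb) (frame_coord ah) om QFr.
Proof. by eexists; exact: quasi_scalar. Qed.

End Forward.

Section Backward.
Variables (om : form M 2) (QFr : gidx Gb -> (M -> phase R) -> form M 1 -> M -> Prop).
Hypothesis frame_ah : forall i j V e A, lframe (@glb R G Gb i j) V e A ->
  exists s : G -> phase R, forall m, V m -> e m = pval (s m) *: ah i j m.
Hypothesis sg : scalar_gerbe U (@gform R G Gb) (frame_coord ah).
Hypothesis sq : scalar_preq U (@gform R G Gb) (frame_coord ah) om QFr.

(** Every fibre is C and the bundle structure lies in the frames: the possibly discontinuous phases
    s of [QFr] are declared to be smooth unitary frames with connection form A. *)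
Definition scalar_lb (i : gidx Gb) : line_bundle M :=
  @LineBundle R M (fun=> C^o) (fun=> @std_herm R)
    (fun V f A => [/\ open V, V `<=` Psi @^-1` U i, is_form V A &
       exists s, forall m, V m -> f m = pval (s m) /\ QFr i s A m]).

Definition scalar_qlb : quasi_line_bundle (gerbe_pull Psi Gb) :=
  @QuasiLineBundle R M (gerbe_pull Psi Gb) scalar_lb
    (fun i j m => tens (dual_vec (tens (1 : C^o) (dual_vec (1 : C^o)))) (ah i j (Psi m))).

Lemma scalar_lb_line i : is_line_bundle (Psi @^-1` U i) (scalar_lb i).
Proof.
have [Q1 Q2 Q3 Q4] := sq; split.
- by move=> m _; split; [rewrite dimvf|exact: std_herm_inner].
- move=> V e A [oV VU isA [s hs]]; split=> // m Vm.
  by rewrite /= /std_herm (hs m Vm).1 phaseP.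
- move=> m Ui; have [s [A q]] := Q1 i m Ui.
  have : nbhs m [set m' | QFr i s A m'] by exact: Q2 q.
  rewrite nbhsE => -[V [oV Vm] VQ].
  exists V, (fun m => pval (s m) : C^o), A; split=> //; split=> //.
  + by move=> m' /VQ/Q4[].
  + by apply/(is_formP hM _ oV) => m' /VQ/Q4[].
  + by exists s => m' /VQ.
- move=> V e A V' e' A' [oV VU isA [s hs]] [oV' _ isA' [s' hs']].
  have oVV := openI oV oV'.
  (* For equal indices the comparison clause involves a frame t of L_ii. By the cocycle clause at
     (i, i, i) this t has connection form B in the sense of [Par], so it can be added back. *)
  have main q : (V `&` V') q -> Par (fun x => s' x - s x) (fadd A' (fopp A)) q.
    move=> [Vq V'q]; have Uq := VU q Vq.
    have [S1 _ _ S4 _] := sg; have [t [B fB]] := S1 i i _ Uq Uq.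
    have h1 := Q3 _ _ _ _ _ _ _ _ _ (hs q Vq).2 (hs' q V'q).2 fB.
    have h2 := Par_pull hM hG (@near_allT M q _ sPsi) (S4 _ _ _ _ _ _ _ _ _ _ fB fB fB).
    apply: (Par_eq hM _ _ (Par_add hM h1 h2)); apply: near_allT => x /=; first by zmod.
    by move=> v; rewrite /form_app1 /form_pull /fadd /fopp; ring.
  exists (fun q => pval (s' q - s q)); split.
  + by apply/(csmoothP hM _ oVV) => q /main/nbhs_singleton[].
  + move=> q [Vq V'q]; rewrite (hs q Vq).1 (hs' q V'q).1 pvalB.
    by rewrite -[RHS]/(_ * _) divfK // pval_neq0.
  + by move=> q v /main/nbhs_singleton[_ ->].
Qed.

(** A frame of the bundle of psi unfolds into frames s of E_j, t of E_i and u of L_ij; the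
    coordinate of psi is the phase s - t - u, whose connection form the comparison clause
    provides. *)
Lemma scalar_psi i j V F AF :
  lframe (lb_tensor (lb_dual (lb_delta1 scalar_lb i j)) (lb_pull Psi (@glb R G Gb i j))) V F AF ->
  open V /\ exists S, forall m, V m -> [/\ qpsi scalar_qlb i j m = pval (S m) *: F m,
    Par S (fopp AF) m & U i (Psi m) /\ U j (Psi m)].
Proof.
have [Q1 Q2 Q3 Q4] := sq.
move=> [V1 [f1 [A1 [V2 [f2 [A2 [fr1 fr2 -> hF]]]]]]].
have [g [Ag [frg hg]]] := fr1.
have [Va [e1 [B1 [Vb [e2 [B2 [fra frb VE hg2]]]]]]] := frg.
have [e3 [B3 [fr3 h3]]] := frb.
have [V' [e' [A' [fr' V2E h']]]] := fr2.
have [oa aU _ [s hs]] := fra; have [ob bU _ [t ht]] := fr3.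
have [_ hlb _ _ _] := hGb; have [[_ g3 _ _] _] := hlb i j; have [oV' _ _ _] := g3 _ _ _ fr'.
have oV1 : open V1 by rewrite VE; exact: openI.
have oV2 : open V2 by rewrite V2E; apply: open_comp => // q _; exact: cPsi.
split; first exact: openI.
have [u hu] := frame_ah fr'.
exists (fun m => s m - t m - u (Psi m)) => m [V1m V2m].
have [Vam Vbm] : (Va `&` Vb) m by rewrite -VE.
have V'm : V' (Psi m) by rewrite -[V' _]/((Psi @^-1` V') m) -V2E.
have Ui := bU m Vbm; have Uj := aU m Vam; split=> //.
  rewrite (hF m (conj V1m V2m)).1 (hg m V1m).1 (hg2 m V1m).1 (h3 m Vbm).1 (h' m V2m).1 hu //.
  by rewrite (hs m Vam).1 (ht m Vbm).1; exact: tens_psi_phase.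
have fr : frame_coord ah i j u A' (Psi m) by exists V', e'.
have P1 := Q3 _ _ _ _ _ _ _ _ _ (ht m Vbm).2 (hs m Vam).2 fr.
apply: (Par_eq hM _ _ P1); first exact: near_allT.
have nV : \forall q \near m, V1 q /\ V2 q.
  by apply: (open_nbhs_nbhs (A := V1 `&` V2)); split=> //; exact: openI.
apply: filterS nV => q [V1q V2q] v.
have [Vaq Vbq] : (Va `&` Vb) q by rewrite -VE.
rewrite /form_app1 /fopp /fadd (hF q (conj V1q V2q)).2 (hg q V1q).2 (hg2 q V1q).2 (h3 q Vbq).2 (h' q V2q).2.
ring.
Qed.

Lemma scalar_quasi : is_quasi_line_bundle scalar_qlb.
Proof.
split.
- exact: scalar_lb_line.
- move=> i j; split; last first.
    move=> m [Ui Uj]; have [_ _ h] := (uline_tens (uline_dual (uline_tens (@uline_std R) (uline_dual (@uline_std R)))) (uah Ui Uj)); exact: h.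
  move=> V F AF fF; have [oV [S hS]] := scalar_psi fF.
  exists (fun m => pval (S m)); split; last by move=> m [_ Vm]; have [] := hS m Vm.
  apply/(csmoothP hM) => [|q [_ Vq]]; first by apply: openI => //; apply: openI; exact: openU.
  by have [_ /nbhs_singleton[]] := hS q Vq.
- move=> i j k m Ui Uj Uk e a [ei ej ek] [aij aik ajk] c0 c1 c2.
  have [sij _ _] := uah Ui Uj; have [sik _ _] := uah Ui Uk; have [sjk _ _] := uah Uj Uk.
  have [yij Eij] := sij (a i j); have [yik Eik] := sik (a i k); have [yjk Ejk] := sjk (a j k).
  have nij : yij != 0 by apply: contraNneq aij => y0; rewrite Eij y0 scale0r.
  have nik : yik != 0 by apply: contraNneq aik => y0; rewrite Eik y0 scale0r.
  have njk : yjk != 0 by apply: contraNneq ajk => y0; rewrite Ejk y0 scale0r.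
  (* As psi is 1 by construction, its coordinate c is determined by the vectors chosen in E and
     L. *)
  have main i' j' y c : U i' (Psi m) -> U j' (Psi m) -> e i' != 0 -> e j' != 0 ->
      a i' j' = y *: ah i' j' (Psi m) -> psi_coord (Q := scalar_qlb) e a i' j' c ->
      1 = c * (e i' / e j' * y) :> C.
    move=> Ui' Uj' ei' ej' aE; rewrite /psi_coord aE.
    exact: (tens_psi1_coord (uah Ui' Uj') ej' ei').
  move=> /(main _ _ _ _ Uj Uk ej ek Ejk) E0 /(main _ _ _ _ Ui Uk ei ek Eik) E1 /(main _ _ _ _ Ui Uj ei ej Eij) E2.
  rewrite /theta_coord /= Eij Eik Ejk (tens_theta _ _ _ _ (uah Ui Uk) nik) scalerA.
  rewrite thah // -[LHS]scale1r; congr (_ *: _).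
  have X0 : c0 = (e j / e k * yjk)^-1 by apply: (mulIf (x := e j / e k * yjk)); rewrite ?mulVf -?E0 // !mulf_neq0 ?invr_neq0.
  have X1 : c1 = (e i / e k * yik)^-1 by apply: (mulIf (x := e i / e k * yik)); rewrite ?mulVf -?E1 // !mulf_neq0 ?invr_neq0.
  have X2 : c2 = (e i / e j * yij)^-1 by apply: (mulIf (x := e i / e j * yij)); rewrite ?mulVf -?E2 // !mulf_neq0 ?invr_neq0.
  rewrite X0 X1 X2.
  move: (e i : C) (e j : C) (e k : C) ei ej ek => xi xj xk ei ej ek.
  by field; rewrite nij nik njk ei ej ek.
- move=> i j V F AF fF; have [oV [S hS]] := scalar_psi fF.
  exists (fun m => pval (S m)); split.
  + apply/(csmoothP hM) => [|q [_ Vq]]; first by apply: openI => //; apply: openI; exact: openU.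
    by have [_ /nbhs_singleton[]] := hS q Vq.
  + by move=> m [_ Vm]; have [] := hS m Vm.
  + move=> m v [_ Vm]; have [_ /nbhs_singleton[_ ->] _] := hS m Vm.
    rewrite /form_app1 /fopp rmorphN /=; ring.
Qed.

Lemma scalar_error : has_error_form scalar_qlb om.
Proof.
have [_ _ _ Q4] := sq.
move=> i V e A [oV VU isA [s hs]] m v [_ Vm].
have [_ _ ->] := Q4 _ _ _ _ (hs m Vm).2.
by rewrite opprB addrC subrK.
Qed.

End Backward.

End ScalarPreq.

Lemma near_and (X : topologicalType) (x : X) (P Q : X -> Prop) :
  (\forall y \near x, P y) -> (\forall y \near x, Q y) -> \forall y \near x, P y /\ Q y.
Proof. by move=> h h'; apply: filterS2 h h' => y; split. Qed.

(** * The fusion gerbe on G x G *)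

Section FusionGerbe.
Context {R : realType}.
Variables (G : lie_group R) (hG : is_lie_group G).
Variable B : lie_alg G -> lie_alg G -> R.
Hypothesis hB : invariant_inner_product B.
Local Notation "a ** b" := (@lmul R G a b) (at level 40, left associativity).
Local Notation PG := (prod_manifold G G).
Local Notation e := (lone G).
Let aG := lie_atlas hG.
Let aP := atlas_prod aG aG.

Variables (I : Type) (U : I -> set G) (w : I -> form G 2).
Variable Fr : I -> I -> (G -> phase R) -> form G 1 -> G -> Prop.
Hypotheses (openU : forall i, open (U i)) (coverU : forall g, exists i, U i g).
Hypotheses (formw : forall i g, U i g -> sform (w i) g).
Hypothesis curvw : forall i g v, U i g -> dform (w i) g v = @canonical3 R G B g v.
Hypothesis sg : scalar_gerbe U w Fr.

Let mult (p : PG) : G := p.1 ** p.2.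

Let smult (p : PG) : smap mult p. Proof. exact: smap_mul. Qed.
Let sfst (p : PG) : @smap R PG G fst p. Proof. exact: smap_fst. Qed.
Let ssnd (p : PG) : @smap R PG G snd p. Proof. exact: smap_snd. Qed.

(** The indices choose sheets of Gb over the two factors and over their product; [mA] is a
    connection form whose curvature is the resulting closed 2-form. *)
Record model := Model { mi : I; mj : I; mk : I; mA : form PG 1 }.

Definition mdom (a : model) (p : PG) := [/\ U (mi a) p.1, U (mj a) p.2 & U (mk a) (mult p)].

(** The 2-form of Mult^* Gb - pr_1^* Gb - pr_2^* Gb on the chosen sheets, with (1/2) beta added. *)
Definition mform (a : model) : form PG 2 :=
  fadd (fadd (form_pull mult (w (mk a))) (fopp (@form_pull R PG G fst 2 (w (mi a)))))
       (fadd (fopp (@form_pull R PG G snd 2 (w (mj a)))) (fscale 2^-1 (@beta R G B))).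

Lemma mdom_near a p : mdom a p -> \forall q \near p, mdom a q.
Proof.
move=> [h1 h2 h3].
have n1 : \forall q \near p, U (mi a) q.1 := (sfst p).1 _ (open_nbhs_nbhs (conj (openU _) h1)).
have n2 : \forall q \near p, U (mj a) q.2 := (ssnd p).1 _ (open_nbhs_nbhs (conj (openU _) h2)).
have n3 : \forall q \near p, U (mk a) (mult q) := (smult p).1 _ (open_nbhs_nbhs (conj (openU _) h3)).
by apply: filterS3 n1 n2 n3 => q ? ? ?; split.
Qed.

(** On each sheet the derivative of w is the canonical 3-form, so the claim is [canonical3_mul]. *)
Lemma mform_closed a p : mdom a p -> sform (mform a) p /\ forall v, dform (mform a) p v = 0.
Proof.
move=> [h1 h2 h3].
have s1 : sform (form_pull mult (w (mk a))) p.
  by apply: (sform_pull aP aG _ (formw h3)); exact: (@near_allT PG).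
have s2 : sform (@form_pull R PG G fst 2 (w (mi a))) p.
  by apply: (sform_pull aP aG _ (formw h1)); exact: (@near_allT PG).
have s3 : sform (@form_pull R PG G snd 2 (w (mj a))) p.
  by apply: (sform_pull aP aG _ (formw h2)); exact: (@near_allT PG).
have s4 := sform_beta hG hB p.
have s2' := sform_opp s2; have s3' := sform_opp s3; have s4' := sform_scale 2^-1 s4.
have s12 := sform_add s1 s2'; have s34 := sform_add s3' s4'.
split; first exact: sform_add.
move=> v; rewrite (dform_add v s12 s34) (dform_add v s1 s2') (dform_add v s3' s4').
have D1 : dform (form_pull mult (w (mk a))) p v = form_pull mult (@canonical3 R G B) p v :=
  etrans (congr1 (fun f => f v) (form_pull_dform2 aP aG (@near_allT PG _ _ smult) (formw h3)))
    (curvw _ h3).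
have D2 : dform (@form_pull R PG G fst 2 (w (mi a))) p v = @form_pull R PG G fst 3 (@canonical3 R G B) p v :=
  etrans (congr1 (fun f => f v) (form_pull_dform2 aP aG (@near_allT PG _ _ sfst) (formw h1)))
    (curvw _ h1).
have D3 : dform (@form_pull R PG G snd 2 (w (mj a))) p v = @form_pull R PG G snd 3 (@canonical3 R G B) p v :=
  etrans (congr1 (fun f => f v) (form_pull_dform2 aP aG (@near_allT PG _ _ ssnd) (formw h2)))
    (curvw _ h2).
exact: (etrans (congr2 +%R (congr2 +%R D1 (etrans (dform_opp v s2) (congr1 -%R D2)))
  (congr2 +%R (etrans (dform_opp v s3) (congr1 -%R D3)) (dform_scale 2^-1 v s4)))
  (etrans (addrA _ _ _) (canonical3_mul hG hB p v))).
Qed.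

Definition mD (a : model) : set (G * G) := [set p : PG | \forall q \near p,
  [/\ mdom a q, sform (mA a) q & forall v, dform (mA a) q v = mform a q v]].

(* p is an isomorphism between the local trivialisations a and b of the gerbe
   Mult^* Gb - pr_1^* Gb - pr_2^* Gb near z *)
Definition mcmp (a b : model) (z : G * G) (p : G * G -> phase R) : Prop :=
  [/\ mD a z, mD b z & exists e1 A1 e2 A2 e3 A3,
    [/\ Fr (mi a) (mi b) e1 A1 z.1, Fr (mj a) (mj b) e2 A2 z.2,
        Fr (mk a) (mk b) e3 A3 (mult z) &
        @Par R PG (fun x => p x + e1 x.1 + e2 x.2 - e3 (mult x))
          (fadd (fadd (mA b) (fopp (mA a)))
            (fadd (fadd (@form_pull R PG G fst 1 A1) (@form_pull R PG G snd 1 A2))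
              (fopp (form_pull mult A3)))) z]].

(** The cocycle clause at (i, i, i) trivialises L_ii. *)
Let Fr_diag i s A g : Fr i i s A g -> Par s A g.
Proof.
have [_ _ _ S4 _] := sg; move=> f.
apply: (Par_eq aG _ _ (S4 _ _ _ _ _ _ _ _ _ _ f f f)); apply: near_allT => x; first by zmod.
by move=> v; rewrite /form_app1 /fadd /fopp; ring.
Qed.

Let pfst s A (z : PG) : @Par R G s A z.1 -> @Par R PG (fun x => s x.1) (@form_pull R PG G fst 1 A) z.
Proof. exact: (Par_pull aP aG (@near_allT PG _ _ sfst)). Qed.
Let psnd s A (z : PG) : @Par R G s A z.2 -> @Par R PG (fun x => s x.2) (@form_pull R PG G snd 1 A) z.
Proof. exact: (Par_pull aP aG (@near_allT PG _ _ ssnd)). Qed.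
Let pmult s A (z : PG) : @Par R G s A (mult z) -> @Par R PG (fun x => s (mult x)) (form_pull mult A) z.
Proof. exact: (Par_pull aP aG (@near_allT PG _ _ smult)). Qed.

Lemma mD_open a : open (mD a).
Proof. by rewrite openE => p h; exact: nbhs_interior. Qed.

Lemma mD_mdom a z : mD a z -> mdom a z.
Proof. by move=> /nbhs_singleton[]. Qed.

Lemma model_exists i j k z : U i z.1 -> U j z.2 -> U k (mult z) ->
  exists A, mD (Model i j k A) z.
Proof.
move=> h1 h2 h3; pose a0 := Model i j k (fun _ _ => 0).
have md : mdom a0 z by [].
have : \forall q \near z, sform (mform a0) q /\ forall v, dform (mform a0) q v = 0.
  by apply: filterS (mdom_near md) => q; exact: mform_closed.
move=> /(closed_form2_primitive aP)[A hA]; exists A.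
apply: filterS2 (mdom_near md) hA => q mq [sA dA]; split=> //.
by move=> v; rewrite dA.
Qed.

(** Models on different sheets are compared by a phase whose connection form combines mA b - mA a
    with the connection forms of frames of Gb. This form is closed: d mA is the 2-form of the model,
    and a change of sheets alters that 2-form by the curvatures of the frames. So [Par_exists] gives
    the phase. The other clauses follow from the cocycle properties of Gb. *)
Lemma fusion_flat_gerbe : flat_gerbe mD mcmp.
Proof.
have [S1 S2 S3 S4 S5] := sg; split.
- split; first exact: mD_open.
  move=> z; have [i hi] := coverU z.1; have [j hj] := coverU z.2; have [k hk] := coverU (mult z).
  by have [A hA] := model_exists hi hj hk; exists (Model i j k A).
- move=> a b z Da Db.
  have [a1 a2 a3] := mD_mdom Da; have [b1 b2 b3] := mD_mdom Db.
  have [e1 [A1 f1]] := S1 _ _ _ a1 b1.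
  have [e2 [A2 f2]] := S1 _ _ _ a2 b2.
  have [e3 [A3 f3]] := S1 _ _ _ a3 b3.
  have nf1 : \forall q \near z, Fr (mi a) (mi b) e1 A1 q.1 := (sfst z).1 _ (S2 _ _ _ _ _ f1).
  have nf2 : \forall q \near z, Fr (mj a) (mj b) e2 A2 q.2 := (ssnd z).1 _ (S2 _ _ _ _ _ f2).
  have nf3 : \forall q \near z, Fr (mk a) (mk b) e3 A3 (mult q) := (smult z).1 _ (S2 _ _ _ _ _ f3).
  pose P1 := @form_pull R PG G fst 1 A1; pose P2 := @form_pull R PG G snd 1 A2.
  pose P3 := form_pull mult A3.
  pose AF := fadd (fadd (mA b) (fopp (mA a))) (fadd (fadd P1 P2) (fopp P3)).
  have cl : \forall q \near z, sform AF q /\ forall v, dform AF q v = 0.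
    have nab := near_and (Da : \forall q \near z, _) (Db : \forall q \near z, _).
    apply: filterS2 (near_and nf1 (near_and nf2 nf3)) nab => q [g1 [g2 g3]] [[_ sa da] [_ sb db]].
    have [_ _ t1 d1] := S5 _ _ _ _ _ g1; have [_ _ t2 d2] := S5 _ _ _ _ _ g2.
    have [_ _ t3 d3] := S5 _ _ _ _ _ g3.
    have p1 : sform P1 q by apply: (sform_pull aP aG _ t1); exact: (@near_allT PG).
    have p2 : sform P2 q by apply: (sform_pull aP aG _ t2); exact: (@near_allT PG).
    have p3 : sform P3 q by apply: (sform_pull aP aG _ t3); exact: (@near_allT PG).
    have sa' := sform_opp sa; have p3' := sform_opp p3.
    have q1 := sform_add sb sa'; have q2 := sform_add p1 p2; have q3 := sform_add q2 p3'.
    split; first exact: sform_add.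
    move=> v; rewrite (dform_add v q1 q3) (dform_add v sb sa') (dform_add v q2 p3').
    rewrite (dform_add v p1 p2) (dform_opp v sa) (dform_opp v p3) da db.
    rewrite (form_pull_dform1 aP aG (@near_allT PG _ _ sfst) t1).
    rewrite (form_pull_dform1 aP aG (@near_allT PG _ _ ssnd) t2).
    rewrite (form_pull_dform1 aP aG (@near_allT PG _ _ smult) t3).
    rewrite /form_pull d1 d2 d3.
    have comb (x1 x2 x3 y1 y2 y3 c : R) : (x3 + - x1 + (- x2 + c)) + - (y3 + - y1 + (- y2 + c))
        + ((x1 - y1) + (x2 - y2) + - (x3 - y3)) = 0 by ring.
    exact: comb.
  have [s hs] := Par_exists aP cl.
  exists (fun x => s x - e1 x.1 - e2 x.2 + e3 (mult x)); split=> //.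
  exists e1, A1, e2, A2, e3, A3; split=> //.
  by apply: (Par_eq aP _ _ hs); apply: (@near_allT PG) => // x; zmod.
- split.
    move=> a z Da; have [a1 a2 a3] := mD_mdom Da.
    have [e1 [A1 f1]] := S1 _ _ _ a1 a1; have [e2 [A2 f2]] := S1 _ _ _ a2 a2.
    have [e3 [A3 f3]] := S1 _ _ _ a3 a3.
    split=> //; exists e1, A1, e2, A2, e3, A3; split=> //.
    have h := Par_add aP (Par_add aP (pfst (Fr_diag f1)) (psnd (Fr_diag f2)))
      (Par_opp aP (pmult (Fr_diag f3))).
    apply: (Par_eq aP _ _ h); apply: (@near_allT PG) => x; first by zmod.
    by move=> v; rewrite /form_app1 /fadd /fopp; ring.
  split.
    move=> a b z p [Da Db [e1 [A1 [e2 [A2 [e3 [A3 [f1 f2 f3 hp]]]]]]]].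
    have [a1 a2 a3] := mD_mdom Da; have [b1 b2 b3] := mD_mdom Db.
    have [e1' [A1' f1']] := S1 _ _ _ b1 a1; have [e2' [A2' f2']] := S1 _ _ _ b2 a2.
    have [e3' [A3' f3']] := S1 _ _ _ b3 a3.
    (* A frame of L_ij and one of L_ji are compared with a frame of L_ii, which [Fr_diag]
       trivialises. *)
    have [t1 [C1 g1]] := S1 _ _ _ a1 a1; have [t2 [C2 g2]] := S1 _ _ _ a2 a2.
    have [t3 [C3 g3]] := S1 _ _ _ a3 a3.
    split=> //; exists e1', A1', e2', A2', e3', A3'; split=> //.
    have h1 := pfst (Par_add aG (S4 _ _ _ _ _ _ _ _ _ _ f1 f1' g1) (Fr_diag g1)).
    have h2 := psnd (Par_add aG (S4 _ _ _ _ _ _ _ _ _ _ f2 f2' g2) (Fr_diag g2)).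
    have h3 := pmult (Par_add aG (S4 _ _ _ _ _ _ _ _ _ _ f3 f3' g3) (Fr_diag g3)).
    have h := Par_add aP (Par_opp aP hp) (Par_add aP (Par_add aP h1 h2) (Par_opp aP h3)).
    apply: (Par_eq aP _ _ h); apply: (@near_allT PG) => x; first by cbv beta; zmod.
    by move=> v; rewrite /form_app1 /fadd /fopp /form_pull; ring.
  move=> a b c z p q [Da Db [e1 [A1 [e2 [A2 [e3 [A3 [f1 f2 f3 hp]]]]]]]].
  move=> [_ Dc [e1' [A1' [e2' [A2' [e3' [A3' [f1' f2' f3' hq]]]]]]]].
  have [a1 a2 a3] := mD_mdom Da; have [c1 c2 c3] := mD_mdom Dc.
  have [t1 [C1 g1]] := S1 _ _ _ a1 c1; have [t2 [C2 g2]] := S1 _ _ _ a2 c2.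
  have [t3 [C3 g3]] := S1 _ _ _ a3 c3.
  split=> //; exists t1, C1, t2, C2, t3, C3; split=> //.
  have h1 := pfst (S4 _ _ _ _ _ _ _ _ _ _ f1 f1' g1).
  have h2 := psnd (S4 _ _ _ _ _ _ _ _ _ _ f2 f2' g2).
  have h3 := pmult (S4 _ _ _ _ _ _ _ _ _ _ f3 f3' g3).
  have h := Par_add aP (Par_add aP hp hq) (Par_add aP (Par_opp aP (Par_add aP h1 h2)) h3).
  apply: (Par_eq aP _ _ h); apply: (@near_allT PG) => x; first by cbv beta; zmod.
  by move=> v; rewrite /form_app1 /fadd /fopp /form_pull; ring.
- move=> a b z p [Da Db [e1 [A1 [e2 [A2 [e3 [A3 [f1 f2 f3 hp]]]]]]]].
  have nf1 : \forall q \near z, Fr (mi a) (mi b) e1 A1 q.1 := (sfst z).1 _ (S2 _ _ _ _ _ f1).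
  have nf2 : \forall q \near z, Fr (mj a) (mj b) e2 A2 q.2 := (ssnd z).1 _ (S2 _ _ _ _ _ f2).
  have nf3 : \forall q \near z, Fr (mk a) (mk b) e3 A3 (mult q) := (smult z).1 _ (S2 _ _ _ _ _ f3).
  have nDa : \forall q \near z, mD a q := nbhs_interior Da.
  have nDb : \forall q \near z, mD b q := nbhs_interior Db.
  apply: filterS3 (near_and nf1 (near_and nf2 nf3)) (near_and nDa nDb) (Par_near hp).
  move=> q [g1 [g2 g3]] [Daq Dbq] pq; split=> //.
  by exists e1, A1, e2, A2, e3, A3; split.
- move=> a b z p q [Da Db [e1 [A1 [e2 [A2 [e3 [A3 [f1 f2 f3 hp]]]]]]]]; split.
    move=> [_ _ [e1' [A1' [e2' [A2' [e3' [A3' [f1' f2' f3' hq]]]]]]]].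
    have h1 := pfst (S3 _ _ _ _ _ _ _ f1 f1').
    have h2 := psnd (S3 _ _ _ _ _ _ _ f2 f2').
    have h3 := pmult (S3 _ _ _ _ _ _ _ f3 f3').
    have h := Par_add aP (Par_add aP hq (Par_opp aP hp)) (Par_add aP (Par_opp aP (Par_add aP h1 h2)) h3).
    have h' : @Par R PG (fun x => q x - p x) (fun _ _ => 0) z.
      apply: (Par_eq aP _ _ h); apply: (@near_allT PG) => x; first by cbv beta; zmod.
      by move=> v; rewrite /form_app1 /fadd /fopp /form_pull; ring.
    by apply: (Par_lc aP h'); exact: (@near_allT PG).
  move=> l; split=> //; exists e1, A1, e2, A2, e3, A3; split=> //.
  have l' : @Par R PG (fun x => q x - p x) (fun _ _ => 0) z.
    by apply: (lc_Par aP l); exact: (@near_allT PG).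
  apply: (Par_eq aP _ _ (Par_add aP hp l')); apply: (@near_allT PG) => x; first by cbv beta; zmod.
  by move=> v; rewrite /form_app1 /fadd /fopp; ring.
Qed.


Let cmp_gerbe := fusion_flat_gerbe.

Section SliceSection.
Variables (iota : G -> PG) (good : model -> Prop).
Hypothesis siota : forall g, smap iota g.
Hypothesis good_exists : forall g, exists2 a, good a & mD a (iota g).
Hypothesis good_form : forall a g v, good a -> mD a (iota g) -> form_pull iota (mform a) g v = 0.
Hypothesis good_cmp : forall a b e1 A1 e2 A2 e3 A3 g, good a -> good b ->
  Fr (mi a) (mi b) e1 A1 (iota g).1 -> Fr (mj a) (mj b) e2 A2 (iota g).2 ->
  Fr (mk a) (mk b) e3 A3 (mult (iota g)) ->
  @Par R G (fun x => e1 (iota x).1 + e2 (iota x).2 - e3 (mult (iota x)))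
    (form_pull iota (fadd (fadd (@form_pull R PG G fst 1 A1) (@form_pull R PG G snd 1 A2))
              (fopp (form_pull mult A3)))) g.

(** For a good model the 2-form vanishes along the slice, so the pull-back of [mA] is closed and
    integrates to a phase s g. The shift by s g compensates [mA], and [good_cmp] says that the
    frames of Gb compensate each other. *)
Lemma slice_section : exists s, sec mD mcmp iota setT s.
Proof.
have [A0 hA] := choice (fun g => (let: ex_intro2 a h1 h2 := good_exists g in
  ex_intro _ a (conj h1 h2)) : exists a, good a /\ mD a (iota g)).
have near_mD g : \forall g' \near g, mD (A0 g) (iota g').
  exact: (siota g).1 _ (nbhs_interior (hA g).2).
have ex_s g : exists s, Par s (form_pull iota (mA (A0 g))) g.
  apply: (Par_exists aG); apply: filterS (near_mD g) => g' Dg'.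
  have [_ sA dA] := nbhs_singleton Dg'.
  split; first by apply: (sform_pull aG aP _ sA); exact: (@near_allT G).
  move=> v; rewrite (form_pull_dform1 aG aP (@near_allT G _ _ siota) sA).
  by rewrite /form_pull dA; exact: (good_form v (hA g).1 Dg').
have [s hs] := choice ex_s.
exists (fun g => (A0 g, s g)) => g _; split; first exact: (hA g).2.
apply: filterS2 (near_mD g) (Par_near (hs g)) => g' Dg' pg' _.
have [_ cex _ _ _] := cmp_gerbe.
have [p cp] := cex _ _ _ Dg' (hA g').2.
exists p => //=; have [_ _ [e1 [A1 [e2 [A2 [e3 [A3 [f1 f2 f3 hp]]]]]]]] := cp.
have h1 := Par_pull aG aP (@near_allT G _ _ siota) hp.
have h2 := good_cmp (hA g).1 (hA g').1 f1 f2 f3.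
have h := Par_add aG (Par_add aG (hs g') (Par_opp aG pg')) (Par_add aG (Par_opp aG h1) h2).
have h' : @Par R G (fun x => s g' x - s g x - p (iota x) - 0) (fun _ _ => 0) g'.
  apply: (Par_eq aG _ _ h); apply: (@near_allT G) => x; first by rewrite /=; zmod.
  by move=> v; rewrite /form_app1 /fadd /fopp /form_pull; ring.
by apply: (Par_lc aG h'); exact: (@near_allT G).
Qed.

End SliceSection.

Let form_pull_id (k : nat) (A : form G k) g : form_pull id A g = A g.
Proof.
apply/funext => v; rewrite /form_pull; congr (A _ _); apply/funext => i.
exact: mdiff_id.
Qed.

Let cst_form k (iota : G -> PG) (pr : PG -> G) (A : form G k.+1) g :
  (forall g, smap iota g) -> (forall p, smap pr p) -> pr \o iota = (fun=> e) ->
  multilinear_form (A e) -> form_pull iota (form_pull pr A) g = fun=> 0.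
Proof.
move=> s1 s2 E mA0; rewrite -(form_pull_comp aG aP A (s1 g) (s2 _)) E.
exact: form_pull_cst.
Qed.

Let id_form k (iota : G -> PG) (pr : PG -> G) (A : form G k) g :
  (forall g, smap iota g) -> (forall p, smap pr p) -> pr \o iota = id ->
  form_pull iota (form_pull pr A) g = A g.
Proof.
by move=> s1 s2 E; rewrite -(form_pull_comp aG aP A (s1 g) (s2 _)) E form_pull_id.
Qed.

Let in1 (g : G) : PG := (g, e).
Let in2 (g : G) : PG := (e, g).
Let sin1 g : smap in1 g.
Proof. by apply: smap_pair; [exact: smap_id|exact: smap_cst]. Qed.
Let sin2 g : smap in2 g.
Proof. by apply: smap_pair; [exact: smap_cst|exact: smap_id]. Qed.
Let mult1 : mult \o in1 = id.
Proof. by apply/funext => g; rewrite /= /mult /= (rmul1 hG). Qed.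
Let mult2 : mult \o in2 = id.
Proof. by apply/funext => g; rewrite /= /mult /= (lmul1 hG). Qed.

Let beta_in1 g v : form_pull in1 (@beta R G B) g v = 0.
Proof.
have z u : thetaR (in1 g).2 (@mdiff R PG G snd (in1 g) (mdiff in1 g u)) = 0.
  rewrite -(mdiff_comp aG aP u (sin1 g) (ssnd _)) [mdiff _ _ _]mdiff_cst.
  by rewrite /thetaR /mdiff linear0.
have b0 x : B x (0 : 'rV[R]_(mdim G)) = 0.
  by rewrite -[0 in LHS](scale0r 0) (inner_Zr hB) mul0r.
by rewrite /form_pull /beta !z !b0 subrr.
Qed.

Let beta_in2 g v : form_pull in2 (@beta R G B) g v = 0.
Proof.
have z u : thetaL (in2 g).1 (@mdiff R PG G fst (in2 g) (mdiff in2 g u)) = 0.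
  rewrite -(mdiff_comp aG aP u (sin2 g) (sfst _)) [mdiff _ _ _]mdiff_cst.
  by rewrite /thetaL /mdiff linear0.
have b0 x : B (0 : 'rV[R]_(mdim G)) x = 0.
  by rewrite -[0 in LHS](scale0r 0) (inner_Zl hB) mul0r.
by rewrite /form_pull /beta !z !b0 subrr.
Qed.

Let sform_multilin k (A : form G k) g : sform A g -> multilinear_form (A g).
Proof. by move=> [/nbhs_singleton[]]. Qed.

(** On G x {e} multiplication is the first projection. With k = i the sheets over the product and
    over the first factor cancel, and what comes from the second factor and from beta is pulled back
    by a constant map. *)
Lemma section_in1 : exists s, sec mD mcmp in1 setT s.
Proof.
have [S1 S2 S3 S4 S5] := sg.
apply: (@slice_section in1 (fun a => mk a = mi a)) => //.
- move=> g; have [i hi] := coverU g; have [j hj] := coverU e.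
  have hk : U i (mult (in1 g)) by rewrite /mult /= (rmul1 hG).
  by have [A hA] := @model_exists i j i (in1 g) hi hj hk; exists (Model i j i A).
- move=> a g v ga /mD_mdom[h1 h2 h3].
  have m2 : multilinear_form (w (mj a) e) by exact: sform_multilin (formw h2).
  have E1 := congr1 (fun f => f v) (id_form (w (mk a)) g sin1 smult mult1).
  have E2 := congr1 (fun f => f v) (id_form (w (mi a)) g sin1 sfst erefl).
  have E3 := congr1 (fun f => f v) (cst_form (k := 1) g sin1 ssnd erefl m2).
  have E4 := beta_in1 g v.
  apply: (etrans (congr2 +%R (congr2 +%R E1 (congr1 -%R E2))
    (congr2 +%R (congr1 -%R E3) (congr1 ( *%R 2^-1) E4)))).
  by rewrite ga subrr oppr0 mulr0 !addr0.
- move=> a b e1 A1 e2 A2 e3 A3 g ga gb f1 f2 f3.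
  have f3' : Fr (mi a) (mi b) e3 A3 g.
    by move: f3; rewrite ga gb -[mult _]/((mult \o in1) g) mult1.
  have h := Par_add aG (Par_opp aG (S3 _ _ _ _ _ _ _ f1 f3')) (lc_Par aG (lc_cst (e2 e) g)
    (near_allT _ (fun q v => erefl : form_app1 (fun _ _ => 0) q v = 0))).
  apply: (Par_eq aG _ _ h); apply: (@near_allT G) => x.
    by rewrite /= -[mult _]/((mult \o in1) x) mult1; zmod.
  move=> v; have [_ _ /sform_multilin m2 _] := S5 _ _ _ _ _ f2.
  have E1 := congr1 (fun f => f (fun=> v)) (id_form A3 x sin1 smult mult1).
  have E2 := congr1 (fun f => f (fun=> v)) (id_form A1 x sin1 sfst erefl).
  have E3 := congr1 (fun f => f (fun=> v)) (cst_form (k := 0) x sin1 ssnd erefl m2).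
  apply/esym; apply: (etrans (congr2 +%R (congr2 +%R E2 E3) (congr1 -%R E1))).
  by rewrite /form_app1 /fadd /fopp; ring.
Qed.

Lemma section_in2 : exists s, sec mD mcmp in2 setT s.
Proof.
have [S1 S2 S3 S4 S5] := sg.
apply: (@slice_section in2 (fun a => mk a = mj a)) => //.
- move=> g; have [j hj] := coverU g; have [i hi] := coverU e.
  have hk : U j (mult (in2 g)) by rewrite /mult /= (lmul1 hG).
  by have [A hA] := @model_exists i j j (in2 g) hi hj hk; exists (Model i j j A).
- move=> a g v ga /mD_mdom[h1 h2 h3].
  have m2 : multilinear_form (w (mi a) e) by exact: sform_multilin (formw h1).
  have E1 := congr1 (fun f => f v) (id_form (w (mk a)) g sin2 smult mult2).
  have E2 := congr1 (fun f => f v) (id_form (w (mj a)) g sin2 ssnd erefl).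
  have E3 := congr1 (fun f => f v) (cst_form (k := 1) g sin2 sfst erefl m2).
  have E4 := beta_in2 g v.
  apply: (etrans (congr2 +%R (congr2 +%R E1 (congr1 -%R E3))
    (congr2 +%R (congr1 -%R E2) (congr1 ( *%R 2^-1) E4)))).
  by rewrite ga oppr0 mulr0 !addr0 subrr.
- move=> a b e1 A1 e2 A2 e3 A3 g ga gb f1 f2 f3.
  have f3' : Fr (mj a) (mj b) e3 A3 g.
    by move: f3; rewrite ga gb -[mult _]/((mult \o in2) g) mult2.
  have h := Par_add aG (Par_opp aG (S3 _ _ _ _ _ _ _ f2 f3')) (lc_Par aG (lc_cst (e1 e) g)
    (near_allT _ (fun q v => erefl : form_app1 (fun _ _ => 0) q v = 0))).
  apply: (Par_eq aG _ _ h); apply: (@near_allT G) => x.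
    by rewrite /= -[mult _]/((mult \o in2) x) mult2; zmod.
  move=> v; have [_ _ /sform_multilin m2 _] := S5 _ _ _ _ _ f1.
  have E1 := congr1 (fun f => f (fun=> v)) (id_form A3 x sin2 smult mult2).
  have E2 := congr1 (fun f => f (fun=> v)) (id_form A2 x sin2 ssnd erefl).
  have E3 := congr1 (fun f => f (fun=> v)) (cst_form (k := 0) x sin2 sfst erefl m2).
  apply/esym; apply: (etrans (congr2 +%R (congr2 +%R E3 E2) (congr1 -%R E1))).
  by rewrite /form_app1 /fadd /fopp; ring.
Qed.

Hypotheses (cG : compact [set: G]) (scG : @simply_connected R G).

Lemma fusion_section : exists s, sec mD mcmp id setT s.
Proof.
apply: (product_section cmp_gerbe cG (loc_good_manifold aG)
  (simply_connected_conn e scG)); [exact: section_in1|exact: section_in2].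
Qed.

End FusionGerbe.

(** * Fusion of pre-quantizations *)

Lemma smap_comp_fst {R : realType} (M N Q : manifold R) (f : M -> Q) : atlas M -> atlas N ->
  (forall m, smap f m) -> forall p : prod_manifold M N, smap (fun q : prod_manifold M N => f q.1) p.
Proof.
move=> hM hN sf p.
have s1 : @smap R (prod_manifold M N) M fst p by exact: smap_fst.
exact: (smap_comp (atlas_prod hM hN) hM s1 (sf _)).
Qed.

Lemma smap_comp_snd {R : realType} (M N Q : manifold R) (f : N -> Q) : atlas M -> atlas N ->
  (forall m, smap f m) -> forall p : prod_manifold M N, smap (fun q : prod_manifold M N => f q.2) p.
Proof.
move=> hM hN sf p.
have s2 : @smap R (prod_manifold M N) N snd p by exact: smap_snd.
exact: (smap_comp (atlas_prod hM hN) hN s2 (sf _)).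
Qed.

Section FusionPreq.
Context {R : realType}.
Variables (G : lie_group R) (hG : is_lie_group G).
Variable B : lie_alg G -> lie_alg G -> R.
Hypothesis hB : invariant_inner_product B.
Local Notation "a ** b" := (@lmul R G a b) (at level 40, left associativity).
Local Notation PG := (prod_manifold G G).
Let aG := lie_atlas hG.
Let aP := atlas_prod aG aG.

Variables (I : Type) (U : I -> set G) (w : I -> form G 2).
Variable Fr : I -> I -> (G -> phase R) -> form G 1 -> G -> Prop.
Hypotheses (openU : forall i, open (U i)) (coverU : forall g, exists i, U i g).
Hypotheses (formw : forall i g, U i g -> sform (w i) g).
Hypothesis curvw : forall i g v, U i g -> dform (w i) g v = @canonical3 R G B g v.
Hypothesis sg : scalar_gerbe U w Fr.

Local Notation mD := (mD B U w).
Local Notation mcmp := (mcmp B U w Fr).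
Let cmp_gerbe := fusion_flat_gerbe hG hB openU coverU formw curvw sg.
Variable sigma : G * G -> obj (phase R) (model G I) (G * G).
Hypothesis hsigma : sec mD mcmp id setT sigma.

Variables (M1 M2 : manifold R) (h1 : atlas M1) (h2 : atlas M2).
Variables (Psi1 : M1 -> G) (Psi2 : M2 -> G).
Hypotheses (s1 : forall m, smap Psi1 m) (s2 : forall m, smap Psi2 m).
Variables (om1 : form M1 2) (om2 : form M2 2).
Variables (Q1 : I -> (M1 -> phase R) -> form M1 1 -> M1 -> Prop).
Variables (Q2 : I -> (M2 -> phase R) -> form M2 1 -> M2 -> Prop).
Hypotheses (q1 : scalar_preq Psi1 U w Fr om1 Q1) (q2 : scalar_preq Psi2 U w Fr om2 Q2).

Local Notation P := (prod_manifold M1 M2).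
Let hP := atlas_prod h1 h2.
Let mult (p : PG) : G := p.1 ** p.2.
Let Phi (p : P) : PG := (Psi1 p.1, Psi2 p.2).
Let Psi (p : P) : G := Psi1 p.1 ** Psi2 p.2.

Let smult (p : PG) : smap mult p. Proof. exact: smap_mul. Qed.
Let sfst (p : P) : @smap R P M1 fst p. Proof. exact: smap_fst. Qed.
Let ssnd (p : P) : @smap R P M2 snd p. Proof. exact: smap_snd. Qed.
Let sfst' (p : PG) : @smap R PG G fst p. Proof. exact: smap_fst. Qed.
Let ssnd' (p : PG) : @smap R PG G snd p. Proof. exact: smap_snd. Qed.
Let sP1 (p : P) : smap (fun p : P => Psi1 p.1) p.
Proof. exact: smap_comp_fst. Qed.
Let sP2 (p : P) : smap (fun p : P => Psi2 p.2) p.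
Proof. exact: smap_comp_snd. Qed.
Let sPhi (p : P) : smap Phi p. Proof. exact: smap_pair. Qed.

Definition fusion_om : form P 2 := fun p v =>
  @form_pull R P M1 fst 2 om1 p v + @form_pull R P M2 snd 2 om2 p v
  - 2^-1 * form_pull Phi (@beta R G B) p v.

(** A frame of the tensor product of the two quasi-line bundles and the flat trivialisation sigma,
    over the sheet k. The sheets over the factors are auxiliary; q is the shift that identifies
    sigma with the model a, and phases and connection forms add up. *)
Definition fusion_frame (k : I) (s : P -> phase R) (A : form P 1) (m : P) : Prop :=
  exists (a : model G I) (q : G * G -> phase R) t1 A1 t2 A2,
  [/\ [/\ mk a = k, Q1 (mi a) t1 A1 m.1 & Q2 (mj a) t2 A2 m.2],
      mD a (Phi m), hom mcmp id (Phi m) (sigma (Phi m)) (a, q) (fun=> 0),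
      \forall m' \near m, s m' = t1 m'.1 + t2 m'.2 + q (Phi m') &
      \forall m' \near m, A m' = fadd (fadd (@form_pull R P M1 fst 1 A1) (@form_pull R P M2 snd 1 A2))
         (form_pull Phi (mA a)) m'].

Let sPsi (p : P) : smap Psi p.
Proof. exact: (smap_comp hP aP (sPhi p) (smult _)). Qed.

Let pfst s A (z : P) : @Par R M1 s A z.1 -> @Par R P (fun x => s x.1) (@form_pull R P M1 fst 1 A) z.
Proof. exact: (Par_pull hP h1 (@near_allT P _ _ sfst)). Qed.
Let psnd s A (z : P) : @Par R M2 s A z.2 -> @Par R P (fun x => s x.2) (@form_pull R P M2 snd 1 A) z.
Proof. exact: (Par_pull hP h2 (@near_allT P _ _ ssnd)). Qed.
Let pPhi s A (z : P) : @Par R PG s A (Phi z) -> @Par R P (fun x => s (Phi x)) (form_pull Phi A) z.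
Proof. exact: (Par_pull hP aP (@near_allT P _ _ sPhi)). Qed.

(** d A is the sum of w_i - om1, w_j - om2 and the 2-form w_k - w_i - w_j + (1/2) beta of the model,
    all pulled back; the auxiliary sheets i and j cancel. *)
Lemma fusion_frame_form k s A m : fusion_frame k s A m ->
  [/\ U k (Psi m), sform A m & forall v, dform A m v = form_pull Psi (w k) m v - fusion_om m v].
Proof.
have [_ _ _ S1] := q1; have [_ _ _ S2] := q2.
move=> [a [q [t1 [A1 [t2 [A2 [[ka f1 f2] Da _ _ eA]]]]]]].
have [[d1 d2 d3] sA dA] := nbhs_singleton Da.
have [_ sA1 dA1] := S1 _ _ _ _ f1; have [_ sA2 dA2] := S2 _ _ _ _ f2.
have p1 : sform (@form_pull R P M1 fst 1 A1) m.
  by apply: (sform_pull hP h1 _ sA1); exact: (@near_allT P).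
have p2 : sform (@form_pull R P M2 snd 1 A2) m.
  by apply: (sform_pull hP h2 _ sA2); exact: (@near_allT P).
have p3 : sform (form_pull Phi (mA a)) m.
  by apply: (sform_pull hP aP _ sA); exact: (@near_allT P).
have p12 := sform_add p1 p2; have p123 := sform_add p12 p3.
have eA' : \forall m' \near m, fadd (fadd (@form_pull R P M1 fst 1 A1) (@form_pull R P M2 snd 1 A2))
         (form_pull Phi (mA a)) m' = A m' by apply: filterS eA => m' ->.
split; first by rewrite -ka.
  exact: sform_eq eA' p123.
move=> v; rewrite (dform_eq hP v eA' p123) (dform_add v p12 p3) (dform_add v p1 p2).
have D1 := etrans (congr1 (fun f => f v) (form_pull_dform1 hP h1 (@near_allT P _ _ sfst) sA1)) (dA1 _).
have D2 := etrans (congr1 (fun f => f v) (form_pull_dform1 hP h2 (@near_allT P _ _ ssnd) sA2)) (dA2 _).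
have D3 := etrans (congr1 (fun f => f v) (form_pull_dform1 hP aP (@near_allT P _ _ sPhi) sA)) (dA _).
apply: (etrans (congr2 +%R (congr2 +%R D1 D2) D3)).
have C1 := congr1 (fun f => f v) (form_pull_comp hP h1 (w (mi a)) (sfst m) (s1 _)).
have C2 := congr1 (fun f => f v) (form_pull_comp hP h2 (w (mj a)) (ssnd m) (s2 _)).
have C1' := congr1 (fun f => f v) (form_pull_comp hP aP (w (mi a)) (sPhi m) (sfst' _)).
have C2' := congr1 (fun f => f v) (form_pull_comp hP aP (w (mj a)) (sPhi m) (ssnd' _)).
have C3 := congr1 (fun f => f v) (form_pull_comp hP aP (w (mk a)) (sPhi m) (smult _)).
have comb (x1 x2 x3 x1' x2' o1 o2 b y : R) : x1 = x1' -> x2 = x2' -> y = x3 ->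
   (x1 - o1) + (x2 - o2) + (x3 + - x1' + (- x2' + 2^-1 * b)) = y - (o1 + o2 - 2^-1 * b).
  by move=> -> -> ->; ring.
rewrite -ka; apply: comb.
- exact: (etrans (esym C1) C1').
- exact: (etrans (esym C2) C2').
- exact: C3.
Qed.

Let sigma_mD z : mD (sigma z).1 z. Proof. by have [] := hsigma (y := z) Logic.I. Qed.

Let sigma_near z : \forall z' \near z, hom mcmp id z' (sigma z) (sigma z') (fun=> 0).
Proof. by have [_ h] := hsigma (y := z) Logic.I; apply: filterS h => z'; exact. Qed.

Let hom0 y o o' f : hom mcmp id y o o' f -> (forall z, f z = 0) -> hom mcmp id y o o' (fun=> 0).
Proof. by move=> h f0; apply: hom_ext h _; apply: lc_ext (lc_cst 0 _) => z; rewrite f0 subrr. Qed.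

Lemma fusion_frame_exists k m : U k (Psi m) -> exists s A, fusion_frame k s A m.
Proof.
have [T1 _ _ _] := q1; have [R1 _ _ _] := q2.
move=> Uk; have [i hi] := coverU (Psi1 m.1); have [j hj] := coverU (Psi2 m.2).
have [t1 [A1 f1]] := T1 i m.1 hi; have [t2 [A2 f2]] := R1 j m.2 hj.
have [A hA] := @model_exists R G hG B hB I U w openU formw curvw i j k (Phi m) hi hj Uk.
have [f hf] := hom_exists cmp_gerbe (phi := id) (o' := (Model i j k A, fun=> 0)) (sigma_mD _) hA.
(* Shifting the model by - f turns its isomorphism with sigma into 0; the leading 0 is the original
   shift of the model. *)
pose q x := 0 - f x.
exists (fun m' => t1 m'.1 + t2 m'.2 + q (Phi m')),
  (fadd (fadd (@form_pull R P M1 fst 1 A1) (@form_pull R P M2 snd 1 A2)) (form_pull Phi A)).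
exists (Model i j k A), q, t1, A1, t2, A2; split=> //; last 2 first.
- exact: (@near_allT P).
- exact: (@near_allT P).
by apply: hom0 (hom_twistr (fun x => - f x) hf) _ => z; rewrite subrr.
Qed.

Lemma fusion_frame_near k s A m : fusion_frame k s A m ->
  \forall m' \near m, fusion_frame k s A m'.
Proof.
have [_ T2 _ _] := q1; have [_ R2 _ _] := q2.
move=> [a [q [t1 [A1 [t2 [A2 [[ka f1 f2] Da ha es eA]]]]]]].
have n1 : \forall z \near m, Q1 (mi a) t1 A1 z.1 := (sfst m).1 _ (T2 _ _ _ _ f1).
have n2 : \forall z \near m, Q2 (mj a) t2 A2 z.2 := (ssnd m).1 _ (R2 _ _ _ _ f2).
have n3 : \forall z \near m, mD a (Phi z) := (sPhi m).1 _ (nbhs_interior Da).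
have n4 : \forall z \near m, hom mcmp id (Phi z) (sigma (Phi m)) (a, q) (fun=> 0) :=
  (sPhi m).1 _ (hom_near cmp_gerbe (phi := id) (fun x => cvg_id) ha).
have n5 : \forall z \near m, hom mcmp id (Phi z) (sigma (Phi m)) (sigma (Phi z)) (fun=> 0) :=
  (sPhi m).1 _ (sigma_near _).
apply: filterS3 (near_and n1 (near_and n2 n3)) (near_and n4 n5)
  (near_and (nbhs_interior es) (nbhs_interior eA)).
move=> z [g1 [g2 g3]] [g4 g5] [g6 g7].
exists a, q, t1, A1, t2, A2; split=> //.
by apply: hom0 (hom_comp cmp_gerbe (hom_opp cmp_gerbe g5) g4) _ => x; rewrite oppr0 addr0.
Qed.

(** Composing the two identifications with sigma compares the models a and a' directly, and sigma
    disappears. In this comparison the frames of Gb over the two factors cancel those in the clauses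
    of Q1 and Q2, and e3 is exchanged for t, a frame of the same line bundle. *)
Lemma fusion_frame_Par i j s A s' A' t C m : fusion_frame i s A m -> fusion_frame j s' A' m ->
  Fr i j t C (Psi m) ->
  Par (fun x => s' x - s x - t (Psi x)) (fadd (fadd A' (fopp A)) (fopp (form_pull Psi C))) m.
Proof.
have [_ _ T3 _] := q1; have [_ _ R3 _] := q2; have [_ _ S3 _ _] := sg.
move=> [a [q [t1 [A1 [t2 [A2 [[ka f1 f2] Da ha es eA]]]]]]].
move=> [a' [q' [t1' [A1' [t2' [A2' [[ka' f1' f2'] Da' ha' es' eA']]]]]]] ft.
have [p [_ _ [e1 [E1 [e2 [E2 [e3 [E3 [g1 g2 g3 hp]]]]]]]] lp] :=
  hom_comp cmp_gerbe (hom_opp cmp_gerbe ha) ha'.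
have g3' : Fr i j e3 E3 (Psi m) by rewrite -ka -ka'.
have F1 := pfst (T3 _ _ _ _ _ _ _ _ _ f1 f1' g1).
have F2 := psnd (R3 _ _ _ _ _ _ _ _ _ f2 f2' g2).
have F3 := Par_pull hP aG (@near_allT P _ _ sPsi) (S3 _ _ _ _ _ _ _ ft g3').
have F4 := pPhi hp.
have l0 : @Par R PG (fun x => q' x - q x - p x) (fun _ _ => 0) (Phi m).
  apply: (lc_Par aP _ (@near_allT PG _ _ _)) => //.
  by apply: lc_ext lp => x /=; rewrite oppr0 addr0 subr0.
have F5 := pPhi l0.
have h := Par_add hP (Par_add hP (Par_add hP F1 F2) (Par_add hP F4 F5)) F3.
apply: (Par_eq hP _ _ h).
  by apply: filterS2 es es' => x -> ->; rewrite /Psi /Phi /mult /=; cbv beta; zmod.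
apply: filterS2 eA eA' => x eAx eAx' v.
rewrite /form_app1 /fadd /fopp eAx eAx' /fadd.
set V := fun=> v.
have C1 := etrans (esym (congr1 (fun f => f V) (form_pull_comp hP h1 E1 (sfst x) (s1 _))))
  (congr1 (fun f => f V) (form_pull_comp hP aP E1 (sPhi x) (sfst' _))).
have C2 := etrans (esym (congr1 (fun f => f V) (form_pull_comp hP h2 E2 (ssnd x) (s2 _))))
  (congr1 (fun f => f V) (form_pull_comp hP aP E2 (sPhi x) (ssnd' _))).
have C3 := congr1 (fun f => f V) (form_pull_comp hP aP E3 (sPhi x) (smult _)).
rewrite /form_pull /= in C1 C2 C3 *.
have comb (u1 u1' u2 u2' u3 u3' x1 y1 x2 y2 x3 y3 c : R) : x1 = y1 -> x2 = y2 -> y3 = x3 ->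
    u1' - u1 - x1 + (u2' - u2 - x2) + (u3' - u3 + (y1 + y2 - x3) + 0) + (y3 - c) =
    u1' + u2' + u3' - (u1 + u2 + u3) - c by move=> -> -> ->; ring.
exact: comb C1 C2 C3.
Qed.

Lemma fusion_scalar_preq : scalar_preq Psi U w Fr fusion_om fusion_frame.
Proof.
split.
- exact: fusion_frame_exists.
- exact: fusion_frame_near.
- exact: fusion_frame_Par.
- exact: fusion_frame_form.
Qed.

End FusionPreq.

(** [fusion_form] differentiates each moment map composed with a projection, whereas [fusion_om]
    pulls beta back by the pair of them; the chain rule identifies the two. *)
Lemma fusion_omE {R : realType} (G : lie_group R) (G_lie : is_lie_group G)
    (B : lie_alg G -> lie_alg G -> R) (M1 M2 : ham_data G) (h1 : atlas M1) (h2 : atlas M2) :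
  (forall m, smap (@hmom R G M1) m) -> (forall m, smap (@hmom R G M2) m) ->
  fusion_om B (@hmom R G M1) (@hmom R G M2) (hform M1) (hform M2) = fusion_form B (M1 := M1) (M2 := M2).
Proof.
move=> s1 s2; apply/funext => p; apply/funext => v.
have aG := lie_atlas G_lie; have aP := atlas_prod aG aG; have hP := atlas_prod h1 h2.
pose Phi (q : prod_manifold M1 M2) : prod_manifold G G := (hmom q.1, hmom q.2).
have s1' : @smap R (prod_manifold M1 M2) G (fun q => hmom q.1) p.
  exact: smap_comp_fst.
have s2' : @smap R (prod_manifold M1 M2) G (fun q => hmom q.2) p.
  exact: smap_comp_snd.
have sPhi : smap Phi p by exact: smap_pair.
have f1 : @smap R (prod_manifold G G) G fst (Phi p) by exact: smap_fst.
have f2 : @smap R (prod_manifold G G) G snd (Phi p) by exact: smap_snd.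
have D1 u : thetaL (hmom p.1) (@mdiff R (prod_manifold G G) G fst (Phi p) (mdiff Phi p u)) =
    thetaL (hmom p.1) (mdiff (fun q : prod_manifold M1 M2 => hmom q.1) p u).
  have E := mdiff_comp hP aP u sPhi f1.
  exact (congr1 (@thetaL R G (hmom p.1)) (esym E)).
have D2 u : thetaR (hmom p.2) (@mdiff R (prod_manifold G G) G snd (Phi p) (mdiff Phi p u)) =
    thetaR (hmom p.2) (mdiff (fun q : prod_manifold M1 M2 => hmom q.2) p u).
  have E := mdiff_comp hP aP u sPhi f2.
  exact (congr1 (@thetaR R G (hmom p.2)) (esym E)).
exact (congr1 (fun r => _ - 2^-1 * r)
  (congr2 (fun r s => r - s) (congr2 B (D1 _) (D2 _)) (congr2 B (D1 _) (D2 _)))).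
Qed.

Theorem theorem5p4p1 (R : realType) (G : lie_group R)
    (G_lie : is_lie_group G)
    (G_compact : compact [set: G])
    (G_simple : simple_lie_algebra G)
    (G_simply_connected : @simply_connected R G)
    (B : lie_alg G -> lie_alg G -> R)
    (B_inner : invariant_inner_product B)
    (Gb : gerbe G)
    (Gb_gerbe : is_gerbe Gb)
    (Gb_curvature : gerbe_curvature Gb (canonical3 B))
    (M1 M2 : ham_data G)
    (M1_qham : is_quasi_hamiltonian B M1)
    (M2_qham : is_quasi_hamiltonian B M2) :
  prequantizable Gb M1 -> prequantizable Gb M2 ->
  prequantizable Gb (fusion B M1 M2).
Proof.
have aG := lie_atlas G_lie.
have [/is_manifold_atlas h1 _ _ [/(smapP h1 aG) s1 _] _] := M1_qham.
have [/is_manifold_atlas h2 _ _ [/(smapP h2 aG) s2 _] _] := M2_qham.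
have [[openU _] _ _ _ [formU _]] := Gb_gerbe.
have formw i g (Ug : gcov i g) : sform (gform i) g := (is_formP aG _ (openU i)).1 (formU i) g Ug.
have [ah [uah thah frame_ah sg]] := gerbe_scalarise aG Gb_gerbe.
move=> [P1 [hP1 e1]] [P2 [hP2 e2]].
have [Q1 q1] := quasi_scalarise h1 s1 Gb_gerbe uah thah hP1 e1.
have [Q2 q2] := quasi_scalarise h2 s2 Gb_gerbe uah thah hP2 e2.
have coverU := gerbe_cover Gb_gerbe.
have [sigma hsigma] :=
  fusion_section G_lie B_inner openU coverU formw Gb_curvature sg G_compact G_simply_connected.
have q := fusion_scalar_preq G_lie B_inner openU coverU formw Gb_curvature sg hsigma h1 h2 s1 s2 q1 q2.
rewrite (fusion_omE G_lie B h1 h2 s1 s2) in q.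
have hP := atlas_prod h1 h2.
pose Phi (p : prod_manifold M1 M2) : prod_manifold G G := (hmom p.1, hmom p.2).
have sPhi p : smap Phi p.
  apply: smap_pair => //.
    exact: smap_comp_fst.
  exact: smap_comp_snd.
have sPsi (p : fusion B M1 M2) : smap (@hmom R G (fusion B M1 M2)) p.
  exact: (smap_comp hP (atlas_prod aG aG) (sPhi p) (smap_mul G_lie _)).
(* [fusion] unfolds to the product manifold with the product moment map, so q has this type by
   computation. *)
have [Q hQ] : exists Q, scalar_preq (@hmom R G (fusion B M1 M2)) (@gcov R G Gb) (@gform R G Gb)
    (frame_coord ah) (hform (fusion B M1 M2)) Q by exact: (ex_intro _ _ q).
exists (scalar_qlb (@hmom R G (fusion B M1 M2)) ah Q); split; last exact: scalar_error hQ.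
exact: (scalar_quasi aG hP sPsi Gb_gerbe uah thah frame_ah sg hQ).
Qed.
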